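(* Every $B$-orbit in $\mathcal N_2$ is strongly orthogonal; that is, every $B$-orbit in $\mathcal N_2$ is of the form $Be_S$ for some strongly orthogonal subset $S\subset\Phi$.
   Context: $G$ is an almost simple algebraic group over an algebraically closed field of characteristic zero, with Borel subgroup $B$ and maximal torus $T\subset B$; $\mathfrak g$ is its Lie algebra and $\Phi$ the root system of $(G,T)$. For every $\alpha\in\Phi$ fix a nonzero $e_\alpha$ in the root space $\mathfrak g_\alpha$. For a nilpotent $e\in\mathfrak g$, $\mathrm{ht}(e)=\max\{n\in\mathbb N : \mathrm{ad}(e)^n\neq0\}$, and $\mathcal N_2$ is the set of nilpotent elements of $\mathfrak g$ of height at most $2$. Two roots $\alpha\neq\pm\beta$ are strongly orthogonal if neither $\alpha+\beta$ nor $\alpha-\beta$ is a root; a subset $S\subset\Phi$ (possibly empty) is strongly orthogonal if its distinct elements are pairwise strongly orthogonal. For such $S$ set $e_S=\sum_{\alpha\in S}e_\alpha$. *)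

(* Defs.v *)
(* Algebraic groups are linear algebraic groups: Zariski closed subgroups of
   GL_n(K), for an arbitrary n, identified with their groups of K-points. *)
From HB Require Import structures.
From mathcomp Require Import all_boot all_order all_algebra.
From mathcomp Require Import mpoly.
From mathcomp Require Import boolp classical_sets functions cardinality fsbigop.

Set Implicit Arguments.
Unset Strict Implicit.
Unset Printing Implicit Defensive.

Import GRing.Theory.
Local Open Scope classical_set_scope.
Local Open Scope ring_scope.

Section ZariskiTopology.
Variables (K : closedFieldType) (n : nat).
Implicit Types (X : set 'M[K]_n) (p : {mpoly K[n * n]}).

(* The variable ['X_(mxvec_index i j)] is the matrix coordinate x_ij. *)
Definition mxeval p (A : 'M[K]_n) : K := p.@[fun k => mxvec A 0 k].

(* Closed subsets of GL_n; the coordinate ring of GL_n is K[x_ij, 1/det], so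
   clearing denominators shows that polynomials in the x_ij suffice. *)
Definition zariski_closed X : Prop :=
  exists I : set {mpoly K[n * n]},
    X = [set A | A \in unitmx /\ forall p, I p -> mxeval p A = 0].

Definition zariski_connected X : Prop :=
  forall Y Z : set 'M[K]_n, zariski_closed Y -> zariski_closed Z ->
    X = Y `|` Z -> Y `&` Z = set0 -> Y = set0 \/ Z = set0.

(* Restrictions to [X] of elements of K[x_ij, 1/det]. *)
Definition regular_function X (f : X -> K) : Prop :=
  exists (p : {mpoly K[n * n]}) (k : nat),
    forall x : X, f x = mxeval p (val x) / \det (val x) ^+ k.

End ZariskiTopology.

Section Groups.
Variables (K : closedFieldType) (n : nat).
Implicit Types (G H N B T : set 'M[K]_n) (x y g : 'M[K]_n).

Definition subgroup_GL H : Prop :=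
  [/\ forall x, H x -> x \in unitmx,
      H 1%:M,
      forall x y, H x -> H y -> H (x *m y)
    & forall x, H x -> H (invmx x)].

Definition closed_subgroup H : Prop := subgroup_GL H /\ zariski_closed H.

Definition mxconj g x : 'M[K]_n := g *m x *m invmx g.

Definition normal_subgroup G N : Prop :=
  [/\ subgroup_GL N, N `<=` G & forall g x, G g -> N x -> N (mxconj g x)].

Definition almost_simple G : Prop :=
  [/\ closed_subgroup G,
      zariski_connected G,
      exists x y, [/\ G x, G y & x *m y != y *m x]
    & forall N, normal_subgroup G N -> closed_subgroup N ->
        zariski_connected N -> N = [set 1%:M] \/ N = G].

Definition commutator_subgroup H : set 'M[K]_n :=
  [set z | forall L, subgroup_GL L ->
     (forall x y, H x -> H y -> L (x *m y *m invmx x *m invmx y)) -> L z].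

Definition solvable_group H : Prop :=
  exists k : nat, iter k commutator_subgroup H = [set 1%:M].

Definition connected_solvable H : Prop :=
  [/\ closed_subgroup H, zariski_connected H & solvable_group H].

Definition borel_subgroup G B : Prop :=
  [/\ B `<=` G, connected_solvable B
    & forall H, H `<=` G -> connected_solvable H -> B `<=` H -> H = B].

Definition B_orbit B x : set 'M[K]_n := [set mxconj b x | b in B].

End Groups.

(* The r-dimensional torus, as a closed subgroup of GL_r. *)
Definition diag_group (K : closedFieldType) (r : nat) : set 'M[K]_r :=
  [set A | A \in unitmx /\ is_diag_mx A].

Definition group_morphism (K : closedFieldType) (n m : nat)
    (X : set 'M[K]_n) (Y : set 'M[K]_m) (f : X -> Y) : Prop :=
  (forall i j, regular_function (fun x : X => val (f x) i j)) /\
  (forall x y z : X, val z = val x *m val y ->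
     val (f z) = val (f x) *m val (f y)).

Section Torus.
Variables (K : closedFieldType) (n : nat).
Implicit Types (G T : set 'M[K]_n).

Definition is_torus T : Prop :=
  closed_subgroup T /\
  exists (r : nat) (f : T -> @diag_group K r) (g : @diag_group K r -> T),
    [/\ group_morphism f, group_morphism g, cancel f g & cancel g f].

Definition maximal_torus G T : Prop :=
  [/\ T `<=` G, is_torus T
    & forall H, H `<=` G -> is_torus H -> T `<=` H -> H = T].

End Torus.

Section LieAlgebra.
Variables (K : closedFieldType) (n : nat).
Implicit Types (G : set 'M[K]_n) (x y : 'M[K]_n).

(* Tangent space of [G] at 1: the matrices killed by the differential at 1 of
   every polynomial vanishing on [G]. *)
Definition Lie G : set 'M[K]_n :=
  [set x | forall p : {mpoly K[n * n]}, (forall g, G g -> mxeval p g = 0) ->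
     \sum_(k < n * n) mxeval p^`M(k) 1%:M * mxvec x 0 k = 0].

Definition ad x y : 'M[K]_n := x *m y - y *m x.

(* ad(x)^m <> 0, where ad(x) acts on the Lie algebra of [G]. *)
Definition ad_pow_neq0 G x (m : nat) : Prop :=
  exists2 y, Lie G y & iter m (ad x) y != 0.

Definition Lie_nilpotent G x : Prop :=
  Lie G x /\ exists m, ~ ad_pow_neq0 G x m.

Definition is_height G x (h : nat) : Prop :=
  ad_pow_neq0 G x h /\ forall m, ad_pow_neq0 G x m -> (m <= h)%N.

Definition nilpotent_height_le2 G : set 'M[K]_n :=
  [set x | Lie_nilpotent G x /\ exists2 h, is_height G x h & (h <= 2)%N].

End LieAlgebra.

(* Characters of [T] are written multiplicatively: alpha + beta is the
   pointwise product, - alpha the pointwise inverse, 0 the constant 1. *)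
Section Roots.
Variables (K : closedFieldType) (n : nat) (G T : set 'M[K]_n).
Implicit Types (alpha beta : T -> K) (S : set (T -> K)).

Definition is_character alpha : Prop :=
  [/\ regular_function alpha,
      forall t, alpha t != 0
    & forall s t u : T, val u = val s *m val t -> alpha u = alpha s * alpha t].

Definition root_space alpha : set 'M[K]_n :=
  [set x | Lie G x /\ forall t : T, mxconj (val t) x = alpha t *: x].

Definition is_root alpha : Prop :=
  [/\ is_character alpha, alpha <> (fun=> 1)
    & exists2 x, root_space alpha x & x != 0].

Definition char_add alpha beta : T -> K := fun t => alpha t * beta t.
Definition char_opp alpha : T -> K := fun t => (alpha t)^-1.

Definition strongly_orthogonal_roots alpha beta : Prop :=
  [/\ alpha <> beta, alpha <> char_opp beta,
      ~ is_root (char_add alpha beta)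
    & ~ is_root (char_add alpha (char_opp beta))].

Definition strongly_orthogonal S : Prop :=
  S `<=` is_root /\
  forall alpha beta, S alpha -> S beta -> alpha <> beta ->
    strongly_orthogonal_roots alpha beta.

(* A sum with finite support: a set of roots is finite, since the root spaces
   are linearly independent in 'M_n. *)
Definition e_sum (e : (T -> K) -> 'M[K]_n) S : 'M[K]_n :=
  \sum_(alpha \in S) e alpha.

End Roots.

(* Main.v *)
Require Import Defs.
From mathcomp Require Import all_boot all_order all_algebra.
From mathcomp Require Import mpoly.
From mathcomp Require Import boolp classical_sets functions cardinality fsbigop.
From mathcomp Require Import intdiv ring lra zify.

(** Let [g] be the Lie algebra of [G], let [X] be the bracket with [x] on [g],
    and let [a] be the image of [X^2].  As [X^3 = 0], the Jacobi identity alone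
    shows that [a] is abelian and inner, that is, that the double brackets of two
    elements of [a] with an element of [g] lie in [a]; all elements of [a] are
    nilpotent, and [x] belongs to [a].  The idea is to move [x] by [B] until [a]
    is a sum of root spaces, and then to simplify [x] inside [a].

    What is needed about [G] is linear algebra for the trace form on [g].  This
    form is nondegenerate ([form_nondeg]): its radical is an ideal of nilpotent
    matrices, and the exponentials of the center of that ideal would be a
    commutative family normalised by [G].  Maximality of [T] makes the
    centralizer of [T] in [g] equal to the Lie algebra of [T] ([torus_coords],
    [g0_hh]), whence sl2-triples and lines of root vectors in the usual way.
    Maximality of [B] enters once, through [perp_b]: the orthogonal of the Lie
    algebra [b] of [B] is the set [n] of nilpotent elements of [b].

    First stage.  Call [z] good when the bracket of [x] with [z] lies in [a].  The
    orthogonal of the space of good elements consists of nilpotent matrices, so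
    that, by duality with respect to [n] and [b], every element [h] of the Cartan
    algebra is congruent modulo [n] to a good element of [b] ([cartan_lift]).  For
    a regular [h] this good element is conjugate to [h] under [B] ([conj_reg]).
    After the conjugation [h] is itself good, hence normalises [a], which is
    therefore the sum of its intersections with the root spaces.

    Second stage ([eliminate]).  Order the weights by a functional positive on the
    roots of [B].  Let [e0] be the component of [x] of lowest weight, in an
    sl2-triple [(e0, h0, f0)].  For each component [y] of [x] of higher weight,
    the bracket of [f0] with [y] lies in [n]; conjugating by its exponential
    preserves [a], because [a] is inner, and removes [y] up to higher terms,
    unless [y] has weight zero for [h0].  What is left commutes with [e0] and
    [f0], so that its roots are strongly orthogonal to that of [e0], and the
    procedure is repeated.  The result is a sum of root vectors for pairwise
    strongly orthogonal roots; these roots are linearly independent, and [T]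
    rescales the root vectors to the prescribed ones ([so_scaling]). *)

Set Implicit Arguments.
Unset Strict Implicit.
Unset Printing Implicit Defensive.

Import GRing.Theory.
Local Open Scope classical_set_scope.
Local Open Scope ring_scope.

(** * Algebras of functions, and regular functions on the general linear group *)

Section FunAlg.
Variable (K : fieldType).

Definition fun_alg (D : Type) (P : (D -> K) -> Prop) : Prop :=
  [/\ forall c, P (fun=> c),
      forall f g, P f -> P g -> P (fun x => f x + g x)
    & forall f g, P f -> P g -> P (fun x => f x * g x)].

Section Gen.
Variables (D : Type) (P : (D -> K) -> Prop).
Hypothesis PA : fun_alg P.

Lemma fun_algC c : P (fun=> c). Proof. by case: PA. Qed.
Lemma fun_algD f g : P f -> P g -> P (fun x => f x + g x).
Proof. by case: PA => _ h _; apply: h. Qed.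
Lemma fun_algM f g : P f -> P g -> P (fun x => f x * g x).
Proof. by case: PA => _ _; apply. Qed.
Lemma fun_algN f : P f -> P (fun x => - f x).
Proof.
move=> Pf; have := fun_algM (fun_algC (-1)) Pf.
by congr P; apply/funext => x; rewrite mulN1r.
Qed.
Lemma fun_algB f g : P f -> P g -> P (fun x => f x - g x).
Proof. by move=> Pf Pg; apply: fun_algD => //; apply: fun_algN. Qed.

Lemma fun_alg_sum (I : Type) (r : seq I) (Q : pred I) (F : I -> D -> K) :
  (forall i, Q i -> P (F i)) -> P (fun x => \sum_(i <- r | Q i) F i x).
Proof.
move=> PF; elim: r => [|i r IH].
  by have := fun_algC 0; congr P; apply/funext => x; rewrite big_nil.
case Qi : (Q i).
  have := fun_algD (PF _ Qi) IH.
  by congr P; apply/funext => x; rewrite big_cons Qi.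
by move: IH; congr P; apply/funext => x; rewrite big_cons Qi.
Qed.

Lemma fun_alg_prod (I : Type) (r : seq I) (Q : pred I) (F : I -> D -> K) :
  (forall i, Q i -> P (F i)) -> P (fun x => \prod_(i <- r | Q i) F i x).
Proof.
move=> PF; elim: r => [|i r IH].
  by have := fun_algC 1; congr P; apply/funext => x; rewrite big_nil.
case Qi : (Q i).
  have := fun_algM (PF _ Qi) IH.
  by congr P; apply/funext => x; rewrite big_cons Qi.
by move: IH; congr P; apply/funext => x; rewrite big_cons Qi.
Qed.

Lemma fun_algX f k : P f -> P (fun x => f x ^+ k).
Proof.
move=> Pf; elim: k => [|k IH].
  by have := fun_algC 1; congr P; apply/funext => x; rewrite expr0.
by have := fun_algM Pf IH; congr P; apply/funext => x; rewrite exprS.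
Qed.

Definition entries m n (phi : D -> 'M[K]_(m, n)) := forall i j, P (fun x => phi x i j).

Lemma entriesC m n (A : 'M[K]_(m, n)) : entries (fun=> A).
Proof. by move=> i j; apply: fun_algC. Qed.

Lemma entriesD m n (phi psi : D -> 'M[K]_(m, n)) :
  entries phi -> entries psi -> entries (fun x => phi x + psi x).
Proof.
move=> h1 h2 i j; have := fun_algD (h1 i j) (h2 i j).
by congr P; apply/funext => x; rewrite mxE.
Qed.

Lemma entriesM m n p (phi : D -> 'M[K]_(m, n)) (psi : D -> 'M[K]_(n, p)) :
  entries phi -> entries psi -> entries (fun x => phi x *m psi x).
Proof.
move=> h1 h2 i j.
have := @fun_alg_sum _ (index_enum 'I_n) xpredT (fun k x => phi x i k * psi x k j)
  (fun k _ => fun_algM (h1 i k) (h2 k j)).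
by congr P; apply/funext => x; rewrite mxE.
Qed.

Lemma entriesZ m n f (phi : D -> 'M[K]_(m, n)) :
  P f -> entries phi -> entries (fun x => f x *: phi x).
Proof.
move=> hf h i j; have := fun_algM hf (h i j).
by congr P; apply/funext => x; rewrite mxE.
Qed.

Lemma fun_alg_det n (phi : D -> 'M[K]_n) : entries phi -> P (fun x => \det (phi x)).
Proof.
move=> h; rewrite /determinant; apply: fun_alg_sum => s _.
by apply: fun_algM; [exact: fun_algC | apply: fun_alg_prod => i _].
Qed.

Lemma entries_adj n (phi : D -> 'M[K]_n) : entries phi -> entries (fun x => \adj (phi x)).
Proof.
move=> h i j; rewrite /adjugate /cofactor.
have : P (fun x => (-1) ^+ (j + i) * \det (row' j (col' i (phi x)))).
  apply: fun_algM; first exact: fun_algC.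
  apply: fun_alg_det => k l; have := h (lift j k) (lift i l).
  by congr P; apply/funext => x; rewrite !mxE.
by congr P; apply/funext => x; rewrite !mxE.
Qed.

End Gen.

End FunAlg.

Section Poly.
Variable (K : closedFieldType).

Lemma fun_alg_mxeval (D : Type) (P : (D -> K) -> Prop) n (phi : D -> 'M[K]_n)
    (p : {mpoly K[n * n]}) :
  fun_alg P -> entries P phi -> P (fun x => mxeval p (phi x)).
Proof.
move=> PA h.
have : P (fun x => \sum_(m <- msupp p) p@_m * \prod_i mxvec (phi x) 0 i ^+ m i).
  apply: (fun_alg_sum PA) => m _; apply: (fun_algM PA); first exact: (fun_algC PA).
  apply: (fun_alg_prod PA) => i _; apply: (fun_algX PA).
  by case/mxvec_indexP: i => a b; have := h a b; congr P; apply/funext => x; rewrite mxvecE.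
by congr P; apply/funext => x; rewrite /mxeval mevalE.
Qed.

Lemma mxevalD n (p q : {mpoly K[n * n]}) A : mxeval (p + q) A = mxeval p A + mxeval q A.
Proof. by rewrite /mxeval mevalD. Qed.
Lemma mxevalB n (p q : {mpoly K[n * n]}) A : mxeval (p - q) A = mxeval p A - mxeval q A.
Proof. by rewrite /mxeval mevalB. Qed.
Lemma mxevalM n (p q : {mpoly K[n * n]}) A : mxeval (p * q) A = mxeval p A * mxeval q A.
Proof. by rewrite /mxeval mevalM. Qed.
Lemma mxevalXn n (p : {mpoly K[n * n]}) k A : mxeval (p ^+ k) A = mxeval p A ^+ k.
Proof. by elim: k => [|k IH]; rewrite ?expr0 /mxeval ?meval1 // !exprS -IH -mxevalM. Qed.

Definition polyf n (f : 'M[K]_n -> K) := exists p, f = mxeval p.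

Lemma polyf_alg n : fun_alg (@polyf n).
Proof.
split=> [c|f g [p ->] [q ->]|f g [p ->] [q ->]].
- by exists c%:MP; apply/funext => A; rewrite /mxeval mevalC.
- by exists (p + q); apply/funext => A; rewrite /mxeval mevalD.
- by exists (p * q); apply/funext => A; rewrite /mxeval mevalM.
Qed.

Lemma polyf_entries n : entries (@polyf n) id.
Proof.
move=> i j; exists 'X_(mxvec_index i j); apply/funext => A.
by rewrite /mxeval mevalXU mxvecE.
Qed.

(** Regular functions on [GL_n], as functions on all matrices of which only the
    values at invertible ones are constrained. *)
Definition regf n (f : 'M[K]_n -> K) := exists p k,
  forall A, A \in unitmx -> f A = mxeval p A / \det A ^+ k.

Lemma regf_ext n (f g : 'M[K]_n -> K) :
  (forall A, A \in unitmx -> f A = g A) -> regf f -> regf g.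
Proof. by move=> fg [p [k h]]; exists p, k => A uA; rewrite -fg // h. Qed.

Lemma regf_polyf n (f : 'M[K]_n -> K) : polyf f -> regf f.
Proof. by move=> [p ->]; exists p, 0%N => A _; rewrite expr0 divr1. Qed.

Lemma polyf_det n : polyf (fun A : 'M[K]_n => \det A).
Proof. apply: (fun_alg_det (polyf_alg n)); exact: polyf_entries. Qed.

Lemma regf_alg n : fun_alg (@regf n).
Proof.
have [d dE] := polyf_det n.
have dA (A : 'M[K]_n) : mxeval d A = \det A by rewrite -[in LHS]dE.
split=> [c|f g [p [k hp]] [q [l hq]]|f g [p [k hp]] [q [l hq]]].
- by apply: regf_polyf; apply: (fun_algC (polyf_alg n)).
- exists (p * d ^+ l + q * d ^+ k), (k + l)%N => A uA; rewrite hp // hq //.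
  have dn0 : \det A != 0 by rewrite -unitfE -unitmxE.
  rewrite mxevalD !mxevalM !mxevalXn dA exprD mulrDl; congr (_ + _).
    by rewrite -mulf_div divff ?mulr1 // expf_neq0.
  by rewrite [\det A ^+ k * _]mulrC -mulf_div divff ?mulr1 // expf_neq0.
- exists (p * q), (k + l)%N => A uA; rewrite hp // hq //.
  by rewrite mxevalM exprD mulf_div.
Qed.

Lemma regf_entries n : entries (@regf n) id.
Proof. by move=> i j; apply: regf_polyf; apply: polyf_entries. Qed.

Lemma regf_detV n : regf (fun A : 'M[K]_n => (\det A)^-1).
Proof. by exists 1, 1%N => A uA; rewrite /mxeval meval1 expr1 mul1r. Qed.

Lemma regf_entries_inv n : entries (@regf n) (@invmx K n).
Proof.
move=> i j.
have : regf (fun A : 'M[K]_n => (\det A)^-1 * (\adj A) i j).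
  apply: (fun_algM (regf_alg n)); first exact: regf_detV.
  exact: (entries_adj (regf_alg n) (@regf_entries n)).
by apply: regf_ext => A uA; rewrite /invmx uA [RHS]mxE.
Qed.

(** The denominator of [f] becomes a power of the determinant of [phi A], which is
    why the inverse of that determinant has to be regular too. *)
Lemma regf_comp n m (f : 'M[K]_m -> K) (phi : 'M[K]_n -> 'M[K]_m) :
  regf f -> entries (@regf n) phi ->
  regf (fun A => (\det (phi A))^-1) ->
  (forall A, A \in unitmx -> phi A \in unitmx) ->
  regf (fun A => f (phi A)).
Proof.
move=> [p [k hp]] ephi dphi uphi.
have : regf (fun A => mxeval p (phi A) * (\det (phi A))^-1 ^+ k).
  apply: (fun_algM (regf_alg n)); first exact: (fun_alg_mxeval _ (regf_alg n)).
  exact: (fun_algX (regf_alg n)).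
by apply: regf_ext => A uA; rewrite hp ?uphi // exprVn.
Qed.

Lemma regf_inv n (f : 'M[K]_n -> K) : regf f -> regf (fun A => f (invmx A)).
Proof.
move=> rf; apply: (regf_comp rf); first exact: regf_entries_inv.
  have : regf (fun A : 'M[K]_n => \det A) by apply: regf_polyf; apply: polyf_det.
  by apply: regf_ext => A uA; rewrite det_inv invrK.
by move=> A; rewrite unitmx_inv.
Qed.

Lemma regf_mul n (f : 'M[K]_n -> K) (P Q : 'M[K]_n) :
  P \in unitmx -> Q \in unitmx -> regf f -> regf (fun A => f (P *m A *m Q)).
Proof.
move=> uP uQ rf; apply: (regf_comp rf).
- apply: (entriesM (regf_alg n)); last exact: (entriesC (regf_alg n)).
  by apply: (entriesM (regf_alg n)); [exact: (entriesC (regf_alg n)) | exact: regf_entries].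
- have := fun_algM (regf_alg n) (fun_algC (regf_alg n) ((\det P)^-1 * (\det Q)^-1)) (@regf_detV n).
  by apply: regf_ext => A uA; rewrite !det_mulmx !invfM mulrAC.
- by move=> A uA; rewrite !unitmx_mul uP uA uQ.
Qed.

(** Clearing the denominator, a power of the determinant, does not change the
    zeros among invertible matrices. *)
Lemma regf_eq0 n (f : 'M[K]_n -> K) : regf f ->
  exists p, forall A, A \in unitmx -> (f A = 0 <-> mxeval p A = 0).
Proof.
move=> [p [k hp]]; exists p => A uA; rewrite hp //.
have dn0 : \det A ^+ k != 0 by rewrite expf_neq0 // -unitfE -unitmxE.
split=> [/eqP|->]; last by rewrite mul0r.
by rewrite mulf_eq0 invr_eq0 (negPf dn0) orbF => /eqP.
Qed.

End Poly.

Section Nonroot.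
Variable (K : closedFieldType) (charK0 : [pchar K] =i pred0).

Lemma nat_neq0 k : (k.+1%:R != 0 :> K).
Proof. by have /pcharf0P -> := charK0. Qed.

Lemma nat_inj : injective (fun k : nat => k%:R : K).
Proof.
have h k l : (k <= l)%N -> k%:R = l%:R :> K -> k = l.
  move=> kl /eqP; rewrite eq_sym -subr_eq0 -natrB //.
  have /pcharf0P -> := charK0; rewrite subn_eq0 => lk.
  by apply/eqP; rewrite eqn_leq kl lk.
by move=> k l /= e; case/orP: (leq_total k l) => kl; [|symmetry]; apply: h.
Qed.

Lemma nonroot_nat (q : {poly K}) : q != 0 -> exists k : nat, q.[k%:R] != 0.
Proof.
move=> q0; apply: contrapT => /forallNP h.
have := @max_poly_roots _ q [seq k%:R | k <- iota 0 (size q)] q0.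
rewrite size_map size_iota ltnn => H; suff: false by [].
apply: H; last by rewrite map_inj_uniq ?iota_uniq //; apply: nat_inj.
apply/allP => _ /mapP [k _ ->]; rewrite /root; apply/negPn/negP => e.
exact: (h k).
Qed.

Lemma nonroot (q : {poly K}) : q != 0 -> exists t, q.[t] != 0.
Proof. by move=> /nonroot_nat [k]; exists k%:R. Qed.

Lemma poly_ext (p q : {poly K}) : (forall t, p.[t] = q.[t]) -> p = q.
Proof.
move=> h; apply/eqP; rewrite -subr_eq0; apply/negPn/negP => /nonroot [t].
by rewrite hornerD hornerN h subrr eqxx.
Qed.

(** Multiplying by the variable brings back the missing point. *)
Lemma poly_ext_neq0 (p q : {poly K}) : (forall t, t != 0 -> p.[t] = q.[t]) -> p = q.
Proof.
move=> h; apply: (@mulfI _ 'X); first by rewrite polyX_eq0.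
apply: poly_ext => t; rewrite !hornerM hornerX.
by case: (eqVneq t 0) => [->|t0]; rewrite ?mul0r // h.
Qed.

End Nonroot.

(** * Closed sets, connectedness and generated groups *)

Section Topology.
Variable (K : closedFieldType) (n : nat).
Implicit Types (X Y Z H : set 'M[K]_n) (A B C : 'M[K]_n).

Definition vanish X (p : {mpoly K[n * n]}) := forall A, X A -> mxeval p A = 0.

Lemma zc_sep X A : zariski_closed X -> A \in unitmx -> ~ X A ->
  exists p, vanish X p /\ mxeval p A != 0.
Proof.
move=> [I ->] uA nX; apply: contrapT => h; apply: nX; split => // p Ip.
apply: contrapT => /eqP p0; apply: h; exists p; split => // B [_]; exact.
Qed.

Lemma zc_mem X A : zariski_closed X -> A \in unitmx ->
  (forall p, vanish X p -> mxeval p A = 0) -> X A.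
Proof.
move=> zX uA h; apply: contrapT => /(zc_sep zX uA) [p [vp]].
by rewrite h // eqxx.
Qed.

Lemma zc_fam (I : Type) (F : I -> 'M[K]_n -> K) :
  (forall i, regf (F i)) -> zariski_closed [set A | A \in unitmx /\ forall i, F i A = 0].
Proof.
move=> rF.
exists [set p | exists i, forall A, A \in unitmx -> (F i A = 0 <-> mxeval p A = 0)].
apply/seteqP; split=> A /= [uA h]; split => //.
  by move=> p [i /(_ A uA) [h1 _]]; apply: h1.
move=> i; have [p hp] := regf_eq0 (rF i); apply/(hp A uA); apply: h; by exists i.
Qed.

Lemma zcI X Y : zariski_closed X -> zariski_closed Y -> zariski_closed (X `&` Y).
Proof.
move=> [I ->] [J ->]; exists (I `|` J); apply/seteqP; split=> A /=.
  by move=> [[uA hI] [_ hJ]]; split => // p [/hI|/hJ].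
by move=> [uA h]; split; split => // p hp; apply: h; [left | right].
Qed.

Lemma zc_trans X (P Q : 'M[K]_n) : P \in unitmx -> Q \in unitmx ->
  zariski_closed X -> zariski_closed [set A | X (P *m A *m Q)].
Proof.
move=> uP uQ [I ->].
have := @zc_fam {p | I p} (fun p A => mxeval (sval p) (P *m A *m Q)) _.
have h p : regf (fun A => mxeval p (P *m A *m Q)).
  by apply: (@regf_mul _ n (mxeval p)) => //; apply: regf_polyf; exists p.
move=> /(_ (fun p => h (sval p))); congr zariski_closed; apply/seteqP; split=> A /=.
  move=> [uA hA]; rewrite !unitmx_mul uP uA uQ; split => // p Ip.
  exact: (hA (exist _ p Ip)).
move=> [+ hA]; rewrite !unitmx_mul uP uQ andbT /= => uA; split=> // [[p Ip]].
exact: hA.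
Qed.

(** Connectedness phrased through regular functions, so that it makes sense for
    subgroups that are not closed, such as the members of a derived series. *)
Definition conn H := forall f, regf f ->
  (exists s : seq K, forall h, H h -> f h \in s) -> forall h, H h -> f h = f 1%:M.

(** The fibre of [f] through [1] and the union of its finitely many other fibres
    are closed and disjoint. *)
Lemma zariski_conn H : subgroup_GL H -> zariski_closed H -> zariski_connected H -> conn H.
Proof.
move=> [uH H1 _ _] zH cH f rf [s hs] h Hh.
pose Y := H `&` [set A | A \in unitmx /\ forall i : unit, f A - f 1%:M = 0].
pose g A := \prod_(c <- s | c != f 1%:M) (f A - c).
have rA := regf_alg K n.
have zY : zariski_closed Y.
  apply: zcI => //; apply: zc_fam => _; apply: (fun_algB rA) => //.
  exact: (fun_algC rA).
pose Z := H `&` [set A | A \in unitmx /\ forall i : unit, g A = 0].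
have zZ : zariski_closed Z.
  apply: zcI => //; apply: zc_fam => _; apply: (fun_alg_prod rA) => c _.
  by apply: (fun_algB rA) => //; exact: (fun_algC rA).
have HYZ : H = Y `|` Z.
  apply/seteqP; split=> [A HA|A [[]|[]]] //.
  have [e|ne] := eqVneq (f A) (f 1%:M).
    by left; split => //; split; [exact: uH | move=> _; rewrite e subrr].
  right; split => //; split; first exact: uH.
  move=> _; apply/eqP; rewrite /g prodf_seq_eq0; apply/hasP; exists (f A); first exact: hs.
  by rewrite ne subrr eqxx.
have YZ0 : Y `&` Z = set0.
  apply/seteqP; split=> // A [[_ [_ /(_ tt)/subr0_eq e]] [_ [_ /(_ tt)/eqP]]].
  rewrite /g prodf_seq_eq0 => /hasP [c _ /andP [cn]]; rewrite e subr_eq0 eq_sym => /eqP ce.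
  by rewrite ce eqxx in cn.
case: (cH Y Z zY zZ HYZ YZ0) => [Y0|Z0].
  have : Y 1%:M by split => //; split; [exact: unitmx1 | move=> _; rewrite subrr].
  by rewrite Y0.
by move: Hh; rewrite HYZ Z0 setU0 => -[_ [_ /(_ tt)/subr0_eq]].
Qed.

(** The Zariski closure in [GL_n]. *)
Definition zcl H : set 'M[K]_n :=
  [set A | A \in unitmx /\ forall p, vanish H p -> mxeval p A = 0].

Lemma zcl_closed H : zariski_closed (zcl H).
Proof. by exists (vanish H). Qed.

Lemma sub_zcl H : (forall A, H A -> A \in unitmx) -> H `<=` zcl H.
Proof. by move=> uH A HA; split; [exact: uH | move=> p; apply]. Qed.

Lemma zcl_min H Y : zariski_closed Y -> H `<=` Y -> zcl H `<=` Y.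
Proof.
move=> zY HY A [uA hA]; apply: (zc_mem zY uA) => p vp; apply: hA => B /HY; exact: vp.
Qed.

Lemma zcl_regf H f A : (forall B, H B -> B \in unitmx) -> regf f ->
  (forall B, H B -> f B = 0) -> zcl H A -> f A = 0.
Proof.
move=> uH rf h [uA hA]; have [p hp] := regf_eq0 rf.
by apply/(hp A uA)/hA => B HB; apply/(hp B (uH B HB))/h.
Qed.

(** A closed condition that holds on the products of elements of [H] passes to the
    closure one factor at a time. *)
Lemma zcl_subgroup H : subgroup_GL H -> subgroup_GL (zcl H).
Proof.
move=> [uH H1 HM HV]; have uz A : zcl H A -> A \in unitmx by case.
have rp (p : {mpoly K[n * n]}) : regf (mxeval p) by apply: regf_polyf; exists p.
have M1 A B : H A -> zcl H B -> zcl H (A *m B).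
  move=> HA zB; split; first by rewrite unitmx_mul uH ?uz.
  move=> p vp; have uA := uH _ HA.
  have rf := regf_mul uA (unitmx1 K n) (rp p).
  have := zcl_regf uH rf _ zB; rewrite mulmx1; apply => C HC.
  by rewrite mulmx1; apply: vp; apply: HM.
split=> //.
- exact: (sub_zcl uH).
- move=> A B zA zB; split; first by rewrite unitmx_mul !uz.
  move=> p vp; have uB := uz _ zB.
  have rf := regf_mul (unitmx1 K n) uB (rp p).
  have := zcl_regf uH rf _ zA; rewrite mul1mx; apply => C HC.
  by rewrite mul1mx; case: (M1 C B HC zB) => _; apply.
- move=> A zA; split; first by rewrite unitmx_inv uz.
  by move=> p vp; apply: (zcl_regf uH (regf_inv (rp p)) _ zA) => B HB; apply/vp/HV.
Qed.

(** The monoid generated by [X], which is a group as soon as [X] is stable under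
    inversion. *)
Definition gen X : set 'M[K]_n := [set A | forall L : set 'M[K]_n,
  L 1%:M -> (forall B C, L B -> X C -> L (B *m C)) -> L A].

Lemma gen1 X : gen X 1%:M. Proof. by []. Qed.
Lemma genMX X A C : gen X A -> X C -> gen X (A *m C).
Proof. by move=> gA XC L L1 LM; exact: (LM _ _ (gA L L1 LM) XC). Qed.
Lemma sub_gen X : X `<=` gen X.
Proof. by move=> A XA; rewrite -[A]mul1mx; apply: genMX. Qed.
Lemma genM X A B : gen X A -> gen X B -> gen X (A *m B).
Proof.
move=> gA gB; apply: (gB [set B | gen X (A *m B)]); first by rewrite /= mulmx1.
by move=> C D /= h XD; rewrite mulmxA; apply: genMX.
Qed.

Lemma gen_subgroup X : (forall A, X A -> A \in unitmx) ->
  (forall A, X A -> X (invmx A)) -> subgroup_GL (gen X).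
Proof.
move=> uX XV.
have ug A : gen X A -> A \in unitmx.
  move=> gA; apply: (gA [set A | A \in unitmx]); first exact: unitmx1.
  by move=> B C /= uB XC; rewrite unitmx_mul uB uX.
split=> //; first exact: genM.
move=> A gA.
suff [] : (A \in unitmx) /\ gen X (invmx A) by [].
apply: (gA [set A | (A \in unitmx) /\ gen X (invmx A)]).
  by split; rewrite ?unitmx1 ?invmx1.
move=> B C [uB gB] XC; have uC := uX _ XC; split; first by rewrite unitmx_mul uB.
rewrite (_ : invmx _ = invmx C *m invmx B); last first.
  apply: (can_inj (mulKmx (_ : B *m C \in unitmx))); first by rewrite unitmx_mul uB.
  by rewrite mulmxV ?unitmx_mul ?uB // mulmxA mulmxK // mulmxV.
exact: (genM (sub_gen (XV _ XC)) gB).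
Qed.

Lemma gen_min X H : subgroup_GL H -> X `<=` H -> gen X `<=` H.
Proof. by move=> [_ H1 HM _] XH A gA; apply: gA => // B C HB /XH HC; apply: HM. Qed.

(** A step by [C] never crosses from one part of a separation to the other; this
    is what connectedness of a piece containing [1] and [C] gives. *)
Definition linked H C := forall A Y Z, H A -> zariski_closed Y -> zariski_closed Z ->
  H `<=` Y `|` Z -> Y `&` Z = set0 -> Y A -> Y (A *m C).

(** The part of a separation that contains [1] is preserved by every generator, so
    it contains the generated group and its closure. *)
Lemma zcl_gen_connected X : (forall A, X A -> A \in unitmx) ->
  (forall C, X C -> linked (gen X) C) -> zariski_connected (zcl (gen X)).
Proof.
move=> uX lX Y Z zY zZ e YZ.
have ug A : gen X A -> A \in unitmx.
  move=> gA; apply: (gA [set A | A \in unitmx]); first exact: unitmx1.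
  by move=> B C /= uB XC; rewrite unitmx_mul uB uX.
have main Y' Z' : zariski_closed Y' -> zariski_closed Z' ->
    zcl (gen X) = Y' `|` Z' -> Y' `&` Z' = set0 -> Y' 1%:M -> Z' = set0.
  move=> zY' zZ' e' YZ' Y1.
  have gs : gen X `<=` Y' `|` Z' by rewrite -e'; apply: sub_zcl.
  have gY : gen X `<=` Y'.
    move=> A gA; suff [] : gen X A /\ Y' A by [].
    apply: (gA [set A | gen X A /\ Y' A]); first by split => //; apply: gen1.
    move=> B C [gB YB] XC; split; first exact: genMX.
    exact: (lX C XC B Y' Z').
  have zs := zcl_min zY' gY.
  apply/seteqP; split=> // A ZA; rewrite -YZ'; split => //.
  by apply: zs; rewrite e'; right.
have : (Y `|` Z) 1%:M by rewrite -e; apply: (sub_zcl ug).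
case=> h1; [right; exact: (main Y Z) | left; apply: (main Z Y) => //].
  by rewrite setUC.
by rewrite setIC.
Qed.

Lemma linked_conn H C (HC : set 'M[K]_n) : zariski_closed HC -> zariski_connected HC ->
  HC 1%:M -> HC C -> (forall A, H A -> A \in unitmx) ->
  (forall A B, H A -> HC B -> H (A *m B)) -> linked H C.
Proof.
move=> zC cC C1 CC uH HM A Y Z HA zY zZ HYZ YZ YA.
have uA := uH _ HA.
pose tr W := HC `&` [set B | W (A *m B *m 1%:M)].
have ztr W : zariski_closed W -> zariski_closed (tr W).
  by move=> zW; apply: zcI => //; apply: zc_trans => //; apply: unitmx1.
have e : HC = tr Y `|` tr Z.
  apply/seteqP; split=> [B hB|B [[]|[]]] //; rewrite /tr /= !mulmx1.
  by case: (HYZ (A *m B) (HM _ _ HA hB)); [left | right].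
have d : tr Y `&` tr Z = set0.
  apply/seteqP; split=> // B; rewrite /tr /= !mulmx1 => -[[_ hY] [_ hZ]].
  by suff: (Y `&` Z) (A *m B) by rewrite YZ.
case: (cC _ _ (ztr _ zY) (ztr _ zZ) e d) => e0.
  have : tr Y 1%:M by split => //=; rewrite !mulmx1.
  by rewrite e0.
by move: CC; rewrite e e0 setU0 => -[_] /=; rewrite mulmx1.
Qed.

(** Satisfied by curves with entries polynomial in [t] up to a power of [t], such
    as additive and multiplicative one-parameter subgroups. *)
Definition curve_ok (phi : K -> 'M[K]_n) := forall p, exists q : {poly K},
  forall t, t != 0 -> (q.[t] == 0) = (mxeval p (phi t) == 0).

Lemma curve_ok_mull A phi : curve_ok phi -> curve_ok (fun t => A *m phi t).
Proof.
move=> h p.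
have [q hq] : polyf (fun B => mxeval p (A *m B)).
  have PA := polyf_alg K n; apply: (fun_alg_mxeval p PA).
  by apply: (entriesM PA); [exact: (entriesC PA) | exact: polyf_entries].
have [r hr] := h q; exists r => t t0; rewrite hr //.
by rewrite -(congr1 (fun f => f (phi t)) hq).
Qed.

Hypothesis charK0 : [pchar K] =i pred0.

(** Polynomials vanishing on one part and not at the end lying in the other pull
    back to two nonzero polynomials in the parameter; if the curve crossed, every
    parameter would be a root of one of them. *)
Lemma linked_curve H phi t0 : curve_ok phi -> t0 != 0 -> phi 1 = 1%:M ->
  (forall A, H A -> A \in unitmx) ->
  (forall A t, H A -> t != 0 -> H (A *m phi t)) -> linked H (phi t0).
Proof.
move=> /curve_ok_mull cphi t00 phi1 uH HM A Y Z HA zY zZ HYZ YZ YA.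
apply: contrapT => nY.
have [p [vp p0]] := zc_sep zY (uH _ (HM _ _ HA t00)) nY.
have nZ : ~ Z (A *m phi 1).
  by rewrite phi1 mulmx1 => ZA; suff: (Y `&` Z) A by rewrite YZ.
have [p' [vp' p'0]] := zc_sep zZ (uH _ (HM _ _ HA (oner_neq0 K))) nZ.
have [q hq] := cphi A p; have [q' hq'] := cphi A p'.
(* the factor ['X] excludes the parameter [0], where the curve is not controlled *)
have : 'X * q * q' != 0.
  rewrite !mulf_neq0 ?polyX_eq0 //.
    by apply: contraNneq p0 => e; rewrite -hq // e horner0.
  by apply: contraNneq p'0 => e; rewrite -hq' ?oner_neq0 // e horner0.
move=> /(nonroot charK0) [t]; rewrite !hornerM hornerX !mulf_eq0 !negb_or.
move=> /andP [/andP [t0' qt] q't].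
case: (HYZ _ (HM _ _ HA t0')) => h.
  by move: qt; rewrite hq // vp ?eqxx.
by move: q't; rewrite hq' // vp' ?eqxx.
Qed.

End Topology.

(** * The Lie algebra of a group through invariant vector fields *)

Section Derivations.
Variables (K : closedFieldType) (N : nat).
Implicit Types (p q : {mpoly K[N]}).

Lemma mpoly_alg_ind (P : {mpoly K[N]} -> Prop) :
  (forall c, P c%:MP) -> (forall i, P 'X_i) ->
  (forall p q, P p -> P q -> P (p + q)) -> (forall p q, P p -> P q -> P (p * q)) ->
  forall p, P p.
Proof.
move=> hC hX hD hM p; rewrite [p]mpolyE.
elim: (msupp p : seq _) => [|m s IH]; first by rewrite big_nil; exact: (hC 0).
rewrite big_cons; apply: (hD) => //; rewrite -mul_mpolyC; apply: (hM) => //.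
rewrite mpolyXE_id; elim: (index_enum _) => [|i r IHr].
  by rewrite big_nil; exact: (hC 1).
rewrite big_cons; apply: (hM) => //.
elim: (m i) => [|k IHk]; first by rewrite expr0; exact: (hC 1).
by rewrite exprS; apply: hM.
Qed.

Definition der (l : 'I_N -> {mpoly K[N]}) p := \sum_k p^`M(k) * l k.

Lemma derC l c : der l c%:MP = 0.
Proof. by rewrite /der big1 // => k _; rewrite mderivC mul0r. Qed.

Lemma der0 l : der l 0 = 0.
Proof. by have := derC l 0. Qed.

Lemma derD l p q : der l (p + q) = der l p + der l q.
Proof. by rewrite /der -big_split; apply: eq_bigr => k _; rewrite mderivD mulrDl. Qed.

Lemma derZ l c p : der l (c *: p) = c *: der l p.
Proof. by rewrite /der scaler_sumr; apply: eq_bigr => k _; rewrite mderivZ scalerAl. Qed.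

Lemma derM l p q : der l (p * q) = der l p * q + p * der l q.
Proof.
rewrite /der mulr_suml mulr_sumr -big_split; apply: eq_bigr => k _ /=.
by rewrite mderivM mulrDl mulrAC mulrA.
Qed.

Lemma derX l k : der l 'X_k = l k.
Proof.
rewrite /der (bigD1 k) //= mderivX big1 => [|j jk].
  by rewrite mnm1E eqxx -{1}[U_(_)%MM]add0m addmK mpolyX0 scale1r mul1r addr0.
by rewrite mderivX mnm1E eq_sym (negPf jk) scale0r mul0r.
Qed.

Lemma der_comm l1 l2 l3 p : (forall k, der l1 (l2 k) - der l2 (l1 k) = l3 k) ->
  der l1 (der l2 p) - der l2 (der l1 p) = der l3 p.
Proof.
move=> h; elim/mpoly_alg_ind: p => [c|i|p q hp hq|p q hp hq].
- by rewrite !derC subrr.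
- by rewrite !derX.
- by rewrite !derD -hp -hq; rewrite opprD addrACA.
- by rewrite !(derM, derD) -hp -hq; ring.
Qed.

End Derivations.

Section LieAlg.
Variables (K : closedFieldType) (n : nat).
Implicit Types (G H : set 'M[K]_n) (p q : {mpoly K[n * n]}) (A Y x y : 'M[K]_n).

(** The differential of [p] at [A], applied to [Y]. *)
Definition dp p A Y := \sum_(k < n * n) mxeval p^`M(k) A * mxvec Y 0 k.

Lemma LieP G x : Lie G x <-> forall p, vanish G p -> dp p 1%:M x = 0.
Proof. by []. Qed.

Lemma dpD p A Y Y' : dp p A (Y + Y') = dp p A Y + dp p A Y'.
Proof. by rewrite /dp -big_split; apply: eq_bigr => k _; rewrite linearD mxE mulrDr. Qed.
Lemma dpZ p A c Y : dp p A (c *: Y) = c * dp p A Y.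
Proof.
by rewrite /dp mulr_sumr; apply: eq_bigr => k _; rewrite linearZ mxE mulrCA.
Qed.

Lemma mmap_poly_eval (h : 'I_(n * n) -> {poly K}) p t :
  (mmap polyC h p).[t] = p.@[fun k => (h k).[t]].
Proof.
elim/mpoly_alg_ind: p => [c|i|p q hp hq|p q hp hq].
- by rewrite mmapC mevalC hornerC.
- by rewrite mmapX mmap1U mevalXU.
- by rewrite mmapD mevalD hornerD hp hq.
- by rewrite rmorphM mevalM hornerM hp hq.
Qed.

Lemma mmap_poly_deriv (h : 'I_(n * n) -> {poly K}) p :
  (mmap polyC h p)^`() = \sum_k mmap polyC h p^`M(k) * (h k)^`().
Proof.
elim/mpoly_alg_ind: p => [c|i|p q hp hq|p q hp hq].
- by rewrite mmapC derivC big1 // => k _; rewrite mderivC mmap0 mul0r.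
- rewrite mmapX mmap1U (bigD1 i) //= mderivX big1 => [|j ji].
    by rewrite mnm1E eqxx -{1}[U_(_)%MM]add0m addmK mpolyX0 scale1r rmorph1 mul1r addr0.
  by rewrite mderivX mnm1E eq_sym (negPf ji) scale0r mmap0 mul0r.
- by rewrite mmapD derivD hp hq -big_split; apply: eq_bigr => k _; rewrite mderivD mmapD mulrDl.
- rewrite rmorphM derivM hp hq mulr_suml mulr_sumr -big_split; apply: eq_bigr => k _.
  by rewrite mderivM mmapD !rmorphM /=; ring.
Qed.

Definition line p A Y : {poly K} :=
  mmap polyC (fun k => (mxvec A 0 k)%:P + (mxvec Y 0 k) *: 'X) p.

Lemma line_eval p A Y t : (line p A Y).[t] = mxeval p (A + t *: Y).
Proof.
rewrite /line mmap_poly_eval /mxeval; apply: meval_eq => k.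
by rewrite hornerD hornerC hornerZ hornerX linearD linearZ !mxE mulrC.
Qed.

Lemma line_deriv p A Y : (line p A Y)^`().[0] = dp p A Y.
Proof.
rewrite /line mmap_poly_deriv horner_sum; apply: eq_bigr => k _.
rewrite hornerM mmap_poly_eval /mxeval derivD derivC derivZ derivX add0r.
rewrite hornerZ hornerC mulr1; congr (_ * _); apply: meval_eq => j.
by rewrite hornerD hornerC hornerZ hornerX mulr0 addr0.
Qed.

Hypothesis charK0 : [pchar K] =i pred0.

Lemma dp_ext p q A B Y Z :
  (forall t, mxeval p (A + t *: Y) = mxeval q (B + t *: Z)) -> dp p A Y = dp q B Z.
Proof.
move=> h; rewrite -!line_deriv; congr (_^`()).[0].
by apply: (poly_ext charK0) => t; rewrite !line_eval.
Qed.

Lemma polyf_lin (P Q : 'M[K]_n) p : exists q, forall A, mxeval q A = mxeval p (P *m A *m Q).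
Proof.
have PA := polyf_alg K n.
have [q hq] : polyf (fun A => mxeval p (P *m A *m Q)).
  apply: (fun_alg_mxeval p PA); apply: (entriesM PA); last exact: (entriesC PA).
  by apply: (entriesM PA); [exact: (entriesC PA) | exact: polyf_entries].
by exists q => A; rewrite -(congr1 (fun f => f A) hq).
Qed.

Lemma Lie_map G H (P Q : 'M[K]_n) x : P *m Q = 1%:M ->
  (forall A, G A -> H (P *m A *m Q)) -> Lie G x -> Lie H (P *m x *m Q).
Proof.
move=> PQ hGH /LieP Lx; apply/LieP => p vp; have [q hq] := polyf_lin P Q p.
have vq : vanish G q by move=> A GA; rewrite hq; apply/vp/hGH.
rewrite -(Lx q vq); apply: dp_ext => t; rewrite hq mulmxDr mulmxDl mulmx1 PQ.
by rewrite -scalemxAr -scalemxAl.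
Qed.

Lemma Lie_sub G H x : G `<=` H -> Lie G x -> Lie H x.
Proof. by move=> GH Lx p vp; apply: Lx => A /GH; apply: vp. Qed.

Lemma Lie0 G : Lie G 0.
Proof. by move=> p _; rewrite big1 // => k _; rewrite linear0 mxE mulr0. Qed.

Lemma LieD G x y : Lie G x -> Lie G y -> Lie G (x + y).
Proof. by move=> /LieP Lx /LieP Ly; apply/LieP => p vp; rewrite dpD Lx // Ly // addr0. Qed.

Lemma LieZ G c x : Lie G x -> Lie G (c *: x).
Proof. by move=> /LieP Lx; apply/LieP => p vp; rewrite dpZ Lx // mulr0. Qed.

Definition Xmat : 'M[{mpoly K[n * n]}]_n := \matrix_(i, j) 'X_(mxvec_index i j).
Definition ell y k := mxvec (Xmat *m map_mx (@mpolyC _ K) y) 0 k.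
(** The left-invariant vector field of [y]: at [A] it differentiates in the
    direction [A *m y]. *)
Definition Dy y p := der (ell y) p.

Lemma ell_eval y k A : mxeval (ell y k) A = mxvec (A *m y) 0 k.
Proof.
case/mxvec_indexP: k => i j; rewrite /ell !mxvecE !mxE /mxeval raddf_sum.
by apply: eq_bigr => l _; rewrite !mxE /= mevalM mevalXU mevalC mxvecE.
Qed.

Lemma Dy_eval y p A : mxeval (Dy y p) A = dp p A (A *m y).
Proof.
rewrite /Dy /der /mxeval raddf_sum; apply: eq_bigr => k _ /=.
by rewrite mevalM; congr (_ * _); rewrite -ell_eval.
Qed.

(** Left translations by [G] preserve the ideal of [G], so the condition at [1]
    that defines the Lie algebra holds at every point of [G]. *)
Lemma Dy_vanish G y p : subgroup_GL G -> Lie G y -> vanish G p -> vanish G (Dy y p).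
Proof.
move=> [_ _ GM _] /LieP Ly vp g Gg; rewrite Dy_eval.
have [q hq] := polyf_lin g 1%:M p.
have vq : vanish G q by move=> A GA; rewrite hq mulmx1; apply/vp/GM.
rewrite -(Ly q vq); apply: dp_ext => t.
by rewrite hq mulmx1 mulmxDr mulmx1 -scalemxAr.
Qed.

Lemma Dy_comm x y p : Dy x (Dy y p) - Dy y (Dy x p) = Dy (ad x y) p.
Proof.
apply: der_comm => k.
have h z w l : der (ell z) (ell w l) = mxvec (Xmat *m map_mx (@mpolyC _ K) (z *m w)) 0 l.
  case/mxvec_indexP: l => i j; rewrite [ell w _]mxvecE [RHS]mxvecE [in LHS]mxE [RHS]mxE.
  transitivity (\sum_l (\sum_m Xmat i m * (z m l)%:MP) * (w l j)%:MP).
    rewrite (big_morph _ (derD (ell z)) (der0 _)); apply: eq_bigr => l _.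
    rewrite !mxE derM derC mulr0 addr0 derX /ell mxvecE !mxE; congr (_ * _).
    by apply: eq_bigr => m _; rewrite !mxE.
  under eq_bigr do rewrite mulr_suml.
  rewrite exchange_big; apply: eq_bigr => l _; rewrite !mxE raddf_sum mulr_sumr.
  by apply: eq_bigr => m _; rewrite /= mpolyCM mulrA.
rewrite !h /ell; have -> : map_mx (@mpolyC (n * n) K) (ad x y) =
    map_mx (@mpolyC (n * n) K) (x *m y) - map_mx (@mpolyC (n * n) K) (y *m x).
  apply/matrixP => i j; rewrite mxE /ad [in LHS]mxE [(- (y *m x)) i j]mxE mpolyCB.
  rewrite [RHS]mxE; congr (_ + _); first by rewrite [RHS]mxE.
  by rewrite [RHS]mxE; congr (- _); rewrite [RHS]mxE.
by rewrite mulmxBr linearB !mxE.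
Qed.

(** The commutator of the vector fields of [x] and [y] is the vector field of
    [ad x y], and all three preserve the ideal of [G]. *)
Lemma Lie_bracket G x y : subgroup_GL G -> Lie G x -> Lie G y -> Lie G (ad x y).
Proof.
move=> sG Lx Ly; apply/LieP => p vp.
have G1 : G 1%:M by case: sG.
have vxy := Dy_vanish sG Lx (Dy_vanish sG Ly vp).
have vyx := Dy_vanish sG Ly (Dy_vanish sG Lx vp).
rewrite -[ad x y]mul1mx -Dy_eval -Dy_comm mxevalB.
exact: (etrans (congr2 (fun a b => a - b) (vxy _ G1) (vyx _ G1)) (subrr 0)).
Qed.

End LieAlg.

(** * Nilpotent matrices and the Jordan decomposition *)

Section Nilp.
Variables (K : closedFieldType) (n : nat).
Implicit Types (x y u w : 'M[K]_n) (P Q : 'M[K]_n).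

Definition nilp y : Prop := y ^+ n = 0.

Lemma nilp_char_poly y k : y ^+ k = 0 -> char_poly y = 'X^n.
Proof.
move=> yk0; have [r hr] := closed_field_poly_normal (char_poly y).
have mc := char_poly_monic y; move: (mc); rewrite monicE => /eqP lc.
rewrite lc scale1r in hr.
have r0 z : z \in r -> z = 0.
  move=> zr; have : root (char_poly y) z by rewrite hr root_prod_XsubC.
  rewrite -eigenvalue_root_char => /eigenvalueP [v vy v0].
  have vyk j : v *m (y ^+ j) = z ^+ j *: v.
    elim: j => [|j IH]; first by rewrite !expr0 mulmx1 scale1r.
    by rewrite exprSr -mulmxE mulmxA IH -scalemxAl vy scalerA -exprSr.
  move: (vyk k); rewrite yk0 mulmx0 => /esym/eqP.
  by rewrite scaler_eq0 (negPf v0) orbF expf_eq0 => /andP [_ /eqP].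
have e : char_poly y = 'X^(size r).
  rewrite hr; elim: (r) r0 => [|z s IH] r0; first by rewrite big_nil expr0.
  rewrite big_cons (r0 z) ?mem_head // subr0 exprS IH // => t ts.
  by apply: r0; rewrite in_cons ts orbT.
have := size_char_poly y; rewrite e size_polyXn => -[->]; by [].
Qed.

End Nilp.

Section Nilp2.
Variables (K : closedFieldType).

Lemma mx0_eq (A B : 'M[K]_0) : A = B.
Proof. by apply/matrixP => -[]. Qed.

Lemma nilpI n (y : 'M[K]_n) k : y ^+ k = 0 -> nilp y.
Proof.
rewrite /nilp; case: n y => [|m] y yk0; first exact: mx0_eq.
have := Cayley_Hamilton y; rewrite (nilp_char_poly yk0).
by rewrite rmorphXn /= horner_mx_X.
Qed.

Lemma nilp_tr0 n (y : 'M[K]_n) : nilp y -> \tr y = 0.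
Proof.
case: n y => [|m] y ny; first by rewrite /mxtrace big_ord0.
have := char_poly_trace y (isT : (0 < m.+1)%N).
rewrite (nilp_char_poly ny) coefXn /= (ltn_eqF (ltnSn m)) => /eqP.
by rewrite eq_sym oppr_eq0 => /eqP.
Qed.

Variable n : nat.
Implicit Types (x y u w : 'M[K]_n) (P Q : 'M[K]_n).

Lemma mxV P : P \in unitmx -> P * invmx P = 1.
Proof. exact: mulmxV. Qed.
Lemma Vmx P : P \in unitmx -> invmx P * P = 1.
Proof. exact: mulVmx. Qed.
Lemma trM x y : \tr (x * y) = \tr (y * x).
Proof. exact: mxtrace_mulC. Qed.
Lemma tr_conj P y : P \in unitmx -> \tr (P * y * invmx P) = \tr y.
Proof. by move=> uP; rewrite trM mulrA Vmx // mul1r. Qed.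
Lemma conjK P y : P \in unitmx -> invmx P * (P * y * invmx P) * P = y.
Proof. by move=> uP; rewrite !mulrA Vmx // mul1r -mulrA Vmx // mulr1. Qed.
Lemma conjVK P y : P \in unitmx -> P * (invmx P * y * P) * invmx P = y.
Proof. by move=> uP; rewrite !mulrA mxV // mul1r -mulrA mxV // mulr1. Qed.

Lemma sclMl c x y : (c *: x) * y = c *: (x * y).
Proof. by rewrite -!mulmxE scalemxAl. Qed.
Lemma sclMr c x y : x * (c *: y) = c *: (x * y).
Proof. by rewrite -!mulmxE scalemxAr. Qed.

Lemma nilp0 : nilp (0 : 'M[K]_n).
Proof. by apply: (@nilpI _ _ 1); rewrite expr1. Qed.

Lemma nilpMcomm x y : x * y = y * x -> nilp y -> nilp (x * y).
Proof. by move=> c ny; rewrite /nilp exprMn_comm // ny mulr0. Qed.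

Lemma nilpZ c y : nilp y -> nilp (c *: y).
Proof.
move=> ny; rewrite -mul_scalar_mx mulmxE; apply: nilpMcomm => //.
by rewrite -mulmxE scalar_mxC.
Qed.

Lemma nilpDcomm x y : x * y = y * x -> nilp x -> nilp y -> nilp (x + y).
Proof.
move=> c nx ny; apply: (@nilpI _ _ (n + n)); rewrite exprDn_comm // big1 // => i _.
have [ni|ni] := leqP n i.
  by rewrite -(subnK ni) [y ^+ _]exprD ny mulr0 mulr0 mul0rn.
rewrite (_ : (n + n - i = (n - i) + n)%N); last by rewrite addnC addnBA // ltnW.
by rewrite exprD nx mulr0 mul0r mul0rn.
Qed.

Lemma conj_exp P Q y k : Q * P = 1 -> P * Q = 1 -> (P * y * Q) ^+ k = P * y ^+ k * Q.
Proof.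
move=> QP PQ; elim: k => [|k IH]; first by rewrite !expr0 mulr1.
by rewrite !exprS IH !mulrA -[P * y * Q * P]mulrA QP mulr1.
Qed.

Lemma nilp_conj P Q y : Q * P = 1 -> P * Q = 1 -> nilp y -> nilp (P * y * Q).
Proof. by move=> QP PQ ny; rewrite /nilp conj_exp // ny mulr0 mul0r. Qed.

End Nilp2.

Section JordanChevalley.
Variables (K : closedFieldType).

(** The polynomial that acts as the scalar [a] on the generalised eigenspace of
    each [a], by the Chinese remainder theorem. *)
Lemma crt_poly (rs : seq K) m : uniq rs ->
  exists S : {poly K}, forall a, a \in rs -> ('X - a%:P) ^+ m %| S - a%:P.
Proof.
elim: rs => [|a rs IH] /=; first by exists 0.
move=> /andP [ars /IH [S hS]].
pose Q := \prod_(b <- rs) ('X - b%:P) ^+ m.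
have cop : coprimep (('X - a%:P) ^+ m) Q.
  rewrite /Q big_seq; elim/big_ind: _ => [|p q hp hq|b brs].
  - exact: coprimep1.
  - by rewrite coprimepMr hp hq.
  - apply/coprimep_expl/coprimep_expr; rewrite coprimep_XsubC root_XsubC.
    by apply: contraNneq ars => <-.
have [[u v] /= uv] := Bezout_eq1_coprimepP _ _ cop.
exists (S + v * Q * (a%:P - S)) => b; rewrite inE => /orP [/eqP ->|brs].
  have -> : S + v * Q * (a%:P - S) - a%:P = (S - a%:P) * u * ('X - a%:P) ^+ m.
    rewrite -[RHS]mulrA -[u * _](addrK (v * Q)) uv; ring.
  exact: dvdp_mull (dvdpp _).
rewrite addrAC dvdp_add ?hS // -mulrA dvdp_mull // dvdp_mulr //.
by rewrite /Q (big_rem b) //= dvdp_mulr.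
Qed.

Lemma dvdp_prod_exp (r : seq K) (q : {poly K}) :
  (forall a, a \in r -> 'X - a%:P %| q) -> \prod_(a <- r) ('X - a%:P) %| q ^+ size r.
Proof.
elim: r => [|a r IH] h; first by rewrite big_nil expr0.
rewrite big_cons /= exprS dvdp_mul ?h ?mem_head // IH // => b br.
by rewrite h // in_cons br orbT.
Qed.

(** The semisimple part is a polynomial in [y], hence commutes with whatever
    commutes with [y]. *)
Lemma jordan_chevalley n (y : 'M[K]_n) : exists s P a, [/\ P \in unitmx,
  P * s * invmx P = diag_mx a, nilp (y - s) & forall z, z * y = y * z -> z * s = s * z].
Proof.
case: n y => [|m] y.
  by exists 0, 1%:M, 0; split=> [|||z _]; rewrite ?unitmx1 //; apply: mx0_eq.
set n := m.+1; have [r hr] := closed_field_poly_normal (char_poly y).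
have mc := char_poly_monic y; move: (mc); rewrite monicE => /eqP lc.
rewrite lc scale1r in hr.
have sr : size r = n.
  by have := size_char_poly y; rewrite hr size_prod_XsubC => -[].
have [S hS] := crt_poly n (undup_uniq r).
pose s := horner_mx y S.
pose q := \prod_(a <- undup r) ('X - a%:P).
have qa a : a \in r -> 'X - a%:P %| q.
  by move=> ar; rewrite /q (big_rem a) ?mem_undup //= dvdp_mulr.
have cq : char_poly y %| q ^+ n by rewrite hr -sr; apply: dvdp_prod_exp.
have horn0 (p : {poly K}) : char_poly y %| p -> horner_mx y p = 0.
  by move=> /dvdpP [t ->]; rewrite rmorphM /= Cayley_Hamilton mulr0.
have nys : nilp (y - s).
  have -> : y - s = horner_mx y ('X - S) by rewrite rmorphB /= horner_mx_X.
  rewrite /nilp -rmorphXn; apply: horn0; apply: dvdp_trans cq _; apply: dvdp_exp2r.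
  apply: uniq_roots_dvdp; last by rewrite uniq_rootsE undup_uniq.
  apply/allP => a; rewrite mem_undup -mem_undup => ar; apply/rootP.
  have /rootP : root (S - a%:P) a.
    rewrite -dvdp_XsubCl; apply: dvdp_trans (hS a ar).
    by rewrite exprS dvdp_mulr.
  rewrite !hornerD !hornerN hornerC hornerX => /subr0_eq ->; exact: subrr.
have qs0 : horner_mx s q = 0.
  have -> : horner_mx s q = horner_mx y (\prod_(a <- undup r) (S - a%:P)).
    rewrite /q !rmorph_prod /=; apply: eq_bigr => a _.
    by rewrite !rmorphB /= horner_mx_X !horner_mx_C.
  apply: horn0; apply: dvdp_trans cq _; rewrite /q -prodrXl.
  rewrite big_seq [X in _ %| X]big_seq; elim/big_rec2: _ => [|a p1 p2 ar h]; first exact: dvdpp.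
  by rewrite dvdp_mul // hS.
have [P uP dP] : diagonalizable s.
  by apply/diagonalizableP; exists (undup r); [exact: undup_uniq | exact: mxminpoly_min].
have [a /(simmxLR uP) sa] := diagonalizable_forPex dP.
exists s, P, a; split => //; last first.
  by move=> z zy; apply: comm_mx_horner; rewrite /comm_mx mulmxE.
rewrite sa /mxpoly.conjmx pinvmxE ?unitmx_inv // invmxK -!mulmxE !mulmxA mulmxV // mul1mx.
by rewrite -mulmxA mulmxV ?mulmx1.
Qed.

End JordanChevalley.

Section Jacobson.
Variables (K : closedFieldType) (charK0 : [pchar K] =i pred0) (n : nat).
Implicit Types (x y u z : 'M[K]_n) (P Q : 'M[K]_n).

Lemma diag_conj_exp P s a k : P \in unitmx -> P * s * invmx P = diag_mx a ->
  P * s ^+ k * invmx P = diag_mx (\row_i a 0 i ^+ k).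
Proof.
move=> uP sa; rewrite -conj_exp ?sa; [|exact: mulVmx|exact: mulmxV].
elim: k => [|k IH].
  rewrite expr0; apply/matrixP => i j; rewrite !mxE expr0; by case: (i == j).
rewrite exprS IH -mulmxE mulmx_diag; congr diag_mx.
by apply/rowP => i; rewrite !mxE exprS.
Qed.

(** The power sums of the eigenvalues vanish, and so do the sums over the
    eigenvalues of any polynomial without constant term; one that is supported on
    a single nonzero eigenvalue yields a nonzero multiple of a natural number. *)
Lemma tr_exp_nilp u : (forall k, \tr (u ^+ k.+1) = 0) -> nilp u.
Proof.
move=> tu; have [s [P [a [uP sa nus cs]]]] := jordan_chevalley u.
have us : u * s = s * u by rewrite cs.
suff s0 : s = 0 by move: nus; rewrite s0 subr0.
have ts k : \tr (s ^+ k.+1) = 0.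
  rewrite -[s ^+ _](subrK (u ^+ k.+1)) mxtraceD tu addr0 -opprB raddfN /=.
  rewrite (subrXX_comm _ us) nilp_tr0 ?oppr0 //.
  have cus : GRing.comm (u - s) u.
    by rewrite /GRing.comm mulrBl mulrBr us.
  have css : GRing.comm (u - s) s.
    by rewrite /GRing.comm mulrBl mulrBr us.
  set w := \sum_(_ < _) _; have c : w * (u - s) = (u - s) * w.
    apply: commr_sym; apply: commr_sum => i _; apply: commrM; exact: commrX.
  by rewrite -c; apply: nilpMcomm.
have ta k : \sum_i a 0 i ^+ k.+1 = 0.
  have := ts k; rewrite -(tr_conj _ uP) (diag_conj_exp k.+1 uP sa) mxtrace_diag => h; rewrite -[RHS]h.
  by apply: eq_bigr => i _; rewrite mxE.
have tq (q : {poly K}) : \sum_i ('X * q).[a 0 i] = 0.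
  rewrite -[q]coefK poly_def mulr_sumr.
  under eq_bigr do rewrite horner_sum.
  rewrite exchange_big big1 // => j _ /=.
  transitivity (q`_j * \sum_i a 0 i ^+ j.+1); last by rewrite ta mulr0.
  rewrite mulr_sumr; apply: eq_bigr => i _.
  by rewrite -scalerAr hornerZ -exprS hornerXn.
have a0 i : a 0 i = 0.
  apply/eqP/negPn/negP => ai0.
  pose q := \prod_(b <- undup [seq a 0 j | j : 'I_n] | b != a 0 i) ('X - b%:P).
  have qz j : a 0 j != a 0 i -> q.[a 0 j] = 0.
    move=> ne; apply/rootP; rewrite /q -big_filter root_prod_XsubC mem_filter ne.
    by rewrite mem_undup; apply: map_f; rewrite mem_enum.
  have qi : q.[a 0 i] != 0.
    rewrite -/(root q _) /q -big_filter root_prod_XsubC mem_filter negb_and.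
    by rewrite eqxx.
  have := tq q; rewrite (bigID (fun j => a 0 j == a 0 i)) /= [X in _ + X]big1 ?addr0; last first.
    by move=> j ne; rewrite hornerM qz ?mulr0.
  rewrite (eq_bigr (fun=> a 0 i * q.[a 0 i])); last first.
    by move=> j /eqP ->; rewrite hornerM hornerX.
  rewrite sumr_const => /eqP; rewrite -mulr_natr !mulf_eq0 (negPf ai0) (negPf qi) /=.
  have : (0 < #|[pred j | a 0%R j == a 0%R i]|)%N by apply/card_gt0P; exists i; rewrite inE.
  case: #|_| => // k _; exact/negP/nat_neq0.
rewrite -(conjK s uP) sa (_ : diag_mx a = 0) ?mulr0 ?mul0r //.
by apply/matrixP => i j; rewrite !mxE a0 mul0rn.
Qed.

(** As [x] commutes with [u = ad x z], the matrix [u^(k+1) = ad x (u^k z)] has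
    trace zero. *)
Lemma jacobson x z : ad x (ad x z) = 0 -> nilp (ad x z).
Proof.
set u := ad x z => /eqP; rewrite /ad subr_eq0 !mulmxE => /eqP xu.
apply: tr_exp_nilp => k; rewrite exprSr {2}/u /ad !mulmxE mulrBr !mulrA.
have c : GRing.comm (u ^+ k) x by apply: commr_sym; apply: commrX.
by rewrite c -[x * _ * z]mulrA raddfB /= trM subrr.
Qed.

(** The bracket [u = ad x y] is nilpotent and commutes with [x], and
    [x^(i+1) y = y x^(i+1) + (i+1) u x^i]; by descending induction on [i] some
    power of [x y] is killed by [x^i] on the left. *)
Lemma nilp_mul_ad x y : nilp x -> ad x (ad x y) = 0 -> nilp (x * y).
Proof.
move=> nx /[dup] /jacobson; set u := ad x y => nu /eqP.
rewrite /ad subr_eq0 !mulmxE => /eqP xu.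
have xy : x * y = y * x + u by rewrite /u /ad !mulmxE addrC subrK.
have step i : x ^+ i.+1 * y = y * x ^+ i.+1 + (u * x ^+ i) *+ i.+1.
  elim: i => [|i IH]; first by rewrite expr1 expr0 mulr1 mulr1n.
  have cx : GRing.comm u (x ^+ i.+1) by apply: commrX; rewrite /GRing.comm xu.
  rewrite [in LHS]exprS -mulrA IH mulrDr mulrA xy mulrDl -[y * x * _]mulrA -exprS.
  by rewrite mulrnAr mulrA xu -[u * x * _]mulrA -exprS -addrA -mulrS.
have key i : exists N, x ^+ (n - i) * (x * y) ^+ N = 0.
  elim: i => [|i [N hN]]; first by exists 0%N; rewrite subn0 nx mul0r.
  have [ni|ni] := leqP n i.
    have e0 : (n - i = 0)%N by apply/eqP; rewrite subn_eq0.
    by exists N; rewrite subnS e0 -[X in x ^+ X]e0.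
  have e : (n - i = (n - i.+1).+1)%N by rewrite subnSK.
  move: hN; rewrite e; set j := (n - i.+1)%N => hN; exists (n + N)%N.
  have cu k : GRing.comm (u ^+ k) (x ^+ j).
    by apply: commr_sym; apply: commrX; apply: commr_sym; apply: commrX; rewrite /GRing.comm xu.
  have st k : x ^+ j * (x * y) ^+ (k + N) = (u ^+ k * x ^+ j * (x * y) ^+ N) *+ (j.+1 ^ k) /\
       x ^+ j.+1 * (x * y) ^+ (k + N) = 0.
    elim: k => [|k [IH1 IH2]]; first by rewrite expr0 mul1r expn0 mulr1n.
    have E : x ^+ j * (x * y) ^+ (k.+1 + N) = (u * (x ^+ j * (x * y) ^+ (k + N))) *+ j.+1.
      rewrite addSn exprS !mulrA -exprSr step mulrDl -[y * _ * _]mulrA IH2 mulr0 add0r.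
      by rewrite mulrnAl -mulrA.
    split.
      by rewrite E IH1 mulrnAr -mulrnA expnSr !mulrA -exprS.
    rewrite exprS -mulrA E mulrnAr mulrA xu -mulrA [x * _]mulrA -exprS IH2 mulr0 mul0rn //.
  by have [-> _] := st n; rewrite nu !mul0r mul0rn.
have [N] := key n; rewrite subnn expr0 mul1r; exact: nilpI.
Qed.

End Jacobson.

(** * Exponentials of nilpotent matrices *)

Section TriangularSums.

(** Regrouping of a Cauchy product of two finite sums. *)
Lemma tri_sum (V : nmodType) (F : nat -> nat -> V) n :
  (forall i j, (n <= i)%N || (n <= j)%N -> F i j = 0) ->
  \sum_(k < n + n) \sum_(i < k.+1) F i (k - i)%N = \sum_(i < n) \sum_(j < n) F i j.
Proof.
move=> F0.
rewrite -(big_mkord xpredT (fun k => \sum_(i < k.+1) F i (k - i)%N)).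
transitivity (\sum_(0 <= k < n + n) \sum_(0 <= i < n + n | (i <= k)%N) F i (k - i)%N).
  rewrite big_nat [RHS]big_nat; apply: eq_bigr => k /andP [_ kn].
  rewrite -(big_mkord xpredT (fun i => F i (k - i)%N)).
  by rewrite (big_nat_widen _ _ _ _ _ (kn : k.+1 <= n + n)%N); apply: eq_bigl => i.
rewrite (exchange_big_dep_nat xpredT) //=.
rewrite -[RHS](big_mkord xpredT (fun i => \sum_(j < n) F i j)).
rewrite (@big_cat_nat _ _ _ n) ?leq_addr //= [X in _ + X]big_nat [X in _ + X]big1 ?addr0.
  rewrite big_nat [RHS]big_nat; apply: eq_bigr => i /andP [_ ilt].
  transitivity (\sum_(i <= k < n + n) F i (k - i)%N).
    by rewrite [RHS](big_nat_widenl _ 0).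
  rewrite -{1}[i]add0n big_addn -(big_mkord xpredT (F i)).
  under eq_bigr do rewrite addnK.
  have le : (n <= n + n - i)%N by rewrite -addnBA ?leq_addr // ltnW.
  rewrite (@big_cat_nat _ _ _ n) //= [X in _ + X]big_nat [X in _ + X]big1 ?addr0 //.
  by move=> j /andP [nj _]; rewrite F0 // nj orbT.
move=> i /andP [ni _]; apply: big1 => k _; by rewrite F0 // ni.
Qed.

End TriangularSums.

Section Exp.
Variables (K : closedFieldType) (charK0 : [pchar K] =i pred0) (n : nat).
Implicit Types (x y z : 'M[K]_n) (G H : set 'M[K]_n).

(** The series stops at [n], which is exact for nilpotent matrices. *)
Definition expm y : 'M[K]_n := \sum_(k < n) (k`!%:R)^-1 *: y ^+ k.

Lemma fact_neq0 k : (k`!%:R != 0 :> K).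
Proof. by rewrite -(prednK (fact_gt0 k)); apply: nat_neq0. Qed.

Lemma expm_wide y N : nilp y -> (n <= N)%N -> \sum_(k < N) (k`!%:R)^-1 *: y ^+ k = expm y.
Proof.
move=> ny nN; rewrite -(big_mkord xpredT (fun k => (k`!%:R)^-1 *: y ^+ k)).
rewrite (@big_cat_nat _ _ _ n) //= big_mkord [X in _ + X]big_nat [X in _ + X]big1 ?addr0 //.
by move=> k /andP [nk _]; rewrite -(subnK nk) exprD ny mulr0 scaler0.
Qed.

Lemma expmD x y : x * y = y * x -> nilp x -> nilp y -> expm (x + y) = expm y * expm x.
Proof.
move=> c nx ny; rewrite -(expm_wide (nilpDcomm c nx ny) (leq_addr n n)).
pose F i j : 'M[K]_n := (i`!%:R)^-1 *: (y ^+ i) * ((j`!%:R)^-1 *: x ^+ j).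
have F0 i j : (n <= i)%N || (n <= j)%N -> F i j = 0.
  case/orP => h; rewrite /F -(subnK h) exprD; first by rewrite ny mulr0 scaler0 mul0r.
  by rewrite nx mulr0 scaler0 mulr0.
rewrite /expm mulr_suml; under [RHS]eq_bigr do rewrite mulr_sumr.
rewrite -(tri_sum F0); apply: eq_bigr => k _.
rewrite exprDn_comm // scaler_sumr; apply: eq_bigr => i _.
have ik : (i <= k)%N by rewrite -ltnS.
have cc : x ^+ (k - i) * y ^+ i = y ^+ i * x ^+ (k - i).
  by apply: commrX; apply: commr_sym; apply: commrX.
rewrite /F cc -scalerMnr -!mulmxE -scalemxAr -scalemxAl !scalerA -scaler_nat scalerA.
congr (_ *: _); rewrite -(bin_fact ik) !natrM !invfM.
rewrite mulrCA mulrA mulVf ?mul1r 1?mulrC //.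
by apply/eqP => e; have := fact_neq0 k; rewrite -(bin_fact ik) natrM e mul0r eqxx.
Qed.

Lemma expm0 : expm 0 = 1.
Proof.
rewrite /expm; case: n => [|m]; first exact: mx0_eq.
rewrite big_ord_recl fact0 expr0 invr1 scale1r big1 ?addr0 // => i _.
by rewrite exprS mul0r scaler0.
Qed.

Lemma expmN y : nilp y -> expm y * expm (- y) = 1.
Proof.
move=> ny; have nNy : nilp (- y) by rewrite -scaleN1r; apply: nilpZ.
by rewrite -expmD ?addNr ?expm0 // mulrN mulNr.
Qed.

Lemma expm_unit y : nilp y -> expm y \in unitmx.
Proof. by move=> /expmN h; have [] := mulmx1_unit h. Qed.

Lemma expmV y : nilp y -> invmx (expm y) = expm (- y).
Proof.
move=> ny; have uy := expm_unit ny.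
by rewrite -[LHS]mulr1 -(expmN ny) mulrA Vmx // mul1r.
Qed.

Lemma iter_adE y z k (F := fun i j => (i`!%:R)^-1 *: y ^+ i * z * ((j`!%:R)^-1 *: (- y) ^+ j)) :
  iter k (ad y) z = (k`!)%:R *: \sum_(i < k.+1) F i (k - i)%N.
Proof.
elim: k => [|k IH] /=.
  by rewrite big_ord_recl big_ord0 /F subnn !expr0 fact0 !invr1 !scale1r !mulr1 mul1r addr0.
have yF i j : y * F i j = i.+1%:R *: F i.+1 j.
  rewrite /F factS natrM invfM !(sclMl, sclMr) !scalerA exprS !mulrA.
  by congr (_ *: _); field; rewrite !fact_neq0 // nat1r nat_neq0.
have Fy i j : F i j * y = - (j.+1%:R *: F i j.+1).
  rewrite /F factS natrM invfM exprSr !(sclMl, sclMr) !scalerA mulrN !mulrA mulrN scalerN opprK mulrA.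
  by congr (_ *: _); field; rewrite !fact_neq0 // nat1r nat_neq0.
rewrite IH {1}/ad !mulmxE sclMl sclMr -scalerBr factS natrM mulrC -scalerA.
congr (_ *: _); rewrite mulr_sumr mulr_suml -sumrB.
rewrite (eq_bigr (fun i : 'I_k.+1 => i.+1%:R *: F i.+1 (k - i)%N +
  (k - i).+1%:R *: F i (k - i).+1)) => [|i _]; last by rewrite (yF i (k - i)%N) Fy opprK.
rewrite big_split /=.
transitivity (\sum_(i < k.+2) (i%:R *: F i (k.+1 - i)%N) +
              \sum_(i < k.+2) ((k.+1 - i)%N%:R *: F i (k.+1 - i)%N)).
  congr (_ + _).
    by rewrite [RHS]big_ord_recl scale0r add0r; apply: eq_bigr => i _; rewrite /= subSS.
  rewrite [RHS]big_ord_recr /= subnn scale0r addr0; apply: eq_bigr => i _.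
  by rewrite subSn // -ltnS.
rewrite -big_split scaler_sumr; apply: eq_bigr => i _ /=.
by rewrite -scalerDl -natrD subnKC // -ltnS.
Qed.

Lemma expm_conj y z : nilp y ->
  expm y * z * expm (- y) = \sum_(k < n + n) (k`!%:R)^-1 *: iter k (ad y) z.
Proof.
move=> ny; have nNy : nilp (- y) by rewrite -scaleN1r; apply: nilpZ.
pose F i j := (i`!%:R)^-1 *: y ^+ i * z * ((j`!%:R)^-1 *: (- y) ^+ j).
have F0 i j : (n <= i)%N || (n <= j)%N -> F i j = 0.
  case/orP => h; rewrite /F -(subnK h) exprD.
    by rewrite ny mulr0 scaler0 !mul0r.
  by rewrite nNy mulr0 scaler0 mulr0.
rewrite /expm !mulr_suml; under eq_bigr do rewrite mulr_sumr.
rewrite -(tri_sum F0); apply: eq_bigr => k _.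
by rewrite iter_adE scalerA mulVf ?fact_neq0 // scale1r.
Qed.

End Exp.

Section ExpGroup.
Variables (K : closedFieldType) (charK0 : [pchar K] =i pred0) (n : nat).
Implicit Types (x y z v : 'M[K]_n) (G H : set 'M[K]_n).

(** The curve [t -> expm (t *: y)], with polynomial entries. *)
Definition expcv y : 'M[{poly K}]_n :=
  \sum_(k < n) ((k`!%:R)^-1 *: 'X^k) *: map_mx polyC (y ^+ k).

Lemma expcvE y i j : expcv y i j = \sum_(k < n) ((y ^+ k) i j / k`!%:R) *: 'X^k.
Proof.
rewrite summxE; apply: eq_bigr => k _; rewrite !mxE mulrC mul_polyC scalerA.
by [].
Qed.

Lemma expcv_eval y t i j : (expcv y i j).[t] = expm (t *: y) i j.
Proof.
rewrite expcvE horner_sum /expm summxE; apply: eq_bigr => k _.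
rewrite hornerZ hornerXn [RHS]mxE.
have -> : (t *: y) ^+ k = t ^+ k *: y ^+ k.
  elim: (k : nat) => [|l IH]; first by rewrite !expr0 scale1r.
  by rewrite !exprS IH sclMl sclMr scalerA.
by rewrite mxE mulrC [RHS]mulrCA; congr (_ * _); exact: mulrC.
Qed.

Lemma expcv_deriv y : nilp y -> map_mx deriv (expcv y) = expcv y *m map_mx polyC y.
Proof.
move=> ny; apply/matrixP => i j.
rewrite mxE expcvE mxE raddf_sum /=.
transitivity (\sum_(k < n) ((y ^+ k.+1) i j / k`!%:R) *: 'X^k); last first.
  transitivity (\sum_l \sum_(k < n) ((y ^+ k) i l * y l j / k`!%:R) *: ('X^k : {poly K})).
    rewrite exchange_big; apply: eq_bigr => k _.
    by rewrite exprSr -mulmxE mxE mulr_suml scaler_suml.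
  apply: eq_bigr => l _; rewrite expcvE mxE mulr_suml; apply: eq_bigr => k _.
  by rewrite -scalerAl ['X^_ * _]mulrC mul_polyC scalerA mulrAC.
case: n y ny i j => [|m] y ny i j; first by case: i.
rewrite big_ord_recl expr0 alg_polyC derivC add0r.
rewrite [RHS]big_ord_recr /= ny mxE mul0r scale0r addr0; apply: eq_bigr => k _.
rewrite derivZ derivXn /= -scaler_nat scalerA factS natrM invfM -mulrA.
by rewrite [_^-1 * _]mulrC -!mulrA mulVf ?nat_neq0 // mulr1.
Qed.

(** The restriction of [p] to the exponential curve. *)
Definition Qc y (p : {mpoly K[n * n]}) := mmap polyC (fun k => mxvec (expcv y) 0 k) p.

Lemma Qc_eval y p t : (Qc y p).[t] = mxeval p (expm (t *: y)).
Proof.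
rewrite /Qc mmap_poly_eval /mxeval; apply: meval_eq => k.
by case/mxvec_indexP: k => i j; rewrite !mxvecE expcv_eval.
Qed.

Lemma Qc_deriv y p : nilp y -> (Qc y p)^`() = Qc y (Dy y p).
Proof.
move=> ny; rewrite /Qc mmap_poly_deriv /Dy /der [RHS]raddf_sum; apply: eq_bigr => k _.
rewrite /= rmorphM; congr (_ * _); case/mxvec_indexP: k => i j.
rewrite /ell !mxvecE.
have := congr1 (fun A : 'M_n => A i j) (expcv_deriv ny); rewrite mxE => ->.
rewrite !mxE raddf_sum; apply: eq_bigr => l _ /=.
by rewrite !mxE rmorphM /= mmapC mmapX mmap1U mxvecE.
Qed.

(** The derivatives at [0] of the restriction of [p] to the exponential curve are
    the values at [1] of iterated vector fields applied to [p]; they vanish. *)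
Lemma exp_mem G y : subgroup_GL G -> zariski_closed G -> Lie G y -> nilp y -> G (expm y).
Proof.
move=> sG zG Ly ny; have G1 : G 1%:M by case: sG.
apply: (zc_mem zG) => [|p vp]; first exact: expm_unit.
have vk k : vanish G (iter k (Dy y) p).
  by elim: k => [|k IH] //=; apply: Dy_vanish.
have dk k : (Qc y p)^`(k) = Qc y (iter k (Dy y) p).
  by elim: k => [|k IH]; rewrite ?derivn0 // derivnS IH Qc_deriv.
have Q0 : Qc y p = 0.
  apply/polyP => k; rewrite coef0.
  have := congr1 (fun q : {poly K} => q.[0]) (dk k).
  rewrite Qc_eval scale0r expm0 (vk k) // horner_coef0 coef_derivn addn0 ffactnn.
  by move=> /eqP; rewrite -mulr_natr mulf_eq0 (negPf (fact_neq0 charK0 k)) orbF => /eqP.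
by rewrite -[y]scale1r -Qc_eval Q0 horner0.
Qed.

Lemma exp_Lie H v : nilp v -> (forall t, H (expm (t *: v))) -> Lie H v.
Proof.
move=> nv h; apply/LieP => p vp.
have Q0 : Qc v p = 0.
  by apply: (poly_ext charK0) => t; rewrite Qc_eval horner0 vp.
rewrite -[v in dp _ _ v]mul1mx -Dy_eval.
have := Qc_eval v (Dy v p) 0; rewrite -Qc_deriv // Q0 derivC horner0 scale0r.
by rewrite expm0.
Qed.

(** The parameter is shifted so that, as for multiplicative one-parameter
    subgroups, the curve passes through [1] at [t = 1]. *)
Lemma exp_curve_ok v : curve_ok (fun t => expm ((t - 1) *: v)).
Proof.
move=> p; exists (Qc v p \Po ('X - 1%:P)) => t _.
by rewrite horner_comp hornerXsubC Qc_eval.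
Qed.

End ExpGroup.

(** * Generalised eigenvectors and integral independence *)

Section GenEigen.
Variables (K : fieldType) (E : lmodType K) (D : E -> E) (W : E -> Prop).
Hypothesis DD : forall u v, D (u + v) = D u + D v.
Hypothesis DZ : forall c u, D (c *: u) = c *: D u.
Hypothesis W0 : W 0.
Hypothesis WD : forall u v, W u -> W v -> W (u + v).
Hypothesis WZ : forall c u, W u -> W (c *: u).
Hypothesis DW : forall u, W u -> W (D u).

Definition sh a u := D u - a *: u.

Lemma shD a u v : sh a (u + v) = sh a u + sh a v.
Proof. by rewrite /sh DD scalerDr opprD addrACA. Qed.
Lemma shZ a c u : sh a (c *: u) = c *: sh a u.
Proof. by rewrite /sh DZ scalerBr !scalerA mulrC. Qed.
Lemma sh0 a : sh a 0 = 0.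
Proof. by have := shZ a 0 0; rewrite !scale0r. Qed.
Lemma shC a b u : sh a (sh b u) = sh b (sh a u).
Proof.
have DB v w : D (v - w) = D v - D w by rewrite DD -scaleN1r DZ scaleN1r.
rewrite /sh !DB !DZ !scalerBr !scalerA [b * a]mulrC !opprB !addrA.
by rewrite [LHS]addrAC [RHS]addrAC; congr (_ + _); rewrite addrAC.
Qed.
Lemma WB u v : W u -> W v -> W (u - v).
Proof. by move=> Wu Wv; apply: WD => //; rewrite -scaleN1r; apply: WZ. Qed.
Lemma shW a u : W u -> W (sh a u).
Proof. by move=> Wu; apply: WB; [apply: DW | apply: WZ]. Qed.
Lemma iter_shC a b k l u : iter k (sh a) (iter l (sh b) u) = iter l (sh b) (iter k (sh a) u).
Proof.
elim: k => //= k ->; move: (iter k _ u) => w; elim: l => //= l <-; exact: shC.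
Qed.
Lemma iter_shD a k u v : iter k (sh a) (u + v) = iter k (sh a) u + iter k (sh a) v.
Proof. by elim: k => //= k ->; rewrite shD. Qed.
Lemma iter_sh0 a k : iter k (sh a) 0 = 0.
Proof. by elim: k => //= k ->; rewrite sh0. Qed.
Lemma iter_shW a k u : W u -> W (iter k (sh a) u).
Proof. by move=> Wu; elim: k => //= k; apply: shW. Qed.
Lemma iter_sh_sum a k (I : Type) (s : seq I) (F : I -> E) :
  iter k (sh a) (\sum_(i <- s) F i) = \sum_(i <- s) iter k (sh a) (F i).
Proof.
elim: s => [|i s IH]; first by rewrite !big_nil iter_sh0.
by rewrite !big_cons iter_shD IH.
Qed.

Lemma sh_reflectW a b N v : a != b -> iter N (sh b) v = 0 -> W (sh a v) -> W v.
Proof.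
move=> ab; elim: N v => [|N IH] v; first by move=> /= -> _.
rewrite iterSr => hv Wv.
have Wbv : W (sh b v) by apply: IH => //; rewrite shC; apply: shW.
have e : v = (b - a)^-1 *: (sh a v - sh b v).
  rewrite /sh opprB [D v - _ + _]addrC addrA addrNK -scalerBl scalerA mulVf ?scale1r //.
  by rewrite subr_eq0 eq_sym.
by rewrite e; apply: WZ; apply: WB.
Qed.

(** A power of [D - a] kills the component for [a] and stays invertible modulo [W]
    on the other ones, whence an induction on the number of eigenvalues. *)
Lemma gen_eigen (s : seq K) (v : K -> E) : uniq s ->
  (forall a, a \in s -> exists N, iter N (sh a) (v a) = 0) ->
  W (\sum_(a <- s) v a) -> forall a, a \in s -> W (v a).
Proof.
elim: s v => [|a s IH] v //= /andP [as_ us] hv Wv b bs.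
have [N hN] := hv a (mem_head _ _).
have Ws c : c \in s -> W (v c).
  move=> cs; have [M hM] : exists N, iter N (sh c) (v c) = 0 by apply: hv; rewrite inE cs orbT.
  have ac : a != c by apply: contraNneq as_ => ->.
  have : W (iter N (sh a) (v c)).
    apply: (IH (fun c => iter N (sh a) (v c))) => //.
      move=> d ds; have [M' hM'] : exists N, iter N (sh d) (v d) = 0.
        by apply: hv; rewrite inE ds orbT.
      by exists M'; rewrite iter_shC hM' iter_sh0.
    rewrite -iter_sh_sum; have := iter_shW a N Wv.
    by rewrite big_cons iter_shD hN add0r.
  elim: (N) => //= N' IHN /sh_reflectW h; apply: IHN; apply: (h c M ac).
  by rewrite iter_shC hM iter_sh0.
move: bs; rewrite inE => /orP [/eqP ->|]; last exact: Ws.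
have : W (\sum_(c <- s) v c).
  by rewrite big_seq; elim/big_ind: _.
by move=> /(WB Wv); rewrite big_cons addrK.
Qed.

End GenEigen.

(** Reduces generalised eigenvectors of a sum of commuting operators, one of them
    diagonal, to nilpotency of the other one. *)
Lemma sh_split (K : fieldType) (E : lmodType K) (Ds Dn D : E -> E) b u k :
  (forall w, D w = Ds w + Dn w) -> (forall c w, Dn (c *: w) = c *: Dn w) ->
  (forall w, Ds (Dn w) = Dn (Ds w)) -> Ds u = b *: u ->
  iter k (sh D b) u = iter k Dn u /\ Ds (iter k Dn u) = b *: iter k Dn u.
Proof.
move=> DE DnZ c Du; elim: k => [|k [IH1 IH2]] //=; split.
  by rewrite IH1 /sh DE IH2 addrC addKr.
by rewrite c IH2 DnZ.
Qed.

Section ZBasis.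
Variables (K : closedFieldType).

Definition Zindep r (b : 'I_r -> K) := forall z : 'I_r -> int,
  \sum_j (z j)%:~R * b j = 0 -> forall j, z j = 0.

(** An integral relation expresses one of the generators through rational multiples
    of the others, which become integral after rescaling. *)
Lemma Zbasis n (a : 'I_n -> K) : [pchar K] =i pred0 -> exists r (N : 'I_n -> 'I_r -> int) (b : 'I_r -> K),
  (forall i, a i = \sum_j (N i j)%:~R * b j) /\ Zindep b.
Proof.
move=> charK0.
suff H r (N : 'I_n -> 'I_r -> int) (b : 'I_r -> K) :
    (forall i, a i = \sum_j (N i j)%:~R * b j) -> exists r' (N : 'I_n -> 'I_r' -> int) (b : 'I_r' -> K),
    (forall i, a i = \sum_j (N i j)%:~R * b j) /\ Zindep b.
  apply: (H n (fun i j => (i == j)%:R) a) => i.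
  rewrite (bigD1 i) //= eqxx mulr1z mul1r big1 ?addr0 // => j ji.
  by rewrite eq_sym (negPf ji) mulr0z mul0r.
elim: r N b => [|r IH] N b ha.
  by exists 0%N, N, b; split => // z _ [].
have [ib|] := pselect (Zindep b); first by exists r.+1, N, b.
move=> /existsNP [z] /not_implyP [zb] /existsNP [j0 /eqP zj0].
have zj0K : (z j0)%:~R != 0 :> K.
  case: (z j0) zj0 => k; first by case: k => // k _; rewrite -pmulrn nat_neq0.
  by move=> _; rewrite NegzE mulrNz oppr_eq0 -pmulrn nat_neq0.
apply: (IH (fun i j => N i (lift j0 j) * z j0 - N i j0 * z (lift j0 j))
           (fun j => b (lift j0 j) / (z j0)%:~R)) => i.
rewrite ha (bigD1_ord j0) //=.
move: zb; rewrite (bigD1_ord j0) //= => /eqP; rewrite addr_eq0 => /eqP zb.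
have -> : b j0 = - (\sum_(j < r) (z (lift j0 j))%:~R * b (lift j0 j)) / (z j0)%:~R.
  by rewrite -zb mulrC mulKf.
rewrite mulrA mulrN mulNr mulr_sumr mulr_suml -sumrN -big_split; apply: eq_bigr => j _ /=.
rewrite rmorphB /= !intrM; field; exact: zj0K.
Qed.

End ZBasis.

(** * One-parameter tori generated by a semisimple part *)

Section Cochar.
Variables (K : closedFieldType) (charK0 : [pchar K] =i pred0) (n : nat).
Implicit Types (y v : 'M[K]_n) (G H : set 'M[K]_n) (p q : {mpoly K[n * n]}).

(** The entry of [a] for the column of the coordinate [k]. *)
Definition colw (R : Type) (a : 'I_n -> R) (k : 'I_(n * n)) : R :=
  mxvec (\matrix_(i < n, j < n) a j) 0 k.

Lemma colwE (R : Type) (a : 'I_n -> R) i j : colw a (mxvec_index i j) = a j.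
Proof. by rewrite /colw mxvecE mxE. Qed.

Definition dgm (a : 'I_n -> K) : 'M[K]_n := diag_mx (\row_i a i).

Lemma dgmE a i j : dgm a i j = a j *+ (i == j).
Proof. by rewrite !mxE; case: eqP => // ->. Qed.

Lemma ell_dgm a k : ell (dgm a) k = colw a k *: 'X_k.
Proof.
case/mxvec_indexP: k => i j; rewrite /ell colwE mxvecE mxE (bigD1 j) //= big1 => [|l lj].
  by rewrite addr0 !mxE eqxx mulr1n mulrC mul_mpolyC.
by rewrite !mxE (negPf lj) mulr0n mpolyC0 mulr0.
Qed.

(** Right multiplication by a diagonal matrix scales the columns, so monomials are
    eigenvectors of the vector field of [dgm a]; this is their eigenvalue. *)
Definition mw (R : pzRingType) (a : 'I_n -> R) (m : 'X_{1..n * n}) : R :=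
  \sum_k (m k)%:R * colw a k.

Lemma Dy_dgmX a m : Dy (dgm a) 'X_[m] = mw a m *: 'X_[m].
Proof.
rewrite /Dy /der /mw scaler_suml; apply: eq_bigr => k _.
rewrite ell_dgm mderivX -scalerAl -scalerAr scalerA -mpolyXD.
have [->|mk0] := eqVneq (m k) 0%N; first by rewrite !mul0r !scale0r.
rewrite submK //; apply/mnm_lepP => l; rewrite mnm1E.
by case: eqP => [<-|//]; rewrite lt0n.
Qed.

Definition mproj (a : 'I_n -> K) (l : K) p := \sum_(m <- msupp p | mw a m == l) p@_m *: 'X_[m].

Lemma derS (N : nat) (l : 'I_N -> {mpoly K[N]}) (I : Type) (s : seq I) (P : pred I) F :
  der l (\sum_(i <- s | P i) F i) = \sum_(i <- s | P i) der l (F i).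
Proof. exact: (big_morph _ (derD l) (der0 l)). Qed.

Lemma Dy_mproj a l p : Dy (dgm a) (mproj a l p) = l *: mproj a l p.
Proof.
rewrite /mproj /Dy derS scaler_sumr; apply: eq_bigr => m /eqP ml.
by rewrite derZ -/(Dy _ _) Dy_dgmX ml scalerA mulrC -scalerA.
Qed.

Definition dweights (a : 'I_n -> K) p := undup [seq mw a m | m <- msupp p].

Lemma mproj_sum a p : p = \sum_(l <- dweights a p) mproj a l p.
Proof.
rewrite {1}[p]mpolyE /mproj [RHS](exchange_big_dep xpredT) //= big_seq [RHS]big_seq.
apply: eq_bigr => m mp; rewrite (big_rem (mw a m)) /=; last first.
  by rewrite mem_undup map_f.
rewrite eqxx big_seq_cond big1 ?addr0 // => l /andP [] + /eqP e.
by rewrite -e mem_rem_uniqF // undup_uniq.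
Qed.

Lemma ellD y z k : ell (y + z) k = ell y k + ell z k.
Proof.
have e : map_mx (@mpolyC (n * n) K) (y + z) =
    map_mx (@mpolyC (n * n) K) y + map_mx (@mpolyC (n * n) K) z.
  apply/matrixP => i j; rewrite mxE [in LHS]mxE mpolyCD [RHS]mxE.
  by congr (_ + _); rewrite [RHS]mxE.
by rewrite /ell e mulmxDr linearD mxE.
Qed.

Lemma DyD y z p : Dy (y + z) p = Dy y p + Dy z p.
Proof.
by rewrite /Dy /der -big_split; apply: eq_bigr => k _; rewrite ellD mulrDr.
Qed.

Lemma ell0 k : ell (0 : 'M[K]_n) k = 0.
Proof.
case/mxvec_indexP: k => i j; rewrite /ell mxvecE mxE big1 // => l _.
by rewrite !mxE mpolyC0 mulr0.
Qed.

Lemma Dy0 p : Dy 0 p = 0.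
Proof. by rewrite /Dy /der big1 // => k _; rewrite ell0 mulr0. Qed.

Lemma Dy_ell y z k : Dy y (ell z k) = ell (y *m z) k.
Proof.
case/mxvec_indexP: k => i j; rewrite /ell [in LHS]mxvecE [RHS]mxvecE [in LHS]mxE [RHS]mxE.
rewrite /Dy derS.
transitivity (\sum_l (\sum_m Xmat K n i m * (y m l)%:MP) * (z l j)%:MP).
  apply: eq_bigr => l _.
  rewrite !mxE derM derC mulr0 addr0 derX /ell mxvecE !mxE; congr (_ * _).
  by apply: eq_bigr => m _; rewrite !mxE.
under eq_bigr do rewrite mulr_suml.
rewrite exchange_big; apply: eq_bigr => l _; rewrite !mxE raddf_sum mulr_sumr.
by apply: eq_bigr => m _; rewrite /= mpolyCM mulrA.
Qed.

Lemma iterDy_D v k p q : iter k (Dy v) (p + q) = iter k (Dy v) p + iter k (Dy v) q.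
Proof. by elim: k => //= k ->; rewrite /Dy derD. Qed.
Lemma iterDy_0 v k : iter k (Dy v) 0 = 0.
Proof. by elim: k => //= k ->; rewrite /Dy der0. Qed.

(** Nilpotency on the coordinates passes to polynomials by the Leibniz rule. *)
Lemma Dy_locnilp v p : nilp v -> exists N, iter N (Dy v) p = 0.
Proof.
move=> nv; elim/mpoly_alg_ind: p => [c|k|p q [a ha] [b hb]|p q [a ha] [b hb]].
- by exists 1%N; rewrite /= /Dy derC.
- exists n.+1; rewrite iterSr /Dy derX -/(Dy v).
  have h N : iter N (Dy v) (ell v k) = ell (v ^+ N.+1) k.
    elim: N => [|N IH]; first by rewrite expr1.
    by rewrite iterS IH Dy_ell mulmxE -exprS.
  by rewrite h exprS nv mulr0 ell0.
- exists (b + a)%N; rewrite iterDy_D {2}addnC !iterD ha.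
  by rewrite (_ : iter b (Dy v) q = 0) // !iterDy_0 addr0.
- exists (a + b)%N.
  suff H s a' b' p' q' : (a' + b' <= s)%N -> iter a' (Dy v) p' = 0 -> iter b' (Dy v) q' = 0 ->
      iter s (Dy v) (p' * q') = 0 by apply: (H _ a b).
  elim: s a' b' p' q' => [|s IH] [|a'] [|b'] p' q' //= h.
  + by move=> -> _; rewrite mul0r.
  + by move=> -> _; rewrite mul0r -iterS iterDy_0.
  + by move=> -> _; rewrite mul0r -iterS iterDy_0.
  + by move=> _ ->; rewrite mulr0 -iterS iterDy_0.
  + rewrite -!iterS => hp hq; rewrite iterSr [Dy v (p' * q')]derM -/(Dy v p') -/(Dy v q') iterDy_D.
    have h1 : (a' + b'.+1 <= s)%N by move: h; rewrite addSn ltnS.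
    have h2 : (a'.+1 + b' <= s)%N by rewrite addSnnS.
    have e1 : iter a' (Dy v) (Dy v p') = 0 by rewrite -iterSr.
    have e2 : iter b' (Dy v) (Dy v q') = 0 by rewrite -iterSr.
    by rewrite (IH _ _ _ _ h1 e1 hq) (IH _ _ _ _ h2 hp e2) addr0.
Qed.

(** The ideal of [G] is stable under the vector field of [dgm a + v], of which the
    eigencomponents for [dgm a] are generalised eigenvectors. *)
Lemma vanish_mproj G (a : 'I_n -> K) v p (l : K) : subgroup_GL G -> nilp v -> dgm a * v = v * dgm a ->
  Lie G (dgm a + v) -> vanish G p -> vanish G (mproj a l p).
Proof.
move=> sG nv cv Ly vp.
have [lw|lw] := boolP (l \in dweights a p); last first.
  move=> A _; rewrite /mproj big_seq_cond big_pred0 /mxeval ?meval0 // => m.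
  apply: contraNF lw => /andP [mp /eqP <-]; by rewrite mem_undup map_f.
have DD u w : Dy (dgm a + v) (u + w) = Dy (dgm a + v) u + Dy (dgm a + v) w by exact: derD.
have DZ c u : Dy (dgm a + v) (c *: u) = c *: Dy (dgm a + v) u by exact: derZ.
have W0 : vanish G 0 by move=> A _; rewrite /mxeval meval0.
have WD u w : vanish G u -> vanish G w -> vanish G (u + w).
  by move=> vu vw A GA; rewrite mxevalD vu // vw // addr0.
have WZ c u : vanish G u -> vanish G (c *: u).
  by move=> vu A GA; rewrite /mxeval mevalZ -/(mxeval u A) vu // mulr0.
have WDy u : vanish G u -> vanish G (Dy (dgm a + v) u) by exact: Dy_vanish.
have Dc w : Dy (dgm a) (Dy v w) = Dy v (Dy (dgm a) w).
  apply/eqP; rewrite -subr_eq0 Dy_comm //.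
  by rewrite /ad !mulmxE cv subrr Dy0.
have Wp : vanish G (\sum_(l <- dweights a p) mproj a l p) by rewrite -mproj_sum.
suff H : forall b, b \in dweights a p -> exists N, iter N (sh (Dy (dgm a + v)) b) (mproj a b p) = 0.
  exact: (gen_eigen DD DZ W0 WD WZ WDy (undup_uniq _) H Wp lw).
move=> b _; have [N hN] := Dy_locnilp (mproj a b p) nv; exists N.
have [-> _] := sh_split N (DyD (dgm a) v) (derZ _) Dc (Dy_mproj a b p).
exact: hN.
Qed.

Lemma mxevalX_dgm t m : mxeval 'X_[m] (dgm t) =
  (\prod_k (colw t k) ^+ m k) * mxeval 'X_[m] 1%:M.
Proof.
rewrite /mxeval !mevalX -big_split; apply: eq_bigr => k _ /=; rewrite -exprMn; congr (_ ^+ _).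
by case/mxvec_indexP: k => i j; rewrite colwE !mxvecE dgmE !mxE mulr_natr.
Qed.

Lemma prod_colw_exp (c : K) (z : 'I_n -> int) (m : 'X_{1..n * n}) : c != 0 ->
  \prod_k (colw (fun i => c ^ z i) k) ^+ m k = c ^ (mw z m).
Proof.
move=> c0; rewrite /mw; have -> : c ^ (\sum_k (m k)%:R * colw z k) = \prod_k c ^ ((m k)%:R * colw z k).
  by apply: (big_morph (fun z : int => c ^ z)) => [a b|]; rewrite ?expr0z // expfzDr.
apply: eq_bigr => k _; case/mxvec_indexP: k => i j; rewrite !colwE mulrC -exprz_exp.
by rewrite natz.
Qed.

(** As the [b j] are integrally independent, monomials with the same eigenvalue have
    the same degree along the [j]-th one-parameter torus.  Each eigencomponent of
    [p] is therefore a scalar multiple of its value at [1], which is zero. *)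
Lemma cochar_vanish G r (N : 'I_n -> 'I_r -> int) (b : 'I_r -> K) v p j c :
  Zindep b -> subgroup_GL G -> nilp v ->
  let a i := \sum_j (N i j)%:~R * b j in
  dgm a * v = v * dgm a -> Lie G (dgm a + v) -> vanish G p -> c != 0 ->
  mxeval p (dgm (fun i => c ^ (N i j))) = 0.
Proof.
move=> ib sG nv a cv Ly vp c0; rewrite [p](mproj_sum a) /mxeval raddf_sum big1_seq //= => l lw.
have G1 : G 1%:M by case: sG.
have h0 := vanish_mproj l sG nv cv Ly vp G1.
have ev A : mxeval (mproj a l p) A =
    \sum_(m <- msupp p | mw a m == l) p@_m * mxeval 'X_[m] A.
  by rewrite /mproj /mxeval raddf_sum; apply: eq_bigr => m _; rewrite /= mevalZ.
rewrite -/(mxeval (mproj a l p) _) ev; rewrite ev in h0.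
have mwa m : mw a m = \sum_j (mw (N^~ j) m)%:~R * b j.
  rewrite /mw; under [RHS]eq_bigr do rewrite rmorph_sum /= mulr_suml.
  rewrite exchange_big; apply: eq_bigr => k _ /=; case/mxvec_indexP: k => i i'.
  rewrite colwE /a mulr_sumr; apply: eq_bigr => j' _.
  by rewrite colwE intrM natz mulrA.
have [m0 m0w] : exists m0, mw a m0 = l.
  by move: lw; rewrite mem_undup => /mapP [m _ ->]; exists m.
rewrite (eq_bigr (fun m => c ^ (mw (N^~ j) m0) * (p@_m * mxeval 'X_[m] 1%:M))).
  by rewrite -mulr_sumr h0 mulr0.
move=> m /eqP mw_; rewrite mxevalX_dgm (prod_colw_exp (N^~ j)) // mulrCA; congr (_ ^ _ * _).
apply/eqP; rewrite -subr_eq0; apply/eqP.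
apply: (ib (fun j => mw (N^~ j) m - mw (N^~ j) m0)).
under eq_bigr do rewrite rmorphB /= mulrBl.
by rewrite sumrB -!mwa mw_ m0w subrr.
Qed.

(** The restriction of [p] to a one-parameter torus, with the exponents shifted
    by a constant that makes them nonnegative. *)
Definition cpoly (e : 'X_{1..n * n} -> nat) p : {poly K} :=
  \sum_(m <- msupp p) (p@_m * mxeval 'X_[m] 1%:M) *: 'X^(e m).

Lemma cpolyP p (z : 'I_n -> int) : exists e B,
  (forall m, m \in msupp p -> (e m : nat)%:Z = mw z m + B%:Z) /\
  forall c, c != 0 -> (cpoly e p).[c] = c ^+ B * mxeval p (dgm (fun i => c ^ z i)).
Proof.
pose B := (\sum_(m <- msupp p) absz (mw z m))%N.
pose e m := absz (mw z m + B%:Z).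
have he m : m \in msupp p -> (e m)%:Z = mw z m + B%:Z.
  move=> mp; have : (absz (mw z m) <= B)%N by rewrite /B (big_rem m) //= leq_addr.
  by rewrite /e; lia.
exists e, B; split=> // c c0; rewrite horner_sum.
rewrite [p in RHS]mpolyE /mxeval raddf_sum mulr_sumr big_seq [RHS]big_seq.
apply: eq_bigr => m mp; rewrite hornerZ hornerXn /= mevalZ -/(mxeval _ _) -/(mxeval _ _).
rewrite mxevalX_dgm prod_colw_exp // [c ^+ e m]exprnP he // expfzDr // [c ^+ B]exprnP.
by move: (mxeval _ _) (c ^ _) (c ^ _) p@_m => a1 a2 a3 a4; ring.
Qed.

Lemma dgm_cochar_Lie H (z : 'I_n -> int) : (forall c, c != 0 -> H (dgm (fun i => c ^ z i))) ->
  Lie H (dgm (fun i => (z i)%:~R)).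
Proof.
move=> hH; apply/LieP => p vp; rewrite -[X in dp _ _ X]mul1mx -Dy_eval.
have [e [B [he hq]]] := cpolyP p z.
have mwK m : mw (fun i => (z i)%:~R : K) m = (mw z m)%:~R.
  rewrite /mw rmorph_sum; apply: eq_bigr => k _ /=; case/mxvec_indexP: k => i j.
  by rewrite !colwE intrM natz.
have q0 : cpoly e p = 0.
  apply: (poly_ext_neq0 charK0) => c c0; rewrite horner0 hq // vp ?mulr0 //; exact: hH.
have q1 : \sum_(m <- msupp p) p@_m * mxeval 'X_[m] 1%:M = 0.
  have := congr1 (fun r : {poly K} => r.[1]) q0; rewrite /= horner0 horner_sum => h.
  by rewrite -[RHS]h; apply: eq_bigr => m _; rewrite hornerZ hornerXn expr1n mulr1.
have q1' : \sum_(m <- msupp p) p@_m * mxeval 'X_[m] 1%:M * (e m)%:R = 0.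
  have := congr1 (fun r : {poly K} => r^`().[1]) q0; rewrite /= derivC horner0 raddf_sum horner_sum => h.
  rewrite -[RHS]h; apply: eq_bigr => m _.
  by rewrite /= derivZ derivXn hornerZ hornerMn hornerXn expr1n.
rewrite [p]mpolyE /Dy derS /mxeval raddf_sum.
transitivity (\sum_(m <- msupp p) (p@_m * mxeval 'X_[m] 1%:M * (e m)%:R -
   p@_m * mxeval 'X_[m] 1%:M * B%:R)); last first.
  by rewrite sumrB q1' -mulr_suml q1 mul0r subrr.
rewrite big_seq [RHS]big_seq; apply: eq_bigr => m mp.
rewrite /= derZ -/(Dy _ _) Dy_dgmX !mevalZ -/(mxeval _ _) mwK -mulrBr mulrCA mulrC; congr (_ * _).
have := congr1 (fun x : int => x%:~R : K) (he m mp); rewrite /= rmorphD /= -!pmulrn => ->.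
by rewrite addrK.
Qed.

End Cochar.

(** * Brackets, subspaces and the theorem of Engel *)

Section AdBasics.
Variables (K : closedFieldType) (n : nat).
Implicit Types (x y z : 'M[K]_n).

Lemma adDl x y z : ad (x + y) z = ad x z + ad y z.
Proof. by rewrite /ad mulmxDl mulmxDr opprD addrACA. Qed.
Lemma adDr x y z : ad x (y + z) = ad x y + ad x z.
Proof. by rewrite /ad mulmxDl mulmxDr opprD addrACA. Qed.
Lemma adZl c x y : ad (c *: x) y = c *: ad x y.
Proof. by rewrite /ad -scalemxAl -scalemxAr scalerBr. Qed.
Lemma adZr c x y : ad x (c *: y) = c *: ad x y.
Proof. by rewrite /ad -scalemxAl -scalemxAr scalerBr. Qed.
Lemma ad0l x : ad 0 x = 0.
Proof. by rewrite /ad mul0mx mulmx0 subrr. Qed.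
Lemma ad0r x : ad x 0 = 0.
Proof. by rewrite /ad mul0mx mulmx0 subrr. Qed.
Lemma adNl x y : ad (- x) y = - ad x y.
Proof. by rewrite -scaleN1r adZl scaleN1r. Qed.
Lemma adNr x y : ad x (- y) = - ad x y.
Proof. by rewrite -scaleN1r adZr scaleN1r. Qed.
Lemma adBr x y z : ad x (y - z) = ad x y - ad x z.
Proof. by rewrite adDr adNr. Qed.
Lemma adxx x : ad x x = 0.
Proof. by rewrite /ad subrr. Qed.
Lemma adC x y : ad x y = - ad y x.
Proof. by rewrite /ad opprB. Qed.
Lemma ad_sumr x (I : Type) (s : seq I) (P : pred I) F :
  ad x (\sum_(i <- s | P i) F i) = \sum_(i <- s | P i) ad x (F i).
Proof. exact: (big_morph _ (adDr x) (ad0r x)). Qed.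
Lemma ad_suml x (I : Type) (s : seq I) (P : pred I) F :
  ad (\sum_(i <- s | P i) F i) x = \sum_(i <- s | P i) ad (F i) x.
Proof.
exact: (big_morph (fun y => ad y x) (fun y z => adDl y z x) (ad0l x)).
Qed.

Lemma jacobi x y z : ad x (ad y z) = ad (ad x y) z + ad y (ad x z).
Proof.
rewrite /ad !mulmxE !mulrBr !mulrBl !mulrA !opprB [RHS]addrACA !addrA !subrK.
by rewrite [LHS]addrAC [RHS]addrAC; congr (_ + _); rewrite addrAC.
Qed.

End AdBasics.

Section Subspaces.
Variables (K : fieldType) (E : vectType K).

(** Subspaces as predicates, since most of those below are cut out by undecidable
    conditions; the corresponding [{vspace E}] exists by [subsp_vs]. *)
Definition subsp (W : E -> Prop) := W 0 /\ forall c u v, W u -> W v -> W (c *: u + v).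

Lemma subsp0 W : subsp W -> W 0. Proof. by case. Qed.
Lemma subspD W u v : subsp W -> W u -> W v -> W (u + v).
Proof. by move=> [_ h] Wu Wv; rewrite -[u]scale1r; apply: h. Qed.
Lemma subspZ W c u : subsp W -> W u -> W (c *: u).
Proof. by move=> [W0 h] Wu; rewrite -[_ *: _]addr0; apply: h. Qed.
Lemma subspN W u : subsp W -> W u -> W (- u).
Proof. by move=> sW Wu; rewrite -scaleN1r; apply: subspZ. Qed.
Lemma subspB W u v : subsp W -> W u -> W v -> W (u - v).
Proof. by move=> sW Wu Wv; apply: subspD => //; apply: subspN. Qed.

Lemma subsp_vs W : subsp W -> exists U : {vspace E}, forall v, v \in U <-> W v.
Proof.
move=> sW; pose P d := `[< exists U : {vspace E}, \dim U = d /\ forall v, v \in U -> W v >].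
have exP : exists d, P d.
  exists 0%N; apply/asboolP; exists 0%VS; rewrite dimv0; split=> // v.
  by rewrite memv0 => /eqP ->; apply: subsp0.
have ubP d : P d -> (d <= \dim {:E})%N.
  by move=> /asboolP [U [<- _]]; apply: dimvS; apply: subvf.
case: (ex_maxnP exP ubP) => d /asboolP [U [dU UW]] dmax.
exists U => v; split; first exact: UW.
move=> Wv; apply/negPn/negP => vU.
suff /dmax : P (\dim (U + <[v]>)).
  rewrite -dU leqNgt (ltn_leqif (dimv_leqif_sup (addvSl U <[v]>))) subv_add subvv /=.
  by rewrite -memvE vU.
apply/asboolP; exists (U + <[v]>)%VS; split=> // w /memv_addP [u /UW Wu [_ /vlineP [c ->] ->]].
by apply: subspD => //; apply: subspZ.
Qed.

Lemma subsp_memv (U : {vspace E}) : subsp (fun v => v \in U).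
Proof. by split=> [|c u v uU vU]; rewrite ?mem0v // memvD // memvZ. Qed.

End Subspaces.

Section PolySubspace.
Variables (K : closedFieldType) (charK0 : [pchar K] =i pred0) (n m : nat).

(** Modulo the subspace, the curve is a polynomial with infinitely many zeros. *)
Lemma poly_coef_subsp (W : 'M[K]_(n, m) -> Prop) N (v : nat -> 'M[K]_(n, m)) : subsp W ->
  (forall t, W (\sum_(k < N) t ^+ k *: v k)) -> forall k, (k < N)%N -> W (v k).
Proof.
move=> /subsp_vs [U hU] h k kN; apply/hU.
rewrite -[v k](subrK (projv U (v k))) memvD ?memv_proj //.
suff -> : v k - projv U (v k) = 0 by exact: mem0v.
apply/matrixP => i j; rewrite [RHS]mxE.
pose q : {poly K} := \poly_(l < N) ((v l - projv U (v l)) i j).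
have q0 : q = 0.
  apply: (poly_ext charK0) => t; rewrite horner0 horner_poly.
  have /hU ht := h t.
  have e : (\sum_(l < N) t ^+ l *: v l) - projv U (\sum_(l < N) t ^+ l *: v l) = 0.
    by rewrite projv_id // subrr.
  have := congr1 (fun A : 'M_(n, m) => A i j) e; rewrite /= [RHS]mxE => h'.
  rewrite -[RHS]h' [projv U _]raddf_sum -sumrB summxE; apply: eq_bigr => l _ /=.
  by rewrite linearZ -scalerBr [RHS]mxE mulrC.
by have := congr1 (fun r : {poly K} => r`_k) q0; rewrite /= coef_poly kN coef0.
Qed.

End PolySubspace.

Section Engel.
Variables (K : closedFieldType) (charK0 : [pchar K] =i pred0) (n : nat).
Implicit Types (x y z v : 'M[K]_n) (k : {vspace 'M[K]_n}).

Lemma iter_ad_nilp y z : nilp y -> iter (n + n) (ad y) z = 0.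
Proof.
move=> ny; rewrite (iter_adE charK0); apply/eqP; rewrite scaler_eq0; apply/orP; right.
apply/eqP/big1 => i _; have [ni|ni] := leqP n i.
  by rewrite -[X in y ^+ X](subnK ni) exprD ny mulr0 scaler0 !mul0r.
have nNy : nilp (- y) by rewrite -scaleN1r; apply: nilpZ.
have le : (n <= n + n - i)%N by rewrite -addnBA ?leq_addr // ltnW.
by rewrite -[X in (- y) ^+ X](subnK le) exprD nNy mulr0 scaler0 mulr0.
Qed.

(** Induction on the dimension of [k]: acting on [k] modulo a maximal proper
    subalgebra, the latter annihilates some [z], and together they span [k].
    The vectors annihilated by the subalgebra are stable under the nilpotent
    operator [ad z]. *)
Lemma engel k : (forall x y, x \in k -> y \in k -> ad x y \in k) ->
  (forall x, x \in k -> nilp x) ->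
  forall P1 P2 : 'M[K]_n -> Prop, subsp P2 -> (forall v, P2 v -> P1 v) ->
  (forall x v, x \in k -> P1 v -> P1 (ad x v)) ->
  (forall x v, x \in k -> P2 v -> P2 (ad x v)) ->
  (exists v, P1 v /\ ~ P2 v) ->
  exists v, [/\ P1 v, ~ P2 v & forall x, x \in k -> P2 (ad x v)].
Proof.
have [d] := ubnP (\dim k); elim: d k => // d IH k dk kL kN P1 P2 sP2 P21 kP1 kP2 exv.
have [k0|kn0] := eqVneq k 0%VS.
  have [v [P1v P2v]] := exv; exists v; split=> // x.
  by rewrite k0 memv0 => /eqP ->; rewrite ad0l; case: sP2.
pose Q e := `[< exists k' : {vspace 'M[K]_n}, [/\ \dim k' = e, (k' <= k)%VS, k' != k &
  forall x y, x \in k' -> y \in k' -> ad x y \in k'] >].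
have exQ : exists e, Q e.
  exists 0%N; apply/asboolP; exists 0%VS; rewrite dimv0 sub0v eq_sym kn0; split=> // x y.
  by rewrite !memv0 => /eqP -> _; rewrite ad0l.
have ubQ e : Q e -> (e <= \dim k)%N.
  by move=> /asboolP [k' [<- k'k _ _]]; apply: dimvS.
case: (ex_maxnP exQ ubQ) => e /asboolP [k' [dk' k'k k'nk k'L]] emax.
have k'sub x : x \in k' -> x \in k by apply/subvP.
have ltk' : (\dim k' < d)%N.
  rewrite -ltnS; apply: leq_trans dk; rewrite ltnS.
  by rewrite (ltn_leqif (dimv_leqif_eq k'k)).
have IHk' := IH k' ltk' k'L (fun x h => kN x (k'sub x h)).
have [z [zk zk' k'z]] : exists z, [/\ z \in k, ~ (z \in k') & forall x, x \in k' -> ad x z \in k'].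
  apply: IHk' => //; first exact: subsp_memv.
  - by move=> x v /k'sub xk vk; apply: kL.
  - apply: contrapT => /forallNP h; move: k'nk; rewrite eqEsubv k'k /= => /negP; apply.
    apply/subvP => v vk; apply/negPn/negP => /negP vk'; exact: (h v).
have ek : (k' + <[z]>)%VS = k.
  apply/eqP; apply: contrapT => /negP ne.
  suff /emax : Q (\dim (k' + <[z]>)).
    rewrite -dk' leqNgt (ltn_leqif (dimv_leqif_sup (addvSl k' <[z]>))) subv_add subvv /=.
    by rewrite -memvE; move/negP: zk' => ->.
  apply/asboolP; exists (k' + <[z]>)%VS; split=> //.
    by rewrite subv_add k'k -memvE.
  move=> _ _ /memv_addP [x xk' [_ /vlineP [a ->] ->]] /memv_addP [y yk' [_ /vlineP [b ->] ->]].
  rewrite adDl !adDr !adZl !adZr adxx !scaler0 addr0 -addrA.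
  apply: (subvP (addvSl k' <[z]>)); rewrite memvD ?k'L // memvD //.
    by rewrite memvZ // k'z.
  by rewrite adC scalerN memvN memvZ // k'z.
pose W v := P1 v /\ forall x, x \in k' -> P2 (ad x v).
have Wz v : W v -> W (ad z v).
  move=> [P1v k'v]; split; first exact: kP1.
  move=> x xk'; rewrite jacobi; apply: (subspD sP2); first exact/k'v/k'z.
  by apply: kP2 => //; apply: k'v.
have [v [P1v P2v k'v]] : exists v, [/\ P1 v, ~ P2 v & forall x, x \in k' -> P2 (ad x v)].
  by apply: (IHk' P1 P2 sP2 P21 _ _ exv) => x v /k'sub xk hv; [apply: kP1 | apply: kP2].
have Wi i : W (iter i (ad z) v) by elim: i => [|i IHi]; [split | apply: Wz].
have exi : exists i, `[< P2 (iter i (ad z) v) >].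
  exists (n + n)%N; apply/asboolP; rewrite iter_ad_nilp; first exact: (subsp0 sP2).
  exact: kN.
case: (ex_minnP exi) => -[|i] /asboolP Pi imin; first by [].
exists (iter i (ad z) v); split; first by case: (Wi i).
  by move=> /asboolP /imin; rewrite ltnn.
move=> x; rewrite -ek => /memv_addP [y yk' [_ /vlineP [c ->] ->]].
rewrite adDl adZl; apply: (subspD sP2); first by case: (Wi i) => _; apply.
by apply: (subspZ _ sP2).
Qed.

End Engel.

(** * Connected solvable groups and the theorem of Lie and Kolchin *)

Section CommutatorSubgroup.
Variables (K : closedFieldType) (n : nat).
Implicit Types (H L : set 'M[K]_n) (x y z A B : 'M[K]_n).

Lemma comm_sub H : subgroup_GL H -> commutator_subgroup H `<=` H.
Proof.
move=> sH z; apply => // x y Hx Hy; case: sH => _ _ HM HV.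
by do !apply: (HM) => //; apply: HV.
Qed.

Lemma comm_subgroup H : subgroup_GL H -> subgroup_GL (commutator_subgroup H).
Proof.
move=> sH; split.
- by move=> x /(comm_sub sH); case: sH => uH _ _ _ /uH.
- by move=> L [].
- move=> x y hx hy L sL hL; case: (sL) => _ _ LM _; apply: LM; [exact: hx | exact: hy].
- move=> x hx L sL hL; case: (sL) => _ _ _ LV; apply: LV; exact: hx.
Qed.

Lemma comm_mem H x y : H x -> H y -> commutator_subgroup H (x *m y *m invmx x *m invmx y).
Proof. by move=> Hx Hy L sL hL; apply: hL. Qed.

Lemma invmxM A B : A \in unitmx -> B \in unitmx -> invmx (A *m B) = invmx B *m invmx A.
Proof.
move=> uA uB; have uAB : A *m B \in unitmx by rewrite unitmx_mul uA.
apply: (can_inj (mulKmx uAB)); by rewrite mulmxV // mulmxA mulmxK // mulmxV.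
Qed.

(** For fixed [A] and [y], the value of [f] at [A] times the commutator of [x] and
    [y] is a regular function of [x] with finitely many values on [H]; being
    constant, it shows that [f] does not change under multiplication by commutators. *)
Lemma comm_conn H : subgroup_GL H -> conn H -> conn (commutator_subgroup H).
Proof.
move=> sH cH f rf [s fs]; have sH' := comm_subgroup sH; have H'H := comm_sub sH.
have [uH H1 HM HV] := sH; have [uH' H'1 H'M H'V] := sH'.
have rA := regf_alg K n.
suff key z : commutator_subgroup H z ->
    commutator_subgroup H z /\ forall A, commutator_subgroup H A -> f (A *m z) = f A.
  by move=> z /key [_ /(_ _ H'1)]; rewrite mul1mx.
move=> h; apply: (h [set z | commutator_subgroup H z /\
   forall A, commutator_subgroup H A -> f (A *m z) = f A]) => /=.
  split=> /=.
  - by move=> x [] /uH'.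
  - by split => // A _; rewrite mulmx1.
  - move=> x y [hx fx] [hy fy]; split; first exact: H'M.
    by move=> A hA; rewrite mulmxA fy ?fx //; apply: H'M.
  - move=> x [hx fx]; split; first exact: H'V.
    move=> A hA; rewrite -(fx (A *m invmx x)); last by apply: H'M => //; apply: H'V.
    by rewrite mulmxKV // uH'.
move=> x y Hx Hy; split; first exact: comm_mem.
move=> A hA; have uA := uH' _ hA; have uy := uH _ Hy.
pose phi x := A *m (x *m y *m invmx x *m invmx y).
have ephi : entries (@regf K n) phi.
  apply: (entriesM rA); first exact: (entriesC rA).
  apply: (entriesM rA); last exact: (entriesC rA).
  apply: (entriesM rA); last exact: regf_entries_inv.
  by apply: (entriesM rA); [exact: regf_entries | exact: (entriesC rA)].
have dphi x' : x' \in unitmx -> \det (phi x') = \det A.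
  move=> ux; rewrite /phi !det_mulmx !det_inv; set a := \det x'; set b := \det y.
  have a0 : a != 0 by rewrite -unitfE -unitmxE.
  have b0 : b != 0 by rewrite -unitfE -unitmxE.
  by field; rewrite a0 b0.
have rg : regf (fun x => f (phi x)).
  apply: (regf_comp rf ephi); last first.
    by move=> B uB; rewrite unitmxE dphi // -unitmxE.
  by apply: (regf_ext _ (fun_algC rA (\det A)^-1)) => B uB; rewrite dphi.
have := cH _ rg _ _ Hx; rewrite /phi => -> //.
  by rewrite mul1mx invmx1 mulmx1 mulmxV // mulmx1.
by exists s => x' Hx'; apply: fs; apply: (H'M _ _ hA); apply: comm_mem.
Qed.

End CommutatorSubgroup.

Section LieKolchin.
Variables (K : closedFieldType) (n : nat).
Implicit Types (H L : set 'M[K]_n) (x y z A B g h : 'M[K]_n).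

(** The action is on row vectors, which reverses products. *)
Definition antirep H d (rho : 'M[K]_n -> 'M[K]_d) :=
  [/\ entries (@regf K n) rho, rho 1%:M = 1%:M &
      forall x y, H x -> H y -> rho (x *m y) = rho y *m rho x].

Lemma subsp_rowmx d (W : 'rV[K]_d -> Prop) : subsp W ->
  exists U : 'M[K]_d, forall v, (v <= U)%MS <-> W v.
Proof.
move=> sW; pose P r := `[< exists U : 'M[K]_d, \rank U = r /\
  forall v : 'rV_d, (v <= U)%MS -> W v >].
have exP : exists r, P r.
  exists 0%N; apply/asboolP; exists 0; rewrite mxrank0; split => // v.
  by rewrite submx0 => /eqP ->; apply: subsp0.
have ubP r : P r -> (r <= d)%N by move=> /asboolP [U [<- _]]; apply: rank_leq_row.
case: (ex_maxnP exP ubP) => r /asboolP [U [rU UW]] rmax.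
exists U => v; split; first exact: UW.
move=> Wv; apply/negPn/negP => vU.
suff /rmax : P (\rank (U + v)%MS).
  rewrite leqNgt -rU; apply/negP/negPn; apply: rank_ltmx.
  by rewrite ltmxE addsmxSl /= addsmx_sub submx_refl.
apply/asboolP; exists (U + v)%MS; split => // w /sub_addsmxP [[a c] /= ->].
apply: (subspD sW); first by apply: UW; apply: submxMl.
by rewrite [c]mx11_scalar mul_scalar_mx; apply: (subspZ _ sW).
Qed.

Lemma char_roots d (A : 'M[K]_d) : exists r : seq K, forall a, eigenvalue A a = (a \in r).
Proof.
have [r hr] := closed_field_poly_normal (char_poly A).
have := char_poly_monic A; rewrite monicE => /eqP lc; rewrite lc scale1r in hr.
by exists r => a; rewrite eigenvalue_root_char hr root_prod_XsubC.
Qed.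

Lemma exists_eigenvalue d (A : 'M[K]_d) : (0 < d)%N -> exists a, eigenvalue A a.
Proof.
move=> d0; have [r hr] := closed_field_poly_normal (char_poly A).
have := char_poly_monic A; rewrite monicE => /eqP lc; rewrite lc scale1r in hr.
case: r hr => [|a r] hr.
  by have := size_char_poly A; rewrite hr big_nil size_poly1 => -[e]; rewrite -e in d0.
by exists a; rewrite eigenvalue_root_char hr root_prod_XsubC mem_head.
Qed.

(** Induction on the derived length and on the dimension.  When the action is
    irreducible, the derived group acts by scalars, by induction and connectedness;
    commutators have determinant one, so these scalars are roots of unity and, by
    connectedness again, trivial; a commutative action has a common eigenvector. *)
Lemma lie_kolchin k : forall H, subgroup_GL H -> conn H ->
  iter k (@commutator_subgroup K n) H = [set 1%:M] ->
  forall d (rho : 'M[K]_n -> 'M[K]_d), (0 < d)%N -> antirep H rho ->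
  exists v : 'rV_d, v != 0 /\ forall h, H h -> exists c, v *m rho h = c *: v.
Proof.
elim: k => [|k IHk] H sH cH.
  rewrite /= => H1 [|d] rho // _ [_ rho1 _].
  exists (delta_mx 0 0); split; first by rewrite -mxrank_eq0 mxrank_delta.
  by rewrite H1 => _ ->; exists 1; rewrite rho1 mulmx1 scale1r.
rewrite iterSr => hk d; have [e] := ubnP d; elim: e d => // e IHe d de rho d0 [erho rho1 rhoM].
have [uH H1 HM HV] := sH; have rA := regf_alg K n.
have sH' := comm_subgroup sH; have cH' := comm_conn sH cH; have H'H := comm_sub sH.
set H' := commutator_subgroup H in hk sH' cH' H'H.
have rhoV g : H g -> rho g *m rho (invmx g) = 1%:M.
  by move=> Hg; rewrite -rhoM ?mulVmx ?uH //; apply: HV.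
have urho g : H g -> rho g \in unitmx by move=> /rhoV /mulmx1_unit [].
have [[U [U0 Ud Ust]]|irr] := pselect (exists U : 'M[K]_d, [/\ U != 0, (\rank U < d)%N &
   forall h, H h -> (U *m rho h <= U)%MS]).
  pose R := row_base U; pose rho' h := R *m rho h *m pinvmx R.
  have Rst h : H h -> rho' h *m R = R *m rho h.
    move=> Hh; rewrite /rho' mulmxKpV // /R (eqmxMr _ (eq_row_base U)) eq_row_base; exact: Ust.
  have fR : row_free R by exact: row_base_free.
  have r0 : (0 < \rank U)%N by rewrite lt0n mxrank_eq0.
  have [] := IHe (\rank U) _ rho' r0.
  - by apply: leq_trans Ud _; rewrite -ltnS.
  - split.
    + apply: (entriesM rA); last exact: (entriesC rA).
      by apply: (entriesM rA); [exact: (entriesC rA) | exact: erho].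
    + by apply: (row_free_inj fR); rewrite Rst // rho1 mulmx1 mul1mx.
    + move=> x y Hx Hy; apply: (row_free_inj fR); rewrite Rst; last exact: HM.
      by rewrite rhoM // mulmxA -Rst // -mulmxA -Rst // mulmxA.
  move=> v [v0 hv]; exists (v *m R); split.
    by apply: contraNneq v0 => vR; apply/eqP; apply: (row_free_inj fR); rewrite vR mul0mx.
  move=> h Hh; have [c hc] := hv h Hh; exists c.
  by rewrite -mulmxA -Rst // mulmxA hc scalemxAl.
have full (W : 'rV[K]_d -> Prop) v : subsp W -> v != 0 -> W v ->
    (forall h w, H h -> W w -> W (w *m rho h)) -> forall w, W w.
  move=> sW v0 Wv Wst w; have [U hU] := subsp_rowmx sW; apply/hU.
  apply: submx_full; rewrite -col_leq_rank leqNgt; apply/negP => Ud; apply: irr; exists U; split=> //.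
    by apply: contraNneq v0 => U0; have /hU := Wv; rewrite U0 submx0.
  move=> h Hh; apply/row_subP => i; rewrite row_mul; apply/hU; apply: Wst => //.
  by apply/hU; exact: row_sub.
have [v [v0 hv]] := IHk H' sH' cH' hk d rho d0 (And3 erho rho1 (fun x y hx hy => rhoM x y (H'H _ hx) (H'H _ hy))).
have [j vj] : exists j, v 0 j != 0.
  apply: contrapT => /forallNP h; move/eqP: v0; apply; apply/rowP => j.
  by rewrite mxE; apply/eqP/negPn/negP; exact: h.
pose chi h := (v *m rho h) 0 j / v 0 j.
have vchi h : H' h -> v *m rho h = chi h *: v.
  by move=> /hv [c hc]; rewrite /chi hc mxE mulfK.
have rchi : regf chi.
  apply: (fun_algM rA); last exact: (fun_algC rA).
  by apply: (entriesM rA); [exact: (entriesC rA) | exact: erho].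
have H'n g h : H g -> H' h -> H' (invmx g *m h *m g).
  move=> Hg hh; rewrite (_ : _ *m _ = (invmx g *m h *m g *m invmx h) *m h); last first.
    by case: sH' => uH' _ _ _; rewrite mulmxKV // uH'.
  case: sH' => _ _ H'M _; apply: H'M => //.
  have := comm_mem (HV _ Hg) (H'H _ hh); rewrite invmxK; exact.
(* conjugate weights are eigenvalues of [rho h], so they are finitely many *)
have chiJ g h : H g -> H' h -> chi (invmx g *m h *m g) = chi h.
  move=> Hg hh; pose phi g := invmx g *m h *m g; have uh := uH _ (H'H _ hh).
  have ephi : entries (@regf K n) phi.
    apply: (entriesM rA); last exact: regf_entries.
    by apply: (entriesM rA); [exact: regf_entries_inv | exact: (entriesC rA)].
  have dphi x' : x' \in unitmx -> \det (phi x') = \det h.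
    move=> ux; rewrite /phi !det_mulmx !det_inv; set a := \det x'.
    have a0 : a != 0 by rewrite -unitfE -unitmxE.
    by field; rewrite a0.
  have rg : regf (fun g => chi (phi g)).
    apply: (regf_comp rchi ephi); last first.
      by move=> B uB; rewrite unitmxE dphi // -unitmxE.
    by apply: (regf_ext _ (fun_algC rA (\det h)^-1)) => B uB; rewrite dphi.
  have := cH _ rg _ _ Hg; rewrite /phi => -> //.
    by rewrite invmx1 mul1mx mulmx1.
  have [r hr] := char_roots (rho h); exists r => g' Hg'; rewrite -hr.
  apply/eigenvalueP; exists (v *m rho g').
    have := vchi _ (H'n _ _ Hg' hh); rewrite -/(phi g') => e1.
    rewrite scalemxAl -e1 -!mulmxA -!rhoM //; last 2 first.
    - exact: (H'H _ (H'n _ _ Hg' hh)).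
    - exact: H'H.
    by rewrite /phi !mulmxA mulmxV ?uH // mul1mx.
  apply: contraNneq v0 => vg; rewrite -[v]mulmx1 -(rhoV _ Hg') mulmxA vg mul0mx //.
have rchiE (w : 'rV_d) : forall h, H' h -> w *m rho h = chi h *: w.
  pose W (w : 'rV_d) := forall h, H' h -> w *m rho h = chi h *: w.
  have sW : subsp W.
    split=> [h' _|c u1 u2 hu hw h' hh']; first by rewrite mul0mx scaler0.
    by rewrite mulmxDl -scalemxAl hu // hw // scalerDr !scalerA mulrC.
  suff st g u : H g -> W u -> W (u *m rho g) by exact: (full W v sW v0 vchi st w).
  move=> Hg hu h' hh'.
  rewrite -mulmxA -rhoM //; last exact: H'H.
  rewrite (_ : h' *m g = g *m (invmx g *m h' *m g)); last first.
    by rewrite !mulmxA mulmxV ?mul1mx // uH.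
  rewrite rhoM //; last exact: (H'H _ (H'n _ _ Hg hh')).
  by rewrite mulmxA hu ?chiJ -?scalemxAl //; apply: H'n.
have rhoS h : H' h -> rho h = (chi h)%:M.
  by move=> hh; apply/row_matrixP => i; rewrite !rowE rchiE // mul_mx_scalar.
have detr1 h : H' h -> \det (rho h) = 1.
  move=> hh; have sL : subgroup_GL [set z | H z /\ \det (rho z) = 1].
    split=> /=.
    - by move=> x [/uH].
    - by rewrite rho1 det1.
    - move=> x y [Hx dx] [Hy dy]; split; first exact: HM.
      by rewrite rhoM // det_mulmx dx dy mulr1.
    - move=> x [Hx dx]; split; first exact: HV.
      by have := congr1 (fun A : 'M_d => \det A) (rhoV _ Hx); rewrite det_mulmx dx mul1r det1.
  have [] // := hh _ sL _ => x y Hx Hy; split.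
    by do !apply: (HM) => //; apply: HV.
  have Hx' := HV _ Hx; have Hy' := HV _ Hy.
  rewrite !rhoM //; [|exact: HM|exact: (HM _ _ (HM _ _ Hx Hy) Hx')].
  have := congr1 (fun A : 'M_d => \det A) (rhoV _ Hx); have := congr1 (fun A : 'M_d => \det A) (rhoV _ Hy).
  rewrite !det_mulmx !det1 => ey ex.
  transitivity ((\det (rho (invmx y)) * \det (rho y)) * (\det (rho (invmx x)) * \det (rho x))).
    by move: (\det _) (\det _) (\det _) (\det _) => a b a' b'; ring.
  by rewrite [X in X * _]mulrC ey [X in _ * X]mulrC ex mulr1.
(* a scalar matrix of determinant one is a [d]-th root of unity *)
have chi1 h : H' h -> chi h = 1.
  move=> hh; have [r hr] := closed_field_poly_normal ('X^d - 1 : {poly K}).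
  rewrite (cH' _ rchi) //; first by rewrite /chi rho1 mulmx1 divff.
  exists r => h' hh'.
  have : root ('X^d - 1 : {poly K}) (chi h').
    rewrite /root hornerD hornerN hornerC hornerXn subr_eq0.
    by rewrite -(detr1 h' hh') (rhoS h' hh') det_scalar.
  by rewrite hr rootZ ?root_prod_XsubC // lead_coefXnsubC // oner_neq0.
have rhoC x y : H x -> H y -> rho x *m rho y = rho y *m rho x.
  move=> Hx Hy; rewrite -!rhoM //.
  have exy : x *m y = (x *m y *m invmx x *m invmx y) *m (y *m x).
    by rewrite !mulmxA mulmxKV ?uH // mulmxKV ?uH.
  have hc := comm_mem Hx Hy.
  have := rhoM _ _ (H'H _ hc) (HM _ _ Hy Hx).
  by rewrite -exy (rhoS _ hc) chi1 // mulmx1.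
exists (delta_mx 0 (Ordinal d0)); split; first by rewrite -mxrank_eq0 mxrank_delta.
move=> h Hh; have [a /eigenvalueP [u ua u0]] := exists_eigenvalue (rho h) d0; exists a.
apply: (full (fun w : 'rV_d => w *m rho h = a *: w) u) => //.
  split=> [|c w w' hw hw']; first by rewrite mul0mx scaler0.
  by rewrite mulmxDl -scalemxAl hw hw' scalerDr !scalerA mulrC.
by move=> g w Hg hw; rewrite -mulmxA rhoC // mulmxA hw scalemxAl.
Qed.

End LieKolchin.

Section LKQuotient.
Variables (K : closedFieldType) (n : nat) (E : vectType K).
Implicit Types (H : set 'M[K]_n) (g h : 'M[K]_n).

(** The action on [P1] modulo [P2] becomes a matrix representation through a basis
    of a complement of [P2]. *)
Lemma lie_kolchin_quot H (act : 'M[K]_n -> E -> E) (P1 P2 : E -> Prop) :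
  subgroup_GL H -> conn H -> solvable_group H ->
  (forall h, H h -> forall c u v, act h (c *: u + v) = c *: act h u + act h v) ->
  (forall u, act 1%:M u = u) ->
  (forall g h u, H g -> H h -> act (g *m h) u = act g (act h u)) ->
  (forall (phi : E -> K), (forall c u v, phi (c *: u + v) = c * phi u + phi v) ->
     forall u, regf (fun h => phi (act h u))) ->
  subsp P1 -> subsp P2 -> (forall v, P2 v -> P1 v) ->
  (forall h v, H h -> P1 v -> P1 (act h v)) -> (forall h v, H h -> P2 v -> P2 (act h v)) ->
  (exists v, P1 v /\ ~ P2 v) ->
  exists v, [/\ P1 v, ~ P2 v & forall h, H h -> exists c, P2 (act h v - c *: v)].
Proof.
move=> sH cH [k hk] actL act1 actM actR /subsp_vs [U1 hU1] /subsp_vs [U2 hU2] P21 st1 st2.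
move=> [v0 [/hU1 v01 /hU2 /negP v02]].
pose C := (U1 :\: U2)%VS; pose X := vbasis C; pose d := \dim C.
have CU2 : (C :&: U2 = 0)%VS by exact: capv_diff.
have U21 : (U2 <= U1)%VS by apply/subvP => v /hU2 /P21 /hU1.
have CU : (C + U2 = U1)%VS by rewrite addv_diff; apply/addv_idPl.
have d0 : (0 < d)%N.
  rewrite lt0n dimv_eq0 diffv_eq0; apply: contra v02 => /subvP; exact.
have uH h : H h -> h \in unitmx by case: sH => + _ _ _; apply.
have HM : forall g h, H g -> H h -> H (g *m h) by case: sH.
pose pi := daddv_pi C U2.
have pi2 z : z \in U1 -> z - pi z \in U2.
  by rewrite -CU => /(daddv_pi_add CU2) {1}<-; rewrite addrAC subrr add0r memv_pi.
have piU z : z \in U2 -> pi z = 0.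
  move=> zU; have : pi z + daddv_pi U2 C z = z.
    by apply: (daddv_pi_add CU2); apply: (subvP (addvSr C U2)).
  rewrite [daddv_pi U2 C z]daddv_pi_id // 1?capvC // => /eqP.
  by rewrite -subr_eq0 addrK => /eqP.
pose co (j : 'I_d) (z : E) : K := coord X j (pi z).
have coE z : pi z = \sum_j co j z *: X`_j.
  by rewrite {1}(coord_vbasis (memv_pi C U2 z)).
have coL j c u v : co j (c *: u + v) = c * co j u + co j v by rewrite /co !linearP.
pose rho h := \matrix_(i < d, j < d) co j (act h X`_i).
have XU i : (i < d)%N -> X`_i \in U1.
  move=> id_; have : X`_i \in C by apply: vbasis_mem; rewrite mem_nth // size_tuple.
  by move/(subvP (diffvSl U1 U2)).
have coS j (I : finType) (a : I -> K) (F : I -> E) : co j (\sum_i a i *: F i) = \sum_i a i * co j (F i).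
  rewrite /co !linear_sum; apply: eq_bigr => i _; by rewrite !linearZ.
have actS h (I : finType) (a : I -> K) (F : I -> E) : H h ->
    act h (\sum_i a i *: F i) = \sum_i a i *: act h (F i).
  move=> Hh; have a0 : act h 0 = 0.
    have := actL h Hh (-1) 0 0; rewrite scaler0 addr0 scaleN1r => {1}->; by rewrite addNr.
  elim: (index_enum I) => [|i s IH]; first by rewrite !big_nil.
  by rewrite !big_cons actL // IH.
have actZ h c u : H h -> act h (c *: u) = c *: act h u.
  move=> Hh; have a0 : act h 0 = 0.
    have := actL h Hh (-1) 0 0; rewrite scaler0 addr0 scaleN1r => {1}->; by rewrite addNr.
  by rewrite -[c *: u]addr0 actL // a0 addr0.
have co2 j z : z \in U2 -> co j z = 0 by move=> zU; rewrite /co piU // linear0.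
have st1U h z : H h -> z \in U1 -> act h z \in U1 by move=> Hh /hU1 zU; apply/hU1/st1.
have st2U h z : H h -> z \in U2 -> act h z \in U2 by move=> Hh /hU2 zU; apply/hU2/st2.
have dec z : z \in U1 -> exists2 w, w \in U2 & z = \sum_j co j z *: X`_j + w.
  by move=> /pi2 h; exists (z - pi z) => //; rewrite -coE addrC subrK.
have coX (i j : 'I_d) : co j X`_i = (i == j)%:R.
  rewrite /co /pi daddv_pi_id //; last by apply: vbasis_mem; rewrite mem_nth // size_tuple.
  by rewrite coord_free // (basis_free (vbasisP C)).
have anti : antirep H rho.
  split.
  - move=> i j; apply: (regf_ext _ (actR (co j) (coL j) X`_i)) => h _; by rewrite mxE.
  - by apply/matrixP => i j; rewrite !mxE act1 coX.
  - move=> g h Hg Hh; apply/matrixP => i j; rewrite !mxE actM //.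
    have [w wU e] := dec _ (st1U h _ Hh (XU i (ltn_ord i))).
    rewrite {1}e -[w]scale1r addrC actL // coL co2 ?mulr0 ?add0r; last exact: st2U.
    rewrite actS // coS; apply: eq_bigr => l _; by rewrite !mxE.
have [x [x0 hx]] := lie_kolchin sH cH hk d0 anti.
pose v := \sum_i x 0 i *: X`_i.
have vC : v \in C.
  by apply: memv_suml => i _; apply: memvZ; apply: vbasis_mem; rewrite mem_nth // size_tuple.
exists v; split.
- by apply/hU1; apply: (subvP (diffvSl U1 U2)).
- move=> /hU2 vU2; have : v \in (C :&: U2)%VS by rewrite memv_cap vC.
  rewrite CU2 memv0 => /eqP v00; move/eqP: x0; apply; apply/rowP => i; rewrite mxE.
  have /freeP h : free X by exact: basis_free (vbasisP C).
  exact: (h (fun i => x 0 i) v00 i).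
- move=> h Hh; have [c hc] := hx h Hh; exists c; apply/hU2.
  rewrite /v actS //.
  have e (i : 'I_d) : exists2 w, w \in U2 & act h X`_i = \sum_j rho h i j *: X`_j + w.
    have [w wU ->] := dec _ (st1U h _ Hh (XU i (ltn_ord i))); exists w => //.
    congr (_ + _); apply: eq_bigr => j _; by rewrite mxE.
  have -> : \sum_i x 0 i *: act h X`_i =
     c *: v + \sum_i x 0 i *: (act h X`_i - \sum_j rho h i j *: X`_j).
    under [in RHS]eq_bigr do rewrite scalerBr.
    rewrite sumrB addrCA -[LHS]addr0; congr (_ + _); apply/esym/eqP; rewrite subr_eq0; apply/eqP.
    rewrite /v scaler_sumr; under [RHS]eq_bigr do rewrite scaler_sumr.
    rewrite exchange_big; apply: eq_bigr => j _ /=.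
    have := congr1 (fun r : 'rV_d => r 0 j) hc; rewrite !mxE => ej.
    rewrite scalerA -ej scaler_suml; apply: eq_bigr => i _; by rewrite scalerA.
  rewrite addrC addKr; apply: memv_suml => i _; apply: memvZ.
  by have [w wU ->] := e i; rewrite addrC addKr.
Qed.

End LKQuotient.

(** * Triangular matrices *)

Section Flags.
Variables (K : fieldType) (n : nat).
Implicit Types (S : set 'M[K]_n) (A B Q : 'M[K]_n).

(** The filtration of lower triangular matrices by subdiagonals: [lvl 0] is
    triangularity and [lvl 1] strict triangularity. *)
Definition lvl k A := forall i j : 'I_n, (i < j + k)%N -> A i j = 0.

Lemma lvlM k l A B : lvl k A -> lvl l B -> lvl (k + l) (A *m B).
Proof.
move=> hA hB i j ij; rewrite mxE big1 // => m _.
have [im|im] := ltnP i (m + k); first by rewrite hA // mul0r.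
rewrite (hB m j) ?mulr0 //; lia.
Qed.
Lemma lvl_le k l A : (k <= l)%N -> lvl l A -> lvl k A.
Proof. by move=> kl h i j ij; apply: h; lia. Qed.
Lemma lvlD k A B : lvl k A -> lvl k B -> lvl k (A + B).
Proof. by move=> hA hB i j ij; rewrite mxE hA // hB // addr0. Qed.
Lemma lvlZ k c A : lvl k A -> lvl k (c *: A).
Proof. by move=> hA i j ij; rewrite mxE hA // mulr0. Qed.
Lemma lvlN k A : lvl k A -> lvl k (- A).
Proof. by move=> hA i j ij; rewrite mxE hA // oppr0. Qed.
Lemma lvlB k A B : lvl k A -> lvl k B -> lvl k (A - B).
Proof. by move=> hA hB; apply: lvlD => //; apply: lvlN. Qed.
Lemma lvl_top A : lvl n A -> A = 0.
Proof. by move=> h; apply/matrixP => i j; rewrite h ?mxE //; have := ltn_ord i; lia. Qed.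
Lemma lvl0_diagM A B i : lvl 0 A -> lvl 0 B -> (A *m B) i i = A i i * B i i.
Proof.
move=> hA hB; rewrite mxE (bigD1 i) //= big1 ?addr0 // => l li.
have [il|il] := ltnP i l; first by rewrite hA ?addn0 // mul0r.
by rewrite (hB l i) ?mulr0 //; move: li; rewrite -val_eqE /=; lia.
Qed.
Lemma lvl1_diag A : lvl 0 A -> (forall i, A i i = 0) -> lvl 1 A.
Proof.
move=> hA h0 i j; rewrite addn1 ltnS leq_eqVlt => /orP [/eqP/val_inj ->|ij]; first exact: h0.
by apply: hA; rewrite addn0.
Qed.
Lemma lvl1 : lvl 0 1%:M.
Proof. by move=> i j; rewrite addn0 mxE => ij; rewrite -val_eqE /= ltn_eqF. Qed.

Lemma unitmx_inj Q : (forall c : 'cV[K]_n, Q *m c = 0 -> c = 0) -> Q \in unitmx.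
Proof.
move=> h; rewrite -unitmx_tr -row_free_unit -kermx_eq0; apply/eqP/row_matrixP => i.
rewrite row0; apply: trmx_inj; rewrite trmx0; apply: h; apply: trmx_inj.
by rewrite trmx_mul trmxK trmx0 -row_mul mulmx_ker row0.
Qed.

Fixpoint flagged S (us : seq 'cV[K]_n) : Prop := if us is u :: us' then
  (forall s, S s -> s *m u \in <<us>>%VS) /\ flagged S us' else True.

Lemma flagged_nth S us j s : flagged S us -> (j < size us)%N -> S s ->
  s *m us`_j \in <<drop j us>>%VS.
Proof.
elim: us j => [|u us IH] [|j] //= [h1 h2] jus Ss; first exact: h1.
exact: IH.
Qed.

Lemma flagged_stable S us s v : flagged S us -> S s -> v \in <<us>>%VS -> s *m v \in <<us>>%VS.
Proof.
move=> h Ss; elim: us h v => [|u us IH] /= => [_ v|[h1 h2] v].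
  by rewrite span_nil !memv0 => /eqP ->; rewrite mulmx0.
rewrite span_cons => /memv_addP [_ /vlineP [c ->] [w wu ->]].
rewrite -span_cons mulmxDr -scalemxAr memvD ?memvZ ?h1 //.
by rewrite span_cons; apply: (subvP (addvSr _ _)); apply: IH.
Qed.

(** Enlarging subspaces one dimension at a time builds a flag of stable subspaces,
    and [Q] is an adapted basis. *)
Lemma flag_triangular S :
  (forall U : {vspace 'cV[K]_n}, (forall s u, S s -> u \in U -> s *m u \in U) -> U != fullv ->
    exists2 u, u \notin U & forall s, S s -> exists c, s *m u - c *: u \in U) ->
  exists2 Q : 'M[K]_n, Q \in unitmx & forall s, S s -> lvl 0 (invmx Q *m s *m Q).
Proof.
move=> ext.
have build k : (k <= n)%N -> exists us, [/\ size us = k, free us & flagged S us].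
  elim: k => [|k IH] kn; first by exists [::]; rewrite nil_free.
  have [us [sus fus hus]] := IH (ltnW kn).
  have [u uU hu] : exists2 u, u \notin <<us>>%VS & forall s, S s -> exists c, s *m u - c *: u \in <<us>>%VS.
    apply: ext; first by move=> s u; apply: flagged_stable.
    apply/eqP => e; move: fus; rewrite /free e dimvf /dim /= muln1 sus => /eqP e2.
    by rewrite e2 ltnn in kn.
  exists (u :: us); rewrite /= sus free_cons uU fus; split=> //; split=> // s Ss.
  have [c hc] := hu s Ss; rewrite span_cons -[s *m u](subrK (c *: u)) addrC.
  by apply: memv_add => //; apply: memvZ; apply: memv_line.
have [us [sus fus hus]] := build n (leqnn n).
pose Q : 'M[K]_n := \matrix_(i, j) (us`_j) i 0.
have QE (c : 'cV[K]_n) : Q *m c = \sum_j c j 0 *: us`_j.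
  apply/colP => i; rewrite mxE summxE; apply: eq_bigr => j _.
  by rewrite !mxE mulrC.
have uQ : Q \in unitmx.
  apply: unitmx_inj => c; rewrite QE => h; apply/colP => i; rewrite mxE.
  have /freeP fX : free (Tuple (introT eqP sus)) by [].
  exact: (fX (fun i => c i 0) h i).
have Qd j : invmx Q *m us`_(j : 'I_n) = delta_mx j 0.
  apply: (can_inj (mulKmx uQ)); rewrite mulKVmx //.
  by rewrite QE (bigD1 j) //= big1 => [|l lj]; rewrite !mxE ?(negPf lj) ?eqxx ?scale1r ?addr0 ?scale0r.
exists Q => // s Ss i j; rewrite addn0 => ij.
pose W (v : 'cV[K]_n) := (invmx Q *m v) i 0 = 0.
have sW : subsp W.
  split; rewrite /W; first by rewrite mulmx0 mxE.
  by move=> c u v hu hv; rewrite mulmxDr -scalemxAr mxE [X in X + _]mxE hu hv mulr0 addr0.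
have [U hU] := subsp_vs sW.
have dU : (<<drop j us>> <= U)%VS.
  apply/span_subvP => v /(nthP 0) [l]; rewrite size_drop nth_drop sus => ls <-.
  have ln : (j + l < n)%N by lia.
  apply/hU; rewrite /W (Qd (Ordinal ln)) mxE -val_eqE /= eqxx andbT.
  by case: eqP => //= e; move: ij; rewrite e; lia.
have js : (j < size us)%N by rewrite sus.
have /hU := subvP dU _ (flagged_nth hus js Ss).
rewrite /W mulmxA => <-.
rewrite [LHS]mxE [RHS]mxE; apply: eq_bigr => l _; by rewrite [Q l j]mxE.
Qed.

End Flags.

Section TriangularGroups.
Variables (K : closedFieldType) (n : nat).
Implicit Types (H L : set 'M[K]_n) (A B Q x y : 'M[K]_n).

Lemma lvlX k A : lvl 1 A -> lvl k (A ^+ k).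
Proof.
move=> hA; elim: k => [|k IH]; first by rewrite expr0; exact: lvl1.
by rewrite exprS -add1n; apply: (lvlM hA).
Qed.

Lemma lvl1_nilp A : lvl 1 A -> nilp A.
Proof. by move=> hA; apply/lvl_top/lvlX. Qed.

Lemma nilp_lvl1 A : lvl 0 A -> nilp A -> lvl 1 A.
Proof.
move=> hA nA; apply: lvl1_diag => // i.
have h k : lvl 0 (A ^+ k) /\ (A ^+ k) i i = A i i ^+ k.
  elim: k => [|k [IH1 IH2]]; first by rewrite !expr0 !mxE eqxx; split=> //; exact: lvl1.
  rewrite !exprS; split; first exact: (lvlM hA IH1).
  by rewrite -mulmxE lvl0_diagM // IH2.
have [_] := h n; rewrite nA mxE => /esym/eqP.
by rewrite expf_eq0 => /andP [_ /eqP].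
Qed.

(** Triangular matrices congruent to [1] up to the [k]-th subdiagonal; asking the
    same of the inverse makes the group property immediate. *)
Definition trg Q k : set 'M[K]_n := [set A | [/\ A \in unitmx,
  lvl 0 (invmx Q *m A *m Q), lvl 0 (invmx Q *m invmx A *m Q) &
  (0 < k)%N -> lvl k (invmx Q *m A *m Q - 1%:M) /\ lvl k (invmx Q *m invmx A *m Q - 1%:M)]].

Lemma conjM Q A B : Q \in unitmx ->
  invmx Q *m (A *m B) *m Q = (invmx Q *m A *m Q) *m (invmx Q *m B *m Q).
Proof. by move=> uQ; rewrite !mulmxA mulmxK. Qed.

Lemma lvl_1M k A B : lvl 0 A -> lvl 0 B -> lvl k (A - 1%:M) -> lvl k (B - 1%:M) ->
  lvl k (A *m B - 1%:M).
Proof.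
move=> hA hB kA kB.
have -> : A *m B - 1%:M = (A - 1%:M) *m B + (B - 1%:M).
  by rewrite mulmxBl mul1mx addrA subrK.
by apply: lvlD => //; rewrite -[k]addn0; apply: lvlM.
Qed.

Lemma trg_subgroup Q k : Q \in unitmx -> subgroup_GL (trg Q k).
Proof.
move=> uQ; split.
- by move=> x [].
- have e : invmx Q *m 1%:M *m Q = 1%:M by rewrite mulmx1 mulVmx.
  split; rewrite ?unitmx1 ?invmx1 ?e; [by [] | exact: lvl1 | exact: lvl1 |].
  by rewrite subrr; split=> i j _; rewrite mxE.
- move=> x y [ux x1 x2 x3] [uy y1 y2 y3]; split; first by rewrite unitmx_mul ux.
  + by rewrite conjM //; exact: (lvlM x1 y1).
  + by rewrite invmxM // conjM //; exact: (lvlM y2 x2).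
  + move=> k0; have [x4 x5] := x3 k0; have [y4 y5] := y3 k0.
    by rewrite invmxM // !conjM //; split; apply: lvl_1M.
- move=> x [ux x1 x2 x3]; split; rewrite ?unitmx_inv ?invmxK //.
  by move=> /x3 [].
Qed.

Lemma lvl_comm k A B A' B' : lvl 0 A -> lvl 0 B -> lvl 0 A' -> lvl 0 B' ->
  A *m B *m A' *m B' = 1%:M + (A *m B - B *m A) *m (A' *m B') ->
  ((0 < k)%N -> lvl k (A - 1%:M) /\ lvl k (B - 1%:M)) ->
  lvl k.+1 (A *m B *m A' *m B' - 1%:M).
Proof.
move=> hA hB hA' hB' -> h; rewrite addrC addKr -[k.+1]addn0; apply: lvlM; last exact: (lvlM hA' hB').
case: k h => [_|k /(_ isT) [kA kB]].
  apply: lvl1_diag; first by apply: lvlB; [exact: (lvlM hA hB) | exact: (lvlM hB hA)].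
  by move=> i; rewrite mxE lvl0_diagM // [X in _ + X]mxE lvl0_diagM // mulrC subrr.
have -> : A *m B - B *m A = (A - 1%:M) *m (B - 1%:M) - (B - 1%:M) *m (A - 1%:M).
  rewrite !mulmxBl !mulmxBr !mul1mx !mulmx1 -[A *m B - A - _]addrA -opprD.
  rewrite -[B *m A - B - _]addrA -opprD [B + (A - _)]addrCA; by set w := A + _; rewrite opprB addrA subrK.
by apply: lvlB; [apply: lvl_le (lvlM kA kB) | apply: lvl_le (lvlM kB kA)]; lia.
Qed.

(** Each commutator goes one subdiagonal deeper. *)
Lemma trg_solvable Q H : Q \in unitmx -> subgroup_GL H ->
  (forall h, H h -> lvl 0 (invmx Q *m h *m Q)) -> solvable_group H.
Proof.
move=> uQ [uH H1 HM HV] hH.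
have sub k : iter k (@commutator_subgroup K n) H `<=` trg Q k.
  elim: k => [|k IH] /=; first by move=> x Hx; split=> //; [exact: uH | exact: hH | apply/hH/HV].
  move=> z /(_ (trg Q k.+1) (trg_subgroup _ uQ)); apply => x y /IH [ux x1 x2 x3] /IH [uy y1 y2 y3].
  have ue A B : A \in unitmx -> B \in unitmx -> 
     invmx (A *m B *m invmx A *m invmx B) = B *m A *m invmx B *m invmx A.
    move=> uA uB; rewrite !invmxM ?unitmx_mul ?unitmx_inv ?uA ?uB // !invmxK.
    by rewrite !mulmxA.
  have cE A B : A \in unitmx -> B \in unitmx ->
    invmx Q *m (A *m B *m invmx A *m invmx B) *m Q = (invmx Q *m A *m Q) *m (invmx Q *m B *m Q)
      *m (invmx Q *m invmx A *m Q) *m (invmx Q *m invmx B *m Q).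
    by move=> uA uB; rewrite !conjM.
  have cE2 A B : A \in unitmx -> B \in unitmx ->
    let A1 := invmx Q *m A *m Q in let B1 := invmx Q *m B *m Q in
    let A2 := invmx Q *m invmx A *m Q in let B2 := invmx Q *m invmx B *m Q in
    A1 *m B1 *m A2 *m B2 = 1%:M + (A1 *m B1 - B1 *m A1) *m (A2 *m B2).
    move=> uA uB A1 B1 A2 B2; rewrite mulmxBl.
    have -> : B1 *m A1 *m (A2 *m B2) = 1%:M.
      rewrite /A1 /B1 /A2 /B2 -!conjM // [_ *m _ *m (_ *m _)]mulmxA mulmxK // mulmxV //.
      by rewrite mulmx1 mulVmx.
    by rewrite addrC subrK; exact/esym/mulmxA.
  split.
  - by rewrite !unitmx_mul !unitmx_inv ux uy.
  - rewrite cE //; exact: (lvlM (lvlM (lvlM x1 y1) x2) y2).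
  - rewrite ue // cE //; exact: (lvlM (lvlM (lvlM y1 x1) y2) x2).
  - move=> _; rewrite ue // !cE //; split; apply: lvl_comm => //; try exact: cE2.
      by move=> k0; have [? _] := x3 k0; have [? _] := y3 k0.
    by move=> k0; have [? _] := x3 k0; have [? _] := y3 k0.
exists n.+1; apply/seteqP; split=> [x /sub [ux _ _ /(_ isT) [hx _]]|_ ->] /=.
  have : invmx Q *m x *m Q - 1%:M = 0 by apply: lvl_top; apply: lvl_le hx.
  move=> /subr0_eq e; rewrite -[x](mulKVmx uQ) -[invmx Q *m x](mulmxK uQ) e.
  by rewrite mul1mx mulmxV.
by move=> L [].
Qed.

End TriangularGroups.

(** * Jordan decomposition in the Lie algebra of a closed group *)

Section DiagCoord.
Variables (K : closedFieldType) (charK0 : [pchar K] =i pred0) (n : nat).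
Implicit Types (x y v w P : 'M[K]_n) (G H X : set 'M[K]_n) (s t a : 'I_n -> K).

(** Diagonal matrices in the coordinates given by [P]. *)
Definition dc P t : 'M[K]_n := invmx P * dgm t * P.

Lemma dgmM s t : dgm s * dgm t = dgm (fun i => s i * t i).
Proof.
rewrite -mulmxE; apply/matrixP => i j; rewrite mxE (bigD1 i) //= big1 ?addr0 => [|k ki].
  by rewrite !dgmE eqxx mulr1n; case: eqP => [->|_]; rewrite ?mulr1n ?mulr0n ?mulr0.
by rewrite dgmE eq_sym (negPf ki) mulr0n mul0r.
Qed.

Lemma dgm1 : dgm (fun=> 1) = 1 :> 'M[K]_n.
Proof. by apply/matrixP => i j; rewrite dgmE mxE. Qed.

Lemma eq_dgm s t : s =1 t -> dgm s = dgm t.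
Proof. by move=> st; apply/matrixP => i j; rewrite !dgmE st. Qed.

Lemma eq_dc P s t : s =1 t -> dc P s = dc P t.
Proof. by move=> /eq_dgm; rewrite /dc => ->. Qed.

Section P.
Variables (P : 'M[K]_n) (uP : P \in unitmx).

Lemma dcK t : P * dc P t * invmx P = dgm t.
Proof. exact: conjVK. Qed.

Lemma dcM s t : dc P s * dc P t = dc P (fun i => s i * t i).
Proof.
rewrite /dc -dgmM !mulrA; congr (_ * _); rewrite -!mulrA; congr (_ * _).
by rewrite [P * _]mulrA mxV // mul1r.
Qed.

Lemma dc1 : dc P (fun=> 1) = 1.
Proof. by rewrite /dc dgm1 mulr1 Vmx. Qed.

Lemma dc_unit t : (forall i, t i != 0) -> dc P t \in unitmx.
Proof.
move=> t0; have : dc P t * dc P (fun i => (t i)^-1) = 1.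
  by rewrite dcM -dc1; apply: eq_dc => i; rewrite divff.
by move=> /mulmx1_unit [].
Qed.

Lemma dcV t : (forall i, t i != 0) -> invmx (dc P t) = dc P (fun i => (t i)^-1).
Proof.
move=> t0; have h : dc P t * dc P (fun i => (t i)^-1) = 1.
  by rewrite dcM -dc1; apply: eq_dc => i; rewrite divff.
by rewrite -[LHS]mulr1 -h mulrA Vmx ?mul1r // dc_unit.
Qed.

Lemma dcD s t : dc P s + dc P t = dc P (fun i => s i + t i).
Proof.
rewrite /dc -mulrDl -mulrDr; congr (_ * _ * _); apply/matrixP => i j.
by rewrite mxE !dgmE mulrnDl.
Qed.

Lemma dcZ c t : c *: dc P t = dc P (fun i => c * t i).
Proof.
rewrite /dc -!mulmxE scalemxAl scalemxAr; congr (_ *m _ *m _); apply/matrixP => i j.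
by rewrite mxE !dgmE mulrnAr.
Qed.

Lemma dc_sum (I : finType) (F : I -> 'I_n -> K) :
  \sum_k dc P (F k) = dc P (fun i => \sum_k F k i).
Proof.
rewrite /dc -mulr_suml -mulr_sumr; congr (_ * _ * _); apply/matrixP => i j.
by rewrite summxE !dgmE -sumrMnl; apply: eq_bigr => k _; rewrite dgmE.
Qed.

Lemma dc0 : dc P (fun=> 0) = 0.
Proof.
rewrite /dc (_ : dgm _ = 0) ?mulr0 ?mul0r //.
by apply/matrixP => i j; rewrite dgmE mul0rn mxE.
Qed.

Lemma dc_inj s t : dc P s = dc P t -> s =1 t.
Proof.
move=> e i; have := congr1 (fun A : 'M_n => (P * A * invmx P) i i) e.
by rewrite /= !dcK !dgmE eqxx !mulr1n.
Qed.

Lemma tr_dcM s t : \tr (dc P s * dc P t) = \sum_i s i * t i.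
Proof.
rewrite dcM -(tr_conj _ uP) dcK; apply: eq_bigr => i _.
by rewrite dgmE eqxx mulr1n.
Qed.

Lemma dc_conjr w t : P * (w * dc P t) * invmx P = P * w * invmx P * dgm t.
Proof. by rewrite /dc !mulrA -[LHS]mulrA mxV // mulr1. Qed.

Lemma dc_conjl w t : P * (dc P t * w) * invmx P = dgm t * (P * w * invmx P).
Proof. by rewrite /dc !mulrA mxV // mul1r. Qed.

Lemma dc_commE w t : (w * dc P t = dc P t * w) <->
  forall i j, (P * w * invmx P) i j * (t j - t i) = 0.
Proof.
have ee : w * dc P t = dc P t * w <-> P * w * invmx P * dgm t = dgm t * (P * w * invmx P).
  rewrite -dc_conjr -dc_conjl; split=> [-> //|h].
  by rewrite -[LHS](conjK _ uP) h conjK.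
rewrite ee; set W := P * w * invmx P.
have el i j : (W * dgm t) i j = W i j * t j.
  rewrite -mulmxE mxE (bigD1 j) //= big1 ?addr0 => [|k kj]; rewrite dgmE ?eqxx ?mulr1n //.
  by rewrite (negPf kj) mulr0n mulr0.
have er i j : (dgm t * W) i j = t i * W i j.
  rewrite -mulmxE mxE (bigD1 i) //= big1 ?addr0 => [|k kj]; rewrite dgmE ?eqxx ?mulr1n //.
  by rewrite eq_sym (negPf kj) mulr0n mul0r.
split=> [h i j|h].
  by rewrite mulrBr -el h er mulrC subrr.
apply/matrixP => i j; rewrite el er mulrC; apply/eqP.
by rewrite -subr_eq0 -mulrBl mulrC h.
Qed.

Lemma dc_comm w a f : w * dc P a = dc P a * w -> (forall i j, a i = a j -> f i = f j) ->
  w * dc P f = dc P f * w.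
Proof.
move=> /dc_commE h af; apply/dc_commE => i j.
have /eqP := h i j; rewrite mulf_eq0 => /orP [/eqP ->|]; first by rewrite mul0r.
by rewrite subr_eq0 => /eqP/af ->; rewrite subrr mulr0.
Qed.

End P.

Lemma cochar_mem G P v r (N : 'I_n -> 'I_r -> int) (b : 'I_r -> K) j c
    (a := fun i => \sum_j (N i j)%:~R * b j) :
  P \in unitmx -> subgroup_GL G -> zariski_closed G -> Zindep b -> nilp v ->
  dc P a * v = v * dc P a -> Lie G (dc P a + v) -> c != 0 ->
  G (dc P (fun i => c ^ N i j)).
Proof.
move=> uP sG zG ib nv cv Ly c0; have [uG G1 GM GV] := sG.
pose H : set 'M[K]_n := [set A | G (invmx P * A * P)].
have sH : subgroup_GL H.
  split; rewrite /H /=.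
  - move=> x /uG; rewrite -!mulmxE !unitmx_mul => /andP [/andP [_ ->]] //.
  - by rewrite -[1%:M]/(1 : 'M_n) mulr1 Vmx.
  - move=> x y hx hy; have := GM _ _ hx hy.
    by rewrite !mulmxE !mulrA -[invmx P * x * P * invmx P]mulrA mxV // mulr1.
  - move=> x hx; have ux : x \in unitmx.
      by move: (uG _ hx); rewrite -!mulmxE !unitmx_mul => /andP [/andP [_ ->]].
    have := GV _ hx; rewrite -!mulmxE !invmxM ?invmxK ?mulmxA //.
    + by rewrite unitmx_inv.
    + by rewrite unitmx_mul unitmx_inv uP.
have LH : Lie H (dgm a + P * v * invmx P).
  have -> : dgm a + P * v * invmx P = P *m (dc P a + v) *m invmx P.
    by rewrite !mulmxE mulrDr mulrDl dcK.
  apply: (Lie_map charK0 (mxV uP)) Ly => A GA; rewrite /H /= !mulmxE conjK //.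
have nv' : nilp (P * v * invmx P) by apply: nilp_conj; rewrite ?mxV ?Vmx.
have cv' : dgm a * (P * v * invmx P) = P * v * invmx P * dgm a.
  by rewrite -dc_conjr // -cv dc_conjl.
apply: (zc_mem zG) => [|p vp]; first by apply: dc_unit => // i; rewrite expfz_neq0.
have [q hq] := polyf_lin (invmx P) P p.
rewrite /dc -!mulmxE -hq.
apply: (cochar_vanish charK0 j ib sH nv' cv' LH) => // A HA.
by rewrite hq; apply: vp.
Qed.

Lemma cochar_Lie H P (z : 'I_n -> int) : P \in unitmx ->
  (forall c, c != 0 -> H (dc P (fun i => c ^ z i))) -> Lie H (dc P (fun i => (z i)%:~R)).
Proof.
move=> uP h; pose H' : set 'M[K]_n := [set A | H (invmx P * A * P)].
apply: (Lie_map charK0 (Vmx uP) (G := H')) => //.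
by apply: (dgm_cochar_Lie charK0) => c c0; apply: h.
Qed.

Lemma Zindep_eq r (N N' : 'I_r -> int) (b : 'I_r -> K) : Zindep b ->
  \sum_j (N j)%:~R * b j = \sum_j (N' j)%:~R * b j -> N =1 N'.
Proof.
move=> ib e j; apply/eqP; rewrite -subr_eq0; apply/eqP; apply: (ib (fun j => N j - N' j)).
under eq_bigr do rewrite rmorphB /= mulrBl.
by rewrite sumrB e subrr.
Qed.

(** The eigenvalues of the semisimple part are written with integral coefficients
    [N i j] in independent [b j]; every [j] contributes a one-parameter torus, which
    is the reason why the semisimple part is tangent to [G]. *)
Lemma jordan_Lie G y : subgroup_GL G -> zariski_closed G -> Lie G y ->
  exists P a v r (N : 'I_n -> 'I_r -> int) (b : 'I_r -> K),
  [/\ P \in unitmx, y = dc P a + v, nilp v,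
      (forall z, z * y = y * z -> z * dc P a = dc P a * z) &
  [/\ (forall i, a i = \sum_j (N i j)%:~R * b j), Zindep b &
      forall j c, c != 0 -> G (dc P (fun i => c ^ N i j))]].
Proof.
move=> sG zG Ly; have [s [P [d [uP sd nv cs]]]] := jordan_chevalley y.
pose a i := d 0 i.
have sE : s = dc P a.
  rewrite -(conjK s uP) sd /dc; congr (_ * _ * _).
  by apply/matrixP => i j; rewrite dgmE mxE; case: eqP => // ->.
have [r [N [b [aN ib]]]] := Zbasis a charK0.
have ea : dc P a = dc P (fun i => \sum_j (N i j)%:~R * b j) by apply: eq_dc.
have cv : dc P a * (y - s) = (y - s) * dc P a.
  rewrite sE mulrBr mulrBl; congr (_ - _); rewrite -sE; apply/esym.
  exact: (cs y erefl).
exists P, a, (y - s), r, N, b; split=> //; first by rewrite -sE addrC subrK.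
  by rewrite -sE.
split=> // j c c0; apply: (cochar_mem j uP sG zG ib nv _ _ c0); first by rewrite -ea.
by rewrite -ea -sE addrC subrK.
Qed.

Lemma Lie_lin H (P Q : 'M[K]_n) i j c v : H 1%:M -> (forall A, H A -> (P *m A *m Q) i j = c) ->
  Lie H v -> (P *m v *m Q) i j = 0.
Proof.
move=> H1 h /LieP Lv; have PA := polyf_alg K n.
have [p hp] : polyf (fun A => (P *m A *m Q) i j - c).
  apply: (fun_algB PA); last exact: (fun_algC PA).
  apply: (entriesM PA); last exact: (entriesC PA).
  by apply: (entriesM PA); [exact: (entriesC PA) | exact: polyf_entries].
have hpA A : mxeval p A = (P *m A *m Q) i j - c by rewrite -[LHS](congr1 (fun f => f A) hp).
have vp : vanish H p by move=> A /h e; rewrite hpA e subrr.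
have := Lv p vp; rewrite -line_deriv.
have -> : line p 1%:M v = (P *m v *m Q) i j *: 'X.
  apply: (poly_ext charK0) => t; rewrite line_eval hpA hornerZ hornerX.
  rewrite mulmxDr mulmxDl mxE (h _ H1) addrC addrK -scalemxAr -scalemxAl mxE.
  by rewrite mulrC.
by rewrite derivZ derivX hornerZ hornerC mulr1.
Qed.

(** The tangent of the [j]-th one-parameter torus of [y] has eigenvalues [N i j].
    Its orthogonality to [y] means, by independence of the [b j], that the sum of
    the squares of these integers is zero. *)
Lemma rad_nilp G y : subgroup_GL G -> zariski_closed G -> Lie G y ->
  (forall z, Lie G z -> \tr (y * z) = 0) -> nilp y.
Proof.
move=> sG zG Ly ry.
have [P [a [v [r [N [b [uP ye nv cs [aN ib hc]]]]]]]] := jordan_Lie sG zG Ly.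
have N0 i j : N i j = 0.
  pose sj := dc P (fun i => (N i j)%:~R).
  have Lsj : Lie G sj by apply: cochar_Lie => // c c0; apply: hc.
  have csv : dc P a * v = v * dc P a.
    have e := cs y erefl; apply/eqP; rewrite -subr_eq0.
    move/eqP: e; rewrite -subr_eq0 ye mulrDl mulrDr opprD addrACA subrr add0r.
    by move=> /eqP/subr0_eq ->; rewrite subrr.
  have sjv : v * sj = sj * v.
    apply: (dc_comm uP (a := a)); first by rewrite csv.
    by move=> k l; rewrite !aN => /(Zindep_eq ib) ->.
  have := ry sj Lsj; rewrite ye mulrDl mxtraceD [X in _ + X]nilp_tr0 ?addr0; last first.
    by rewrite sjv; apply: nilpMcomm.
  rewrite tr_dcM // => e.
  have : \sum_l (\sum_i N i l * N i j)%:~R * b l = 0.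
    rewrite -[RHS]e; under eq_bigr do rewrite rmorph_sum /= mulr_suml.
    rewrite exchange_big; apply: eq_bigr => k _ /=; rewrite aN mulr_suml.
    by apply: eq_bigr => l _; rewrite intrM mulrAC.
  move=> /ib /(_ j) /eqP; rewrite Num.Theory.psumr_eq0 => [/allP /(_ i)|k _].
    by rewrite mem_index_enum mulf_eq0 orbb => /(_ isT)/eqP.
  by rewrite -expr2 Num.Theory.sqr_ge0.
have a0 : dc P a = 0.
  by rewrite -(dc0 P); apply: eq_dc => i; rewrite aN big1 // => j _; rewrite N0 mul0r.
by rewrite ye a0 add0r.
Qed.

End DiagCoord.

(** * The trace form of an almost simple group *)

Section SimpleGroups.
Variables (K : closedFieldType) (charK0 : [pchar K] =i pred0) (n : nat).
Implicit Types (x y v w P : 'M[K]_n) (G H X : set 'M[K]_n).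

Definition cent X : set 'M[K]_n := [set A | A \in unitmx /\ forall s, X s -> A *m s = s *m A].

Lemma cent_closed X : zariski_closed (cent X).
Proof.
have RA := regf_alg K n.
have h (k : {s | X s} * ('I_n * 'I_n)) :
  regf (fun A : 'M[K]_n => (A *m sval k.1 + (-1) *: (sval k.1 *m A)) k.2.1 k.2.2).
  apply: (entriesD RA); first by apply: (entriesM RA); [exact: regf_entries | exact: (entriesC RA)].
  apply: (entriesZ RA); first exact: (fun_algC RA).
  by apply: (entriesM RA); [exact: (entriesC RA) | exact: regf_entries].
have -> : cent X = [set A | A \in unitmx /\ forall k : {s | X s} * ('I_n * 'I_n),
    (A *m sval k.1 + (-1) *: (sval k.1 *m A)) k.2.1 k.2.2 = 0]; last exact: zc_fam h.
apply/seteqP; split=> A /= [uA hA]; split=> //.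
  by move=> [[s Xs] [i j]] /=; rewrite hA // scaleN1r subrr mxE.
move=> s Xs; apply/eqP; rewrite -subr_eq0; apply/eqP/matrixP => i j.
by rewrite [RHS]mxE -scaleN1r; exact: (hA (exist _ s Xs, (i, j))).
Qed.

(** The closure of the group generated by [X] is connected and normal, hence trivial
    or equal to [G]; it is commutative, and [G] is not. *)
Lemma simple_no_abelian G X : almost_simple G -> X `<=` G ->
  (forall A, X A -> X (invmx A)) -> (forall A B, X A -> X B -> A *m B = B *m A) ->
  (forall g A, G g -> X A -> X (mxconj g A)) -> (forall C, X C -> linked (gen X) C) ->
  X `<=` [set 1%:M].
Proof.
move=> [[sG zG] _ [g1 [g2 [Gg1 Gg2 /eqP ncom]]] simpG] XG XV Xc XJ Xl.
have [uG G1 GM GV] := sG.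
have uX A : X A -> A \in unitmx by move=> /XG/uG.
have sX := gen_subgroup uX XV; have ugen A : gen X A -> A \in unitmx by case: sX => u *; exact: u.
pose N := zcl (gen X).
have sN : subgroup_GL N := zcl_subgroup sX.
have NG : N `<=` G by apply: zcl_min => //; apply: gen_min.
have XN : X `<=` N by move=> A XA; apply: (sub_zcl ugen); apply: sub_gen.
have nN : normal_subgroup G N.
  split=> // g A Gg NA; have ug := uG _ Gg; have uV : invmx g \in unitmx by rewrite unitmx_inv.
  apply: (zcl_min (zc_trans ug uV (zcl_closed (gen X))) _ NA) => B /= gB.
  suff : gen X (g *m B *m invmx g) by apply: (sub_zcl ugen).
  apply: (gB (fun B => gen X (g *m B *m invmx g))) => [|C D gC XD].
    by rewrite mulmx1 mulmxV.
  have -> : g *m (C *m D) *m invmx g = (g *m C *m invmx g) *m mxconj g D.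
    by rewrite /mxconj !mulmxA -[g *m C *m invmx g *m g]mulmxA mulVmx // mulmx1.
  by apply: genMX => //; apply: XJ.
have [e|e] := simpG N nN (conj sN (@zcl_closed _ _ _)) (zcl_gen_connected uX Xl).
  by move=> A /XN; rewrite e.
have gcen S : X `<=` cent S -> N `<=` cent S.
  move=> XS; apply: zcl_min; first exact: cent_closed.
  move=> A gA; apply: gA; first by split=> [|s Ss]; rewrite ?unitmx1 ?mulmx1 ?mul1mx.
  move=> B C [uB hB] /XS [uC hC]; split=> [|s Ss]; first by rewrite unitmx_mul uB.
  by rewrite -mulmxA hC // !mulmxA hB.
(* [N] commutes with [X], hence [X] with [N], hence [N] with itself *)
have NX : N `<=` cent X by apply: gcen => A XA; split=> [|s Xs]; [exact: uX | exact: Xc].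
have XcN : X `<=` cent N.
  by move=> A XA; split=> [|s /NX [_ h]]; [exact: uX | rewrite h].
by have [] := gcen N XcN g1; rewrite ?e // => _ /(_ g2 Gg2) /ncom.
Qed.

Lemma Lie_Ad G g x : subgroup_GL G -> G g -> Lie G x -> Lie G (mxconj g x).
Proof.
move=> [uG _ GM GV] Gg; apply: (Lie_map charK0 (G := G)); first by rewrite mulmxV ?uG.
by move=> A GA; apply: GM (GM _ _ Gg GA) (GV _ Gg).
Qed.

Lemma expm_mxconj g v : g \in unitmx -> mxconj g (expm v) = expm (mxconj g v).
Proof.
move=> ug; rewrite /expm /mxconj mulmx_sumr mulmx_suml; apply: eq_bigr => k _.
by rewrite -scalemxAr -scalemxAl conj_exp ?mxV ?Vmx.
Qed.

Lemma nilp_mxconj g v : g \in unitmx -> nilp v -> nilp (mxconj g v).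
Proof. by move=> ug; apply: nilp_conj; rewrite ?mxV ?Vmx. Qed.

Lemma two_neq0 : 2%:R != 0 :> K. Proof. exact: (nat_neq0 charK0 1). Qed.

Lemma linked_exp X v : (forall A, X A -> A \in unitmx) ->
  (forall A, X A -> X (invmx A)) -> nilp v ->
  (forall t, X (expm (t *: v))) -> linked (gen X) (expm v).
Proof.
move=> uX XV nv h.
pose phi (t : K) := expm ((t - 1) *: v).
have -> : expm v = phi 2%:R by rewrite /phi -[2%:R]/(1 + 1) addrK scale1r.
apply: (linked_curve charK0); rewrite ?two_neq0 //.
- exact: exp_curve_ok.
- by rewrite /phi subrr scale0r expm0.
- by have [u *] := gen_subgroup uX XV; apply: u.
- by move=> A t gA _; apply: genMX => //; apply: h.
Qed.

Lemma linked_cochar X P (z : 'I_n -> int) c : P \in unitmx -> c != 0 ->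
  (forall A, X A -> A \in unitmx) -> (forall A, X A -> X (invmx A)) ->
  (forall c, c != 0 -> X (dc P (fun i => c ^ z i))) ->
  linked (gen X) (dc P (fun i => c ^ z i)).
Proof.
move=> uP c0 uX XV h.
pose phi (c : K) := dc P (fun i => c ^ z i).
apply: (linked_curve charK0 (phi := phi)) => //.
- move=> p; have [q hq] := polyf_lin (invmx P) P p.
  have [e [m [_ he]]] := cpolyP q z; exists (cpoly e q) => t t0.
  by rewrite he // mulf_eq0 expf_eq0 (negPf t0) andbF /= hq.
- by rewrite /phi -[RHS](dc1 uP); apply: eq_dc => i; rewrite exp1rz.
- by have [u *] := gen_subgroup uX XV; apply: u.
- by move=> A t gA t0; apply: genMX => //; apply: h.
Qed.

Lemma tr_ad x y z : \tr (ad x y * z) = \tr (x * ad y z).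
Proof.
rewrite /ad !mulmxE mulrBl mulrBr !mxtraceD !raddfN /= -!mulrA; congr (_ - _).
by rewrite trM mulrA.
Qed.

Lemma tr_mxconj g x y : g \in unitmx ->
  \tr (mxconj g x * y) = \tr (x * mxconj (invmx g) y).
Proof.
move=> ug; rewrite /mxconj invmxK !mulmxE -[LHS](tr_conj _ (_ : invmx g \in unitmx)) ?unitmx_inv //.
by rewrite invmxK !mulrA Vmx // mul1r.
Qed.

Lemma mxconj_lin g c u v : mxconj g (c *: u + v) = c *: mxconj g u + mxconj g v.
Proof. by rewrite /mxconj mulmxDr mulmxDl -scalemxAr -scalemxAl. Qed.

Lemma mxconjK g v : g \in unitmx -> mxconj (invmx g) (mxconj g v) = v.
Proof. by move=> ug; rewrite /mxconj invmxK !mulmxE conjK. Qed.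

Lemma mxconjVK g v : g \in unitmx -> mxconj g (mxconj (invmx g) v) = v.
Proof. by move=> ug; rewrite /mxconj invmxK !mulmxE conjVK. Qed.

Lemma mxconjM g h v : g \in unitmx -> h \in unitmx -> mxconj (g *m h) v = mxconj g (mxconj h v).
Proof. by move=> ug uh; rewrite /mxconj invmxM // !mulmxA. Qed.

Lemma mxconj_ad g x y : g \in unitmx -> mxconj g (ad x y) = ad (mxconj g x) (mxconj g y).
Proof.
move=> ug; have h u w : mxconj g u *m mxconj g w = mxconj g (u *m w).
  by rewrite /mxconj !mulmxA -[_ *m invmx g *m g]mulmxA mulVmx // mulmx1.
by rewrite /ad !h /mxconj mulmxBr mulmxBl.
Qed.

Lemma subsp_Lie G : subsp (Lie G : 'M[K]_n -> Prop).
Proof. by split=> [|c u v Lu Lv]; [exact: Lie0 | apply: LieD => //; apply: LieZ]. Qed.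

Lemma Lie_comb G (I : Type) (s : seq I) (P : pred I) (c : I -> K) (F : I -> 'M[K]_n) :
  (forall i, P i -> Lie G (F i)) -> Lie G (\sum_(i <- s | P i) c i *: F i).
Proof.
move=> h; elim/big_ind: _ => [|u v Lu Lv|i Pi]; [exact: Lie0 | exact: LieD |].
by apply: LieZ; apply: h.
Qed.

(** The radical of the form is an ideal of nilpotent matrices.  If it were not zero,
    it would have a nonzero center by Engel, and the exponentials of that center
    would contradict [simple_no_abelian]. *)
Lemma form_nondeg G y : almost_simple G -> Lie G y ->
  (forall z, Lie G z -> \tr (y * z) = 0) -> y = 0.
Proof.
move=> sim Ly ry; have [[sG zG] _ _ _] := sim; have [uG G1 GM GV] := sG.
pose r := [set y : 'M[K]_n | Lie G y /\ forall z, Lie G z -> \tr (y * z) = 0].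
have sr : subsp r.
  split; first by split=> [|z _]; [exact: Lie0 | rewrite mul0r mxtrace0].
  move=> c u v [Lu hu] [Lv hv]; split=> [|z Lz]; first by apply: LieD => //; apply: LieZ.
  by rewrite mulrDl mxtraceD hv // addr0 sclMl mxtraceZ hu ?mulr0.
have rn v : r v -> nilp v by move=> [Lv hv]; apply: (rad_nilp charK0 sG zG Lv hv).
have rad x v : Lie G x -> r v -> r (ad x v).
  move=> Lx [Lv hv]; split=> [|z Lz]; first by apply: Lie_bracket.
  by rewrite adC mulNr raddfN /= tr_ad hv ?oppr0 //; apply: Lie_bracket.
have rAd g v : G g -> r v -> r (mxconj g v).
  move=> Gg [Lv hv]; split=> [|z Lz]; first by apply: Lie_Ad.
  by rewrite tr_mxconj ?uG // hv //; apply: Lie_Ad => //; apply: GV.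
have [k hk] := subsp_vs sr.
have [-> //|/eqP y0] := eqVneq y 0; exfalso.
have [v [rv v0 hv]] : exists v, [/\ r v, v <> 0 & forall x, x \in k -> ad x v = 0].
  apply: (@engel _ charK0 _ k _ _ r (fun v => v = 0)).
  - by move=> x z /hk rx /hk rz; apply/hk; apply: rad => //; case: rx.
  - by move=> x /hk/rn.
  - by split=> // c u v -> ->; rewrite scaler0 addr0.
  - by move=> v ->; apply: subsp0.
  - by move=> x v /hk [Lx _]; apply: rad.
  - by move=> x v _ ->; rewrite ad0r.
  - by exists y.
pose W := [set v : 'M[K]_n | r v /\ forall x, r x -> ad x v = 0].
have Wn w : W w -> nilp w by move=> [/rn].
have WZ c w : W w -> W (c *: w).
  move=> [rw hw]; split=> [|x /hw e]; first exact: subspZ.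
  by rewrite adZr e scaler0.
have Wc v' w : W v' -> W w -> v' * w = w * v'.
  move=> [rv' _] [_ hw]; have := hw v' rv'.
  by rewrite /ad !mulmxE => /eqP; rewrite subr_eq0 => /eqP.
pose X : set 'M[K]_n := [set expm w | w in W].
have XG : X `<=` G by move=> _ [w Ww <-]; exact: (exp_mem charK0 sG zG (proj1 (proj1 Ww)) (Wn _ Ww)).
have uX A : X A -> A \in unitmx by move=> /XG/uG.
have XV A : X A -> X (invmx A).
  move=> [w Ww <-]; rewrite expmV //; last exact: Wn.
  by exists (- w) => //; rewrite -scaleN1r; apply: WZ.
have Xe w : W w -> X (expm w) by exists w.
have X1 : X `<=` [set 1%:M].
  apply: (simple_no_abelian sim) => //.
  - move=> _ _ [u Wu <-] [w Ww <-]; rewrite !mulmxE.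
    rewrite -(expmD charK0 (Wc _ _ Ww Wu) (Wn _ Ww) (Wn _ Wu)).
    by rewrite -(expmD charK0 (Wc _ _ Wu Ww) (Wn _ Wu) (Wn _ Ww)) addrC.
  - move=> g _ Gg [w [rw hw] <-]; rewrite expm_mxconj ?uG //; apply: Xe; split; first exact: rAd.
    move=> x rx; have ug := uG _ Gg.
    rewrite -(mxconjVK x ug) -mxconj_ad // hw; last by apply: rAd => //; apply: GV.
    by rewrite /mxconj mulmx0 mul0mx.
  - by move=> _ [w Ww <-]; apply: linked_exp => // [|t]; [exact: Wn | apply: Xe; apply: WZ].
apply: v0; have Wv : W v by split=> // x /hk; apply: hv.
have Lv : Lie [set 1%:M] v.
  by apply: (exp_Lie charK0 (rn _ rv)) => t; apply: X1; apply: Xe; apply: WZ.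
apply/matrixP => i j; rewrite mxE.
have := Lie_lin charK0 (P := 1%:M) (Q := 1%:M) (i := i) (j := j) (c := (1%:M : 'M[K]_n) i j) (H := [set 1%:M]) erefl _ Lv.
by rewrite mul1mx mulmx1; apply=> A ->; rewrite mul1mx mulmx1.
Qed.

(** A subspace is its own double orthogonal for a nondegenerate form. *)
Lemma perp_sep G (W : 'M[K]_n -> Prop) v : almost_simple G -> subsp W -> (forall w, W w -> Lie G w) ->
  Lie G v -> ~ W v ->
  exists y, [/\ Lie G y, forall w, W w -> \tr (y * w) = 0 & \tr (y * v) != 0].
Proof.
move=> sim sW WG Lv nWv.
have [U hU] := subsp_vs (subsp_Lie G); have [V hV] := subsp_vs sW.
pose X := vbasis U; pose m := \dim U.
pose Q : 'M[K]_m := \matrix_(i, j) \tr (X`_i * X`_j).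
have LX i : Lie G X`_(i : 'I_m) by apply/hU; apply: vbasis_mem; rewrite mem_nth // size_tuple.
have comb (y : 'rV_m) j : \tr ((\sum_i y 0 i *: X`_i) * X`_(j : 'I_m)) = (y *m Q) 0 j.
  rewrite mulr_suml raddf_sum mxE /=; apply: eq_bigr => i _.
  by rewrite sclMl mxtraceZ mxE.
have span w : Lie G w -> exists d : 'rV_m, w = \sum_i d 0 i *: X`_i.
  move=> /hU/coord_vbasis e; exists (\row_i coord X i w); rewrite {1}e.
  by apply: eq_bigr => i _; rewrite mxE.
have uQ : Q \in unitmx.
  rewrite -row_free_unit; apply/inj_row_free => y yQ.
  have y0 : \sum_i y 0 i *: X`_i = 0.
    apply: (form_nondeg sim); first by apply: Lie_comb.
    move=> z /span [d ->]; rewrite mulr_sumr raddf_sum big1 // => j _ /=.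
    by rewrite sclMr mxtraceZ comb yQ mxE mulr0.
  apply/rowP => i; rewrite [RHS]mxE.
  by have /freeP := basis_free (vbasisP U); apply.
pose phi (w : 'M[K]_n) := w - projv V w.
have phil c u w : phi (c *: u + w) = c *: phi u + phi w.
  by rewrite /phi linearP scalerBr opprD addrACA.
have phi0 w : W w -> phi w = 0 by move=> /hV/projv_id; rewrite /phi => ->; rewrite subrr.
have [[i j] pv] : exists k, phi v k.1 k.2 != 0.
  apply: contrapT => h; apply: nWv; apply/hV.
  have -> : v = projv V v.
    apply/eqP; rewrite -subr_eq0; apply/eqP/matrixP => i j; rewrite [RHS]mxE.
    by apply/eqP; apply: contrapT => /negP hij; apply: h; exists (i, j).
  exact: memv_proj.
pose c : 'rV_m := \row_k phi X`_k i j.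
pose y := \sum_k (c *m invmx Q) 0 k *: X`_k.
have Ly : Lie G y by apply: Lie_comb.
have yE w : Lie G w -> \tr (y * w) = phi w i j.
  move=> /span [d ->].
  have -> : phi (\sum_i0 d 0 i0 *: X`_i0) = \sum_k d 0 k *: phi X`_k.
    elim/big_rec2: _ => [|k a b _ <-]; first by rewrite /phi linear0 subr0.
    by rewrite phil.
  rewrite mulr_sumr raddf_sum summxE; apply: eq_bigr => k _ /=.
  by rewrite sclMr mxtraceZ comb -mulmxA mulVmx // mulmx1 !mxE.
exists y; split=> // [w Ww|]; first by rewrite yE ?phi0 ?mxE //; apply: WG.
by rewrite yE.
Qed.

End SimpleGroups.

(** * Characters of tori and their weight idempotents *)

Section Monomials.
Variables (K : closedFieldType) (charK0 : [pchar K] =i pred0) (r : nat).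
Implicit Types (mu nu : 'rV[int]_r) (d : 'I_r -> K).

(** The character of exponent [mu] of the torus of rank [r]. *)
Definition mon mu d : K := \prod_l d l ^ mu 0 l.

(** The points of the torus of rank [r] are the functions without zeros. *)
Definition nz d := forall l, d l != 0.

Lemma mon0 d : mon 0 d = 1.
Proof. by rewrite /mon big1 // => l _; rewrite mxE expr0z. Qed.

Lemma monD mu nu d : nz d -> mon (mu + nu) d = mon mu d * mon nu d.
Proof. by move=> d0; rewrite /mon -big_split; apply: eq_bigr => l _; rewrite mxE expfzDr. Qed.

Lemma monMd mu d d' : mon mu (fun l => d l * d' l) = mon mu d * mon mu d'.
Proof. by rewrite /mon -big_split; apply: eq_bigr => l _; rewrite expfzMl. Qed.

Lemma mon1 mu : mon mu (fun=> 1) = 1.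
Proof. by rewrite /mon big1 // => l _; rewrite exp1rz. Qed.

Lemma mon_neq0 mu d : nz d -> mon mu d != 0.
Proof. by move=> d0; apply/prodf_neq0 => l _; rewrite expfz_neq0. Qed.

Lemma monN mu d : nz d -> mon (- mu) d = (mon mu d)^-1.
Proof.
move=> d0; apply: (mulfI (mon_neq0 mu d0)).
by rewrite -monD // subrr mon0 mulfV // mon_neq0.
Qed.

(** The pairing of characters with one-parameter subgroups. *)
Definition pair (u : 'I_r -> int) mu : int := \sum_l mu 0 l * u l.

Lemma pairD u mu nu : pair u (mu + nu) = pair u mu + pair u nu.
Proof. by rewrite /pair -big_split; apply: eq_bigr => l _; rewrite mxE mulrDl. Qed.

Lemma pairN u mu : pair u (- mu) = - pair u mu.
Proof. by rewrite /pair -sumrN; apply: eq_bigr => l _; rewrite mxE mulNr. Qed.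

Lemma mon_curve u mu c : c != 0 -> mon mu (fun l => c ^ u l) = c ^ (pair u mu).
Proof.
move=> c0; rewrite /mon /pair; elim/big_rec2: _ => [|l a b _ ->]; first by rewrite expr0z.
by rewrite expfzDr // exprz_exp [u l * _]mulrC.
Qed.

Lemma int_eq0 (z : int) : (z%:~R == 0 :> K) = (z == 0).
Proof.
case: z => k; last by rewrite NegzE mulrNz oppr_eq0 (negPf (nat_neq0 charK0 k)).
by case: k => [|k]; rewrite ?eqxx // (negPf (nat_neq0 charK0 k)).
Qed.

Lemma intr_injK : injective (fun z : int => z%:~R : K).
Proof.
by move=> a b /= e; apply/eqP; rewrite -subr_eq0 -int_eq0 rmorphB /= e subrr.
Qed.

(** For [u l = k ^ l] the pairing with [mu] is the value at [k] of a nonzero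
    polynomial. *)
Lemma generic (s : seq 'rV[int]_r) : (forall mu, mu \in s -> mu != 0) ->
  exists u, forall mu, mu \in s -> pair u mu != 0.
Proof.
move=> s0; pose q (mu : 'rV[int]_r) : {poly K} := \sum_(l < r) (mu 0 l)%:~R *: 'X^l.
have q0 mu : mu != 0 -> q mu != 0.
  apply: contraNneq => qm; apply/eqP/rowP => l; rewrite [RHS]mxE; apply/eqP.
  rewrite -int_eq0 -[X in _ == X](coef0 _ l) -qm coef_sum (bigD1 l) //= big1 ?addr0.
    by rewrite coefZ coefXn eqxx mulr1.
  by move=> k kl; rewrite coefZ coefXn eq_sym (inj_eq val_inj) (negPf kl) mulr0.
have [|k] := nonroot_nat charK0 (q := \prod_(mu <- s) q mu).
  by rewrite prodf_seq_neq0; apply/allP => mu /s0/q0.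
rewrite horner_prod prodf_seq_neq0 => /allP h; exists (fun l => (k ^ l)%N%:Z) => mu /h /=.
rewrite -int_eq0 /pair rmorph_sum horner_sum /=; congr (~~ (_ == 0)).
apply: eq_bigr => l _; rewrite hornerZ hornerXn intrM; congr (_ * _).
by rewrite -natrX -pmulrn.
Qed.

(** On a one-parameter subgroup that separates the elements of [s], the relation is
    a polynomial identity in one variable. *)
Lemma mon_indep (s : seq 'rV[int]_r) (c : 'rV[int]_r -> K) : uniq s ->
  (forall d, nz d -> \sum_(mu <- s) mon mu d * c mu = 0) -> forall mu, mu \in s -> c mu = 0.
Proof.
move=> us h mu0 ms.
have [|u hu] := generic (s := [seq x | x <- [seq x.1 - x.2 | x <- [seq (x, y) | x <- s, y <- s]] & x != 0]).
  by move=> mu; rewrite map_id mem_filter => /andP [].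
have inju mu nu : mu \in s -> nu \in s -> pair u mu = pair u nu -> mu = nu.
  move=> ms' ns e; apply/eqP; rewrite -subr_eq0; apply: contraT => ne.
  have /hu : mu - nu \in [seq x | x <- [seq x.1 - x.2 | x <- [seq (x, y) | x <- s, y <- s]] & x != 0].
    rewrite map_id mem_filter ne; apply/mapP; exists (mu, nu) => //.
    by apply/allpairsP; exists (mu, nu).
  by rewrite pairD pairN e subrr eqxx.
(* shifting by [B] makes all exponents nonnegative *)
pose B : nat := (\sum_(mu <- s) absz (pair u mu))%N.
have pB mu : mu \in s -> exists k : nat, pair u mu + B%:Z = k.
  move=> ms'; exists (absz (pair u mu + B%:Z)).
  have : (absz (pair u mu) <= B)%N by rewrite /B (big_rem mu) //= leq_addr.
  by lia.
pose kk mu : nat := (absz (pair u mu + B%:Z)).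
have kkE mu : mu \in s -> pair u mu + B%:Z = kk mu by move=> /pB [k e]; rewrite /kk e.
pose q : {poly K} := \sum_(mu <- s) c mu *: 'X^(kk mu).
have q0 : q = 0.
  apply: (poly_ext_neq0 charK0) => t t0; rewrite horner0 horner_sum.
  have := h (fun l => t ^ u l) (fun l => expfz_neq0 _ t0) => /(congr1 ( *%R (t ^ B%:Z))).
  rewrite mulr0 mulr_sumr => e; rewrite -[RHS]e big_seq [RHS]big_seq; apply: eq_bigr => mu ms'.
  by rewrite hornerZ hornerXn mon_curve // mulrA -expfzDr // addrC kkE // mulrC.
have := congr1 (fun p : {poly K} => p`_(kk mu0)) q0; rewrite /= coef0 coef_sum.
rewrite (big_rem mu0) //= big_seq big1 ?addr0 => [|nu].
  by rewrite coefZ coefXn eqxx mulr1.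
rewrite mem_rem_uniq // inE => /andP [/eqP nm ns].
rewrite coefZ coefXn; case: eqP => [e|]; rewrite ?mulr0 //; case: nm.
by apply/esym; apply: inju => //; apply: (addIr B%:Z); rewrite !kkE // e.
Qed.

Lemma mon_indep_mx (m p : nat) (s : seq 'rV[int]_r) (c : 'rV[int]_r -> 'M[K]_(m, p)) : uniq s ->
  (forall d, nz d -> \sum_(mu <- s) mon mu d *: c mu = 0) -> forall mu, mu \in s -> c mu = 0.
Proof.
move=> us h mu ms; apply/matrixP => i j; rewrite [RHS]mxE.
apply: (mon_indep (c := fun mu => c mu i j) us) ms => d d0.
have := congr1 (fun A : 'M_(m, p) => A i j) (h d d0); rewrite /= summxE mxE => e.
by rewrite -[RHS]e; apply: eq_bigr => nu _; rewrite mxE.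
Qed.

Lemma mon_inj mu nu : (forall d, nz d -> mon mu d = mon nu d) -> mu = nu.
Proof.
move=> h; apply/eqP; apply: contraT => mn.
have us : uniq [:: mu; nu] by rewrite /= inE mn.
have h1 d : nz d -> \sum_(x <- [:: mu; nu]) mon x d * (if x == mu then 1 else -1) = 0.
  move=> d0; rewrite !big_cons big_nil eqxx eq_sym (negPf mn) (h _ d0).
  by rewrite mulr1 mulrN1 addr0 subrr.
by have /eqP := mon_indep us h1 (mem_head _ _); rewrite eqxx oner_eq0.
Qed.

Definition nzd := {d : 'I_r -> K | nz d}.

(** Functions on the torus that are Laurent polynomials. *)
Definition laur (f : nzd -> K) := exists s : seq (K * 'rV[int]_r),
  forall d : nzd, f d = \sum_(x <- s) x.1 * mon x.2 (sval d).

Lemma laur_alg : fun_alg laur.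
Proof.
split.
- move=> c; exists [:: (c, 0)] => d; by rewrite big_seq1 mon0 mulr1.
- by move=> f g [s hs] [s' hs']; exists (s ++ s') => d; rewrite big_cat hs hs'.
- move=> f g [s hs] [s' hs']; exists [seq (x.1 * y.1, x.2 + y.2) | x <- s, y <- s'] => d.
  rewrite hs hs' big_allpairs_dep mulr_suml; apply: eq_bigr => x _; rewrite mulr_sumr.
  apply: eq_bigr => y _ /=; rewrite (monD _ _ (svalP d)); exact: mulrACA.
Qed.

Lemma laur_mon mu : laur (fun d : nzd => mon mu (sval d)).
Proof. by exists [:: (1, mu)] => d; rewrite big_seq1 mul1r. Qed.

Lemma laur_regular (p : {mpoly K[r * r]}) k :
  laur (fun d : nzd => mxeval p (dgm (sval d)) / \det (dgm (sval d)) ^+ k).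
Proof.
have LA := laur_alg.
have lc l e : laur (fun d : nzd => sval d l ^ e).
  have [s hs] := laur_mon (e *: delta_mx 0 l); exists s => d; rewrite -hs /mon (bigD1 l) //=.
  rewrite big1 ?mulr1 ?mxE ?eqxx ?mulr1 // => l' ll'.
  by rewrite !mxE (negPf ll') mulr0 expr0z.
apply: (fun_algM LA).
  apply: (fun_alg_mxeval _ LA) => i j; case: (eqVneq i j) => [->|ij].
    by have [s hs] := lc j 1; exists s => d; rewrite -hs dgmE eqxx mulr1n expr1z.
  by exists [::] => d; rewrite big_nil dgmE (negPf ij) mulr0n.
have : laur (fun d : nzd => (\prod_l sval d l ^ (-1)) ^+ k).
  by apply: (fun_algX LA); apply: (fun_alg_prod LA) => l _; apply: lc.
case=> s hs; exists s => d; rewrite -hs det_diag prodfV exprVn; congr (_ ^+ k)^-1.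
by apply: eq_bigr => l _; rewrite mxE.
Qed.

End Monomials.

Section TorusStructure.
Variables (K : closedFieldType) (charK0 : [pchar K] =i pred0) (n : nat).
Implicit Types (v P : 'M[K]_n) (G H X T : set 'M[K]_n).

(** The projections onto the weight spaces of a torus acting on the space of column
    vectors. *)
Definition idem_family r (s : seq 'rV[int]_r) (M : 'rV[int]_r -> 'M[K]_n) :=
  [/\ uniq s, \sum_(mu <- s) M mu = 1 &
      forall mu nu, mu \in s -> nu \in s -> M mu * M nu = if mu == nu then M mu else 0].

(** The entries of an isomorphism from a diagonal group are Laurent polynomials.
    Their coefficient matrices are orthogonal idempotents, because the isomorphism
    is multiplicative and distinct characters are independent. *)
Lemma torus_expansion T : is_torus T -> exists r (s : seq 'rV[int]_r) (M : 'rV[int]_r -> 'M[K]_n),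
  idem_family s M /\
  forall A, T A <-> exists2 d, nz d & A = \sum_(mu <- s) mon mu d *: M mu.
Proof.
move=> [[sT zT] [r [f [g [hf [hg gM] fK gK]]]]]; exists r.
have dgP (d : nzd K r) : @diag_group K r (dgm (sval d)).
  split; last exact: diag_mx_is_diag.
  rewrite unitmxE det_diag unitfE; apply/prodf_neq0 => l _; rewrite mxE; exact: (svalP d).
pose mk (d : nzd K r) : @diag_group K r := SigSub (mem_set (dgP d)).
pose gg d := val (g (mk d)).
have ggl i j : laur (fun d => gg d i j).
  have [p [k hp]] := hg i j; have [s hs] := laur_regular p k; exists s => d.
  by rewrite -hs /gg hp.
have /choice [S hS] : forall ij : 'I_n * 'I_n, exists s : seq (K * 'rV[int]_r),
    forall d, gg d ij.1 ij.2 = \sum_(x <- s) x.1 * mon x.2 (sval d).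
  by move=> [i j]; apply: ggl.
pose s := undup (flatten [seq [seq x.2 | x <- S ij] | ij <- enum {: 'I_n * 'I_n}]).
pose M mu : 'M[K]_n := \matrix_(i, j) \sum_(x <- S (i, j) | x.2 == mu) x.1.
exists s, M.
have us : uniq s := undup_uniq _.
have ggE d : gg d = \sum_(mu <- s) mon mu (sval d) *: M mu.
  apply/matrixP => i j; rewrite (hS (i, j)) summxE /=.
  under [RHS]eq_bigr do rewrite 2!mxE mulr_sumr.
  rewrite (exchange_big_dep xpredT) //= big_seq [RHS]big_seq; apply: eq_bigr => x xS.
  rewrite (big_rem x.2) /= ?eqxx; last first.
    rewrite mem_undup; apply/flattenP; exists [seq x.2 | x <- S (i, j)].
      by apply/mapP; exists (i, j); rewrite ?mem_enum.
    by apply/mapP; exists x.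
  rewrite mulrC big_seq_cond big1 ?addr0 // => mu /andP [].
  by rewrite mem_rem_uniq // inE eq_sym => /andP [/negPf ->].
have mkM (d d' : nzd K r) : exists d'' : nzd K r, sval d'' = (fun l => sval d l * sval d' l).
  have h : nz (fun l => sval d l * sval d' l).
    by move=> l; rewrite mulf_neq0 //; [apply: (svalP d) | apply: (svalP d')].
  by exists (exist _ _ h).
have ggM d d' d'' : sval d'' = (fun l => sval d l * sval d' l) -> gg d'' = gg d * gg d'.
  move=> e; apply: gM; rewrite /= e -dgmM //.
split.
  have MM mu nu : mu \in s -> nu \in s -> M mu * M nu = if mu == nu then M mu else 0.
    move=> ms ns.
    have h1 (d' : nzd K r) : \sum_(nu <- s) mon nu (sval d') *: (M mu * M nu) = mon mu (sval d') *: M mu.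
      apply/eqP; rewrite -subr_eq0; apply/eqP.
      apply: (mon_indep_mx charK0 (c := fun mu => \sum_(nu <- s) mon nu (sval d') *: (M mu * M nu) - mon mu (sval d') *: M mu) us) ms.
      move=> d d0; pose D : nzd K r := exist _ d d0; have [d'' e''] := mkM D d'.
      have := ggM D d' d'' e''; rewrite !ggE e'' mulr_suml => e.
      under eq_bigr do rewrite scalerBr.
      rewrite sumrB; apply/eqP; rewrite subr_eq0; apply/eqP.
      under [RHS]eq_bigr do rewrite scalerA -monMd.
      rewrite e; apply: eq_bigr => mu' _; rewrite sclMl mulr_sumr; congr (_ *: _).
      by apply: eq_bigr => nu' _; rewrite sclMr.
    apply/eqP; rewrite -subr_eq0; apply/eqP.
    apply: (mon_indep_mx charK0 (c := fun nu => M mu * M nu - (if mu == nu then M mu else 0)) us) ns.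
    move=> d d0; under eq_bigr do rewrite scalerBr.
    rewrite sumrB (h1 (exist _ d d0)) (big_rem mu) //= eqxx big_seq big1 ?addr0 ?subrr // => nu'.
    by rewrite mem_rem_uniq // inE eq_sym => /andP [/negPf -> _]; rewrite scaler0.
  split=> //.
  have h1 : nz (fun _ : 'I_r => 1 : K) by move=> l; exact: oner_neq0.
  have := ggE (exist _ _ h1); under eq_bigr do rewrite /= mon1 scale1r.
  move=> <-; have gd : gg (exist _ _ h1) = gg (exist _ _ h1) * gg (exist _ _ h1).
    by apply: ggM => /=; apply/funext => l; rewrite mulr1.
  have ug : gg (exist _ _ h1) \in unitmx.
    by have [u _ _ _] := sT; apply: u; apply: set_mem; exact: (valP (g _)).
  by rewrite -[LHS]mul1r -{1}(Vmx ug) -mulrA -gd Vmx.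
move=> A; split=> [TA|[d d0 ->]].
  pose t : T := SigSub (mem_set TA).
  have [D eD] : exists D : nzd K r, val (f t) = dgm (sval D).
    have [uft dft] : @diag_group K r (val (f t)) by apply: set_mem; exact: (valP (f t)).
    have [D0 eD] := diag_mxP _ dft.
    have h : nz (fun l => D0 0 l).
      move: uft; rewrite eD unitmxE det_diag unitfE => /prodf_neq0 h l; exact: h.
    exists (exist _ _ h); rewrite eD /=; congr diag_mx; by apply/rowP => l; rewrite mxE.
  exists (sval D); first exact: (svalP D).
  rewrite -ggE /gg -[A]/(val t) -(fK t); congr (val (g _)); apply: val_inj.
  exact: eD.
by rewrite -(ggE (exist _ d d0)); apply: set_mem; exact: (valP (g _)).
Qed.

(** Commuting diagonalisable matrices have a common basis of eigenvectors, and in it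
    the idempotents have entries [0] and [1]: each index [i] belongs to exactly one
    of them, the one of weight [w i]. *)
Lemma codiag_family r (s : seq 'rV[int]_r) M x P0 a0 : idem_family s M ->
  P0 \in unitmx -> x = dc P0 a0 -> (forall mu, mu \in s -> x * M mu = M mu * x) ->
  exists P (w : 'I_n -> 'rV[int]_r) a, [/\ P \in unitmx, x = dc P a, forall i, w i \in s &
    forall f : 'rV[int]_r -> K, \sum_(mu <- s) f mu *: M mu = dc P (fun i => f (w i))].
Proof.
move=> [us M1 MM] uP0 xE xM.
have MMi mu : mu \in s -> M mu * M mu = M mu by move=> ms; rewrite MM // eqxx.
have [|P uP /allP dP] := (codiagonalizableP (x :: [seq M mu | mu <- s])).1.
  split.
    move=> A B; rewrite !inE => /orP [/eqP->|/mapP [mu ms ->]] /orP [/eqP->|/mapP [nu ns ->]];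
      rewrite /comm_mx !mulmxE ?xM // !MM // eq_sym; by case: eqP => // ->.
  move=> A; rewrite inE => /orP [/eqP->|/mapP [mu ms ->]].
    exists P0; rewrite // ; apply/diagonalizable_forP => // i j ij.
    by rewrite xE !mulmxE dcK // dgmE (_ : (i == j) = false) ?mulr0n //; apply/negbTE.
  case: (n) (M mu) (MMi mu ms) => [C _|n' C CC].
    by exists 1%:M; rewrite ?unitmx1 //; apply/diagonalizable_forP; rewrite ?unitmx1 // => [[]].
  apply/diagonalizableP; exists [:: 0; 1]; first by rewrite /= inE eq_sym oner_eq0.
  apply: mxminpoly_min; rewrite !big_cons big_nil mulr1 subr0 rmorphM /= rmorphB /= horner_mx_X.
  by rewrite horner_mx_C mulrBr -[1%:M]/(1 : 'M_n'.+1) mulr1 CC subrr.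
have dgo A : A \in x :: [seq M mu | mu <- s] -> exists e, A = dc P e.
  move=> /dP /= /(diagonalizable_forP _ uP) h; exists (fun i => (P *m A *m invmx P) i i).
  rewrite -{1}(conjK A uP) /dc; congr (_ * _ * _); apply/matrixP => i j.
  rewrite dgmE; case: eqP => [-> //|/eqP ij]; rewrite mulr0n -mulmxE; exact: h.
have [a xa] := dgo x (mem_head _ _).
have /choice [e he] : forall mu, exists e, mu \in s -> M mu = dc P e.
  move=> mu; case: (boolP (mu \in s)) => ms; last by exists (fun=> 0).
  have [|e he] := dgo (M mu); last by exists e.
  by rewrite inE map_f ?orbT.
have ee mu nu i : mu \in s -> nu \in s -> e mu i * e nu i = if mu == nu then e mu i else 0.
  move=> ms ns; have := MM mu nu ms ns; rewrite !he // dcM // => h.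
  have h' : dc P (fun i => e mu i * e nu i) = dc P (fun i => if mu == nu then e mu i else 0).
    by rewrite h; case: eqP => // _; rewrite dc0.
  exact: (dc_inj uP h').
have sumE (f : 'rV[int]_r -> K) :
    \sum_(mu <- s) f mu *: M mu = dc P (fun i => \sum_(mu <- s) f mu * e mu i).
  have hz t : (forall i, t i = 0) -> dc P t = 0 by move=> t0; rewrite -(dc0 P); apply: eq_dc.
  elim: (s) he => [|mu s' IH] he'; first by rewrite big_nil hz // => i; rewrite big_nil.
  rewrite big_cons IH => [|nu ns]; last by apply: he'; rewrite inE ns orbT.
  by rewrite he' ?mem_head // dcZ dcD; apply: eq_dc => i; rewrite big_cons.
have e1 i : \sum_(mu <- s) e mu i = 1.
  have := sumE (fun=> 1); under eq_bigr do rewrite scale1r.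
  rewrite M1 -(dc1 uP) => /(dc_inj uP) /(_ i) ->; apply: eq_bigr => mu _; by rewrite mul1r.
have /choice [w hw] : forall i, exists mu, mu \in s /\ e mu i != 0.
  move=> i; apply: contrapT => h; have /eqP := e1 i; rewrite big_seq big1 => [|mu ms].
    by rewrite eq_sym oner_eq0.
  by apply/eqP; apply: contrapT => /negP m0; apply: h; exists mu.
have ew i : e (w i) i = 1.
  have [ms m0] := hw i; apply: (mulfI m0); by rewrite ee // eqxx mulr1.
exists P, w, a; split=> // [i|f]; first by case: (hw i).
rewrite sumE; apply: eq_dc => i; have [ms m0] := hw i.
rewrite (big_rem (w i)) //= ew mulr1 big_seq big1 ?addr0 // => mu.
rewrite mem_rem_uniq // inE => /andP [mw ms']; suff -> : e mu i = 0 by rewrite mulr0.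
by rewrite -[LHS]mulr1 -(ew i) ee // (negPf mw).
Qed.

End TorusStructure.

(** * Monomial maps between tori *)

Section MonomialMaps.
Variables (K : closedFieldType).

(** The homomorphism of tori attached to an integer matrix. *)
Definition mono m p (A : 'M[int]_(m, p)) (c : 'I_p -> K) : 'I_m -> K :=
  fun i => mon (row i A) c.

Lemma expfz_sum (c : K) (I : Type) (s : seq I) (P : pred I) (F : I -> int) : c != 0 ->
  c ^ (\sum_(i <- s | P i) F i) = \prod_(i <- s | P i) c ^ F i.
Proof.
move=> c0; elim/big_rec2: _ => [|i a b _ <-]; first by rewrite expr0z.
by rewrite expfzDr.
Qed.

Lemma expfz_prodz (I : Type) (s : seq I) (P : pred I) (F : I -> K) (z : int) :
  (\prod_(i <- s | P i) F i) ^ z = \prod_(i <- s | P i) F i ^ z.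
Proof.
elim/big_rec2: _ => [|i a b _ <-]; first by rewrite exp1rz.
by rewrite expfzMl.
Qed.

Lemma nz_mono m p (A : 'M[int]_(m, p)) c : nz c -> nz (mono A c).
Proof. by move=> c0 i; apply: mon_neq0. Qed.

Lemma mono_mul m p q (A : 'M[int]_(m, p)) (B : 'M[int]_(p, q)) c : nz c ->
  mono A (mono B c) =1 mono (A *m B) c.
Proof.
move=> c0 i; rewrite /mono /mon.
under [RHS]eq_bigr do rewrite mxE mxE expfz_sum //.
rewrite exchange_big; apply: eq_bigr => k _; rewrite expfz_prodz; apply: eq_bigr => l _.
by rewrite !mxE exprz_exp mulrC.
Qed.

Lemma eq_mon p (mu : 'rV[int]_p) (c c' : 'I_p -> K) : c =1 c' -> mon mu c = mon mu c'.
Proof. by move=> cc; apply: eq_bigr => l _; rewrite cc. Qed.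

Lemma eq_mono m p (A : 'M[int]_(m, p)) c c' : c =1 c' -> mono A c =1 mono A c'.
Proof. by move=> cc i; apply: eq_mon. Qed.

Lemma mono1 m (c : 'I_m -> K) : mono 1%:M c =1 c.
Proof.
move=> i; rewrite /mono /mon (bigD1 i) //= big1 ?mulr1 => [|k ki].
  by rewrite !mxE eqxx expr1z.
by rewrite !mxE eq_sym (negPf ki) expr0z.
Qed.

Lemma mono_Mr m p (A : 'M[int]_(m, p)) c c' :
  mono A (fun i => c i * c' i) =1 (fun i => mono A c i * mono A c' i).
Proof. by move=> i; apply: monMd. Qed.

Lemma mono_Vr m p (A : 'M[int]_(m, p)) c : nz c ->
  mono A (fun i => (c i)^-1) =1 (fun i => (mono A c i)^-1).
Proof.
move=> c0 i; apply: (mulfI (nz_mono A c0 i)); rewrite divff; last exact: nz_mono.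
rewrite -[LHS](mono_Mr A c (fun i => (c i)^-1) i) -[RHS](mon1 K (row i A)).
by apply: eq_mon => l; rewrite divff.
Qed.

Lemma zroot (e : K) (z : int) : z != 0 -> e != 0 -> exists2 x, x != 0 & x ^ z = e.
Proof.
have nroot (k : nat) (a : K) : a != 0 -> exists2 x, x != 0 & x ^+ k.+1 = a.
  move=> a0; have [x hx] := solve_monicpoly (fun i => if i == 0%N then a else 0) (ltn0Sn k).
  have xa : x ^+ k.+1 = a.
    by rewrite hx big_ord_recl /= expr0 mulr1 big1 ?addr0 // => i _; rewrite mul0r.
  exists x => //; apply: contraNneq a0 => x0; by rewrite -xa x0 expr0n.
case: z => [[|k]|k] // _ e0; first exact: (nroot k e e0).
have [x x0 xe] := nroot k e^-1 (invr_neq0 e0).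
by exists x => //; rewrite NegzE -exprnN xe invrK.
Qed.

(** The character [mu] of the diagonal entries, extended to a regular function by
    taking negative exponents in the inverse matrix. *)
Definition zmon m (mu : 'rV[int]_m) (A : 'M[K]_m) : K :=
  \prod_k (match mu 0 k with Posz z => A k k ^+ z | Negz z => invmx A k k ^+ z.+1 end).

Lemma regf_zmon m (mu : 'rV[int]_m) : regf (zmon mu).
Proof.
have RA := regf_alg K m; apply: (fun_alg_prod RA) => k _.
by case: (mu 0 k) => z; apply: (fun_algX RA); [exact: regf_entries | exact: regf_entries_inv].
Qed.

Lemma dgm_unit m (c : 'I_m -> K) : nz c -> dgm c \in unitmx.
Proof.
move=> c0; rewrite unitmxE det_diag unitfE; apply/prodf_neq0 => l _; rewrite mxE; exact: c0.
Qed.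

Lemma dgm_inv m (c : 'I_m -> K) : nz c -> invmx (dgm c) = dgm (fun i => (c i)^-1).
Proof.
move=> c0; have h : dgm c * dgm (fun i => (c i)^-1) = 1.
  by rewrite dgmM -dgm1; apply: eq_dgm => i; rewrite divff.
by rewrite -[LHS]mulr1 -h mulrA Vmx ?mul1r // dgm_unit.
Qed.

Lemma zmonE m (mu : 'rV[int]_m) (c : 'I_m -> K) : nz c -> zmon mu (dgm c) = mon mu c.
Proof.
move=> c0; apply: eq_bigr => k _; rewrite dgm_inv // !dgmE eqxx !mulr1n.
by case: (mu 0 k) => z //; rewrite NegzE -exprnN exprVn.
Qed.

End MonomialMaps.

Section MonomialTorus.
Variables (K : closedFieldType) (n m : nat).
Variables (P : 'M[K]_n) (uP : P \in unitmx) (W : 'M[int]_(n, m)).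

Definition montorus : set 'M[K]_n := [set A | exists2 c, nz c & A = dc P (mono W c)].

Variables (L Li : 'M[int]_n) (R Ri : 'M[int]_m) (d : seq int).
Hypotheses (LiL : Li *m L = 1%:M) (LLi : L *m Li = 1%:M) (RRi : R *m Ri = 1%:M).
Let D : 'M[int]_(n, m) := \matrix_(i, j) (d`_i *+ (i == j :> nat)).
Hypothesis WE : W = L *m D *m R.

Let I := [set i : 'I_n | (i < m)%N && (d`_i != 0)]%SET.

(** In the coordinates changed by [L], the image is that of a diagonal integer matrix.
    As [K] has roots of every order, it is given by making the coordinates outside
    the support [I] equal to [1]. *)
Lemma montorusP A : montorus A <->
  exists2 c, nz c & A = dc P c /\ forall i, i \notin I -> mono Li c i = 1.
Proof.
split=> [[c c0 ->]|[c c0 [-> hc]]].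
  exists (mono W c); first exact: nz_mono.
  split=> // i iI; rewrite mono_mul // WE -mulmxA mulmxA LiL mul1mx -mono_mul //.
  rewrite /mono /mon big1 // => j _; rewrite !mxE.
  case: eqP => [ij|]; rewrite ?mulr0n ?expr0z // mulr1n.
  by move: iI; rewrite inE ij ltn_ord /= => /negPn /eqP ->; rewrite expr0z.
have /choice [e he] : forall j : 'I_m, exists e : K, e != 0 /\
    forall i, i \in I -> i = j :> nat -> e ^ d`_i = mono Li c i.
  move=> j; case: (pselect (exists2 i, i \in I & i = j :> nat)) => [[i iI ij]|h].
    have [e e0 ee] : exists2 e, e != 0 & e ^ d`_i = mono Li c i.
      by apply: zroot; [move: iI; rewrite inE => /andP [] | exact: nz_mono].
    exists e; split=> // i' _ i'j; have -> : i' = i by apply: val_inj; rewrite /= i'j.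
    by [].
  exists 1; split; first exact: oner_neq0.
  by move=> i iI ij; case: h; exists i.
have e0 : nz e by move=> j; case: (he j).
exists (mono Ri e); first exact: nz_mono.
apply: eq_dc => i; rewrite mono_mul // WE -!mulmxA RRi mulmx1 -mono_mul //.
rewrite -[LHS]mono1 -LLi -mono_mul //; apply: eq_mono => {}i.
case: (boolP (i \in I)) => iI.
  have im : (i < m)%N by move: iI; rewrite inE => /andP [].
  rewrite -[LHS](proj2 (he (Ordinal im)) i iI erefl) /mono /mon (bigD1 (Ordinal im)) //=.
  rewrite big1 ?mulr1 => [|k /eqP ki]; first by rewrite !mxE eqxx mulr1n.
  rewrite !mxE; case: eqP => [e'|]; rewrite ?mulr0n ?expr0z //.
  by case: ki; apply: val_inj.
rewrite hc // /mono /mon big1 // => j _; rewrite !mxE.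
case: eqP => [ij|]; rewrite ?mulr0n ?expr0z // mulr1n.
by move: iI; rewrite inE ij ltn_ord /= => /negPn /eqP ->; rewrite expr0z.
Qed.

Lemma montorus_subgroup : subgroup_GL montorus.
Proof.
split.
- by move=> _ [c c0 ->]; apply: dc_unit => // i; apply: nz_mono.
- exists (fun=> 1); first by move=> i; exact: oner_neq0.
  by rewrite -[LHS](dc1 uP); apply: eq_dc => i; rewrite /mono mon1.
- move=> _ _ [c c0 ->] [c' c'0 ->]; exists (fun i => c i * c' i); first by move=> i; rewrite mulf_neq0.
  by rewrite mulmxE dcM //; apply: eq_dc => i; rewrite mono_Mr.
- move=> _ [c c0 ->]; exists (fun i => (c i)^-1); first by move=> i; rewrite invr_neq0.
  rewrite dcV //; last exact: nz_mono.
  by apply: eq_dc => i; rewrite mono_Vr.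
Qed.

Lemma diag_coord p (B : 'M[K]_p) : B \in unitmx -> (forall i j, i != j -> B i j = 0) ->
  exists2 c, nz c & B = dgm c.
Proof.
move=> uB hB; have BE : B = dgm (fun i => B i i).
  apply/matrixP => i j; rewrite dgmE; case: eqP => [-> //|/eqP ij]; rewrite mulr0n; exact: hB.
exists (fun i => B i i); rewrite // => l.
by move: uB; rewrite {1}BE unitmxE det_diag unitfE => /prodf_neq0 /(_ l isT); rewrite mxE.
Qed.

Lemma dg_coord A : A \in unitmx -> (forall i j, i != j -> (P *m A *m invmx P) i j = 0) ->
  exists2 c, nz c & A = dc P c.
Proof.
move=> uA h; have [|c c0 e] := diag_coord _ h; first by rewrite !unitmx_mul uP uA unitmx_inv uP.
by exists c; rewrite // /dc -e !mulmxE conjK.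
Qed.

Lemma regf_conjP (F : 'M[K]_n -> K) : regf F -> regf (fun A => F (P *m A *m invmx P)).
Proof. by apply: regf_mul => //; rewrite unitmx_inv. Qed.

Lemma montorus_closed : zariski_closed montorus.
Proof.
have RA := regf_alg K n.
pose F (k : 'I_n * 'I_n + 'I_n) (A : 'M[K]_n) : K := match k with
  | inl ij => if ij.1 == ij.2 then 0 else (P *m A *m invmx P) ij.1 ij.2
  | inr i => if i \in I then 0 else zmon (row i Li) (P *m A *m invmx P) - 1 end.
have RF k : regf (F k).
  case: k => [[i j]|i]; rewrite /F /=.
    case: (eqVneq i j) => _; first exact: (fun_algC RA).
    exact: (regf_conjP (@regf_entries K n i j)).
  case: (boolP (i \in I)) => _; first exact: (fun_algC RA).
  apply: (fun_algB RA); last exact: (fun_algC RA).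
  exact: (regf_conjP (@regf_zmon K n _)).
have -> : montorus = [set A | A \in unitmx /\ forall k, F k A = 0]; last exact: zc_fam.
apply/seteqP; split=> A.
  move=> /montorusP [c c0 [-> hc]]; split; first by apply: dc_unit.
  have e : P *m dc P c *m invmx P = dgm c by rewrite !mulmxE dcK.
  case=> [[i j]|i] /=; rewrite e; case: ifP => // /negbT ij; first by rewrite dgmE (negPf ij).
  by rewrite zmonE // [X in X - 1](hc i ij) subrr.
move=> [uA hA]; have [|c c0 Ac] := dg_coord uA.
  by move=> i j ij; have := hA (inl (i, j)); rewrite /= (negPf ij).
apply/montorusP; exists c => //; split=> // i iI; have := hA (inr i).
rewrite /= (negPf iI) Ac !mulmxE dcK // zmonE // => /eqP.
by rewrite subr_eq0 => /eqP.
Qed.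

Let r := #|I|.
Let E : 'M[int]_(n, r) := \matrix_(i, k) (enum_val k == i)%:R.

Lemma EtE : E^T *m E = 1%:M.
Proof.
apply/matrixP => k l; rewrite !mxE (bigD1 (enum_val k)) //= big1 => [|i ik].
  by rewrite !mxE eqxx mul1r addr0 (inj_eq enum_val_inj) eq_sym.
by rewrite !mxE eq_sym (negPf ik) mul0r.
Qed.

Lemma EEt (c : 'I_n -> K) : nz c -> (forall i, i \notin I -> c i = 1) -> mono (E *m E^T) c =1 c.
Proof.
move=> c0 hc i; rewrite -mono_mul // /mono /mon.
case: (boolP (i \in I)) => iI; last first.
  rewrite hc // big1 // => k _; rewrite !mxE; case: eqP => [ki|]; last by rewrite expr0z.
  by move: iI; rewrite -ki enum_valP.
rewrite (bigD1 (enum_rank_in iI i)) //= [X in _ * X]big1 ?mulr1 => [|k ki].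
  rewrite !mxE enum_rankK_in // eqxx expr1z (bigD1 i) //= big1 ?mulr1 => [|j ji].
    by rewrite !mxE enum_rankK_in // eqxx expr1z.
  by rewrite !mxE enum_rankK_in // eq_sym (negPf ji) expr0z.
rewrite !mxE; case: eqP => [e|]; rewrite ?expr0z //.
by case/eqP: ki; apply: enum_val_inj; rewrite enum_rankK_in.
Qed.

Lemma montorus_torus : is_torus montorus.
Proof.
split; first by split; [exact: montorus_subgroup | exact: montorus_closed].
pose ff (A : 'M[K]_n) : 'M[K]_r := dgm (fun k => zmon (row k (E^T *m Li)) (P *m A *m invmx P)).
pose gg (A : 'M[K]_r) : 'M[K]_n := dc P (fun i => zmon (row i (L *m E)) A).
have ffE c : nz c -> ff (dc P c) = dgm (mono (E^T *m Li) c).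
  by move=> c0; apply: eq_dgm => k; rewrite !mulmxE dcK // zmonE.
have ggE c : nz c -> gg (dgm c) = dc P (mono (L *m E) c).
  by move=> c0; apply: eq_dc => k; rewrite zmonE.
have fP (A : montorus) : diag_group (ff (val A)).
  have [c c0 [-> _]] := (montorusP (val A)).1 (set_mem (valP A)).
  rewrite ffE //; split; last exact: diag_mx_is_diag.
  by apply: dgm_unit; apply: nz_mono.
have dP (A : @diag_group K r) : exists2 c, nz c & val A = dgm c.
  have [uA dA] : diag_group (val A) := set_mem (valP A).
  have [D0 eD] := diag_mxP _ dA; rewrite eD; exists (fun l => D0 0 l); last first.
    by congr diag_mx; apply/rowP => l; rewrite mxE.
  by move: uA; rewrite eD unitmxE det_diag unitfE => /prodf_neq0 h l; exact: h.
have E1 i : i \notin I -> row i E = 0.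
  move=> iI; apply/rowP => k; rewrite !mxE; case: eqP => // e.
  by move: iI; rewrite -e enum_valP.
have gP (A : @diag_group K r) : montorus (gg (val A)).
  have [c c0 ->] := dP A; rewrite ggE //; apply/montorusP; exists (mono (L *m E) c); first exact: nz_mono.
  split=> // i iI; rewrite mono_mul // mulmxA LiL mul1mx /mono E1 //; exact: mon0.
pose f (A : montorus) : @diag_group K r := SigSub (mem_set (fP A)).
pose g (A : @diag_group K r) : montorus := SigSub (mem_set (gP A)).
exists r, f, g; split.
- split.
    have h i j : regf (fun A => ff A i j).
      apply: (regf_ext (f := fun A => (i == j)%:R * zmon (row j (E^T *m Li)) (P *m A *m invmx P))).
        by move=> A _; rewrite dgmE mulr_natl.
      apply: (fun_algM (regf_alg K n)); first exact: (fun_algC (regf_alg K n)).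
      exact: (regf_conjP (@regf_zmon K n (row j (E^T *m Li)))).
    move=> i j; have [p [k hp]] := h i j; exists p, k => A; apply: hp.
    by have [u _ _ _] := montorus_subgroup; apply: u; exact: (set_mem (valP A)).
  move=> x y z /= e; have [c c0 [ex _]] := (montorusP (val x)).1 (set_mem (valP x)).
  have [c' c'0 [ey _]] := (montorusP (val y)).1 (set_mem (valP y)).
  rewrite e ex ey !mulmxE dcM // !ffE // ?dgmM; last by move=> i; rewrite mulf_neq0.
  by apply: eq_dgm => i; rewrite mono_Mr.
- split.
    have h i j : regf (fun A => gg A i j).
      have RA := regf_alg K r; apply: (entriesM RA); last exact: (entriesC RA).
      apply: (entriesM RA); first exact: (entriesC RA).
      move=> k l; apply: (regf_ext (f := fun A => (k == l)%:R * zmon (row l (L *m E)) A)).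
        by move=> A _; rewrite dgmE mulr_natl.
      by apply: (fun_algM RA); [exact: (fun_algC RA) | exact: regf_zmon].
    move=> i j; have [p [k hp]] := h i j; exists p, k => A; apply: hp.
    by have [c c0 ->] := dP A; apply: dgm_unit.
  move=> x y z /= e; have [c c0 ex] := dP x; have [c' c'0 ey] := dP y.
  rewrite e ex ey !mulmxE dgmM !ggE // ?dcM //; last by move=> i; rewrite mulf_neq0.
  by apply: eq_dc => i; rewrite mono_Mr.
- move=> A; apply: val_inj; rewrite /= /g /f /=.
  have [c c0 [-> hc]] := (montorusP (val A)).1 (set_mem (valP A)).
  rewrite ffE // ggE; last exact: nz_mono.
  apply: eq_dc => i; rewrite mono_mul // -mulmxA [E *m _]mulmxA -mono_mul //.
  rewrite -[RHS]mono1 -LLi -mono_mul //; apply: eq_mono => {}i.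
  by rewrite -mono_mul // EEt //; exact: nz_mono.
- move=> A; apply: val_inj; rewrite /=; have [c c0 ->] := dP A.
  rewrite ggE // ffE; last exact: nz_mono.
  apply: eq_dgm => i; rewrite mono_mul // -mulmxA [Li *m _]mulmxA LiL mul1mx EtE.
  exact: mono1.
Qed.

End MonomialTorus.

(** The Smith normal form reduces monomial maps to diagonal ones. *)
Lemma is_torus_mono (K : closedFieldType) (n m : nat) (P : 'M[K]_n)
  (W : 'M[int]_(n, m)) : P \in unitmx -> is_torus (montorus P W).
Proof.
move=> uP; have [L uL [R uR [d _ WE]]] := int_Smith_normal_form W.
apply: (montorus_torus uP (mulVmx uL) (mulmxV uL) (mulmxV uR) WE).
Qed.

(** * Consequences of the maximality of a torus *)

Section MaxTorus.
Variables (K : closedFieldType) (charK0 : [pchar K] =i pred0).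

Lemma pow2_inj (z : int) : (2%:R : K) ^ z = 1 -> z = 0.
Proof.
have h k : (2%:R : K) ^+ k.+1 <> 1.
  rewrite -natrX -[1]/(1%:R) => /(nat_inj charK0) e.
  by have := expn_gt0 2 k; move: e; rewrite expnS; lia.
case: z => [[|k]|k] //; first by move/h.
by rewrite NegzE -exprnN => /(congr1 GRing.inv); rewrite invrK invr1 => /h.
Qed.

(** The differential of the character [mu], at the tangent vector [b] of the torus. *)
Definition ev r (b : 'I_r -> K) (mu : 'rV[int]_r) : K := \sum_l (mu 0 l)%:~R * b l.

Lemma evD r (b : 'I_r -> K) mu nu : ev b (mu + nu) = ev b mu + ev b nu.
Proof. by rewrite /ev -big_split; apply: eq_bigr => l _; rewrite mxE rmorphD mulrDl. Qed.

Lemma evN r (b : 'I_r -> K) mu : ev b (- mu) = - ev b mu.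
Proof. by rewrite /ev -sumrN; apply: eq_bigr => l _; rewrite mxE rmorphN mulNr. Qed.

Lemma ev0 r (b : 'I_r -> K) : ev b 0 = 0.
Proof. by rewrite /ev big1 // => l _; rewrite mxE mul0r. Qed.

(** Otherwise a column of the cokernel of the matrix of [w] would not annihilate [N].
    Writing its entries with integral coefficients in an independent family turns it
    into integral relations between the [w i], which do annihilate [N]. *)
Lemma solve_relations n r (w : 'I_n -> 'rV[int]_r) (N : 'I_n -> int) :
  (forall k : 'I_n -> int, \sum_i k i *: w i = 0 -> \sum_i k i * N i = 0) ->
  exists b : 'I_r -> K, forall i, (N i)%:~R = ev b (w i).
Proof.
move=> h; pose A : 'rV[K]_n := \row_i (N i)%:~R.
pose B : 'M[K]_(r, n) := \matrix_(l, i) (w i 0 l)%:~R.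
have : (A <= B)%MS.
  rewrite submxE; apply/eqP/rowP => q; rewrite !mxE.
  have [r' [Z [b [hZ ib]]]] := Zbasis (fun i => cokermx B i q) charK0.
  have rel j : \sum_i Z i j *: w i = 0.
    apply/rowP => l; rewrite summxE mxE.
    apply: (ib (fun j => \sum_i (Z i j *: w i) 0 l)).
    have : (B *m cokermx B) l q = 0 by rewrite mulmx_coker mxE.
    rewrite mxE => e; rewrite -[RHS]e.
    under [RHS]eq_bigr do rewrite hZ mxE mulr_sumr.
    rewrite exchange_big; apply: eq_bigr => j' _; rewrite rmorph_sum mulr_suml.
    by apply: eq_bigr => i _; rewrite mxE /= rmorphM /= mulrA [X in X * _]mulrC.
  under eq_bigr do rewrite mxE hZ mulr_sumr.
  rewrite exchange_big big1 //= => j _.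
  have := congr1 (fun z : int => z%:~R * b j : K) (h _ (rel j)).
  rewrite /= mul0r rmorph_sum mulr_suml => e; rewrite -[RHS]e.
  by apply: eq_bigr => i _; rewrite rmorphM /= mulrA [X in X * _]mulrC.
move=> /submxP [D eD]; exists (fun l => D 0 l) => i.
have := congr1 (fun C : 'rV_n => C 0 i) eD; rewrite /= !mxE => ->.
by apply: eq_bigr => l _; rewrite mxE mulrC.
Qed.

Variables (n : nat) (G T : set 'M[K]_n).
Hypotheses (sim : almost_simple G) (maxT : maximal_torus G T).

(** The one-parameter tori of an element [y] centralizing [T] generate with [T] a
    torus, which is [T] by maximality.  Hence their exponents satisfy the integral
    relations between the weights of [T], and the semisimple part of [y] is tangent
    to [T]. *)
Lemma torus_coords : exists r (P : 'M[K]_n) (w : 'I_n -> 'rV[int]_r),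
  [/\ P \in unitmx,
      forall A, T A <-> exists2 d, nz d & A = dc P (fun i => mon (w i) d) &
      forall y, Lie G y -> (forall t, T t -> t * y = y * t) ->
        exists b v, nilp v /\ y = dc P (fun i => ev b (w i)) + v].
Proof.
have [[sG zG] _ _ _] := sim; have [TG torT Tmax] := maxT.
have [r [s [M [Mid hT]]]] := torus_expansion charK0 torT; have [us _ _] := Mid.
have [|P [w [_ [uP _ ws FE]]]] := codiag_family (P0 := 1) (x := 0) (a0 := fun=> 0) Mid (unitmx1 _ _) (esym (dc0 1)).
  by move=> mu _; rewrite mul0r mulr0.
exists r, P, w; split=> //.
  by move=> A; split=> [/hT [d d0 ->]|[d d0 ->]]; [exists d | apply/hT; exists d]; rewrite ?FE.
move=> y Ly cy.
have [P' [a [v [r' [N [b [uP' yE nv cs [aN ib hc]]]]]]]] := jordan_Lie charK0 sG zG Ly.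
pose x := dc P' a.
have Lx : Lie G x.
  have -> : x = \sum_j b j *: dc P' (fun i => (N i j)%:~R).
    under eq_bigr do rewrite dcZ //.
    by rewrite dc_sum //; apply: eq_dc => i; rewrite aN; apply: eq_bigr => j _; rewrite mulrC.
  by apply: Lie_comb => j _; apply: (cochar_Lie charK0) => // c c0; apply: hc.
have xM mu : mu \in s -> x * M mu = M mu * x.
  move=> ms; apply/eqP; rewrite -subr_eq0; apply/eqP.
  apply: (mon_indep_mx charK0 (c := fun mu => x * M mu - M mu * x) us) ms => d d0.
  have e1 : \sum_(mu <- s) mon mu d *: (x * M mu) = x * \sum_(mu <- s) mon mu d *: M mu.
    by rewrite mulr_sumr; apply: eq_bigr => nu _; rewrite sclMr.
  have e2 : \sum_(mu <- s) mon mu d *: (M mu * x) = (\sum_(mu <- s) mon mu d *: M mu) * x.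
    by rewrite mulr_suml; apply: eq_bigr => nu _; rewrite sclMl.
  under eq_bigr do rewrite scalerBr.
  rewrite sumrB e1 e2; apply/eqP; rewrite subr_eq0 eq_sym; apply/eqP.
  by apply: cs; apply: cy; apply/hT; exists d.
have [P1 [w1 [a1 [uP1 xE ws1 FE1]]]] := codiag_family Mid uP' (erefl x) xM.
have [r1 [N1 [b1 [aN1 ib1]]]] := Zbasis a1 charK0.
have x1 : x = dc P1 (fun i => \sum_j (N1 i j)%:~R * b1 j).
  by rewrite xE; apply: eq_dc => i; rewrite aN1.
have GN j c : c != 0 -> G (dc P1 (fun i => c ^ N1 i j)).
  move=> c0; apply: (cochar_mem charK0 j (v := 0) uP1 sG zG ib1 _ _ _ c0).
  - exact: nilp0.
  - by rewrite mul0r mulr0.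
  - by rewrite addr0 -x1.
have T1 d : nz d -> T (dc P1 (fun i => mon (w1 i) d)).
  by move=> d0; apply/hT; exists d; rewrite ?FE1.
(* the parameters of [T] followed by those of the one-parameter tori of [x] *)
pose W : 'M[int]_(n, r + r1) := row_mx (\matrix_(i, l) w1 i 0 l) (\matrix_(i, j) N1 i j).
have WE c : nz c -> dc P1 (mono W c) = dc P1 (fun i => mon (w1 i) (fun l => c (lshift r1 l))) *
    dc P1 (fun i => \prod_j c (rshift r j) ^ N1 i j).
  move=> c0; rewrite dcM //; apply: eq_dc => i; rewrite /mono /mon big_split_ord; congr (_ * _).
    by apply: eq_bigr => l _; rewrite mxE row_mxEl mxE.
  by apply: eq_bigr => l _; rewrite mxE row_mxEr mxE.
have [uG G1 GM GV] := sG.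
have HG : montorus P1 W `<=` G.
  move=> _ [c c0 ->]; rewrite WE //; apply: (GM _ _).
    by apply: TG; apply: T1 => l; apply: c0.
  elim: (index_enum _) => [|j s' IH].
    have -> // : dc P1 (fun i => \prod_(j <- [::]) c (rshift r j) ^ N1 i j) = 1%:M.
    by rewrite -[RHS](dc1 uP1); apply: eq_dc => i; rewrite big_nil.
  have -> : dc P1 (fun i => \prod_(k <- j :: s') c (rshift r k) ^ N1 i k) =
      dc P1 (fun i => c (rshift r j) ^ N1 i j) *m dc P1 (fun i => \prod_(k <- s') c (rshift r k) ^ N1 i k).
    by rewrite mulmxE dcM //; apply: eq_dc => i; rewrite big_cons.
  exact: (GM _ _ (GN _ _ (c0 _)) IH).
have sl l : fintype.split (lshift r1 l) = inl l := unsplitK (inl l).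
have sr j : fintype.split (rshift r j) = inr j := unsplitK (inr j).
have TH : T `<=` montorus P1 W.
  move=> A /hT [d d0 ->]; exists (fun k => match fintype.split k with inl l => d l | inr _ => 1 end).
    by move=> k; case: (fintype.split k) => // _; apply: oner_neq0.
  rewrite WE; last by move=> k; case: (fintype.split k) => // _; apply: oner_neq0.
  rewrite (FE1 (fun mu => mon mu d)) dcM //; apply: eq_dc => i.
  rewrite [X in _ = _ * X]big1 ?mulr1 => [|j _].
    by apply: eq_mon => l; rewrite sl.
  by rewrite sr exp1rz.
have HT := Tmax _ HG (is_torus_mono W uP1) TH.
have solve j : exists beta : 'I_r -> K, forall i, (N1 i j)%:~R = ev beta (w1 i).
  apply: solve_relations => k kw.
  (* the [j]-th new parameter is set to [2], which is not a root of unity *)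
  pose c (q : 'I_(r + r1)) : K := match fintype.split q with inl _ => 1 | inr j' => if j' == j then 2%:R else 1 end.
  have c0 : nz c.
    move=> q; rewrite /c; case: (fintype.split q) => [_|j']; first exact: oner_neq0.
    by case: (j' == j); [exact: (two_neq0 charK0) | exact: oner_neq0].
  have : montorus P1 W (dc P1 (mono W c)) by exists c.
  rewrite HT => /hT [d d0]; rewrite (FE1 (fun mu => mon mu d)) WE // dcM // => /(dc_inj uP1) e.
  have e' i : (2%:R : K) ^ N1 i j = mon (w1 i) d.
    rewrite -e /mon big1 ?mul1r => [|l _].
      rewrite (bigD1 j) //= big1 ?mulr1 => [|j' jj]; rewrite /c sr ?eqxx //.
      by rewrite (negPf jj) exp1rz.
    by rewrite /c sl exp1rz.
  apply: pow2_inj; rewrite expfz_sum ?(two_neq0 charK0) //.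
  have -> : \prod_i (2%:R : K) ^ (k i * N1 i j) = \prod_i mon (k i *: w1 i) d.
    apply: eq_bigr => i _; rewrite mulrC -exprz_exp e' /mon expfz_prodz.
    by apply: eq_bigr => l _; rewrite mxE exprz_exp mulrC.
  have e2 : mon (\sum_i k i *: w1 i) d = \prod_i mon (k i *: w1 i) d.
    by elim/big_rec2: _ => [|i u z _ <-]; rewrite ?mon0 // monD.
  by rewrite -e2 kw mon0.
have {solve} /choice [beta hbeta] := solve.
exists (fun l => \sum_j beta j l * b1 j), v; split=> //; rewrite yE; congr (_ + _).
rewrite -/x x1 -(FE (ev _)) FE1; apply: eq_dc => i; rewrite /ev.
under eq_bigr do rewrite hbeta /ev mulr_suml.
rewrite exchange_big; apply: eq_bigr => l _; rewrite mulr_sumr; apply: eq_bigr => j _.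
by rewrite mulrA.
Qed.

End MaxTorus.

Section Entries.
Variables (K : pzRingType) (m p : nat).
Implicit Types (A B : 'M[K]_(m, p)).
Lemma mxeD A B i j : (A + B) i j = A i j + B i j. Proof. exact: mxE. Qed.
Lemma mxeB A B i j : (A - B) i j = A i j - B i j. Proof. by rewrite !mxE. Qed.
Lemma mxeZ c A i j : (c *: A) i j = c * A i j. Proof. exact: mxE. Qed.
Lemma mxe0 i j : (0 : 'M[K]_(m, p)) i j = 0. Proof. exact: mxE. Qed.
End Entries.

(** * Weight decomposition of matrices *)

Section Weights.
Variables (K : closedFieldType) (charK0 : [pchar K] =i pred0) (n r : nat).
Variables (P : 'M[K]_n) (uP : P \in unitmx) (w : 'I_n -> 'rV[int]_r).
Implicit Types (x y z v : 'M[K]_n) (mu nu : 'rV[int]_r).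

(** The coordinates in which [T] is diagonal, and back. *)
Definition co z : 'M[K]_n := P * z * invmx P.
Definition uco z : 'M[K]_n := invmx P * z * P.

Lemma coK z : uco (co z) = z. Proof. exact: conjK. Qed.
Lemma ucoK z : co (uco z) = z. Proof. exact: conjVK. Qed.
Lemma co_inj y z : co y = co z -> y = z.
Proof. by move=> e; rewrite -(coK y) e coK. Qed.
Lemma coM y z : co (y * z) = co y * co z.
Proof. by rewrite /co !mulrA; congr (_ * _ * _); rewrite -mulrA Vmx // mulr1. Qed.
Lemma coD y z : co (y + z) = co y + co z.
Proof. by rewrite /co mulrDr mulrDl. Qed.
Lemma coB y z : co (y - z) = co y - co z.
Proof. by rewrite /co mulrBr mulrBl. Qed.
Lemma coZ c z : co (c *: z) = c *: co z.
Proof. by rewrite /co sclMr sclMl. Qed.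
Lemma co0 : co 0 = 0. Proof. by rewrite /co mulr0 mul0r. Qed.
Lemma co_sum (I : Type) (s : seq I) (Q : pred I) F :
  co (\sum_(i <- s | Q i) F i) = \sum_(i <- s | Q i) co (F i).
Proof. by rewrite /co mulr_sumr mulr_suml. Qed.

(** The weight projection: under conjugation by [T], the entry [(i, j)] has weight
    [w i - w j]. *)
Definition wpr mu z : 'M[K]_n :=
  uco (\matrix_(i, j) if w i - w j == mu then co z i j else 0).

Lemma co_wpr mu z i j : co (wpr mu z) i j = if w i - w j == mu then co z i j else 0.
Proof. by rewrite /wpr ucoK mxE. Qed.

Definition wts : seq 'rV[int]_r := undup [seq w k.1 - w k.2 | k : 'I_n * 'I_n].

Lemma mem_wts i j : w i - w j \in wts.
Proof. by rewrite mem_undup; apply/mapP; exists (i, j); rewrite ?mem_enum. Qed.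

Lemma wts_uniq : uniq wts. Proof. exact: undup_uniq. Qed.

Lemma wts_sum_entry (f : 'rV[int]_r -> K) z i j :
  \sum_(mu <- wts) f mu * co (wpr mu z) i j = f (w i - w j) * co z i j.
Proof.
rewrite (bigD1_seq (w i - w j)) ?mem_wts ?wts_uniq //= big1 ?addr0 ?co_wpr ?eqxx // => mu.
by rewrite co_wpr eq_sym => /negPf ->; rewrite mulr0.
Qed.

Lemma co_wts_sum (f : 'rV[int]_r -> K) z i j :
  co (\sum_(mu <- wts) f mu *: wpr mu z) i j = f (w i - w j) * co z i j.
Proof.
rewrite -wts_sum_entry co_sum summxE; apply: eq_bigr => mu _; by rewrite coZ mxE.
Qed.

Lemma wpr_sum z : \sum_(mu <- wts) wpr mu z = z.
Proof.
apply: co_inj; apply/matrixP => i j; rewrite -[RHS]mul1r -[RHS](co_wts_sum (fun=> 1)).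
by congr (co _ i j); apply: eq_bigr => mu _; rewrite scale1r.
Qed.

Lemma wprD mu y z : wpr mu (y + z) = wpr mu y + wpr mu z.
Proof.
apply: co_inj; apply/matrixP => i j; rewrite coD mxeD !co_wpr coD mxeD.
by case: eqP; rewrite ?addr0.
Qed.

Lemma wprZ mu c z : wpr mu (c *: z) = c *: wpr mu z.
Proof.
apply: co_inj; apply/matrixP => i j; rewrite coZ mxeZ !co_wpr coZ mxeZ.
by case: eqP; rewrite ?mulr0.
Qed.

Lemma wpr0 mu : wpr mu 0 = 0.
Proof. by rewrite -[in LHS](scale0r (0 : 'M[K]_n)) wprZ scale0r. Qed.

Lemma wpr_bigsum mu (I : Type) (s : seq I) (Q : pred I) F :
  wpr mu (\sum_(i <- s | Q i) F i) = \sum_(i <- s | Q i) wpr mu (F i).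
Proof. by elim/big_rec2: _ => [|i a b _ <-]; rewrite ?wpr0 ?wprD. Qed.

Lemma wpr_wpr mu nu z : wpr mu (wpr nu z) = if mu == nu then wpr nu z else 0.
Proof.
apply: co_inj; apply/matrixP => i j; rewrite !co_wpr.
case: (eqVneq mu nu) => [->|mn]; rewrite ?co_wpr ?co0 ?mxe0; first by case: eqP.
by case: (eqVneq (w i - w j) mu) => // ->; rewrite (negPf mn).
Qed.

Definition wt mu z := wpr mu z = z.

Lemma wtP mu z : wt mu z <-> forall i j, co z i j != 0 -> w i - w j = mu.
Proof.
split=> [e i j|h]; first by rewrite -e co_wpr; case: (eqVneq (w i - w j) mu) => [//|_]; rewrite eqxx.
apply: co_inj; apply/matrixP => i j; rewrite co_wpr; case: eqP => // ne.
by apply/eqP; rewrite eq_sym; apply: contraT => /h/ne.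
Qed.

Lemma wt_wpr mu z : wt mu (wpr mu z).
Proof. by rewrite /wt wpr_wpr eqxx. Qed.

Lemma wt_neq mu nu z : wt mu z -> mu != nu -> wpr nu z = 0.
Proof. by move=> <- mn; rewrite wpr_wpr eq_sym (negPf mn). Qed.

Lemma wt_subsp mu : subsp (wt mu : 'M[K]_n -> Prop).
Proof.
by split=> [|c u v hu hv]; rewrite /wt ?wpr0 // wprD wprZ hu hv.
Qed.

Lemma wtM mu nu x y : wt mu x -> wt nu y -> wt (mu + nu) (x * y).
Proof.
move=> /wtP hx /wtP hy; apply/wtP => i j; rewrite coM -mulmxE mxE => ne.
have [k] : exists k, co x i k * co y k j != 0.
  apply: contrapT => h; case/eqP: ne; rewrite big1 // => k _; apply/eqP.
  by apply: contraT => kk; case: h; exists k.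
by rewrite mulf_eq0 negb_or => /andP [/hx <- /hy <-]; rewrite addrA subrK.
Qed.

Lemma wt_ad mu nu x y : wt mu x -> wt nu y -> wt (mu + nu) (ad x y).
Proof.
move=> hx hy; apply: subspB; [exact: wt_subsp | exact: wtM | rewrite addrC; exact: wtM].
Qed.

Lemma wt_tr0 mu z : wt mu z -> mu != 0 -> \tr z = 0.
Proof.
move=> /wtP h m0; rewrite -(tr_conj z uP); apply: big1 => i _; apply/eqP.
by apply: contraT => /h; rewrite subrr => /esym/eqP; rewrite (negPf m0).
Qed.

Lemma wt_tr mu nu x y : wt mu x -> wt nu y -> mu + nu != 0 -> \tr (x * y) = 0.
Proof. by move=> hx hy; apply: wt_tr0; apply: wtM. Qed.

Lemma wt1 : wt 0 1.
Proof.
apply/wtP => i j; rewrite /co mulr1 mxV // mxE; case: (eqVneq i j) => [->|]; rewrite ?subrr ?eqxx //.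
Qed.

Lemma row_mulrn_neq0 mu k : mu != 0 -> mu *+ k.+1 != 0.
Proof.
apply: contraNneq => e; apply/eqP/rowP => l; have := congr1 (fun x : 'rV[int]_r => x 0 l) e.
by rewrite mulmxnE !mxE => /eqP; rewrite Num.Theory.mulrn_eq0 /= => /eqP.
Qed.

Lemma wtX mu x k : wt mu x -> wt (mu *+ k) (x ^+ k).
Proof.
move=> h; elim: k => [|k IH]; first by rewrite mulr0n expr0; exact: wt1.
by rewrite mulrS exprS; apply: wtM.
Qed.

(** All positive powers of [x] have nonzero weight, hence trace zero. *)
Lemma wt_nilp mu x : wt mu x -> mu != 0 -> nilp x.
Proof.
move=> h m0; apply: (tr_exp_nilp charK0) => k.
by apply: (wt_tr0 (wtX k.+1 h)); apply: row_mulrn_neq0.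
Qed.

(** The points of [T] and, as [hh], the elements of its Lie algebra. *)
Definition tt d : 'M[K]_n := dc P (fun i => mon (w i) d).
Definition hh (b : 'I_r -> K) : 'M[K]_n := dc P (fun i => ev b (w i)).

Lemma co_dc f : co (dc P f) = dgm f. Proof. exact: dcK. Qed.

Lemma dgm_mull f z i j : (dgm f * z) i j = f i * z i j.
Proof.
rewrite -mulmxE mxE (bigD1 i) //= big1 ?addr0 => [|k ki]; rewrite dgmE ?eqxx ?mulr1n //.
by rewrite eq_sym (negPf ki) mulr0n mul0r.
Qed.

Lemma dgm_mulr f z i j : (z * dgm f) i j = z i j * f j.
Proof.
rewrite -mulmxE mxE (bigD1 j) //= big1 ?addr0 => [|k kj]; rewrite dgmE ?eqxx ?mulr1n //.
by rewrite (negPf kj) mulr0n mulr0.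
Qed.

Lemma tt_unit d : nz d -> tt d \in unitmx.
Proof. by move=> d0; apply: dc_unit => // i; apply: mon_neq0. Qed.

Lemma tt_conj d z : nz d -> mxconj (tt d) z = \sum_(mu <- wts) mon mu d *: wpr mu z.
Proof.
move=> d0; apply: co_inj; apply/matrixP => i j; rewrite co_wts_sum /mxconj !mulmxE.
rewrite [invmx _]dcV //; last by move=> k; apply: mon_neq0.
by rewrite coM [co (_ * z)]coM !co_dc dgm_mulr dgm_mull monD // monN // mulrAC.
Qed.

Lemma hh_ad b z : ad (hh b) z = \sum_(mu <- wts) ev b mu *: wpr mu z.
Proof.
apply: co_inj; apply/matrixP => i j; rewrite co_wts_sum /ad !mulmxE coB (coM (hh b)) (coM z) mxeB.
by rewrite !co_dc dgm_mulr dgm_mull evD evN mulrBl [X in _ - X]mulrC.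
Qed.

Lemma wt_tt mu z d : wt mu z -> nz d -> mxconj (tt d) z = mon mu d *: z.
Proof.
move=> h d0; rewrite tt_conj //; apply: co_inj; apply/matrixP => i j.
rewrite co_wts_sum coZ mxeZ; case: (eqVneq (co z i j) 0) => [->|ne]; first by rewrite !mulr0.
by have /wtP/(_ i j ne) <- := h.
Qed.

Lemma wt_hh mu z b : wt mu z -> ad (hh b) z = ev b mu *: z.
Proof.
move=> h; rewrite hh_ad; apply: co_inj; apply/matrixP => i j.
rewrite co_wts_sum coZ mxeZ; case: (eqVneq (co z i j) 0) => [->|ne]; first by rewrite !mulr0.
by have /wtP/(_ i j ne) <- := h.
Qed.

Lemma wt_of_tt mu z : (forall d, nz d -> mxconj (tt d) z = mon mu d *: z) -> wt mu z.
Proof.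
move=> h; apply/wtP => i j ne; apply: (mon_inj charK0) => d d0.
have := congr1 (fun A => co A i j) (h d d0); rewrite /= tt_conj // co_wts_sum coZ mxeZ.
by move=> /(mulIf ne).
Qed.

(** The characters of the torus are independent, so its action separates weights. *)
Lemma tt_graded (W : 'M[K]_n -> Prop) z mu : subsp W ->
  (forall d v, nz d -> W v -> W (mxconj (tt d) v)) -> W z -> W (wpr mu z).
Proof.
move=> sW hW Wz; case: (boolP (mu \in wts)) => ms; last first.
  suff -> : wpr mu z = 0 by apply: subsp0.
  apply: co_inj; apply/matrixP => i j; rewrite co_wpr co0 mxe0; case: eqP => // e.
  by move: ms; rewrite -e mem_wts.
have [U hU] := subsp_vs sW; suff : wpr mu z \in U by move/hU.
suff -> : wpr mu z = projv U (wpr mu z) by exact: memv_proj.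
apply/eqP; rewrite -subr_eq0; apply/eqP.
apply: (mon_indep_mx charK0 (c := fun nu => wpr nu z - projv U (wpr nu z)) wts_uniq) ms => d d0.
have := hW d z d0 Wz; rewrite tt_conj // => /hU/projv_id e.
have eP : \sum_(nu <- wts) mon nu d *: projv U (wpr nu z) =
    projv U (\sum_(nu <- wts) mon nu d *: wpr nu z).
  by rewrite linear_sum; apply: eq_bigr => nu _; rewrite linearZ.
under eq_bigr do rewrite scalerBr.
by rewrite sumrB eP e subrr.
Qed.

(** One element of the Cartan algebra is enough, if it takes different values on the
    weights that occur in [z]. *)
Lemma hh_graded (W : 'M[K]_n -> Prop) b z mu : subsp W ->
  (forall v, W v -> W (ad (hh b) v)) ->
  (forall mu nu, mu \in wts -> nu \in wts -> wpr mu z != 0 -> wpr nu z != 0 ->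
     ev b mu = ev b nu -> mu = nu) ->
  W z -> W (wpr mu z).
Proof.
move=> sW hW inj Wz; have [->|nz0] := eqVneq (wpr mu z) 0; first exact: subsp0.
have ms : mu \in wts.
  apply: contraT => ms; case/eqP: nz0; apply: co_inj; apply/matrixP => i j.
  rewrite co_wpr co0 mxe0; case: eqP => // e; by move: ms; rewrite -e mem_wts.
pose s := [seq nu <- wts | wpr nu z != 0].
pose vv (a : K) := \sum_(nu <- s | ev b nu == a) wpr nu z.
have us : uniq s by rewrite filter_uniq // wts_uniq.
have vE nu : nu \in s -> vv (ev b nu) = wpr nu z.
  move=> ns; rewrite /vv big_mkcond (bigD1_seq nu) //= eqxx big_seq_cond big1 ?addr0 // => nu'.
  move: ns; rewrite !mem_filter => /andP [n0 nsw] /andP [/andP [n0' ns'] /eqP nn].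
  by case: eqP => // e; case: nn; apply: inj.
have mss : mu \in s by rewrite mem_filter nz0.
rewrite -vE //.
apply: (@gen_eigen K _ (ad (hh b)) W _ _ _ _ _ _ (undup [seq ev b nu | nu <- s]) vv).
- by move=> u v; rewrite adDr.
- by move=> c u; rewrite adZr.
- exact: subsp0.
- by move=> u v; apply: subspD.
- by move=> c u; apply: subspZ.
- exact: hW.
- exact: undup_uniq.
- move=> a _; exists 1%N; rewrite /= /sh /vv ad_sumr scaler_sumr -sumrB big1 // => nu /eqP <-.
  by rewrite (wt_hh b (wt_wpr nu z)) subrr.
- have -> // : \sum_(a <- undup [seq ev b nu | nu <- s]) vv a = z.
  rewrite -[RHS]wpr_sum (bigID (fun nu => wpr nu z != 0)) /= [X in _ + X]big1 ?addr0.
    rewrite -[RHS]big_filter -/s.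
    rewrite /vv (exchange_big_dep xpredT) //= big_seq [RHS]big_seq; apply: eq_bigr => nu ns.
    rewrite (eq_bigl (fun a => a == ev b nu)); last by move=> a; rewrite eq_sym.
    rewrite -big_filter (filter_pred1_uniq (undup_uniq _)) ?big_seq1 //.
    by rewrite mem_undup map_f.
  by move=> nu /negPn /eqP.
- by rewrite mem_undup map_f.
Qed.

End Weights.

(** * The Cartan subalgebra and the center *)

Section TorusLie.
Variables (K : closedFieldType) (charK0 : [pchar K] =i pred0) (n r : nat).
Variables (P : 'M[K]_n) (uP : P \in unitmx) (w : 'I_n -> 'rV[int]_r) (G T : set 'M[K]_n).
Hypotheses (sim : almost_simple G) (TG : T `<=` G)
  (hT : forall A, T A <-> exists2 d, nz d & A = tt P w d)
  (hg0 : forall y, Lie G y -> (forall t, T t -> t * y = y * t) ->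
    exists b v, nilp v /\ y = hh P w b + v).
Implicit Types (x y z v : 'M[K]_n) (mu nu : 'rV[int]_r).
Notation wt := (wt P w).
Notation wpr := (wpr P w).
Notation hh := (hh P w).
Notation tt := (tt P w).
Notation co := (co P).

Lemma sim_sub : subgroup_GL G. Proof. by case: sim => [[]]. Qed.
Lemma sim_zc : zariski_closed G. Proof. by case: sim => [[]]. Qed.
Lemma sim_conn : conn G.
Proof. by case: sim => [[sG zG] cG _ _]; apply: zariski_conn. Qed.
Lemma sim_unit g : G g -> g \in unitmx. Proof. by case: sim_sub => h _ _ _; apply: h. Qed.

Lemma T_tt d : nz d -> T (tt d). Proof. by move=> d0; apply/hT; exists d. Qed.

Lemma Lie_tt d v : nz d -> Lie G v -> Lie G (mxconj (tt d) v).
Proof. by move=> d0; apply: (Lie_Ad charK0 sim_sub); apply: TG; apply: T_tt. Qed.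

Lemma LieT_hh b : Lie T (hh b).
Proof.
have -> : hh b = \sum_l b l *: dc P (fun i => (w i 0 l)%:~R).
  under eq_bigr do rewrite dcZ //.
  by rewrite dc_sum //; apply: eq_dc => i; apply: eq_bigr => l _; rewrite mulrC.
apply: Lie_comb => l _; apply: (cochar_Lie charK0 uP) => c c0.
pose d (k : 'I_r) := if k == l then c else 1.
have d0 : nz d by move=> k; rewrite /d; case: (k == l); [exact: c0 | exact: oner_neq0].
have -> : dc P (fun i => c ^ w i 0 l) = tt d; last exact: T_tt.
apply: eq_dc => i; rewrite /mon (bigD1 l) //= big1 ?mulr1 /d ?eqxx // => k /negPf ->.
by rewrite exp1rz.
Qed.

Lemma Lie_hh b : Lie G (hh b). Proof. exact: Lie_sub TG (LieT_hh b). Qed.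

Lemma Lie_wpr mu z : Lie G z -> Lie G (wpr mu z).
Proof.
apply: (tt_graded charK0 uP mu (subsp_Lie G)) => d v; exact: Lie_tt.
Qed.

Lemma wt0_comm_tt z t : wt 0 z -> T t -> t * z = z * t.
Proof.
move=> h /hT [d d0 ->]; have ut := tt_unit uP w d0.
have := wt_tt uP h d0; rewrite mon0 scale1r /mxconj !mulmxE => e.
by rewrite -{2}e -[RHS]mulrA Vmx // mulr1.
Qed.

Lemma wt0_hh b : wt 0 (hh b).
Proof.
apply/wtP => // i j; rewrite co_dc // dgmE; case: (eqVneq i j) => [->|_]; first by rewrite subrr.
by rewrite mulr0n eqxx.
Qed.

Lemma wt0_split y : Lie G y -> wt 0 y -> exists b v, [/\ nilp v, y = hh b + v, wt 0 v & Lie G v].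
Proof.
move=> Ly hy; have [|b [v [nv e]]] := hg0 Ly; first by move=> t; apply: wt0_comm_tt.
exists b, v; have -> : v = y - hh b by rewrite e addrC addKr.
split=> //; rewrite ?e; first by rewrite addrC addKr.
- by rewrite [_ - hh b]addrC addKr.
- by rewrite -e; apply: subspB (wt_subsp uP w 0) hy (wt0_hh b).
- by rewrite -e; apply: subspB (subsp_Lie G) Ly (Lie_hh b).
Qed.

(** The trace on the weight space of weight [chi] in the space of column vectors. *)
Definition trx chi x : K := \sum_(i | w i == chi) co x i i.

Lemma trxD chi x y : trx chi (x + y) = trx chi x + trx chi y.
Proof. by rewrite /trx -big_split; apply: eq_bigr => i _; rewrite coD mxeD. Qed.

(** A matrix of weight zero commutes with the projection onto that weight space. *)
Lemma trx_nilp chi v : wt 0 v -> nilp v -> trx chi v = 0.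
Proof.
move=> hv nv; pose f i : K := (w i == chi)%:R.
have cE : v * dc P f = dc P f * v.
  apply/(dc_commE uP) => i j; case: (eqVneq (co v i j) 0) => [e|ne].
    by rewrite -[P * v * invmx P]/(co v) e mul0r.
  have /eqP := (wtP uP w 0 v).1 hv i j ne; rewrite subr_eq0 => /eqP e.
  by rewrite /f e subrr mulr0.
have := nilp_tr0 (nilpMcomm (esym cE) nv).
rewrite -(tr_conj _ uP) -[P * _ * _]/(co (dc P f * v)) coM // co_dc // => e.
rewrite -[RHS]e /trx big_mkcond; apply: eq_bigr => i _; rewrite dgm_mull /f.
by case: eqP; rewrite ?mul1r ?mul0r.
Qed.

(** The traces of [x + y] on the weight spaces vanish, so its Cartan part is zero and
    [x + y] is nilpotent; the quadratic form of the trace vanishes on [x], [y] and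
    [x + y]. *)
Lemma nilp_form x y : wt 0 x -> wt 0 y -> Lie G x -> Lie G y -> nilp x -> nilp y -> \tr (x * y) = 0.
Proof.
move=> hx hy Lx Ly nx ny.
have hxy : wt 0 (x + y) by apply: subspD => //; exact: wt_subsp.
have [b [v [nv e hv Lv]]] := wt0_split (LieD Lx Ly) hxy.
have hb : hh b = 0.
  rewrite -(dc0 P); apply: eq_dc => i; have := trxD (w i) (hh b) v; rewrite -e trxD.
  rewrite (trx_nilp _ hx nx) (trx_nilp _ hy ny) (trx_nilp _ hv nv) !addr0 => /esym; rewrite /trx.
  have -> : \sum_(k | w k == w i) co (hh b) k k = #|[pred k | w k == w i]|%:R * ev b (w i).
    rewrite mulr_natl -sumr_const; apply: eq_big => k //= /eqP <-.
    by rewrite co_dc // dgmE eqxx.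
  have : (0 < #|[pred k | w k == w i]|)%N by apply/card_gt0P; exists i; rewrite inE.
  case: #|_| => // k _ /eqP; rewrite mulf_eq0 (negPf (nat_neq0 charK0 k)) /= => /eqP //.
have nxy : nilp (x + y) by rewrite e hb add0r.
have t2 z : nilp z -> \tr (z * z) = 0 by move=> nz'; apply: nilp_tr0; apply: nilpMcomm.
have := t2 _ nxy; rewrite mulrDl !mulrDr !mxtraceD !t2 // addr0 add0r [\tr (y * x)]trM => /eqP.
by rewrite -mulr2n -mulr_natl mulf_eq0 (negPf (two_neq0 charK0)) => /eqP.
Qed.

(** The nilpotent part of an element of weight zero is orthogonal to the Cartan
    algebra, to nilpotents of weight zero and to the other weights, hence is zero. *)
Lemma g0_hh y : Lie G y -> wt 0 y -> exists b, y = hh b.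
Proof.
move=> Ly hy; have [b [v [nv e hv Lv]]] := wt0_split Ly hy.
exists b; rewrite e; suff -> : v = 0 by rewrite addr0.
apply: (form_nondeg charK0 sim Lv) => z Lz.
have -> : \tr (v * z) = \tr (v * wpr 0 z).
  rewrite -{1}(wpr_sum uP w z) mulr_sumr raddf_sum /=.
  have h0 mu : mu != 0 -> \tr (v * wpr mu z) = 0.
    by move=> m0; apply: (wt_tr uP hv (wt_wpr uP w mu z)); rewrite add0r.
  case: (boolP (0 \in wts w)) => h; last first.
    rewrite big_seq big1 => [|mu ms]; last by apply: h0; apply: contraNneq h => <-.
    suff -> : wpr 0 z = 0 by rewrite mulr0 mxtrace0.
    apply: (co_inj uP); apply/matrixP => i j; rewrite co_wpr // co0 mxe0; case: eqP => // e0.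
    by move: h; rewrite -e0 mem_wts.
  by rewrite (bigD1_seq 0) ?wts_uniq //= big1 ?addr0 // => mu; apply: h0.
have Lz0 := Lie_wpr 0 Lz.
have [b' [v' [nv' e' hv' Lv']]] := wt0_split Lz0 (wt_wpr uP w 0 z).
rewrite e' mulrDr mxtraceD [X in _ + X]nilp_form // addr0.
have cv : hh b' * v = v * hh b'.
  have := wt_hh uP b' hv; rewrite ev0 scale0r /ad !mulmxE => /eqP.
  by rewrite subr_eq0 => /eqP.
by rewrite -cv; apply: nilp_tr0; apply: nilpMcomm.
Qed.

(** Some element of the Cartan algebra has a nonzero eigenvalue on any component
    of nonzero weight. *)
Lemma center_wt0 y : (forall z, Lie G z -> ad y z = 0) -> wt 0 y.
Proof.
move=> hy; have h mu : mu != 0 -> wpr mu y = 0.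
  move=> m0; have [|u hu] := generic charK0 (s := [:: mu]); first by move=> nu; rewrite inE => /eqP ->.
  pose b l : K := (u l)%:~R.
  have := congr1 (wpr mu) (wt_hh uP b (wt_wpr uP w mu y)).
  have : wpr mu (ad (hh b) y) = 0 by rewrite adC hy ?oppr0 ?wpr0 //; exact: Lie_hh.
  rewrite hh_ad // wpr_bigsum //.
  have -> : \sum_(nu <- wts w) wpr mu (ev b nu *: wpr nu y) = ev b mu *: wpr mu y.
    apply: (co_inj uP); apply/matrixP => i j; rewrite co_sum summxE.
    under eq_bigr do rewrite wprZ // wpr_wpr // coZ mxeZ.
    have e nu : ev b nu * co (if mu == nu then wpr nu y else 0) i j =
        (ev b nu * (mu == nu)%:R) * co (wpr nu y) i j.
      by case: eqP; rewrite ?mulr1 // mulr0 co0 mxe0 mulr0 mul0r.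
    under eq_bigr do rewrite e.
    rewrite (wts_sum_entry uP w (fun nu => ev b nu * (mu == nu)%:R)) coZ mxeZ co_wpr // eq_sym.
    by case: eqP => [->|]; rewrite ?mulr1 // mulr0 mul0r mulr0.
  move=> /eqP; rewrite scaler_eq0 => /orP [/eqP e|/eqP //].
  have /eqP := hu mu (mem_head _ _); case; apply: (intr_injK charK0).
  rewrite -[RHS]e /ev /pair rmorph_sum; apply: eq_bigr => l _; by rewrite rmorphM.
rewrite /wt; apply: (co_inj uP); apply/matrixP => i j; rewrite co_wpr //.
case: eqP => // /eqP ne; have := h _ ne => /(congr1 (fun A => co A i j)).
by rewrite /= co_wpr // eqxx co0 mxe0.
Qed.

(** By connectedness a central element [y] is fixed by [G], since its conjugates have
    finitely many possible entries.  The tori of its semisimple part are then central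
    in [G], hence trivial; being nilpotent, [y] lies in the radical of the form. *)
Lemma center0 y : Lie G y -> (forall z, Lie G z -> ad y z = 0) -> y = 0.
Proof.
move=> Ly hy; have sG := sim_sub; have [uG G1 GM GV] := sG.
have cent_y v : Lie G v -> (forall z, Lie G z -> ad v z = 0) -> exists b, v = hh b.
  by move=> Lv hv; apply: g0_hh => //; apply: center_wt0.
have hgy g : G g -> exists b, mxconj g y = hh b.
  move=> Gg; apply: cent_y => [|z Lz]; first exact: Lie_Ad.
  rewrite -(mxconjVK z (uG _ Gg)) -mxconj_ad ?uG // hy; last by apply: Lie_Ad => //; exact: GV.
  by rewrite /mxconj mulmx0 mul0mx.
(* a conjugate is diagonal in the coordinates of [T], with eigenvalues of [y] as entries *)
have Gy g : G g -> mxconj g y = y.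
  move=> Gg; apply: (co_inj uP); apply/matrixP => i j.
  have RA := regf_alg K n.
  have Rf : regf (fun g => co (mxconj g y) i j).
    apply: (entriesM RA); last exact: (entriesC RA).
    apply: (entriesM RA); first exact: (entriesC RA).
    apply: (entriesM RA); last exact: regf_entries_inv.
    by apply: (entriesM RA); [exact: regf_entries | exact: (entriesC RA)].
  have [rs hrs] := char_roots y.
  have := sim_conn Rf; rewrite /= => ->; rewrite ?mxconj1 //; last first.
    exists (0 :: rs) => h Gh; have [b hb] := hgy h Gh; rewrite hb co_dc // dgmE.
    case: eqP => [_|_]; rewrite ?mulr0n ?mem_head // mulr1n inE -hrs; apply/orP; right.
    have uh := uG _ Gh; apply/eigenvalueP.
    pose dj : 'rV[K]_n := delta_mx 0 j; exists (dj *m P *m h); last first.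
      have uPh : P *m h \in unitmx by rewrite unitmx_mul uP.
      apply/negP => /eqP e; have := congr1 (mulmx^~ (invmx (P *m h))) e.
      rewrite /= mul0mx -(mulmxA dj) -mulmxA mulmxV // mulmx1.
      by move=> /(congr1 (fun A : 'rV_n => A 0 j)); rewrite !mxE !eqxx => /eqP; rewrite oner_eq0.
    have -> : dj *m P *m h *m y = dj *m (P *m (mxconj h y)) *m h.
      by rewrite /mxconj -!mulmxA mulVmx // mulmx1.
    rewrite hb (_ : P *m hh b = dgm (fun i => ev b (w i)) *m P); last first.
      by rewrite /hh /dc !mulmxE !mulrA mxV // mul1r.
    rewrite !mulmxA scalemxAl scalemxAl; congr (_ *m _ *m _).
    apply/rowP => k; rewrite -rowE mxE dgmE mxeZ mxE eqxx [k == j]eq_sym.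
    by case: (eqVneq j k) => [->|_]; rewrite ?mulr1n ?mulr0n ?mulr1 ?mulr0.
  by rewrite /mxconj invmx1 mul1mx mulmx1.
have [Q [a [v [m [N [b [uQ ye nv cs [aN ib hc]]]]]]]] := jordan_Lie charK0 sG sim_zc Ly.
pose X : set 'M[K]_n := [set A | exists j c, c != 0 /\ A = dc Q (fun i => c ^ N i j)].
have Xcent A g : X A -> G g -> g * A = A * g.
  move=> [j [c [c0 ->]]] Gg; apply: (dc_comm uQ (a := a)).
    apply: cs; have := Gy g Gg; rewrite /mxconj !mulmxE => e.
    by rewrite -{2}e -[RHS]mulrA Vmx ?uG // mulr1.
  by move=> i k; rewrite !aN => /(Zindep_eq ib) ->.
have XG : X `<=` G by move=> _ [j [c [c0 ->]]]; apply: hc.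
have XV A : X A -> X (invmx A).
  move=> [j [c [c0 ->]]]; exists j, c^-1; split; first by rewrite invr_neq0.
  rewrite dcV //; last by move=> i; rewrite expfz_neq0.
  by apply: eq_dc => i; rewrite exprz_inv invr_expz.
have X1 : X `<=` [set 1%:M].
  apply: (simple_no_abelian sim) => //.
  - by move=> A B XA /XG GB; rewrite !mulmxE (Xcent A).
  - move=> g A Gg XA; suff -> : mxconj g A = A by [].
    by rewrite /mxconj !mulmxE (Xcent A g XA Gg) -mulrA mxV ?uG // mulr1.
  - move=> _ [j [c [c0 ->]]]; apply: (linked_cochar charK0 (z := fun i => N i j)) => //.
      by move=> A /XG/uG.
    by move=> c' c'0; exists j, c'.
have N0 i j : N i j = 0.
  apply: (pow2_inj charK0); have : X (dc Q (fun i => (2%:R : K) ^ N i j)).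
    by exists j, 2%:R; split; rewrite ?two_neq0.
  by move=> /X1 /=; rewrite -[1%:M]/(1 : 'M[K]_n) -(dc1 uQ) => /(dc_inj uQ)/(_ i).
have yv : y = v.
  rewrite ye; suff -> : dc Q a = 0 by rewrite add0r.
  by rewrite -(dc0 Q); apply: eq_dc => i; rewrite aN big1 // => j _; rewrite N0 mul0r.
apply: (form_nondeg charK0 sim Ly) => z Lz.
have cz : y * z = z * y by have := hy z Lz; rewrite /ad !mulmxE => /eqP; rewrite subr_eq0 => /eqP.
by rewrite cz; apply: nilp_tr0; apply: nilpMcomm; rewrite ?yv // -yv.
Qed.

End TorusLie.

(** * Representations of sl2, roots and Cartan integers *)

Section Sl2.
Variables (K : closedFieldType) (charK0 : [pchar K] =i pred0) (V : lmodType K) (E F H : V -> V).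
Hypotheses (EZ : forall c u, E (c *: u) = c *: E u)
  (FZ : forall c u, F (c *: u) = c *: F u)
  (EF : forall v, E (F v) - F (E v) = H v)
  (HE : forall v, H (E v) = E (H v) + 2%:R *: E v)
  (HF : forall v, H (F v) = F (H v) - 2%:R *: F v).

Lemma iter_min (A : V -> V) v N : v != 0 -> iter N A v = 0 ->
  exists k, iter k A v != 0 /\ iter k.+1 A v = 0.
Proof.
move=> v0 e; have ex : exists k, iter k A v == 0 by exists N; rewrite e.
case: (ex_minnP ex) => [[|k]] /= /eqP hk hmin; first by rewrite hk eqxx in v0.
by exists k; split=> //; apply: contraT => /negPn /hmin; rewrite ltnn.
Qed.

(** Along the string of [v] one has [F E^(k+1) v = - (k+1) (l+k) E^k v], and the
    string ends. *)
Lemma sl2_low v l N : v != 0 -> E (F v) = 0 -> H v = l *: v -> iter N E v = 0 ->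
  exists k : nat, l = - k%:R.
Proof.
move=> v0 EFv Hv hN.
have Hk k : H (iter k E v) = (l + (2 * k)%N%:R) *: iter k E v.
  elim: k => [|k IH]; first by rewrite muln0 addr0.
  rewrite iterS HE IH EZ -scalerDl; congr (_ *: _); rewrite mulnS natrD; ring.
have Fk k : F (iter k.+1 E v) = - (k.+1%:R * (l + k%:R)) *: iter k E v.
  elim: k => [|k IH].
    have := EF v; rewrite EFv Hv sub0r /= => e; rewrite -[LHS]opprK e addr0 mul1r scaleNr //.
  have := EF (iter k.+1 E v); rewrite IH Hk EZ -iterS => e.
  have -> : F (iter k.+2 E v) = - (k.+1%:R * (l + k%:R)) *: iter k.+1 E v -
      (l + (2 * k.+1)%N%:R) *: iter k.+1 E v by rewrite -e /= opprB addrC subrK.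
  rewrite -scalerBl; congr (_ *: _); rewrite natrM -!natr1; ring.
have [k [k0 k1]] := iter_min v0 hN; exists k.
have := Fk k; rewrite k1 -(scale0r 0) FZ scale0r => /esym /eqP.
rewrite scaleNr oppr_eq0 scaler_eq0 (negPf k0) orbF mulf_eq0 (negPf (nat_neq0 charK0 k)) /=.
by rewrite addr_eq0 => /eqP.
Qed.

(** The string of [v] under [F] ends in a vector to which [sl2_low] applies. *)
Lemma sl2_int v l N N' : v != 0 -> H v = l *: v -> iter N F v = 0 ->
  (forall u, iter N' E u = 0) -> exists z : int, l = z%:~R.
Proof.
move=> v0 Hv hN hN'; have [p [p0 p1]] := iter_min v0 hN.
have Hk k : H (iter k F v) = (l - (2 * k)%N%:R) *: iter k F v.
  elim: k => [|k IH]; first by rewrite muln0 subr0.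
  rewrite iterS HF IH FZ -scalerBl; congr (_ *: _); rewrite mulnS natrD; ring.
have [|k hk] := sl2_low p0 _ (Hk p) (hN' _).
  by rewrite -iterS p1; have := EZ 0 0; rewrite !scale0r.
exists ((2 * p)%N%:Z - k%:Z); rewrite rmorphB /= -!pmulrn -hk; ring.
Qed.

End Sl2.

Section Roots.
Variables (K : closedFieldType) (charK0 : [pchar K] =i pred0) (n r : nat).
Variables (P : 'M[K]_n) (uP : P \in unitmx) (w : 'I_n -> 'rV[int]_r) (G T : set 'M[K]_n).
Hypotheses (sim : almost_simple G) (TG : T `<=` G)
  (hT : forall A, T A <-> exists2 d, nz d & A = tt P w d)
  (hg0 : forall y, Lie G y -> (forall t, T t -> t * y = y * t) ->
    exists b v, nilp v /\ y = hh P w b + v).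
Implicit Types (x y z v e f : 'M[K]_n) (mu nu al be : 'rV[int]_r).
Notation wt := (wt P w).
Notation wpr := (wpr P w).
Notation hh := (hh P w).
Notation co := (co P).

(** The weight spaces of the Lie algebra of [G]; [Phi] consists of the roots, as
    elements of the character lattice. *)
Definition gs mu x := Lie G x /\ wt mu x.
Definition Phi mu := mu != 0 /\ exists2 x, x != 0 & gs mu x.

Lemma gs_subsp mu : subsp (gs mu : 'M[K]_n -> Prop).
Proof.
have [sL sW] := (subsp_Lie G, wt_subsp uP w mu).
split=> [|c u v [Lu hu] [Lv hv]]; first by split; apply: subsp0.
by split; [apply: sL.2 | apply: sW.2].
Qed.

Lemma gs_hh b : gs 0 (hh b).
Proof. by split; [exact: (Lie_hh charK0 uP TG hT) | exact: wt0_hh]. Qed.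

Lemma gs_ad mu nu x y : gs mu x -> gs nu y -> gs (mu + nu) (ad x y).
Proof.
by move=> [Lx hx] [Ly hy]; split; [exact: (Lie_bracket charK0 (sim_sub sim)) | exact: wt_ad].
Qed.

Lemma gs_wpr mu z : Lie G z -> gs mu (wpr mu z).
Proof. by move=> Lz; split; [exact: (Lie_wpr charK0 uP sim TG hT) | exact: wt_wpr]. Qed.

Lemma gs_0hh y : gs 0 y -> exists b, y = hh b.
Proof. by move=> [Ly hy]; apply: (g0_hh charK0 uP sim TG hT hg0). Qed.

Lemma tr_wpr mu x z : wt mu x -> \tr (x * z) = \tr (x * wpr (- mu) z).
Proof.
move=> hx; rewrite -{1}(wpr_sum uP w z) mulr_sumr raddf_sum /=.
have h0 nu : nu != - mu -> \tr (x * wpr nu z) = 0.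
  by move=> m0; apply: (wt_tr uP hx (wt_wpr uP w nu z)); rewrite addrC addr_eq0.
case: (boolP (- mu \in wts w)) => h; last first.
  rewrite big_seq big1 => [|nu ns]; last by apply: h0; apply: contraNneq h => <-.
  suff -> : wpr (- mu) z = 0 by rewrite mulr0 mxtrace0.
  apply: (co_inj uP); apply/matrixP => i j; rewrite co_wpr // co0 mxe0; case: eqP => // e0.
  by move: h; rewrite -e0 mem_wts.
by rewrite (bigD1_seq (- mu)) ?wts_uniq //= big1 ?addr0 // => nu; apply: h0.
Qed.

Lemma gs_dual mu x : gs mu x -> x != 0 -> exists y, gs (- mu) y /\ \tr (x * y) != 0.
Proof.
move=> [Lx hx] x0; apply: contrapT => h; case/eqP: x0; apply: (form_nondeg charK0 sim Lx) => z Lz.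
rewrite (tr_wpr _ hx); apply/eqP; apply: contraT => ne; case: h.
by exists (wpr (- mu) z); split=> //; apply: gs_wpr.
Qed.

Lemma gs0_nondeg y : gs 0 y -> (forall b, \tr (y * hh b) = 0) -> y = 0.
Proof.
move=> g0y h; apply/eqP; apply: contraT => y0; have [z [gz]] := gs_dual g0y y0.
by rewrite oppr0 in gz; have [b ->] := gs_0hh gz; rewrite h eqxx.
Qed.

Lemma hh_nilp0 b : nilp (hh b) -> hh b = 0.
Proof.
move=> nb; apply: gs0_nondeg => [|c]; first exact: gs_hh.
have e : hh b * hh c = hh c * hh b.
  by rewrite /hh !dcM //; apply: eq_dc => i; rewrite mulrC.
by rewrite e; apply: nilp_tr0; apply: nilpMcomm.
Qed.

Lemma tr_hh mu x y b : wt mu x -> wt (- mu) y -> \tr (ad x y * hh b) = ev b mu * \tr (x * y).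
Proof.
move=> hx hy; rewrite tr_ad adC (wt_hh uP b hy) evN scaleNr opprK.
by rewrite sclMr mxtraceZ.
Qed.

Lemma ev_neq0 mu : mu != 0 -> exists b : 'I_r -> K, ev b mu != 0.
Proof.
move=> m0; have [|u hu] := generic charK0 (s := [:: mu]); first by move=> nu; rewrite inE => /eqP ->.
exists (fun l => (u l)%:~R); apply: contraNneq (hu mu (mem_head _ _)) => e; apply/eqP.
apply: (intr_injK charK0); rewrite -[RHS]e /ev /pair rmorph_sum.
by apply: eq_bigr => l _; rewrite rmorphM.
Qed.

Record triple al e f (c : 'I_r -> K) : Prop := Triple {
  tr_e : gs al e; tr_f : gs (- al) f; tr_h : ad e f = hh c; tr_c : ev c al = 2%:R;
  tr_k : \tr (e * f) != 0 }.

(** Let [y] of opposite weight pair nontrivially with [e].  If the Cartan element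
    [ad e y] commuted with [e], it would be nilpotent by Jacobson, hence zero; its
    trace form with the Cartan algebra shows that it is not. *)
Lemma triple_ex al e : al != 0 -> gs al e -> e != 0 -> exists f c, triple al e f c.
Proof.
move=> a0 ge e0; have [y [gy k0]] := gs_dual ge e0.
have [|b hb] := gs_0hh (y := ad e y); first by rewrite -(subrr al); apply: gs_ad.
have b0 : ev b al != 0.
  apply/eqP => eb; have : nilp (ad e y).
    apply: (jacobson charK0); rewrite hb adC (wt_hh uP b ge.2) eb scale0r oppr0 //.
  rewrite hb => /hh_nilp0 h0; have [c c0] := ev_neq0 a0.
  have := tr_hh c ge.2 gy.2; rewrite hb h0 mul0r mxtrace0 => /esym /eqP.
  by rewrite mulf_eq0 (negPf c0) (negPf k0).
pose k := 2%:R / ev b al; have kn : k != 0 by rewrite mulf_neq0 ?invr_neq0 ?(two_neq0 charK0).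
exists (k *: y), (fun l => k * b l).
have ek mu : ev (fun l => k * b l) mu = k * ev b mu.
  by rewrite /ev mulr_sumr; apply: eq_bigr => l _; rewrite mulrCA.
split=> //.
- exact: subspZ (gs_subsp _) gy.
- by rewrite adZr hb /hh dcZ //; apply: eq_dc => i; rewrite ek.
- by rewrite ek divfK.
- by rewrite sclMr mxtraceZ mulf_neq0.
Qed.

Lemma gs_nilp mu x : mu != 0 -> gs mu x -> nilp x.
Proof. by move=> m0 [_ hx]; apply: (wt_nilp charK0 uP hx). Qed.

Section Triple.
Variables (al : 'rV[int]_r) (e f : 'M[K]_n) (c : 'I_r -> K).
Hypotheses (a0 : al != 0) (tri : triple al e f c).

Lemma tri_ne : nilp e. Proof. exact: (gs_nilp a0 (tr_e tri)). Qed.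
Lemma tri_nf : nilp f.
Proof. by apply: (gs_nilp _ (tr_f tri)); rewrite oppr_eq0. Qed.
Lemma tri_he : ad (hh c) e = 2%:R *: e.
Proof. by rewrite (wt_hh uP c (tr_e tri).2) (tr_c tri). Qed.
Lemma tri_hf : ad (hh c) f = - (2%:R *: f).
Proof. by rewrite (wt_hh uP c (tr_f tri).2) evN (tr_c tri) scaleNr. Qed.

Lemma tri_EF v : ad e (ad f v) - ad f (ad e v) = ad (hh c) v.
Proof. by rewrite (jacobi e f v) (tr_h tri) addrK. Qed.
Lemma tri_HE v : ad (hh c) (ad e v) = ad e (ad (hh c) v) + 2%:R *: ad e v.
Proof. by rewrite (jacobi (hh c) e v) tri_he adZl addrC. Qed.
Lemma tri_HF v : ad (hh c) (ad f v) = ad f (ad (hh c) v) - 2%:R *: ad f v.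
Proof. by rewrite (jacobi (hh c) f v) tri_hf adNl adZl addrC. Qed.

Lemma low_ad v l : v != 0 -> ad e (ad f v) = 0 -> ad (hh c) v = l *: v ->
  exists k : nat, l = - k%:R.
Proof.
move=> v0 h1 h2; apply: (@sl2_low _ charK0 _ (ad e) (ad f) (ad (hh c)) _ _ _ _ v l (n + n)) => //.
- by move=> k u; rewrite adZr.
- by move=> k u; rewrite adZr.
- exact: tri_EF.
- exact: tri_HE.
- exact: (iter_ad_nilp charK0 _ tri_ne).
Qed.

Lemma high_ad v l : v != 0 -> ad f (ad e v) = 0 -> ad (hh c) v = l *: v ->
  exists k : nat, l = k%:R.
Proof.
move=> v0 h1 h2.
have [||||||k hk] := @sl2_low _ charK0 _ (ad f) (ad e) (fun u => - ad (hh c) u) _ _ _ _ v (- l) (n + n) v0 h1 _ _.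
- by move=> k u; rewrite adZr.
- by move=> k u; rewrite adZr.
- by move=> u /=; rewrite -tri_EF [RHS]opprB.
- by move=> u /=; rewrite tri_HF adNr [LHS]opprB addrC.
- by rewrite h2 scaleNr.
- exact: (iter_ad_nilp charK0 _ tri_nf).
by exists k; rewrite -[l]opprK hk opprK.
Qed.

(** A vector of the root space orthogonal to [f] commutes with [f], hence generates
    a string that starts at the positive weight two. *)
Lemma dim1 z : gs al z -> exists k, z = k *: e.
Proof.
move=> gz; pose k := \tr (z * f) / \tr (e * f); exists k.
pose z' := z - k *: e; have gz' : gs al z'.
  by apply: subspB (gs_subsp al) gz _; apply: subspZ (gs_subsp al) (tr_e tri).
apply/eqP; rewrite -subr_eq0 -/z'; apply: contraT => z0.
have t0 : \tr (z' * f) = 0.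
  rewrite /z' mulrBl mxtraceD raddfN /= sclMl mxtraceZ divfK ?subrr //; exact: tr_k tri.
have zf : ad z' f = 0.
  apply: gs0_nondeg => [|b]; first by rewrite -(subrr al); apply: gs_ad => //; exact: tr_f tri.
  by rewrite (tr_hh b gz'.2 (tr_f tri).2) t0 mulr0.
have [||j hj] := low_ad z0 _ (l := 2%:R); first by rewrite [ad f z']adC zf oppr0 ad0r.
  by rewrite (wt_hh uP c gz'.2) (tr_c tri).
by have /eqP := nat_neq0 charK0 j.+1; case; rewrite -addn2 natrD hj addrN.
Qed.

Lemma cartan_int be v : gs be v -> v != 0 -> exists z : int, ev c be = z%:~R.
Proof.
move=> gv v0; apply: (@sl2_int _ charK0 _ (ad e) (ad f) (ad (hh c)) _ _ _ _ _ v _ (n + n) (n + n)) => //.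
- by move=> k u; rewrite adZr.
- by move=> k u; rewrite adZr.
- exact: tri_EF.
- exact: tri_HE.
- exact: tri_HF.
- exact: wt_hh gv.2.
- exact: (iter_ad_nilp charK0 _ tri_nf).
- by move=> u; exact: (iter_ad_nilp charK0 _ tri_ne).
Qed.

(** The action on column vectors is used: there [e] and [f] are nilpotent, and the
    weights of [T] are the [w i]. *)
Lemma cartan_V i : exists z : int, ev c (w i) = z%:~R.
Proof.
pose v : 'M[K]_n := invmx P * delta_mx i i.
have v0 : v != 0.
  apply/eqP => h; have := congr1 (fun A : 'M_n => (P * A) i i) h.
  by rewrite /= mulrA mxV // mul1r mulr0 !mxE !eqxx => /eqP; rewrite oner_eq0.
have hv : hh c * v = ev c (w i) *: v.
  rewrite /v /hh /dc !mulrA -[_ * P * invmx P]mulrA mxV // mulr1 -mulrA -sclMr; congr (_ * _).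
  apply/matrixP => k l; rewrite dgm_mull mxeZ !mxE.
  by case: (eqVneq k i) => [->|]; rewrite // !mulr0.
have xX x k u : iter k (fun u => x * u) u = x ^+ k * u.
  by elim: k => [|k IH]; rewrite ?mul1r // iterS IH exprS mulrA.
have br x y z u : ad x y = z -> x * (y * u) - y * (x * u) = z * u.
  by move=> <-; rewrite /ad !mulmxE mulrBl !mulrA.
apply: (@sl2_int _ charK0 _ (fun u => e * u) (fun u => f * u) (fun u => hh c * u) _ _ _ _ _ v _ n n) => //.
- by move=> k u; rewrite sclMr.
- by move=> k u; rewrite sclMr.
- by move=> u; apply: br; exact: tr_h tri.
- move=> u; have := br _ _ _ u tri_he; rewrite sclMl => <-; by rewrite addrC subrK.
- move=> u; have := br _ _ _ u tri_hf; rewrite mulNr sclMl => h; by rewrite -h addrC subrK.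
- by rewrite xX (_ : f ^+ n = 0) ?mul0r //; exact: tri_nf.
- by move=> u; rewrite xX (_ : e ^+ n = 0) ?mul0r //; exact: tri_ne.
Qed.

Lemma cartan_neg be v k : gs be v -> v != 0 -> ev c be = - k.+1%:R -> ad e v != 0.
Proof.
move=> gv v0 h; apply/eqP => ev0; have [||j hj] := high_ad v0 _ (l := ev c be).
- by rewrite ev0 ad0r.
- exact: wt_hh gv.2.
have /eqP := nat_neq0 charK0 (j + k); case; rewrite -addnS natrD -hj h addNr //.
Qed.

Lemma cartan_pos be v k : gs be v -> v != 0 -> ev c be = k.+1%:R -> ad f v != 0.
Proof.
move=> gv v0 h; apply/eqP => fv0; have [||j hj] := low_ad v0 _ (l := ev c be).
- by rewrite fv0 ad0r.
- exact: wt_hh gv.2.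
have /eqP := nat_neq0 charK0 (j + k); case; rewrite -addnS natrD -h hj addrN //.
Qed.

Lemma tri_e0 : e != 0.
Proof. by apply: contraNneq (tr_k tri) => ->; rewrite mul0r mxtrace0. Qed.
Lemma tri_f0 : f != 0.
Proof. by apply: contraNneq (tr_k tri) => ->; rewrite mulr0 mxtrace0. Qed.

(** Twice [tr (e f)] is the trace of the square of [hh c], a sum of squares of
    integers by [cartan_V].  This makes the signs of the Cartan integers symmetric. *)
Lemma cartan_len : exists N : nat, \tr (e * f) *+ 2 = N.+1%:R.
Proof.
have /choice [z hz] := cartan_V.
have h : \tr (e * f) *+ 2 = (\sum_i absz (z i) ^ 2)%N%:R.
  rewrite -[LHS]mulr_natl -(tr_c tri) -(tr_hh c (tr_e tri).2 (tr_f tri).2) (tr_h tri) tr_dcM //.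
  rewrite natr_sum; apply: eq_bigr => i _; rewrite hz -intrM -expr2 -[RHS]/((absz (z i) ^ 2)%N%:Z%:~R).
  by congr (_%:~R); nia.
exists (\sum_i absz (z i) ^ 2)%N.-1; rewrite h.
case: (\sum_i _)%N h => // h; have := tr_k tri.
have /eqP : 2%:R * \tr (e * f) = 0 by rewrite mulr_natl h.
by rewrite mulf_eq0 (negPf (two_neq0 charK0)) /= => ->.
Qed.

End Triple.

(** If [x] and [y] commuted, [y] would be a highest vector of weight [k >= 0] for the
    triple of [x].  The root space of [y] being a line, [ad x (ad f z) = 0], so [z],
    which has weight [k + 2], would be a lowest vector. *)
Lemma bracket_neq0 al be x y z : Phi al -> be != 0 -> gs al x -> gs be y -> gs (al + be) z ->
  x != 0 -> y != 0 -> z != 0 -> ad x y != 0.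
Proof.
move=> [a0 _] b0 gx gy gz x0 y0 z0; apply/eqP => xy.
have [f [c tri]] := triple_ex a0 gx x0.
have [f' [c' tri']] := triple_ex b0 gy y0.
have [||k hk] := high_ad a0 tri y0 _ (l := ev c be).
- by rewrite xy ad0r.
- exact: wt_hh gy.2.
have gfz : gs be (ad f z) by rewrite -[be](addKr al); apply: gs_ad => //; exact: tr_f tri.
have [m fz] := dim1 b0 tri' gfz.
have [||j hj] := low_ad a0 tri z0 _ (l := ev c (al + be)).
- by rewrite fz adZr xy scaler0.
- exact: wt_hh gz.2.
move: hj; rewrite evD (tr_c tri) hk => hj.
have /eqP := nat_neq0 charK0 (k + j).+1; case.
by rewrite -addn2 !natrD -addrA [j%:R + _]addrC addrA [k%:R + _]addrC hj addNr.
Qed.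

Lemma PhiN al : Phi al -> Phi (- al).
Proof.
move=> [a0 [x x0 gx]]; have [f [c tri]] := triple_ex a0 gx x0.
by split; [rewrite oppr_eq0 | exists f; [exact: (tri_f0 tri) | exact: tr_f tri]].
Qed.

(** The part of the theory of root systems on which positivity and orthogonality
    rest: additivity, symmetry of signs, and the roots produced by a sign. *)
Lemma cartan_integers : exists a : 'rV[int]_r -> 'rV[int]_r -> int,
  [/\ forall al, Phi al -> a al al = 2,
      forall al be ga, Phi al -> Phi be -> Phi ga -> Phi (be + ga) -> a (be + ga) al = a be al + a ga al,
      forall al be, Phi al -> Phi be -> (a al be < 0)%R -> (a be al < 0)%R,
      forall al be, Phi al -> Phi be -> (a be al < 0)%R -> be + al = 0 \/ Phi (be + al) &
      [/\ forall al be, Phi al -> Phi be -> (a be al > 0)%R -> be - al = 0 \/ Phi (be - al),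
      forall al (s : seq 'rV[int]_r), Phi al -> (forall be, be \in s -> Phi be) ->
        \sum_(be <- s) be = 0 -> \sum_(be <- s) a be al = 0 &
      forall al, Phi al -> exists2 c : 'I_r -> K, gs 0 (hh c) & forall be, Phi be -> ev c be = (a be al)%:~R]].
Proof.
have /choice [tr htr] : forall al, exists t : 'M[K]_n * 'M[K]_n * ('I_r -> K),
    Phi al -> triple al t.1.1 t.1.2 t.2.
  move=> al; case: (pselect (Phi al)) => [[a0 [x x0 gx]]|h].
    by have [f [c tri]] := triple_ex a0 gx x0; exists (x, f, c).
  by exists (0, 0, fun=> 0).
pose c al := (tr al).2; pose e al := (tr al).1.1; pose f al := (tr al).1.2.
have tri al : Phi al -> triple al (e al) (f al) (c al) := htr al.
have /choice [A hA] : forall ba : 'rV[int]_r * 'rV[int]_r, exists z : int,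
    Phi ba.1 -> Phi ba.2 -> ev (c ba.2) ba.1 = z%:~R.
  move=> [be al] /=; case: (pselect (Phi be /\ Phi al)) => [[[b0 [x x0 gx]] Pa]|h].
    by have [z hz] := cartan_int Pa.1 (tri _ Pa) gx x0; exists z.
  by exists 0 => Pb Pa; case: h.
pose a be al := A (be, al); exists a.
have aE be al : Phi be -> Phi al -> ev (c al) be = (a be al)%:~R by move=> Pb Pa; apply: (hA (be, al)).
have sym al be : Phi al -> Phi be -> exists N N' : nat, a be al * N.+1%:Z = a al be * N'.+1%:Z.
  move=> Pa Pb; have [N hN] := cartan_len Pb.1 (tri _ Pb); have [N' hN'] := cartan_len Pa.1 (tri _ Pa).
  exists N, N'; apply: (intr_injK charK0); rewrite !intrM -!aE // -!pmulrn -hN -hN'.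
  rewrite !mulrnAr; congr (_ *+ 2).
  have h1 := tr_hh (c al) (tr_e (tri _ Pb)).2 (tr_f (tri _ Pb)).2.
  have h2 := tr_hh (c be) (tr_e (tri _ Pa)).2 (tr_f (tri _ Pa)).2.
  by rewrite -h1 -h2 (tr_h (tri _ Pa)) (tr_h (tri _ Pb)) trM.
split.
- by move=> al Pa; apply: (intr_injK charK0); rewrite -aE // (tr_c (tri _ Pa)).
- move=> al be ga Pa Pb Pg Ps; apply: (intr_injK charK0); rewrite rmorphD /= -!aE // evD //.
- move=> al be Pa Pb h; have [N [N' e1]] := sym _ _ Pa Pb; nia.
- move=> al be Pa Pb h; have [x x0 gx] := Pb.2.
  case: (eqVneq (be + al) 0) => [|ne]; [by left | right; split=> //].
  exists (ad (e al) x); last by rewrite addrC; apply: gs_ad gx; exact: tr_e (tri _ Pa).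
  apply: (cartan_neg Pa.1 (tri _ Pa) (k := (absz (a be al)).-1) gx x0).
  by rewrite aE // pmulrn -mulrNz; congr (_%:~R); lia.
split.
- move=> al be Pa Pb h; have [x x0 gx] := Pb.2.
  case: (eqVneq (be - al) 0) => [|ne]; [by left | right; split=> //].
  exists (ad (f al) x); last by rewrite addrC; apply: gs_ad gx; exact: tr_f (tri _ Pa).
  apply: (cartan_pos Pa.1 (tri _ Pa) (k := (absz (a be al)).-1) gx x0).
  by rewrite aE // pmulrn; congr (_%:~R); lia.
- move=> al s Pa hs s0; apply: (intr_injK charK0); rewrite rmorph_sum /= mulr0z -[RHS](ev0 (c al)) -s0.
  have -> : ev (c al) (\sum_(be <- s) be) = \sum_(be <- s) ev (c al) be.
    by elim: (s) => [|b s' IH]; rewrite ?big_nil ?ev0 // !big_cons evD IH.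
  by rewrite big_seq [RHS]big_seq; apply: eq_bigr => be bs; rewrite aE //; apply: hs.
- move=> al Pa; exists (c al); first exact: gs_hh.
  by move=> be Pb; apply: aE.
Qed.

End Roots.

(** * The Lie algebra of a Borel subgroup *)

Section Borel.
Variables (K : closedFieldType) (charK0 : [pchar K] =i pred0).

Lemma subsp_msum m p (W : 'M[K]_(m, p) -> Prop) (I : Type) (s : seq I) (Q : pred I) F :
  subsp W -> (forall i, Q i -> W (F i)) -> W (\sum_(i <- s | Q i) F i).
Proof.
move=> sW h; elim/big_ind: _ => //; first exact: (subsp0 sW).
by move=> u v; apply: (subspD sW).
Qed.

Lemma nilp_small m (v : 'M[K]_m) : (m <= 1)%N -> nilp v -> v = 0.
Proof.
by case: m v => [|[|m]] // v _ _; exact: mx0_eq.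
Qed.

Lemma regf_linfun n a b (phi : 'M[K]_(a, b) -> K) (F : 'M[K]_n -> 'M[K]_(a, b)) :
  (forall c u v, phi (c *: u + v) = c * phi u + phi v) -> entries (@regf K n) F ->
  regf (fun A => phi (F A)).
Proof.
move=> phil RF; have RA := regf_alg K n.
have phi0 : phi 0 = 0.
  by have := phil 1 0 0; rewrite scaler0 addr0 mul1r => /eqP; rewrite -subr_eq0 opprD addNKr oppr_eq0 => /eqP.
have phis (I : Type) (s : seq I) (c : I -> K) (X : I -> 'M[K]_(a, b)) :
    phi (\sum_(i <- s) c i *: X i) = \sum_(i <- s) c i * phi (X i).
  by elim: s => [|i s IH]; rewrite ?big_nil // !big_cons phil IH.
apply: (regf_ext (f := fun A => \sum_(k : 'I_a * 'I_b) F A k.1 k.2 * phi (delta_mx k.1 k.2))).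
  by move=> A _; rewrite -phis; congr phi; rewrite [RHS]matrix_sum_delta pair_bigA.
apply: (fun_alg_sum RA) => k _; apply: (fun_algM RA); [exact: RF | exact: (fun_algC RA)].
Qed.

Variables (n r : nat).
Variables (P : 'M[K]_n) (uP : P \in unitmx) (w : 'I_n -> 'rV[int]_r) (G T B : set 'M[K]_n).
Hypotheses (sim : almost_simple G) (TG : T `<=` G)
  (hT : forall A, T A <-> exists2 d, nz d & A = tt P w d)
  (hg0 : forall y, Lie G y -> (forall t, T t -> t * y = y * t) ->
    exists b v, nilp v /\ y = hh P w b + v)
  (Bb : borel_subgroup G B) (TB : T `<=` B).
Implicit Types (x y z v e f : 'M[K]_n) (mu nu al be : 'rV[int]_r).
Notation wt := (wt P w).
Notation wpr := (wpr P w).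
Notation hh := (hh P w).
Notation tt := (tt P w).
Notation gs := (gs P w G).

Lemma B_sub : subgroup_GL B. Proof. by case: Bb => _ [[]]. Qed.
Lemma B_zc : zariski_closed B. Proof. by case: Bb => _ [[]]. Qed.
Lemma B_zconn : zariski_connected B. Proof. by case: Bb => _ []. Qed.
Lemma B_conn : conn B.
Proof. exact: (zariski_conn B_sub B_zc B_zconn). Qed.
Lemma B_sol : solvable_group B. Proof. by case: Bb => _ []. Qed.
Lemma BG : B `<=` G. Proof. by case: Bb. Qed.
Lemma B_unit h : B h -> h \in unitmx. Proof. by case: B_sub => u _ _ _; apply: u. Qed.

Lemma mulmx_fixes_quot (U P1 : 'cV[K]_n -> Prop) : subsp U -> subsp P1 ->
  (forall v : 'cV[K]_n, U v -> P1 v) -> (forall h (v : 'cV[K]_n), B h -> P1 v -> P1 (h *m v)) ->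
  (forall h (v : 'cV[K]_n), B h -> U v -> U (h *m v)) -> (exists v : 'cV[K]_n, P1 v /\ ~ U v) ->
  exists v : 'cV[K]_n, [/\ P1 v, ~ U v & forall h, B h -> exists c, U (h *m v - c *: v)].
Proof.
move=> sU sP UP stP stU ex.
apply: (lie_kolchin_quot (act := fun h u => h *m u) B_sub B_conn B_sol) => //.
- by move=> h _ c u v; rewrite mulmxDr -scalemxAr.
- by move=> u; rewrite mul1mx.
- by move=> g h u _ _; rewrite mulmxA.
- move=> phi phil u; apply: (regf_linfun phil); have RA := regf_alg K n.
  by apply: (entriesM RA); [exact: regf_entries | exact: (entriesC RA)].
Qed.

Lemma mxconj_fixes_quot (P1 P2 : 'M[K]_n -> Prop) : subsp P1 -> subsp P2 ->
  (forall v, P2 v -> P1 v) -> (forall h v, B h -> P1 v -> P1 (mxconj h v)) ->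
  (forall h v, B h -> P2 v -> P2 (mxconj h v)) -> (exists v, P1 v /\ ~ P2 v) ->
  exists v, [/\ P1 v, ~ P2 v & forall h, B h -> exists c, P2 (mxconj h v - c *: v)].
Proof.
move=> s1 s2 P21 st1 st2 ex.
apply: (lie_kolchin_quot (act := fun h u => mxconj h u) B_sub B_conn B_sol) => //.
- by move=> h _ c u v; rewrite mxconj_lin.
- by move=> u; rewrite /mxconj invmx1 mul1mx mulmx1.
- by move=> g h u /B_unit ug /B_unit uh; rewrite mxconjM.
- move=> phi phil u; apply: (regf_linfun phil); have RA := regf_alg K n.
  apply: (entriesM RA); last exact: regf_entries_inv.
  by apply: (entriesM RA); [exact: regf_entries | exact: (entriesC RA)].
Qed.

(** Lie-Kolchin provides every step of a flag. *)
Lemma borel_tri : exists2 Q : 'M[K]_n, Q \in unitmx & forall h, B h -> lvl 0 (invmx Q *m h *m Q).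
Proof.
apply: flag_triangular => U stU Unf.
have [||||||u [_ /negP vU hv]] := @mulmx_fixes_quot (fun u => u \in U) (fun=> True).
- exact: subsp_memv.
- by split.
- by [].
- by [].
- by move=> h u; apply: stU.
- apply: contrapT => h; case/negP: Unf; rewrite eqEsubv subvf /=; apply/subvP => u _.
  by apply: contraT => /negP uU; case: h; exists u.
by exists u.
Qed.

Variables (Q : 'M[K]_n) (uQ : Q \in unitmx) (hQ : forall h, B h -> lvl 0 (invmx Q *m h *m Q)).

Lemma LieB_lvl v : Lie B v -> lvl 0 (invmx Q *m v *m Q).
Proof.
move=> Lv i j ij; apply: (Lie_lin charK0 (H := B) (c := 0)) Lv; first by case: B_sub.
by move=> A BA; apply: hQ.
Qed.

(** The nilpotent elements of the Lie algebra of [B], described in coordinates in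
    which [B] is triangular, so that they visibly form a subspace. *)
Definition nn v := Lie B v /\ lvl 1 (invmx Q *m v *m Q).

Lemma nn_Lie v : nn v -> Lie B v. Proof. by case. Qed.

Lemma nn_nilp v : nn v -> nilp v.
Proof.
move=> [_ /lvl1_nilp h]; rewrite -(conjVK v uQ).
by apply: nilp_conj; rewrite ?mxV ?Vmx // -!mulmxE.
Qed.

Lemma nn_of_nilp v : Lie B v -> nilp v -> nn v.
Proof.
move=> Lv nv; split=> //; apply: nilp_lvl1; first exact: LieB_lvl.
by apply: nilp_conj; rewrite ?mxV ?Vmx.
Qed.

Lemma nn_subsp : subsp nn.
Proof.
split; first by split=> [|i j _]; rewrite ?mulmx0 ?mul0mx ?mxE //; exact: Lie0.
move=> c u v [Lu hu] [Lv hv]; split; first by apply: LieD => //; apply: LieZ.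
by rewrite mulmxDr mulmxDl -scalemxAr -scalemxAl; apply: lvlD => //; apply: lvlZ.
Qed.

Lemma LieB_Ad h v : B h -> Lie B v -> Lie B (mxconj h v).
Proof. exact: (Lie_Ad charK0 B_sub). Qed.

Lemma nn_Ad h v : B h -> nn v -> nn (mxconj h v).
Proof.
move=> Bh nv; apply: nn_of_nilp; first by apply: LieB_Ad => //; case: nv.
by apply: nilp_mxconj; [exact: B_unit | exact: nn_nilp].
Qed.

Lemma lvl_mul k l x v : lvl k (invmx Q *m x *m Q) -> lvl l (invmx Q *m v *m Q) ->
  lvl (k + l) (invmx Q *m (x *m v) *m Q).
Proof. by move=> hx hv; rewrite conjM //; apply: lvlM. Qed.

Lemma nn_ad x v : nn x -> Lie B v -> nn (ad x v).
Proof.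
move=> [Lx hx] Lv; have hv := LieB_lvl Lv; split; first exact: (Lie_bracket charK0 B_sub).
rewrite /ad mulmxBr mulmxBl; apply: lvlB; [exact: (lvl_mul hx hv) | exact: (lvl_mul hv hx)].
Qed.

(** The product of a triangular and a strictly triangular matrix is nilpotent. *)
Lemma nn_perp x v : nn x -> Lie B v -> \tr (x * v) = 0.
Proof.
move=> [Lx hx] Lv; have h := lvl_mul hx (LieB_lvl Lv).
rewrite -(tr_conj _ (_ : invmx Q \in unitmx)) ?unitmx_inv // invmxK.
exact: (nilp_tr0 (lvl1_nilp h)).
Qed.

Lemma LieBG v : Lie B v -> Lie G v. Proof. exact: Lie_sub BG. Qed.

Lemma B_tt d : nz d -> B (tt d). Proof. by move=> d0; apply: TB; apply/hT; exists d. Qed.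

Lemma LieB_hh b : Lie B (hh b).
Proof. exact: Lie_sub TB (LieT_hh charK0 uP hT b). Qed.

Lemma LieB_wpr mu v : Lie B v -> Lie B (wpr mu v).
Proof.
apply: (tt_graded charK0 uP mu (subsp_Lie B)) => d u d0; apply: LieB_Ad; exact: B_tt.
Qed.

Lemma nn_wpr mu v : nn v -> nn (wpr mu v).
Proof.
apply: (tt_graded charK0 uP mu nn_subsp) => d u d0; apply: nn_Ad; exact: B_tt.
Qed.

Lemma nn_wt mu v : mu != 0 -> Lie B v -> wt mu v -> nn v.
Proof. by move=> m0 Lv hv; apply: nn_of_nilp => //; apply: (wt_nilp charK0 uP hv). Qed.

Lemma nn_wpr0 v : nn v -> wpr 0 v = 0.
Proof.
move=> nv; have n0 := nn_wpr 0 nv.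
have [|b e] := gs_0hh charK0 uP sim TG hT hg0 (y := wpr 0 v).
  by apply: (gs_wpr charK0 uP sim TG hT); apply: LieBG; apply: nn_Lie.
rewrite e; apply: (hh_nilp0 charK0 uP sim TG hT hg0); rewrite -e; exact: nn_nilp.
Qed.

(** The derivative at [0] of a curve in a subspace lies in the subspace. *)
Lemma exp_stable (U : 'cV[K]_n -> Prop) v (u : 'cV[K]_n) : subsp U -> nilp v ->
  (forall t, U (expm (t *: v) *m u)) -> U (v *m u).
Proof.
move=> sU nv h; case: (ltnP 1 n) => n1; last first.
  by rewrite (nilp_small n1 nv) mul0mx; apply: subsp0.
have := @poly_coef_subsp K charK0 n 1 U n (fun k => (k`!%:R)^-1 *: (v ^+ k *m u)) sU.
have hs t : U (\sum_(k < n) t ^+ k *: ((k`!%:R)^-1 *: (v ^+ k *m u))).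
  have -> // : \sum_(k < n) t ^+ k *: ((k`!%:R)^-1 *: (v ^+ k *m u)) = expm (t *: v) *m u.
  rewrite /expm mulmx_suml; apply: eq_bigr => k _; rewrite -scalemxAl.
  have -> : (t *: v) ^+ k = t ^+ k *: v ^+ k.
    elim: (nat_of_ord k) => [|j IH]; first by rewrite !expr0 scale1r.
    by rewrite !exprS IH sclMl sclMr scalerA.
  by rewrite -scalemxAl !scalerA mulrC.
by move=> /(_ hs 1 n1); rewrite /= invr1 scale1r expr1.
Qed.

Lemma exp_stable_inv (U : 'cV[K]_n -> Prop) v (u : 'cV[K]_n) : subsp U -> (forall u : 'cV[K]_n, U u -> U (v *m u)) ->
  U (v *m u) -> U (expm v *m u - u).
Proof.
move=> sU st h; have hk k : U (v ^+ k.+1 *m u).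
  by elim: k => [|k IH]; rewrite ?expr1 // exprS -mulmxE -mulmxA; apply: st.
rewrite /expm mulmx_suml; case: (n) U sU u v st h hk => [|m] U' sU' u' v' st' h' hk'.
  by rewrite big_ord0 sub0r; apply: subspN => //; suff -> : u' = 0 by [exact: subsp0]; apply/matrixP => [[]].
rewrite big_ord_recl /= fact0 invr1 scale1r expr0 mul1mx addrC addKr.
by apply: (subsp_msum _ sU') => k _; rewrite -scalemxAl; apply: subspZ => //; apply: hk'.
Qed.

End Borel.

(** * Maximality of the Borel subgroup *)

Section BorelMax.
Variables (K : closedFieldType) (charK0 : [pchar K] =i pred0) (n r : nat).
Variables (P : 'M[K]_n) (uP : P \in unitmx) (w : 'I_n -> 'rV[int]_r) (G T B : set 'M[K]_n).
Hypotheses (sim : almost_simple G) (TG : T `<=` G)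
  (hT : forall A, T A <-> exists2 d, nz d & A = tt P w d)
  (hg0 : forall y, Lie G y -> (forall t, T t -> t * y = y * t) ->
    exists b v, nilp v /\ y = hh P w b + v)
  (Bb : borel_subgroup G B) (TB : T `<=` B).
Variables (Q : 'M[K]_n) (uQ : Q \in unitmx) (hQ : forall h, B h -> lvl 0 (invmx Q *m h *m Q)).
Implicit Types (x y z v e f : 'M[K]_n) (mu nu al be : 'rV[int]_r).
Notation wt := (wt P w).
Notation wpr := (wpr P w).
Notation hh := (hh P w).
Notation tt := (tt P w).
Notation gs := (gs P w G).
Notation nn := (nn B Q).
Let nnsub : subsp nn := nn_subsp B Q.
Let uB := B_unit Bb.

Lemma exp_nn_mem v : nn v -> B (expm v).
Proof.
move=> nv; apply: (exp_mem charK0 (B_sub Bb) (B_zc Bb) (nn_Lie nv)).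
exact: (nn_nilp uQ nv).
Qed.

Lemma nn_stable (U : 'cV[K]_n -> Prop) x (u : 'cV[K]_n) : subsp U -> (forall h (u : 'cV[K]_n), B h -> U u -> U (h *m u)) ->
  nn x -> U u -> U (x *m u).
Proof.
move=> sU st nx Uu; apply: (exp_stable charK0 sU (nn_nilp uQ nx)) => t.
by apply: st => //; apply: exp_nn_mem; apply: (subspZ _ nnsub).
Qed.

(** The last vector of the triangular basis outside [U] is sent into the span of
    the following ones. *)
Lemma nn_engel (U : 'cV[K]_n -> Prop) : subsp U -> (exists u : 'cV[K]_n, ~ U u) ->
  exists u : 'cV[K]_n, ~ U u /\ forall x, nn x -> U (x *m u).
Proof.
move=> sU [u0 nu0]; pose q (k : 'I_n) : 'cV[K]_n := col k Q.
have expand (u : 'cV[K]_n) : Q *m u = \sum_k u k 0 *: q k.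
  apply/colP => i; rewrite mxE summxE; apply: eq_bigr => k _; by rewrite !mxE mulrC.
have [k0 nk0] : exists k, ~ U (q k).
  apply: contrapT => h; apply: nu0; rewrite -[u0](mulKVmx uQ) expand.
  apply: (subsp_msum _ sU) => k _; apply: (subspZ _ sU); apply: contrapT => nk; by apply: h; exists k.
have [k [nk hk]] : exists k, ~ U (q k) /\ forall l : 'I_n, (k < l)%N -> U (q l).
  pose A := [pred k : 'I_n | ~~ `[< U (q k) >]].
  have Ak0 : A k0 by apply/asboolPn.
  exists [arg max_(k > k0 | A k) k : nat]; case: arg_maxnP => // k /asboolPn nk hk.
  split=> // l kl; apply: contrapT => nl.
  have hl : (l <= k)%N by apply: hk; apply/asboolPn.
  by move: hl; rewrite leqNgt kl.
exists (q k); split=> // x [_ hx].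
have -> : x *m q k = Q *m ((invmx Q *m x *m Q) *m delta_mx k 0).
  by rewrite !mulmxA mulmxV // mul1mx -mulmxA /q colE.
rewrite expand; apply: (subsp_msum _ sU) => l _; case: (ltnP k l) => kl; first by apply: (subspZ _ sU); exact: hk.
suff -> : ((invmx Q *m x *m Q) *m (delta_mx k 0 : 'cV[K]_n)) l 0 = 0 by rewrite scale0r; exact: (subsp0 sU).
by rewrite -colE mxE hx // addn1.
Qed.

Section Adjoin.
Variable (v : 'M[K]_n).
Hypotheses (Gv : Lie G v) (nv : nilp v) (Bv : forall h, B h -> exists c, nn (mxconj h v - c *: v)).

(** Modulo [nn], [v] is an eigenvector of the nilpotent operator [ad x]. *)
Lemma adj_ad x : nn x -> nn (ad x v).
Proof.
move=> nx; have nix := nn_nilp uQ nx.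
case: (pselect (nn v)) => nnv; first by apply: (nn_ad charK0 Bb uQ hQ) => //; exact: nn_Lie nnv.
pose W u := exists m d, nn m /\ u = m + d *: v.
have sW : subsp W.
  split; first by exists 0, 0; split; [exact: (subsp0 nnsub) | rewrite scale0r addr0].
  move=> c _ _ [m [d [hm ->]]] [m' [d' [hm' ->]]]; exists (c *: m + m'), (c * d + d').
  split; first by apply: (subspD nnsub) => //; apply: (subspZ _ nnsub).
  by rewrite scalerDr scalerA scalerDl addrACA.
have hexp t : W (expm (t *: x) * v * expm (- (t *: x))).
  have ntx : nn (t *: x) by apply: (subspZ _ nnsub).
  have [c hc] := Bv (exp_nn_mem ntx); exists (mxconj (expm (t *: x)) v - c *: v), c; split=> //.
  by rewrite /mxconj expmV ?subrK //; exact: (nn_nilp uQ ntx).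
case: (ltnP 1 (n + n)) => n1; last first.
  have n0 : (n <= 1)%N by lia.
  by rewrite (nilp_small n0 nix) ad0l; exact: (subsp0 nnsub).
have iterZ t k u : iter k (ad (t *: x)) u = t ^+ k *: iter k (ad x) u.
  by elim: k => [|k IH]; rewrite ?scale1r // !iterS IH adZl adZr scalerA exprS.
have [m [d [hm e]]] : W (ad x v).
  have := @poly_coef_subsp K charK0 n n W (n + n) (fun k => (k`!%:R)^-1 *: iter k (ad x) v) sW.
  move=> /(_ _ 1 n1); rewrite /= invr1 scale1r; apply=> t.
  have := hexp t; rewrite (expm_conj charK0) //; last by apply: (nilpZ _ nix).
  congr W; apply: eq_bigr => k _; by rewrite iterZ !scalerA mulrC.
suff d0 : d = 0 by rewrite e d0 scale0r addr0.
have it k : exists m', nn m' /\ iter k (ad x) v = m' + d ^+ k *: v.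
  elim: k => [|k [m' [hm' IH]]].
    by exists 0; split; [exact: (subsp0 nnsub) | rewrite add0r scale1r].
  exists (ad x m' + d ^+ k *: m); split.
    apply: (subspD nnsub); last by apply: (subspZ _ nnsub).
    by apply: (nn_ad charK0 Bb uQ hQ) => //; exact: nn_Lie hm'.
  by rewrite iterS IH adDr adZr e scalerDr addrA scalerA exprSr.
have [m' [hm' e']] := it (n + n); apply/eqP; apply: contraT => d0; case: nnv.
have dk : d ^+ (n + n) != 0 by rewrite expf_neq0.
have -> : v = (d ^+ (n + n))^-1 *: (- m').
  move: e'; rewrite (iter_ad_nilp charK0) // => /esym /eqP; rewrite addrC addr_eq0 => /eqP <-.
  by rewrite scalerA mulVf // scale1r.
by apply: (subspZ _ nnsub); apply: (subspN nnsub).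
Qed.

Let X : set 'M[K]_n := [set A | B A \/ exists t, A = expm (t *: v)].

(** Modulo a proper stable subspace, the vectors killed by [nn] and by [v] form a
    nonzero space stable under [B], and Lie-Kolchin applies to it. *)
Lemma adj_tri : exists2 Q' : 'M[K]_n, Q' \in unitmx & forall h, X h -> lvl 0 (invmx Q' *m h *m Q').
Proof.
apply: flag_triangular => U0 stU Unf; pose U (u : 'cV[K]_n) : Prop := u \in U0.
have sU : subsp U by exact: subsp_memv.
have stB h (u : 'cV[K]_n) : B h -> U u -> U (h *m u) by move=> Bh; apply: stU; left.
have stv (u : 'cV[K]_n) : U u -> U (v *m u).
  by move=> Uu; apply: (exp_stable charK0 sU nv) => t; apply: stU => //; right; exists t.
pose U1 (u : 'cV[K]_n) := forall x, nn x -> U (x *m u).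
pose U2 (u : 'cV[K]_n) := U1 u /\ U (v *m u).
have [u [nu hu]] : exists u, ~ U u /\ U1 u.
  apply: nn_engel => //; apply: contrapT => h; case/negP: Unf; rewrite eqEsubv subvf /=; apply/subvP => u _.
  by apply: contraT => /negP uU; case: h; exists u.
have U1v u' : U1 u' -> U1 (v *m u').
  move=> h x nx; have -> : x *m (v *m u') = v *m (x *m u') + ad x v *m u'.
    by rewrite /ad mulmxBl !mulmxA addrC subrK.
  by apply: (subspD sU); [apply: stv; apply: h | apply: h; apply: adj_ad].
have UU1 u' : U u' -> U1 u' by move=> Uu x nx; apply: nn_stable.
have [u2 [nu2 h2]] : exists u2, ~ U u2 /\ U2 u2.
  have ex : exists k, `[< U (v ^+ k *m u) >].
    exists n; apply/asboolP; suff -> : v ^+ n = 0 by rewrite mul0mx; exact: (subsp0 sU).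
    exact: nv.
  case: (ex_minnP ex) => [[|k]] /asboolP hk hmin; first by rewrite expr0 mul1mx in hk.
  exists (v ^+ k *m u); split.
    by move=> h; have := hmin k; rewrite ltnn => h'; suff : false by []; apply: h'; apply/asboolP.
  split; last by rewrite mulmxA -[v *m v ^+ k]/(v * v ^+ k) -exprS.
  elim: k {hk hmin} => [|k IH]; first by rewrite expr0 mul1mx.
  by rewrite exprS -mulmxE -mulmxA; apply: U1v.
have sU2 : subsp U2.
  split; first by split=> [x _|]; rewrite mulmx0; exact: (subsp0 sU).
  move=> c a b [ha ha'] [hb hb']; split=> [x nx|]; rewrite mulmxDr -scalemxAr;
    (apply: (subspD sU); [apply: (subspZ _ sU) |]) => //; [exact: ha | exact: hb].
have [||||||u3 [[h31 h32] nu3 h33]] := @mulmx_fixes_quot K n G B Bb U U2.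
- exact: sU.
- exact: sU2.
- by move=> u' Uu'; split; [exact: UU1 | exact: stv].
- move=> h u' Bh [h1 h1']; have uh := uB Bh; have BV : B (invmx h) by case: (B_sub Bb) => _ _ _; apply.
  have sw x : x *m (h *m u') = h *m (mxconj (invmx h) x *m u').
    by rewrite /mxconj invmxK !mulmxA mulmxV // mul1mx.
  split=> [x nx|]; rewrite sw; apply: stB => //.
    by apply: h1; apply: (nn_Ad charK0 Bb uQ hQ).
  have [c hc] := Bv BV; rewrite -[mxconj _ v](subrK (c *: v)) mulmxDl; apply: (subspD sU); first exact: h1.
  by rewrite -scalemxAl; apply: (subspZ _ sU).
- exact: stB.
- by exists u2.
exists u3; first exact/negP.
move=> s [Bs|[t ->]]; first exact: h33.
exists 1; rewrite scale1r; apply: (exp_stable_inv sU) => [u' Uu'|].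
  by rewrite -scalemxAl; apply: (subspZ _ sU); apply: stv.
by rewrite -scalemxAl; apply: (subspZ _ sU).
Qed.

(** A nilpotent element that [B] normalizes modulo [nn] can be adjoined to [B]: the
    group generated remains triangular, so its closure is connected and solvable,
    and maximality of [B] leaves no room for it. *)
Lemma adj_mem : nn v.
Proof.
have [uG _ _ _] := sim_sub sim; have BGs := BG Bb; have sB := B_sub Bb.
have ne t : nilp (t *: v) by apply: (nilpZ _ nv).
have XG : X `<=` G.
  move=> A [/BGs //|[t ->]]; apply: (exp_mem charK0 (sim_sub sim) (sim_zc sim)) => //; exact: LieZ.
have uX A : X A -> A \in unitmx by move=> /XG/uG.
have XV A : X A -> X (invmx A).
  move=> [BA|[t ->]]; first by left; case: sB => _ _ _; apply.
  by right; exists (- t); rewrite expmV // scaleNr.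
have sX := gen_subgroup uX XV; have ugen A : gen X A -> A \in unitmx by case: sX => u *; exact: u.
pose H := zcl (gen X).
have sH : subgroup_GL H := zcl_subgroup sX.
have cH : zariski_connected H.
  apply: zcl_gen_connected => // C [BC|[t ->]].
    apply: (linked_conn (B_zc Bb) (B_zconn Bb)) => //; first by case: sB.
    by move=> A C' gA BC'; apply: genMX => //; left.
  apply: (linked_exp charK0) => // t'; right; exists (t' * t); by rewrite scalerA.
have HG : H `<=` G by apply: zcl_min; [exact: (sim_zc sim) | apply: gen_min => //; exact: (sim_sub sim)].
have XH : X `<=` H by move=> A XA; apply: (sub_zcl ugen); apply: sub_gen.
have [Q' uQ' hQ'] := adj_tri.
have hH h : H h -> lvl 0 (invmx Q' *m h *m Q').
  move=> Hh i j ij; have RA := regf_alg K n.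
  apply: (zcl_regf (f := fun A => (invmx Q' *m A *m Q') i j) ugen _ _ Hh).
    apply: (entriesM RA); last exact: (entriesC RA).
    by apply: (entriesM RA); [exact: (entriesC RA) | exact: regf_entries].
  move=> A gA; suff : lvl 0 (invmx Q' *m A *m Q') by apply.
  apply: (gA (fun A => lvl 0 (invmx Q' *m A *m Q'))) => [|C D hC XD].
    by rewrite mulmx1 mulVmx //; exact: lvl1.
  by rewrite conjM //; apply: (lvlM (k := 0) (l := 0)) hC (hQ' _ XD).
have HB : H = B.
  case: Bb => _ _; apply=> //; last by move=> A BA; apply: XH; left.
  split=> //; first by split=> //; exact: zcl_closed.
  exact: (trg_solvable uQ' sH hH).
have Lv : Lie B v.
  by apply: (exp_Lie charK0 nv) => t; rewrite -HB; apply: XH; right; exists t.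
exact: (nn_of_nilp charK0 Bb uQ hQ Lv nv).
Qed.

End Adjoin.

(** If not, [B] would have by Lie-Kolchin an eigenvector in the orthogonal modulo
    [nn], which can be taken of a single weight.  In weight zero it is orthogonal to
    the Cartan algebra and vanishes; otherwise it is nilpotent and [adj_mem] applies. *)
Lemma perp_b y : Lie G y -> (forall z, Lie B z -> \tr (y * z) = 0) -> nn y.
Proof.
move=> Ly hy; apply: contrapT => ny.
pose P1 u := Lie G u /\ forall z, Lie B z -> \tr (u * z) = 0.
have s1 : subsp P1.
  split; first by split=> [|z _]; [exact: Lie0 | rewrite mul0r mxtrace0].
  move=> c a b [La ha] [Lb hb]; split=> [|z Lz]; first by apply: LieD => //; apply: LieZ.
  by rewrite mulrDl mxtraceD sclMl mxtraceZ ha // hb // mulr0 addr0.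
have nP1 u : nn u -> P1 u.
  by move=> hu; split=> [|z Lz]; [exact: (LieBG Bb (nn_Lie hu)) | exact: (nn_perp charK0 Bb uQ hQ)].
have st1 h u : B h -> P1 u -> P1 (mxconj h u).
  move=> Bh [Lu hu]; split=> [|z Lz]; first by apply: (Lie_Ad charK0 (sim_sub sim)) => //; exact: (BG Bb).
  rewrite tr_mxconj ?uB // hu //; apply: (LieB_Ad charK0 Bb) => //.
  by case: (B_sub Bb) => _ _ _; apply.
have st2 h u : B h -> nn u -> nn (mxconj h u) := @nn_Ad K charK0 n G B Bb Q uQ hQ h u.
have [|u [[Lu hu] nu eu]] := mxconj_fixes_quot Bb s1 nnsub nP1 st1 st2; first by exists y.
have Btt d (d0 : nz d) : B (tt d) := B_tt hT TB d0.
(* the components of [u] outside [nn] are scaled alike by [T], so there is only one *)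
have [mu nmu] : exists mu, ~ nn (wpr mu u).
  apply: contrapT => h; apply: nu; rewrite -(wpr_sum uP w u).
  apply: (subsp_msum _ nnsub) => mu _; apply: contrapT => hmu; by apply: h; exists mu.
have P1w nu' : P1 (wpr nu' u).
  by apply: (tt_graded charK0 uP nu' s1) => // d u' d0; apply: st1; exact: Btt.
have other nu' : nu' != mu -> nn (wpr nu' u).
  move=> nm; apply: contrapT => nnu; case/eqP: nm; apply: (mon_inj charK0) => d d0.
  have [c hc] := eu _ (Btt d d0).
  have key la : ~ nn (wpr la u) -> mon la d = c.
    move=> nla; apply/eqP; apply: contraT => ne; case: nla.
    have := nn_wpr charK0 uP hT Bb TB uQ hQ la hc.
    have -> : wpr la (mxconj (tt d) u - c *: u) = (mon la d - c) *: wpr la u.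
      rewrite -scaleNr wprD // wprZ // scalerBl scaleNr; congr (_ - _).
      rewrite tt_conj //; apply: (co_inj uP); apply/matrixP => i j.
      rewrite co_wpr // co_wts_sum // coZ mxeZ co_wpr //; case: eqP => [->|] //; by rewrite mulr0.
    move=> /(subspZ ((mon la d - c)^-1) nnsub); rewrite scalerA mulVf ?scale1r //.
    by rewrite subr_eq0.
  by rewrite (key nu') // (key mu).
pose v := wpr mu u.
have uv : nn (u - v).
  rewrite /v -{1}(wpr_sum uP w u); case: (boolP (mu \in wts w)) => ms.
    rewrite (bigD1_seq mu) ?wts_uniq //= addrC addrK.
    by apply: (subsp_msum _ nnsub) => nu' ne; exact: other.
  case: nmu; suff -> : wpr mu u = 0 by exact: (subsp0 nnsub).
  apply: (co_inj uP); apply/matrixP => i j; rewrite co_wpr // co0 mxe0; case: eqP => // e0.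
  by move: ms; rewrite -e0 mem_wts.
have ev' h : B h -> exists c, nn (mxconj h v - c *: v).
  move=> Bh; have [c hc] := eu h Bh; exists c.
  have -> : mxconj h v - c *: v = (mxconj h u - c *: u) - (mxconj h (u - v) - c *: (u - v)).
    have zm (a b p q : 'M[K]_n) : b - q = (a - p) - ((a - b) - (p - q)).
      by rewrite opprB addrA [a - p + _]addrA subrK opprB [RHS]addrC addrA subrK.
    have -> : mxconj h (u - v) = mxconj h u - mxconj h v by rewrite /mxconj mulmxBr mulmxBl.
    by rewrite scalerBr; exact: zm.
  apply: (subspB nnsub) => //; apply: (subspB nnsub); first exact: st2.
  exact: (subspZ _ nnsub).
have [Lv hv] := P1w mu; rewrite -/v in Lv hv.
apply: nmu; rewrite -/v; case: (eqVneq mu 0) => m0.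
  have gv : gs 0 v by split=> //; rewrite -m0; exact: wt_wpr.
  suff -> : v = 0 by exact: (subsp0 nnsub).
  apply: (gs0_nondeg charK0 uP sim TG hT hg0 gv) => b; apply: hv.
  exact: (LieB_hh charK0 uP hT TB).
apply: adj_mem => //; exact: (wt_nilp charK0 uP (wt_wpr uP w mu u) m0).
Qed.

(** Double orthogonality, from [perp_b]. *)
Lemma perp_n y : Lie G y -> (forall z, nn z -> \tr (y * z) = 0) -> Lie B y.
Proof.
move=> Ly hy; apply: contrapT => nLy.
have [z [Lz hz]] := perp_sep charK0 sim (subsp_Lie B) (LieBG Bb) Ly nLy.
have nz' : nn z by apply: perp_b => // v; exact: hz.
by rewrite trM hy // eqxx.
Qed.

End BorelMax.

(** * Positive roots and a positive functional *)

Section Gordan.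
Import Order.TTheory Num.Theory.
Variable r : nat.
Implicit Types (s : 'rV[int]_r) (u : 'I_r -> rat).

Lemma cancel_opp (a b : int) : (0 < a)%R -> (b < 0)%R -> a *+ absz b + b *+ absz a = 0.
Proof.
move=> a0 b0; have e (x : int) (k : nat) : x *+ k = x * k%:Z by rewrite -mulr_natr natz.
rewrite !e.
have -> : (absz b : int) = - b by lia.
have -> : (absz a : int) = a by lia.
ring.
Qed.

Lemma dom_pos (M : nat) (a b : int) : (0 < a)%R -> (absz b < M)%N -> (0 < M%:Z * a + b)%R.
Proof.
move=> a0 bM; have h : (0 <= M%:Z * (a - 1))%R by rewrite mulr_ge0 //; lia.
have e : M%:Z * (a - 1) = M%:Z * a - M%:Z by ring.
by rewrite e in h; lia.
Qed.

Lemma dom_neq0 (M : nat) (a b : int) : b != 0 -> (absz b < M)%N -> M%:Z * a + b != 0.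
Proof.
move=> b0 bM; case: (ltgtP a 0) => a0; last by rewrite a0 mulr0 add0r.
  have := @dom_pos M (- a) (- b); rewrite oppr_gt0 a0 abszN bM => /(_ isT isT).
  by rewrite mulrN -opprD oppr_gt0 => /lt_eqF ->.
by have /gt_eqF -> := dom_pos a0 bM.
Qed.

Definition pairQ u s : rat := \sum_l (s 0 l)%:~R * u l.

Lemma rat_max (A : seq rat) : exists m, forall a, a \in A -> (a < m)%R.
Proof.
elim: A => [|a A [m hm]]; first by exists 0.
exists (Num.max (a + 1) m) => b; rewrite inE lt_max => /orP [/eqP ->|/hm ->]; last by rewrite orbT.
by rewrite ltrDl ltr01.
Qed.

Lemma rat_between (A B : seq rat) : (forall a b, a \in A -> b \in B -> (a < b)%R) ->
  exists m, (forall a, a \in A -> (a < m)%R) /\ (forall b, b \in B -> (m < b)%R).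
Proof.
elim: B A => [|b B IH] A h.
  by have [m hm] := rat_max A; exists m.
have [|m [h1 h2]] := IH A; first by move=> a b' aA bB; apply: h => //; rewrite inE bB orbT.
have [lt|ge] := ltP m b.
  by exists m; split=> // b'; rewrite inE => /orP [/eqP ->|/h2].
have [m' hm'] : exists m', (forall a, a \in A -> (a < m')%R) /\ (m' < b)%R.
  have {h1 h2 IH ge} : forall a, a \in A -> (a < b)%R by move=> a aA; apply: h; rewrite ?mem_head.
  elim: (A) => [|a A' IHA] hA; first by exists (b - 1); split=> //; rewrite ltrBlDr ltrDl ltr01.
  have [|c [hc cb]] := IHA; first by move=> a' a'A; apply: hA; rewrite inE a'A orbT.
  have ab : (a < b)%R by apply: hA; rewrite mem_head.
  exists (Num.max c ((a + b) / 2%:R)); split.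
    move=> a'; rewrite inE lt_max => /orP [/eqP ->|/hc ->] //.
    by rewrite orbC midf_lt.
  by rewrite gt_max cb midf_lt.
case: hm' => hA mb; exists m'; split=> // b'; rewrite inE => /orP [/eqP -> //|b'B].
exact: lt_le_trans mb (le_trans ge (ltW (h2 _ b'B))).
Qed.

(** Elimination of the last coordinate, after Fourier and Motzkin: vectors with
    coefficients of opposite signs are combined so as to cancel it.  A solution of
    the smaller system bounds the last coordinate from below and from above by
    compatible bounds. *)
Lemma gordanQ k (S : seq 'rV[int]_r) : (k <= r)%N ->
  (forall s (l : 'I_r), s \in S -> (k <= l)%N -> s 0 l = 0) ->
  (exists u, forall s, s \in S -> (0 < pairQ u s)%R) \/
  (exists t, [/\ t != [::], {subset t <= S} & \sum_(s <- t) s = 0]).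
Proof.
elim: k S => [|k IH] S kr hS.
  case: S hS => [|s S] hS; first by left; exists (fun=> 0).
  right; exists [:: s]; split=> //; first by move=> x; rewrite inE => /eqP ->; rewrite mem_head.
  by rewrite big_seq1; apply/rowP => l; rewrite mxE hS ?mem_head.
pose lk : 'I_r := Ordinal kr; pose c s := s 0 lk.
pose Sp := [seq s <- S | (0 < c s)%R]; pose Sn := [seq s <- S | (c s < 0)%R].
pose S0 := [seq s <- S | c s == 0].
pose cmb (p q : 'rV[int]_r) := p *+ absz (c q) + q *+ absz (c p).
pose S' := S0 ++ [seq cmb p q | p <- Sp, q <- Sn].
have entn (p : 'rV[int]_r) m l : (p *+ m) 0 l = p 0 l *+ m by rewrite mulmxnE.
have hS' s (l : 'I_r) : s \in S' -> (k <= l)%N -> s 0 l = 0.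
  rewrite mem_cat => /orP [|/allpairsP [[p q] /= [pS qS ->]]].
    rewrite mem_filter => /andP [/eqP cs sS]; rewrite leq_eqVlt => /orP [/eqP kl|kl].
      by rewrite -cs /c; congr (s 0 _); apply: val_inj.
    by apply: hS.
  move: pS qS; rewrite !mem_filter => /andP [cp pS] /andP [cq qS].
  rewrite leq_eqVlt mxE !entn => /orP [/eqP kl|kl]; last by rewrite !hS ?mul0rn ?addr0.
  have -> : l = lk by apply: val_inj.
  exact: cancel_opp.
have [[u hu]|[t [t0 tS ts]]] := IH S' (ltnW kr) hS'; last first.
  right.
  (* each combined vector is a sum of elements of [S] *)
  have /choice [ex hex] : forall s, exists e : seq 'rV[int]_r,
      s \in S' -> [/\ e != [::], {subset e <= S} & \sum_(x <- e) x = s].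
    move=> s; case: (boolP (s \in S')) => sS; last by exists [::].
    move: sS; rewrite mem_cat => /orP [|/allpairsP [[p q] /= [pS qS ->]]].
      rewrite mem_filter => /andP [_ sS]; exists [:: s] => _; split=> //; last by rewrite big_seq1.
      by move=> x; rewrite inE => /eqP ->.
    move: pS qS; rewrite !mem_filter => /andP [cp pS] /andP [cq qS].
    exists (nseq (absz (c q)) p ++ nseq (absz (c p)) q) => _; split.
    - by rewrite -size_eq0 size_cat !size_nseq; move: cp; lia.
    - by move=> x; rewrite mem_cat !mem_nseq => /orP [/andP [_ /eqP ->]|/andP [_ /eqP ->]].
    - by rewrite big_cat /= !big_nseq !iter_addr_0.
  exists (flatten [seq ex s | s <- t]); split.
  - case: t t0 tS {ts} => // s t _ tS; have [|e0 _ _] := hex s; first by apply: tS; rewrite mem_head.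
    by rewrite /=; case: (ex s) e0.
  - move=> x /flattenP [e /mapP [s st ->]]; have [_ h _] := hex s (tS s st); exact: h.
  - rewrite big_flatten big_map -[RHS]ts big_seq [RHS]big_seq; apply: eq_bigr => s st.
    by have [_ _ h] := hex s (tS s st).
left; pose A := [seq - pairQ u p / (c p)%:~R | p <- Sp]; pose B := [seq - pairQ u q / (c q)%:~R | q <- Sn].
have pcmb p q : pairQ u (cmb p q) = pairQ u p *+ absz (c q) + pairQ u q *+ absz (c p).
  rewrite /cmb /pairQ -!sumrMnl -big_split; apply: eq_bigr => l _.
  by rewrite mxE !entn rmorphD !rmorphMn /= mulrDl !mulrnAl.
have [|m [mA mB]] := rat_between (A := A) (B := B).
  move=> _ _ /mapP [p pS ->] /mapP [q qS ->].
  have : (0 < pairQ u (cmb p q))%R.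
    by apply: hu; rewrite mem_cat; apply/orP; right; apply/allpairsP; exists (p, q).
  move: pS qS; rewrite !mem_filter => /andP [cp pS] /andP [cq qS]; rewrite pcmb.
  have cpQ : (0 < (c p)%:~R :> rat)%R by rewrite ltr0z.
  have cqQ : (0 < - (c q)%:~R :> rat)%R by rewrite oppr_gt0 ltrz0.
  have -> : pairQ u p *+ absz (c q) = pairQ u p * - (c q)%:~R.
    by rewrite -mulr_natr -rmorphN /=; congr (_ * _); rewrite pmulrn; congr (_%:~R); lia.
  have -> : pairQ u q *+ absz (c p) = pairQ u q * (c p)%:~R.
    by rewrite -mulr_natr; congr (_ * _); rewrite pmulrn; congr (_%:~R); lia.
  move=> h; rewrite ltr_pdivrMr // -mulrA mulrC -[X in (_ < X)%R]mulrA.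
  rewrite -subr_gt0 -(pmulr_rgt0 _ cqQ).
  have cq0 : (c q)%:~R != 0 :> rat by rewrite -oppr_eq0 gt_eqF.
  have -> : - (c q)%:~R * ((c q)%:~R^-1 * ((c p)%:~R * - pairQ u q) - - pairQ u p) =
    pairQ u p * - (c q)%:~R + pairQ u q * (c p)%:~R by field.
  by [].
exists (fun l => if l == lk then u l + m else u l) => s sS.
have -> : pairQ (fun l => if l == lk then u l + m else u l) s = pairQ u s + (c s)%:~R * m.
  rewrite /pairQ (bigD1 lk) //= [in RHS](bigD1 lk) //= eqxx mulrDr -!addrA; congr (_ + _).
  by rewrite addrC; congr (_ + _); apply: eq_bigr => l /negPf ->.
case: (ltgtP (c s) 0) => cs.
- have /mB : - pairQ u s / (c s)%:~R \in B by apply/mapP; exists s; rewrite // mem_filter cs.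
  have cQ : ((c s)%:~R < 0 :> rat)%R by rewrite ltrz0.
  by rewrite ltr_ndivlMr // => h; rewrite mulrC -subr_gt0 in h *; lra.
- have /mA : - pairQ u s / (c s)%:~R \in A by apply/mapP; exists s; rewrite // mem_filter cs.
  have cQ : (0 < (c s)%:~R :> rat)%R by rewrite ltr0z.
  by rewrite ltr_pdivrMr // => h; rewrite mulrC -subr_gt0 in h *; lra.
- by rewrite cs mul0r addr0; apply: hu; rewrite mem_cat mem_filter cs eqxx sS.
Qed.

Lemma gordan (S : seq 'rV[int]_r) :
  (forall t, t != [::] -> {subset t <= S} -> \sum_(s <- t) s != 0) ->
  exists u : 'I_r -> int, forall s, s \in S -> (0 < pair u s)%R.
Proof.
move=> hS; have [|[u hu]|[t [t0 tS ts]]] := gordanQ (S := S) (leqnn r).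
- by move=> s l _; rewrite leqNgt ltn_ord.
- pose d := \prod_l denq (u l).
  have d0 : (0 < d)%R by apply: prodr_gt0 => l _; exact: denq_gt0.
  exists (fun l => numq (u l) * \prod_(l' | l' != l) denq (u l')) => s /hu.
  rewrite -(ltr0z rat) => h.
  have -> : (pair (fun l => numq (u l) * \prod_(l' | l' != l) denq (u l')) s)%:~R = d%:~R * pairQ u s :> rat.
    have ed l : d = denq (u l) * \prod_(l' | l' != l) denq (u l') by rewrite /d (bigD1 l).
    rewrite /pair /pairQ rmorph_sum mulr_sumr; apply: eq_bigr => l _ /=.
    rewrite (ed l) !intrM numqE; ring.
  by rewrite mulr_gt0 // ltr0z.
- by have := hS t t0 tS; rewrite ts eqxx.
Qed.

End Gordan.

Section PositiveRoots.
Variables (K : closedFieldType) (charK0 : [pchar K] =i pred0) (n r : nat).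
Variables (P : 'M[K]_n) (uP : P \in unitmx) (w : 'I_n -> 'rV[int]_r) (G T B : set 'M[K]_n).
Hypotheses (sim : almost_simple G) (TG : T `<=` G)
  (hT : forall A, T A <-> exists2 d, nz d & A = tt P w d)
  (hg0 : forall y, Lie G y -> (forall t, T t -> t * y = y * t) ->
    exists b v, nilp v /\ y = hh P w b + v)
  (Bb : borel_subgroup G B) (TB : T `<=` B).
Variables (Q : 'M[K]_n) (uQ : Q \in unitmx) (hQ : forall h, B h -> lvl 0 (invmx Q *m h *m Q)).
Implicit Types (x y z v e f : 'M[K]_n) (mu nu al be de : 'rV[int]_r).
Notation wt := (wt P w).
Notation wpr := (wpr P w).
Notation hh := (hh P w).
Notation gs := (gs P w G).
Notation Phi := (Phi P w G).
Notation nn := (nn B Q).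

Definition pos de := Phi de /\ exists x, [/\ x != 0, gs de x & Lie B x].

Lemma pos_Lie de x : pos de -> gs de x -> Lie B x.
Proof.
move=> [[d0 _] [y [y0 gy Ly]]] gx; have [f [c tri]] := triple_ex charK0 uP sim TG hT hg0 d0 gy y0.
have [k ->] := dim1 charK0 uP sim TG hT hg0 d0 tri gx; exact: LieZ.
Qed.

Lemma pos_nn de x : pos de -> gs de x -> nn x.
Proof.
move=> pd gx; apply: (nn_wt charK0 uP Bb uQ hQ (mu := de)); [by case: pd => [[]] | exact: (pos_Lie pd gx) | exact: (proj2 gx)].
Qed.

Lemma wpr_Phi mu x : Lie G x -> mu != 0 -> wpr mu x != 0 -> Phi mu.
Proof.
by move=> Lx m0 x0; split=> //; exists (wpr mu x) => //; exact: (gs_wpr charK0 uP sim TG hT).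
Qed.

(** A root vector outside the Lie algebra of [B] is not orthogonal to [nn], by
    [perp_n]; the element of [nn] it pairs with has a component of weight [- al]. *)
Lemma pos_or al : Phi al -> pos al \/ pos (- al).
Proof.
move=> Pa; case: (pselect (pos al)) => [|npos]; [by left | right].
have [a0 [x x0 gx]] := Pa.
have nLx : ~ Lie B x by move=> Lx; apply: npos; split=> //; exists x.
have [z nz' tz] : exists2 z, nn z & \tr (x * z) != 0.
  apply: contrapT => h; apply: nLx.
  apply: (perp_n charK0 uP sim TG hT hg0 Bb TB uQ hQ gx.1) => z hz.
  by apply/eqP; apply: contraT => tz; case: h; exists z.
have Lz := LieBG Bb (nn_Lie nz').
rewrite (tr_wpr uP z gx.2) in tz.
have z0 : wpr (- al) z != 0 by apply: contraNneq tz => ->; rewrite mulr0 mxtrace0.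
split; first by apply: (wpr_Phi Lz) => //; rewrite oppr_eq0.
exists (wpr (- al) z); split=> //; first exact: (gs_wpr charK0 uP sim TG hT).
exact: (LieB_wpr charK0 uP hT Bb TB _ (nn_Lie nz')).
Qed.

(** Otherwise two elements of [nn] would pair nontrivially. *)
Lemma pos_not al : pos al -> ~ pos (- al).
Proof.
move=> pa pna; have [[a0 _] [x [x0 gx Lx]]] := pa.
have [y [gy]] := gs_dual charK0 uP sim TG hT gx x0.
by rewrite (nn_perp charK0 Bb uQ hQ (pos_nn pa gx) (pos_Lie pna gy)) eqxx.
Qed.

Lemma pos_add al be : pos al -> pos be -> Phi (al + be) -> pos (al + be).
Proof.
move=> pa pb Pab; split=> //; have [Pa [x [x0 gx Lx]]] := pa; have [Pb [y [y0 gy Ly]]] := pb.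
have [z z0 gz] := Pab.2; exists (ad x y); split.
- exact: (bracket_neq0 charK0 uP sim TG hT hg0 Pa Pb.1 gx gy gz).
- exact: (gs_ad charK0 uP sim).
- exact: (Lie_bracket charK0 (B_sub Bb)).
Qed.

Lemma nn_supp v mu : nn v -> wpr mu v != 0 -> pos mu.
Proof.
move=> nv v0; have Lv := nn_Lie nv; have LGv := LieBG Bb Lv.
have m0 : mu != 0.
  by apply: contraNneq v0 => ->; rewrite (nn_wpr0 charK0 uP sim TG hT hg0 Bb TB uQ hQ nv).
split; first exact: wpr_Phi LGv m0 v0.
exists (wpr mu v); split=> //; first exact: (gs_wpr charK0 uP sim TG hT).
exact: (LieB_wpr charK0 uP hT Bb TB).
Qed.

Lemma wpr_wts mu z : wpr mu z != 0 -> mu \in wts w.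
Proof.
apply: contraR => ms; apply/eqP; apply: (co_inj uP); apply/matrixP => i j.
rewrite co_wpr // co0 mxe0; case: eqP => // e0; by move: ms; rewrite -e0 mem_wts.
Qed.

Lemma Phi_wts mu : Phi mu -> mu \in wts w.
Proof. by move=> [_ [x x0 [_ hx]]]; apply: (@wpr_wts mu x); rewrite hx. Qed.

(** Some Cartan integer between two summands is negative, since those with a fixed
    summand add up to zero; the two summands can be replaced by their sum, a
    positive root. *)
Lemma pos_zerosum (t : seq 'rV[int]_r) : t != [::] -> (forall de, de \in t -> pos de) ->
  \sum_(de <- t) de != 0.
Proof.
have [a [a2 _ _ aneg [_ a0 _]]] := cartan_integers charK0 uP sim TG hT hg0.
move: {2}(size t) (leqnn (size t)) => k; elim: k t => [|k IH] [|de t] //= st _ pt; apply/eqP => s0.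
have pd : pos de by apply: pt; rewrite mem_head.
have hP be : be \in de :: t -> Phi be by move=> /pt [].
have := a0 de (de :: t) pd.1 hP s0; rewrite big_cons (a2 _ pd.1) => asum.
have [be bt ab] : exists2 be, be \in t & (a be de < 0)%R.
  apply: contrapT => h; have : (0 <= \sum_(be <- t) a be de)%R.
    rewrite big_seq; apply: Num.Theory.sumr_ge0 => be bt; rewrite Order.TotalTheory.leNgt.
    by apply/negP => ab; apply: h; exists be.
  by move: asum; move: (\sum_(be <- t) a be de) => S; lia.
have pb : pos be by apply: pt; rewrite inE bt orbT.
have [e0|Pbd] := aneg de be pd.1 pb.1 ab.
  apply: (pos_not pb); have -> : - be = de by apply/eqP; rewrite eq_sym -addr_eq0 addrC e0.
  exact: pd.
have := IH ((be + de) :: rem be t); rewrite /= size_rem // => h.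
have : \sum_(i <- (be + de) :: rem be t) i != 0.
  apply: h => //; first by case: (t) bt st.
  move=> ga; rewrite inE => /orP [/eqP ->|/mem_rem gt]; first exact: pos_add.
  by apply: pt; rewrite inE gt orbT.
suff -> : \sum_(i <- (be + de) :: rem be t) i = 0 by rewrite eqxx.
by apply: etrans s0; rewrite !big_cons (big_rem be bt) /= [be + de]addrC addrA.
Qed.

(** A large multiple of a functional positive on the positive roots, perturbed by a
    functional that separates the weights. *)
Lemma pos_functional : exists u : 'I_r -> int, (forall de, pos de -> (0 < pair u de)%R) /\
  (forall mu nu, mu \in wts w -> nu \in wts w -> pair u mu = pair u nu -> mu = nu).
Proof.
pose S := [seq de <- wts w | `[< pos de >]].
have [|u hu] := @gordan r S.
  by move=> t t0 tS; apply: pos_zerosum => // de /tS; rewrite mem_filter => /andP [/asboolP].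
pose Df := [seq x <- [seq mu - nu | mu <- wts w, nu <- wts w] | x != 0].
have [|g hg] := generic charK0 (s := Df); first by move=> mu; rewrite mem_filter => /andP [].
pose M : nat := (\sum_(mu <- Df ++ S) absz (pair g mu)).+1.
have gM mu : mu \in Df ++ S -> (absz (pair g mu) < M)%N.
  by move=> ms; rewrite /M (big_rem mu ms) /= ltnS leq_addr.
pose u' l := M%:Z * u l + g l.
have pE mu : pair u' mu = M%:Z * pair u mu + pair g mu.
  by rewrite /pair mulr_sumr -big_split; apply: eq_bigr => l _; rewrite /u' mulrDr mulrCA.
exists u'; split=> [de pd|mu nu ms ns e].
  have dS : de \in S by rewrite mem_filter Phi_wts ?andbT; [apply/asboolP | case: pd].
  have := hu de dS; have := gM de; rewrite mem_cat dS orbT pE => /(_ isT) h1 h2; exact: dom_pos.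
apply/eqP; rewrite -subr_eq0; apply: contraT => ne.
have md : mu - nu \in Df by rewrite mem_filter ne; apply/allpairsP; exists (mu, nu).
have := hg _ md; have := gM (mu - nu); rewrite mem_cat md => /(_ isT) h1 h2.
have := dom_neq0 (pair u (mu - nu)) h2 h1; rewrite -pE.
by rewrite pairD pairN e subrr eqxx.
Qed.

End PositiveRoots.

(** * Elements of height two and their inner ideal *)

Section CommutingNilpotents.
Variables (V : zmodType) (A C : V -> V).
Hypotheses (AB : forall u v, A (u - v) = A u - A v) (CB : forall u v, C (u - v) = C u - C v)
  (AC : forall u, A (C u) = C (A u)).

Lemma iter_diff0 p q u : iter p A u = 0 -> iter q C u = 0 ->
  iter (p + q) (fun u => A u - C u) u = 0.
Proof.
have zm (a b c d : V) : (a - b) - (c - d) = (a - c) - (b - d).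
  by rewrite !opprB addrACA [RHS]addrACA [- b - c]addrC.
have DB k a b : iter k (fun u => A u - C u) (a - b) =
    iter k (fun u => A u - C u) a - iter k (fun u => A u - C u) b.
  by elim: k => //= k ->; rewrite AB CB; exact: zm.
have D0 k : iter k (fun u => A u - C u) 0 = 0 by have := DB k 0 0; rewrite !subrr.
have AC' k a : A (iter k C a) = iter k C (A a) by elim: k => //= k <-; rewrite AC.
have CA' k a : C (iter k A a) = iter k A (C a) by elim: k => //= k <-; rewrite AC.
have A0 : A 0 = 0 by have := AB 0 0; rewrite !subrr.
have C0 : C 0 = 0 by have := CB 0 0; rewrite !subrr.
move: {2}(p + q)%N (leqnn (p + q)) => m; elim: m p q u => [|m IH] p q u.
  by case: p q => [|p] [|q] //= _ ->.
case: p => [|p]; first by move=> _ u0 _; have -> : u = 0 := u0; rewrite D0.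
case: q => [|q]; first by move=> _ _ u0; have -> : u = 0 := u0; rewrite D0.
move=> h hp hq; rewrite addSn iterSr DB addnS.
have h1 : iter p A (A u) = 0 by rewrite -iterSr.
have h2 : iter q C (C u) = 0 by rewrite -iterSr.
have hA : iter q.+1 C (A u) = 0 by rewrite -AC' hq A0.
have hC : iter p.+1 A (C u) = 0 by rewrite -CA' hp C0.
have := IH p q.+1 (A u) _ h1 hA; rewrite addnS => -> //; last by move: h; rewrite addSn addnS ltnS.
have := IH p.+1 q (C u) _ hC h2; rewrite addSn => ->; first by rewrite subrr.
by move: h; rewrite addSn addnS ltnS.
Qed.

End CommutingNilpotents.

Lemma adE (K : closedFieldType) (n : nat) (x y : 'M[K]_n) : ad x y = x * y - y * x.
Proof. by []. Qed.

Section AbstractHeightTwo.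
Variables (K : closedFieldType) (charK0 : [pchar K] =i pred0) (n : nat).
Variables (br : 'M[K]_n -> 'M[K]_n -> 'M[K]_n) (g : 'M[K]_n -> Prop) (x : 'M[K]_n).
Hypotheses (brDr : forall a b c, br a (b + c) = br a b + br a c)
  (brZr : forall k a b, br a (k *: b) = k *: br a b) (br0l : forall a, br 0 a = 0)
  (jac : forall a b c, br a (br b c) = br (br a b) c + br b (br a c)).
Hypotheses (gD : forall a b, g a -> g b -> g (a + b)) (gZ : forall k a, g a -> g (k *: a))
  (gB : forall a b, g a -> g b -> g (br a b)) (gx : g x).
Notation X := (br x).
Hypothesis x3 : forall z, g z -> X (X (X z)) = 0.

Let br0r a : br a 0 = 0. Proof. by have := brZr 0 a 0; rewrite !scale0r. Qed.
Let brNr a b : br a (- b) = - br a b.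
Proof. by rewrite -scaleN1r brZr scaleN1r. Qed.
Let brBr a b c : br a (b - c) = br a b - br a c. Proof. by rewrite brDr brNr. Qed.
Let xX z : g z -> g (X z). Proof. exact: gB. Qed.

Lemma der_br2 y z : X (X (br y z)) = br (X (X y)) z + 2%:R *: br (X y) (X z) + br y (X (X z)).
Proof.
rewrite (jac x y z) brDr (jac x (X y) z) (jac x y (X z)); move: (br (br x (br x y)) z) (br (X y) (X z)) (br y _) => p q s.
by apply/matrixP => i j; rewrite !mxE; ring.
Qed.

Lemma der_br3 y z : X (X (X (br y z))) = br (X (X (X y))) z + 3%:R *: br (X (X y)) (X z) +
  3%:R *: br (X y) (X (X z)) + br y (X (X (X z))).
Proof.
rewrite (jac x y z) !brDr der_br2 (der_br2 y (X z)).
rewrite -[X in _ = _ + _ *: X + _ + _]/(br (X (X y)) (X z)).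
move: (br (X (X (X y))) z) (br (X (X y)) (X z)) (br (X y) (X (X z))) (br y _) => p q s t.
by apply/matrixP => i j; rewrite !mxE; ring.
Qed.

(** The two mixed terms of the third derivative of [br y z] cancel. *)
Lemma X2_X y z : g y -> g z -> X (X (br y (X z))) = X (br y (X (X z))).
Proof.
move=> gy gz; have := der_br3 y z; have := der_br2 y (X z).
rewrite (jac x y (X (X z))) !x3 //; last exact: gB.
rewrite br0l br0r add0r !addr0 => -> e.
have h3 : 3%:R != 0 :> K by exact: (nat_neq0 charK0 2).
have /eqP := esym e; rewrite -scalerDr scaler_eq0 (negPf h3) /= => /eqP e'.
apply/eqP; rewrite -subr_eq0 -e'; apply/eqP.
move: (br (X (X y)) (X z)) (br (X y) (X (X z))) => p q.
by apply/matrixP => i j; rewrite !mxE; ring.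
Qed.

Lemma X2_X2 y z : g y -> g z -> X (X (br y (X (X z)))) = 0.
Proof. by move=> gy gz; rewrite X2_X //; [rewrite x3 // !br0r | exact: xX]. Qed.

(** The image of [X^2]. *)
Definition aa v := exists2 y, g y & v = X (X y).

Lemma aa_lin c u v : aa u -> aa v -> aa (c *: u + v).
Proof.
move=> [y gy ->] [z gz ->]; exists (c *: y + z); first by apply: gD => //; apply: gZ.
by rewrite !(brDr, brZr).
Qed.

Lemma br_X2 y v : br (X (X y)) v = X (X (br y v)) - 2%:R *: X (br y (X v)) + br y (X (X v)).
Proof.
rewrite (der_br2 y v) (jac x y (X v)).
move: (br (X (X y)) v) (br (X y) (X v)) (br y (X (X v))) => p q s.
by apply/matrixP => i j; rewrite !mxE; ring.
Qed.

Lemma aa_abelian u v : aa u -> aa v -> br u v = 0.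
Proof.
move=> [y gy ->] [z gz ->]; by rewrite br_X2 X2_X2 // (x3 gz) !br0r scaler0 subr0 add0r.
Qed.

(** The element found is [X^2] of [br y (br y' (X (X z)))], for [u = X (X y)] and
    [v = X (X y')]. *)
Lemma aa_inner u v z : aa u -> aa v -> g z -> aa (br u (br v z)).
Proof.
move=> [y gy ->] [y' gy' ->] gz; pose t := br y' (X (X z)); pose q := br y' (X z).
have gq : g q by apply: gB => //; exact: xX.
have gt : g t by apply: gB => //; do 2!apply: xX.
have sE := br_X2 y' z; set s := br (X (X y')) z in sE *.
have gq0 : g (br y' z) by exact: gB.
have Xq : X (X q) = X t by exact: X2_X.
have Xs : X s = - X t.
  rewrite sE brDr brBr brZr x3 // -/q Xq -/t sub0r.
  by move: (X t) => p; apply/matrixP => i j; rewrite !mxE; ring.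
have X2s : X (X s) = 0 by rewrite Xs brNr /t X2_X2 // oppr0.
have e : X (X (br y s)) = - (2%:R *: X (br y (X t))) + X (X (br y t)).
  rewrite sE -/q -/t !(brDr, brNr, brZr) X2_X2 // X2_X // Xq; by rewrite add0r.
exists (br y t); first exact: gB.
rewrite (br_X2 y s) X2s br0r addr0 Xs !brNr e.
move: (X (br y (X t))) (X (X (br y t))) => p p'; apply/matrixP => i j; rewrite !mxE; ring.
Qed.

(** If [br h x = X (X q)], the brackets with [h] and with [x] commute up to the
    bracket with an element of [aa]. *)
Lemma aa_stable h v : g h -> aa (br h x) -> aa v -> aa (br h v).
Proof.
move=> gh [q gq e] [y gy ->].
have e1 z : br h (X z) = br (X (X q)) z + X (br h z) by rewrite (jac h x z) e.
exists (br h y - 2%:R *: br q (X y)).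
  rewrite -scaleN1r; apply: gD; first exact: gB.
  by do 2!apply: gZ; apply: gB => //; exact: xX.
have gqy : g (br q y) by exact: gB.
rewrite e1 e1 (br_X2 q (X y)) (br_X2 q y) x3 // -(X2_X gq gy) br0r addr0.
rewrite !(brDr, brNr, brZr) x3 // -(X2_X gq gy).
move: (X (X (br q (X y)))) (X (X (br h y))) => p p'; apply/matrixP => i j; rewrite !mxE; ring.
Qed.

End AbstractHeightTwo.

Section HeightTwo.
Variables (K : closedFieldType) (charK0 : [pchar K] =i pred0) (n r : nat).
Variables (P : 'M[K]_n) (uP : P \in unitmx) (w : 'I_n -> 'rV[int]_r) (G T B : set 'M[K]_n).
Hypotheses (sim : almost_simple G) (TG : T `<=` G)
  (hT : forall A, T A <-> exists2 d, nz d & A = tt P w d)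
  (hg0 : forall y, Lie G y -> (forall t, T t -> t * y = y * t) ->
    exists b v, nilp v /\ y = hh P w b + v)
  (Bb : borel_subgroup G B) (TB : T `<=` B).
Variables (Q : 'M[K]_n) (uQ : Q \in unitmx) (hQ : forall h, B h -> lvl 0 (invmx Q *m h *m Q)).
Implicit Types (x y z v e f : 'M[K]_n) (mu nu al be de : 'rV[int]_r).
Notation wt := (wt P w).
Notation wpr := (wpr P w).
Notation hh := (hh P w).
Notation gs := (gs P w G).
Notation Phi := (Phi P w G).
Notation nn := (nn B Q).

Let LB x y : Lie G x -> Lie G y -> Lie G (ad x y) := Lie_bracket charK0 (sim_sub sim) (y := y).

(** The semisimple part of [x] lies in the Lie algebra, and its adjoint action there
    is both diagonalisable and nilpotent; it is central, hence zero. *)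
Lemma ad_nilp_matrix x k : Lie G x -> (forall z, Lie G z -> iter k (ad x) z = 0) -> nilp x.
Proof.
move=> Lx hx.
have [P' [a [v [m [N [b [uP' xE nv cs [aN ib hc]]]]]]]] := jordan_Lie charK0 (sim_sub sim) (sim_zc sim) Lx.
pose s := dc P' a.
have Ls : Lie G s.
  have -> : s = \sum_j b j *: dc P' (fun i => (N i j)%:~R).
    under eq_bigr do rewrite dcZ //.
    by rewrite dc_sum //; apply: eq_dc => i; rewrite aN; apply: eq_bigr => j _; rewrite mulrC.
  by apply: Lie_comb => j _; apply: (cochar_Lie charK0) => // c c0; apply: hc.
have sv : ad s v = 0.
  have -> : v = x - s by rewrite xE addrC addKr.
  by rewrite adBr adxx subr0 adE (cs x erefl) subrr.
have xv : ad x v = 0 by rewrite xE adDl sv adxx addr0.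
have sE z : ad s z = ad x z - ad v z by rewrite xE adDl addrK.
have comm z : ad x (ad v z) = ad v (ad x z) by rewrite jacobi xv ad0l add0r.
have s0 : s = 0.
  apply: (center0 charK0 uP sim TG hT hg0 Ls) => z Lz.
  have : iter (k + (n + n)) (ad s) z = 0.
    rewrite (eq_iter sE); apply: iter_diff0 => //.
    - by move=> u u'; rewrite adBr.
    - by move=> u u'; rewrite adBr.
    - exact: hx.
    - exact: (iter_ad_nilp charK0).
  have entry j z' i i' : (P' * iter j (ad s) z' * invmx P') i i' = (a i - a i') ^+ j * (P' * z' * invmx P') i i'.
    elim: j => [|j IH]; first by rewrite expr0 mul1r.
    rewrite iterS adE mulrBr mulrBl mxeB dc_conjl // dc_conjr // dgm_mull dgm_mulr IH exprS.
    by rewrite [X in _ - X]mulrC -mulrBl mulrA.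
  move=> h; rewrite -(conjK (ad s z) uP') (_ : P' * ad s z * invmx P' = 0) ?mulr0 ?mul0r //.
  apply/matrixP => i j; rewrite mxe0 (entry 1%N) expr1.
  have := entry (k + (n + n))%N z i j; rewrite h mulr0 mul0r mxe0 => /esym /eqP.
  rewrite mulf_eq0 expf_eq0 => /orP [/andP [_ /eqP ->]|/eqP ->]; by rewrite ?mul0r ?mulr0.
by rewrite xE -/s s0 add0r.
Qed.

Variable (x : 'M[K]_n).
Hypotheses (Lx : Lie G x) (x3 : forall z, Lie G z -> ad x (ad x (ad x z)) = 0).
Notation X := (ad x).

Lemma x_nilp : nilp x. Proof. by apply: (@ad_nilp_matrix x 3). Qed.

Lemma xX z : Lie G z -> Lie G (X z). Proof. exact: LB. Qed.
Hint Resolve xX : core.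

Notation aa := (aa (@ad K n) (Lie G : 'M[K]_n -> Prop) x).

Lemma aa_subsp : subsp aa.
Proof.
split; first by exists 0; [exact: Lie0 | rewrite !ad0r].
move=> c u v; apply: (aa_lin (@adDr K n) (@adZr K n)) => [a b|k a]; [exact: LieD | exact: LieZ].
Qed.

Lemma aa_Lie v : aa v -> Lie G v. Proof. by move=> [y Ly ->]; apply: xX; apply: xX. Qed.

Lemma tr_X y z : \tr (X y * z) = - \tr (y * X z).
Proof. by rewrite adC mulNr raddfN /= tr_ad. Qed.

(** [X] is skew for the form, so [X^2] is self-adjoint. *)
Lemma perp_aa y : Lie G y -> (forall v, aa v -> \tr (y * v) = 0) -> X (X y) = 0.
Proof.
move=> Ly hy; apply: (form_nondeg charK0 sim); first by do 2!apply: xX.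
by move=> z Lz; rewrite !tr_X opprK hy //; exists z.
Qed.

(** Otherwise some [y] with [X (X y) = 0] would pair nontrivially with [x], although
    [x * y] is nilpotent by [nilp_mul_ad]. *)
Lemma aa_x : aa x.
Proof.
apply: contrapT => h; have [y [Ly hy]] := perp_sep charK0 sim aa_subsp aa_Lie Lx h.
case/eqP; rewrite trM; apply: nilp_tr0; apply: (nilp_mul_ad charK0 x_nilp).
exact: perp_aa.
Qed.

Lemma aa_nilp v : aa v -> nilp v.
Proof. by move=> [y Ly ->]; apply: (jacobson charK0); rewrite x3. Qed.

(** [aa] is the orthogonal of the kernel of [X^2], and [X] is skew for the form. *)
Lemma X_perp u : Lie G u ->
  (forall k, Lie G k -> X (X k) = 0 -> \tr (u * X k) = 0) -> aa (X u).
Proof.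
move=> Lu hu; apply: contrapT => h.
have [y [Ly hy]] := perp_sep charK0 sim aa_subsp aa_Lie (xX Lu) h.
case/eqP; have := tr_X y u; rewrite trM (hu y Ly (perp_aa Ly hy)) => /esym/eqP.
by rewrite oppr_eq0 => /eqP.
Qed.

(** Otherwise some [y] would be orthogonal to [nn], hence lie in the Lie algebra of
    [B], and to all [z] of that algebra with [X z] in [aa], but not to [hh b].
    By [X_perp], [y] is congruent modulo [nn] to some [X k] with [X (X k) = 0]; this
    is nilpotent by Jacobson, hence in [nn], which is orthogonal to [hh b]. *)
Lemma cartan_lift b : exists z, [/\ Lie B z, aa (X z) & nn (z - hh b)].
Proof.
apply: contrapT => hb; have sN := nn_subsp B Q; have sA := aa_subsp.
have nL v : nn v -> Lie G v by move=> /nn_Lie; exact: LieBG.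
pose W v := exists z m, [/\ Lie B z, aa (X z), nn m & v = z + m].
have sW : subsp W.
  split; first by exists 0, 0; rewrite ad0r addr0; split=> //; [exact: Lie0 | exact: (subsp0 sA) | exact: (subsp0 sN)].
  move=> c _ _ [z [m [Lz hz hm ->]]] [z' [m' [Lz' hz' hm' ->]]]; exists (c *: z + z'), (c *: m + m'); split.
  - by apply: LieD => //; apply: LieZ.
  - by rewrite adDr adZr; apply: sA.2.
  - exact: sN.2.
  - by rewrite scalerDr addrACA.
have WL v : W v -> Lie G v.
  by move=> [z [m [Lz _ hm ->]]]; apply: LieD; [exact: (LieBG Bb Lz) | exact: nL].
have Lh : Lie G (hh b) by exact: (Lie_hh charK0 uP TG hT).
have nW : ~ W (hh b).
  move=> [z [m [Lz hz hm e]]]; apply: hb; exists z; split=> //.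
  by rewrite e opprD addrA subrr sub0r; apply: (subspN sN).
have [y [Ly hy yh]] := perp_sep charK0 sim sW WL Lh nW.
have By : Lie B y.
  apply: (perp_n charK0 uP sim TG hT hg0 Bb TB uQ hQ Ly) => m hm; apply: hy.
  by exists 0, m; rewrite ad0r add0r; split=> //; [exact: Lie0 | exact: (subsp0 sA)].
pose W2 v := exists k m, [/\ Lie G k, X (X k) = 0, nn m & v = X k + m].
have sW2 : subsp W2.
  split; first by exists 0, 0; rewrite !ad0r addr0; split=> //; [exact: Lie0 | exact: (subsp0 sN)].
  move=> c _ _ [z [m [Lz hz hm ->]]] [z' [m' [Lz' hz' hm' ->]]]; exists (c *: z + z'), (c *: m + m'); split.
  - by apply: LieD => //; apply: LieZ.
  - by rewrite (adDr x (c *: z) z') (adZr c x z) (adDr x (c *: X z) (X z')) (adZr c x (X z)) hz hz' scaler0 addr0.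
  - exact: sN.2.
  - by rewrite adDr adZr scalerDr addrACA.
have W2L v : W2 v -> Lie G v.
  by move=> [z [m [Lz _ hm ->]]]; apply: LieD; [exact: xX | exact: nL].
have : W2 y.
  apply: contrapT => nW2; have [u [Lu hu]] := perp_sep charK0 sim sW2 W2L Ly nW2.
  case/eqP; rewrite trM; apply: hy; exists u, 0; rewrite addr0; split=> //; last exact: (subsp0 sN).
    apply: (perp_n charK0 uP sim TG hT hg0 Bb TB uQ hQ Lu) => m hm; apply: hu.
    by exists 0, m; rewrite !ad0r add0r; split=> //; exact: Lie0.
  apply: X_perp => // k Lk hk; apply: hu; exists k, 0; rewrite addr0; split=> //; exact: (subsp0 sN).
move=> [k [m [Lk hk hm e]]].
have nXk : nn (X k).
  apply: (nn_of_nilp charK0 Bb uQ hQ); last exact: (jacobson charK0).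
  by have -> : X k = y - m by [rewrite e addrK]; apply: (subspB (subsp_Lie B)) => //; exact: nn_Lie hm.
case/eqP: yh; apply: (nn_perp charK0 Bb uQ hQ); last exact: (LieB_hh charK0 uP hT TB).
by rewrite e; apply: (subspD sN).
Qed.

End HeightTwo.

(** * Conjugation to a regular element of the Cartan subalgebra *)

Section ExpTail.
Variables (K : closedFieldType) (charK0 : [pchar K] =i pred0) (n : nat).
Implicit Types (y v : 'M[K]_n).

Lemma expm_tail2 (W : 'M[K]_n -> Prop) y v : subsp W -> nilp y ->
  (forall k, W (iter k.+2 (ad y) v)) -> W (mxconj (expm y) v - v - ad y v).
Proof.
move=> sW ny h; case: (ltnP 0 n) => n0; last first.
  suff -> : mxconj (expm y) v - v - ad y v = 0 by exact: (subsp0 sW).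
  by move: (mxconj _ _ - _ - _) => A; case: (n) n0 A => // _ A; exact: mx0_eq.
rewrite /mxconj expmV // !mulmxE (expm_conj charK0 v ny).
have [m e] : exists m, (n + n = m.+2)%N by exists (n + n).-2; lia.
have -> : \sum_(k < n + n) (k`!%:R)^-1 *: iter k (ad y) v =
    v + (ad y v + \sum_(k < m) (k.+2`!%:R)^-1 *: iter k.+2 (ad y) v).
  by rewrite e !big_ord_recl /= invr1 !scale1r.
rewrite [v + _]addrC addrK [ad y v + _]addrC addrK; apply: (subsp_msum _ sW) => k _.
by apply: (subspZ _ sW).
Qed.

Lemma expm_tail1 (W : 'M[K]_n -> Prop) y v : subsp W -> nilp y ->
  (forall k, W (iter k.+1 (ad y) v)) -> W (mxconj (expm y) v - v).
Proof.
move=> sW ny h; rewrite -[_ - v](subrK (ad y v)); apply: (subspD sW); last exact: (h 0%N).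
by apply: expm_tail2 => // k; apply: h.
Qed.

End ExpTail.

Section Levels.
Variables (K : closedFieldType) (charK0 : [pchar K] =i pred0) (n r : nat).
Variables (P : 'M[K]_n) (uP : P \in unitmx) (w : 'I_n -> 'rV[int]_r) (G T B : set 'M[K]_n).
Hypotheses (sim : almost_simple G) (TG : T `<=` G)
  (hT : forall A, T A <-> exists2 d, nz d & A = tt P w d)
  (hg0 : forall y, Lie G y -> (forall t, T t -> t * y = y * t) ->
    exists b v, nilp v /\ y = hh P w b + v)
  (Bb : borel_subgroup G B) (TB : T `<=` B).
Implicit Types (x y z v e f : 'M[K]_n) (mu nu al be de : 'rV[int]_r).
Notation wt := (wt P w).
Notation wpr := (wpr P w).
Notation hh := (hh P w).
Notation gs := (gs P w G).
Notation Phi := (Phi P w G).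
Notation triple := (triple P w G).
Notation pos := (pos P w G B).
Notation wts := (wts w).
Variable (u : 'I_r -> int).
Hypotheses (u_pos : forall de, pos de -> (0 < pair u de)%R)
  (u_inj : forall mu nu, mu \in wts -> nu \in wts -> pair u mu = pair u nu -> mu = nu).

Lemma pair0 : pair u 0 = 0.
Proof. by rewrite /pair big1 // => l _; rewrite mxE mul0r. Qed.

(** The filtration of matrices by the values of [u] on their weights. *)
Definition lev (k : int) v := forall mu, wpr mu v != 0 -> (k <= pair u mu)%R.

Lemma lev_subsp k : subsp (lev k : 'M[K]_n -> Prop).
Proof.
split=> [mu|c y v hy hv mu]; first by rewrite wpr0 // eqxx.
rewrite wprD // wprZ //; have [-> |/hy //] := eqVneq (wpr mu y) 0.
by rewrite scaler0 add0r => /hv.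
Qed.

Lemma lev_le k l v : (l <= k)%R -> lev k v -> lev l v.
Proof. by move=> lk hv mu /hv; exact: Order.le_trans. Qed.

Lemma lev_wt k mu v : wt mu v -> (k <= pair u mu)%R -> lev k v.
Proof.
move=> hv km nu; case: (eqVneq mu nu) => [<- //|ne].
by rewrite (wt_neq uP hv ne) eqxx.
Qed.

Lemma lev_ad k l y v : lev k y -> lev l v -> lev (k + l) (ad y v).
Proof.
move=> hy hv; rewrite -(wpr_sum uP w y) -(wpr_sum uP w v) ad_suml.
have sL := lev_subsp (k + l).
apply: (subsp_msum _ sL) => mu _; rewrite ad_sumr; apply: (subsp_msum _ sL) => nu _.
have [-> |/hy h1] := eqVneq (wpr mu y) 0; first by rewrite ad0l; exact: (subsp0 sL).
have [-> |/hv h2] := eqVneq (wpr nu v) 0; first by rewrite ad0r; exact: (subsp0 sL).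
apply: (lev_wt (wt_ad uP (wt_wpr uP w mu y) (wt_wpr uP w nu v))).
by rewrite pairD; lia.
Qed.

(** A level above all weights. *)
Definition topl : int := (\sum_(mu <- wts) absz (pair u mu)).+1.

Lemma lev_top v : lev topl v -> v = 0.
Proof.
move=> hv; rewrite -(wpr_sum uP w v) big_seq big1 // => mu ms; apply/eqP; apply: contraT => /hv.
have : (absz (pair u mu) <= \sum_(mu <- wts) absz (pair u mu))%N by rewrite (big_rem mu ms) /= leq_addr.
by rewrite /topl; lia.
Qed.

Lemma lev_iter j l y v k : (0 <= j)%R -> lev j y -> lev l v -> lev (l + j) (iter k.+1 (ad y) v).
Proof.
move=> j0 hy hv; elim: k => [|k IH]; first by rewrite addrC; exact: lev_ad.
by apply: lev_le (lev_ad hy IH); lia.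
Qed.

(** The eigenvalue of [ad hu] in weight [mu] is [pair u mu], so that [hu] is regular. *)
Definition hu := hh (fun l => (u l)%:~R).

Lemma ev_u mu : ev (fun l => (u l)%:~R : K) mu = (pair u mu)%:~R.
Proof. by rewrite /ev /pair rmorph_sum; apply: eq_bigr => l _; rewrite rmorphM. Qed.

Definition lc j v := \sum_(mu <- wts | pair u mu == j) wpr mu v.

Lemma lev_lc j v : lev j v -> lev (j + 1) (v - lc j v).
Proof.
move=> hv; rewrite -{1}(wpr_sum uP w v) /lc [\sum_(mu <- wts) _](bigID (fun mu => pair u mu == j)) /=.
rewrite addrC addrK; apply: (subsp_msum _ (lev_subsp _)) => mu ne.
have [-> |/hv h] := eqVneq (wpr mu v) 0; first exact: (subsp0 (lev_subsp _)).
by apply: (lev_wt (wt_wpr uP w mu v)); move: ne => /eqP; lia.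
Qed.

Lemma wpr_ad al be x v : wt al x -> wpr (al + be) (ad x v) = ad x (wpr be v).
Proof.
move=> hx; rewrite -{1}(wpr_sum uP w v) ad_sumr wpr_bigsum //.
have h nu : nu != be -> wpr (al + be) (ad x (wpr nu v)) = 0.
  move=> ne; apply: (wt_neq uP (wt_ad uP hx (wt_wpr uP w nu v))).
  by rewrite (inj_eq (addrI al)).
have [b0|b0] := eqVneq (wpr be v) 0.
  rewrite b0 ad0r big1 // => nu _; have [-> |/h //] := eqVneq nu be.
  by rewrite b0 ad0r wpr0.
rewrite (bigD1_seq be) ?wts_uniq //= ?(wpr_wts uP b0) //.
rewrite big1 ?addr0 => [|nu]; last exact: h.
exact: (wt_ad uP hx (wt_wpr uP w be v)).
Qed.

Section BorelPart.
Variables (Q : 'M[K]_n) (uQ : Q \in unitmx) (hQ : forall h, B h -> lvl 0 (invmx Q *m h *m Q)).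
Notation nn := (nn B Q).

Lemma nn_lev v : nn v -> lev 1 v.
Proof.
move=> nv mu /(nn_supp charK0 uP sim TG hT hg0 Bb TB uQ hQ nv) /u_pos; lia.
Qed.

Lemma nn_iter y v k : nn y -> nn v -> nn (iter k (ad y) v).
Proof.
by move=> ny nv; elim: k => // k IH; apply: (nn_ad charK0 Bb uQ hQ) => //; exact: nn_Lie IH.
Qed.

(** The component of [v] of lowest level [j] is the bracket of [hu] with its [j]-th
    part; conjugating by the exponential of the latter leaves only higher levels. *)
Lemma conj_reg m v : nn v -> lev (topl - m%:Z) v -> exists2 b, B b & mxconj b (hu + v) = hu.
Proof.
elim: m v => [|m IH] v nv hv.
  exists 1%:M; first by case: (B_sub Bb).
  by rewrite /mxconj invmx1 mul1mx mulmx1 (lev_top (v := v)) ?addr0 // -[topl]subr0.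
pose j := topl - m.+1%:Z; have hj : topl - m%:Z = j + 1 by rewrite /j; lia.
(* [nn] has only positive levels *)
case: (Order.TotalTheory.leP j 0) => j0.
  by apply: IH => //; apply: lev_le (nn_lev nv); rewrite hj; lia.
have jn0 : (j%:~R : K) != 0 by rewrite int_eq0 //; lia.
have snn := nn_subsp B Q.
have nlc : nn (lc j v) by apply: (subsp_msum _ snn) => mu _; exact: (nn_wpr charK0 uP hT Bb TB uQ hQ).
pose y := (j%:~R)^-1 *: lc j v.
have ny : nn y by apply: (subspZ _ snn).
have ly : lev j y.
  apply: (subspZ _ (lev_subsp j)); apply: (subsp_msum _ (lev_subsp j)) => mu /eqP e.
  by apply: (lev_wt (wt_wpr uP w mu v)); rewrite e.
have yh : ad y hu = - lc j v.
  rewrite adC /y adZr /lc ad_sumr; congr (- _); rewrite scaler_sumr; apply: eq_bigr => mu /eqP e.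
  by rewrite (wt_hh uP _ (wt_wpr uP w mu v)) ev_u e scalerA mulVf // scale1r.
have nily := nn_nilp uQ ny; have By : B (expm y) by exact: (exp_nn_mem charK0 Bb uQ ny).
pose v' := mxconj (expm y) (hu + v) - hu.
have mD a b : mxconj (expm y) (a + b) = mxconj (expm y) a + mxconj (expm y) b.
  by have := mxconj_lin (expm y) 1 a b; rewrite !scale1r.
have nv' : nn v'.
  rewrite /v' mD addrAC; apply: (subspD snn); last exact: (nn_Ad charK0 Bb uQ hQ).
  apply: (expm_tail1 charK0 snn nily) => k; rewrite iterSr yh; apply: nn_iter => //.
  exact: (subspN snn).
have lv' : lev (topl - m%:Z) v'.
  have -> : v' = (mxconj (expm y) hu - hu - ad y hu) + (mxconj (expm y) v - v) + (v - lc j v).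
    rewrite /v' mD yh; move: (mxconj (expm y) hu) (mxconj (expm y) v) (lc j v) hu => a b c d.
    by apply/matrixP => i i'; rewrite !mxE; ring.
  rewrite hj; have sL := lev_subsp (j + 1); apply: (subspD sL); last exact: lev_lc.
  apply: (subspD sL).
    apply: (expm_tail2 charK0 sL nily) => k; rewrite iterSr yh.
    apply: (lev_le (k := 1 + j)); first by rewrite addrC.
    by apply: lev_iter => //; [lia | apply: nn_lev; exact: (subspN snn)].
  apply: (expm_tail1 charK0 sL nily) => k; rewrite addrC.
  by apply: lev_iter => //; [lia | exact: nn_lev].
have [b Bb' e] := IH v' nv' lv'.
exists (b *m expm y); first by case: (B_sub Bb) => _ _ BM _; exact: BM.
rewrite mxconjM ?(B_unit Bb) // -[RHS]e; congr (mxconj b _).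
by rewrite /v' [RHS]addrC subrK.
Qed.

End BorelPart.

Definition so al be := [/\ al <> be, al <> - be, ~ Phi (al + be) & ~ Phi (al - be)].

Lemma gs_nonroot nu z : nu != 0 -> ~ Phi nu -> gs nu z -> z = 0.
Proof.
move=> n0 nP gz; apply/eqP; apply: contraT => z0; case: nP; split=> //; by exists z.
Qed.

Let Pneg := PhiN charK0 uP sim TG hT hg0.

Lemma so_sym al be : so al be -> so be al.
Proof.
move=> [h1 h2 h3 h4]; split.
- by move=> e; apply: h1.
- by move=> e; apply: h2; rewrite e opprK.
- by rewrite addrC.
- by rewrite -opprB => /Pneg; rewrite opprK.
Qed.

Lemma tri_h0 al e f c : triple al e f c -> hh c != 0.
Proof.
move=> tri; apply: contraNneq (tr_k tri) => h0.
have := tr_hh uP c (tr_e tri).2 (tr_f tri).2; rewrite (tr_h tri) h0 mul0r mxtrace0 (tr_c tri).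
by move/esym/eqP; rewrite mulf_eq0 (negPf (two_neq0 charK0)).
Qed.

(** If [al + be] or [al - be] were a root, one of the brackets of [z] with [e] and
    [f] would not vanish, by [bracket_neq0]; and [z] is a multiple neither of [e]
    nor of [f], whose bracket is not zero. *)
Lemma so_of_comm al e f c be z : Phi al -> triple al e f c -> Phi be -> gs be z -> z != 0 ->
  ad e z = 0 -> ad f z = 0 -> so al be.
Proof.
move=> Pa tri Pb gz z0 ez fz; have [a0 _] := Pa; have [b0 _] := Pb.
have br := bracket_neq0 charK0 uP sim TG hT hg0.
have kh k : k *: hh c = 0 -> k = 0.
  by move=> /eqP; rewrite scaler_eq0 (negPf (tri_h0 tri)) orbF => /eqP.
split.
- move=> e1; rewrite -e1 in gz; have [k zk] := dim1 charK0 uP sim TG hT hg0 a0 tri gz.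
  have : k *: hh c = 0 by rewrite -(tr_h tri) adC scalerN -adZr -zk fz oppr0.
  by move=> /kh k0; move: z0; rewrite zk k0 scale0r eqxx.
- move=> e1; have gz' : gs (- al) z by rewrite e1 opprK.
  have na0 : - al != 0 by rewrite oppr_eq0.
  have [f' [c' tri']] := triple_ex charK0 uP sim TG hT hg0 na0 (tr_f tri) (tri_f0 tri).
  have [k zk] := dim1 charK0 uP sim TG hT hg0 na0 tri' gz'.
  have : k *: hh c = 0 by rewrite -(tr_h tri) -adZr -zk.
  by move=> /kh k0; move: z0; rewrite zk k0 scale0r eqxx.
- move=> Pab; have [x' x0 gx'] := Pab.2.
  by have := br al be e z x' Pa b0 (tr_e tri) gz gx' (tri_e0 tri) z0 x0; rewrite ez eqxx.
- move=> /Pneg; rewrite opprB addrC => Pab; have [x' x0 gx'] := Pab.2.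
  by have := br (- al) be f z x' (Pneg Pa) b0 (tr_f tri) gz gx' (tri_f0 tri) z0 x0; rewrite fz eqxx.
Qed.

End Levels.

(** * Splitting off root vectors *)

Section Elimination.
Variables (K : closedFieldType) (charK0 : [pchar K] =i pred0) (n r : nat).
Variables (P : 'M[K]_n) (uP : P \in unitmx) (w : 'I_n -> 'rV[int]_r) (G T B : set 'M[K]_n).
Hypotheses (sim : almost_simple G) (TG : T `<=` G)
  (hT : forall A, T A <-> exists2 d, nz d & A = tt P w d)
  (hg0 : forall y, Lie G y -> (forall t, T t -> t * y = y * t) ->
    exists b v, nilp v /\ y = hh P w b + v)
  (Bb : borel_subgroup G B) (TB : T `<=` B).
Variables (Q : 'M[K]_n) (uQ : Q \in unitmx) (hQ : forall h, B h -> lvl 0 (invmx Q *m h *m Q)).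
Implicit Types (x y z v e f : 'M[K]_n) (mu nu al be de : 'rV[int]_r).
Notation wt := (wt P w).
Notation wpr := (wpr P w).
Notation hh := (hh P w).
Notation gs := (gs P w G).
Notation Phi := (Phi P w G).
Notation triple := (triple P w G).
Notation nn := (nn B Q).
Notation pos := (pos P w G B).
Notation wts := (wts w).
Variable (u : 'I_r -> int).
Hypotheses (u_pos : forall de, pos de -> (0 < pair u de)%R)
  (u_inj : forall mu nu, mu \in wts -> nu \in wts -> pair u mu = pair u nu -> mu = nu).
Notation lev := (lev P w u).
Notation topl := (topl w u).
Notation so := (so P w G).

Variable aa : 'M[K]_n -> Prop.
Hypotheses (sA : subsp aa) (aaL : forall v, aa v -> Lie G v)
  (aa_ab : forall y v, aa y -> aa v -> ad y v = 0)
  (aa_in : forall y v z, aa y -> aa v -> Lie G z -> aa (ad y (ad v z)))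
  (aa_gr : forall mu v, aa v -> aa (wpr mu v))
  (aa_nil : forall v, aa v -> nilp v).

Let lev0 v (h : lev topl v) : v = 0 := lev_top uP h.

(** Turns brackets with [ad f y] into double brackets with elements of [aa], to which
    innerness applies. *)
Lemma ad_adC f y v : aa y -> aa v -> ad (ad f y) v = ad y (ad v f).
Proof.
move=> ay av; rewrite adC (jacobi v f y) (aa_ab av ay) ad0r addr0 adC opprK //.
Qed.

Section Step.
Variables (al0 : 'rV[int]_r) (e0 f0 : 'M[K]_n) (c0 : 'I_r -> K).
Hypotheses (P0 : Phi al0) (tri0 : triple al0 e0 f0 c0) (ae0 : aa e0).
Notation m0 := (pair u al0).

(** What the root vectors [ef] split off earlier retain with respect to the triple in
    use, and what makes them invariant under the conjugations of [kill_step]. *)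
Definition fixed (ef : 'M[K]_n * 'M[K]_n) := [/\ aa ef.1, ad ef.1 f0 = 0, ad ef.2 f0 = 0, ad ef.2 e0 = 0 &
  exists al, wt al ef.2].

(** Being killed by [e0], a vector of weight zero for the triple generates a trivial
    representation. *)
Lemma f0_kill be y : gs be y -> aa y -> ev c0 be = 0 -> ad f0 y = 0.
Proof.
move=> gy ay b0; apply/eqP; apply: contraT => g0; have [a0 _] := P0.
have e0y : ad e0 y = 0 by exact: aa_ab.
have e0g : ad e0 (ad f0 y) = 0.
  rewrite (jacobi e0 f0 y) (tr_h tri0) e0y ad0r addr0 (wt_hh uP c0 gy.2) b0 scale0r //.
have gg : gs (- al0 + be) (ad f0 y) by apply: (gs_ad charK0 uP sim (tr_f tri0) gy).
have [||k hk] := high_ad charK0 uP a0 tri0 g0 _ (l := ev c0 (- al0 + be)).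
- by rewrite e0g ad0r.
- exact: wt_hh gg.2.
move: hk; rewrite evD evN (tr_c tri0) b0 addr0 => hk.
by have /eqP := nat_neq0 charK0 k.+1; case; rewrite -addn2 natrD -hk addNr.
Qed.

(** Let [y_mu] be the components of [y] at the lowest level that [f0] does not kill.
    The combination [D] of the brackets [ad f0 y_mu], divided by Cartan integers, has
    positive level, hence lies in [nn]; its bracket with [e0] is the opposite of the
    sum of the [y_mu], so that conjugation by [expm D] removes them up to higher
    levels.  It preserves [aa] by innerness and fixes the vectors of [Es], whose
    brackets with [D] vanish. *)
Lemma kill_step k (Es : seq ('M[K]_n * 'M[K]_n)) y :
  (forall ef, ef \in Es -> fixed ef /\ ad ef.2 y = 0) ->
  aa y -> lev (m0 + 1) y -> lev (topl - k%:Z) (ad f0 y) ->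
  exists b y', [/\ B b, mxconj b (e0 + y) = e0 + y', aa y', lev (m0 + 1) y' &
    ad f0 y' = 0 /\ forall ef, ef \in Es -> mxconj b ef.1 = ef.1 /\ ad ef.2 y' = 0].
Proof.
elim: k y => [|k IH] y hE ay ly lf.
  exists 1%:M, y; split=> //; first by case: (B_sub Bb).
    by rewrite /mxconj invmx1 mul1mx mulmx1.
  split; first by apply: lev0; rewrite -[topl]subr0.
  by move=> ef /hE [_ h]; rewrite /mxconj invmx1 mul1mx mulmx1.
pose j := topl - k.+1%:Z; have hj : topl - k%:Z = j + 1 by rewrite /j; lia.
have [Lf0 hf0] := tr_f tri0; have [Le0 he0] := tr_e tri0.
have lf0 : lev (- m0) f0 by apply: (lev_wt uP hf0); rewrite pairN.
have le0 : lev m0 e0 by exact: (lev_wt uP he0).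
(* nothing to do up to level [0]: [y] has level above [m0], and [f0] has level [- m0] *)
case: (Order.TotalTheory.leP j 0) => j0.
  apply: IH => //; rewrite hj; apply: (lev_le _ (lev_ad uP lf0 ly)); lia.
have snn := nn_subsp B Q; have sj i := lev_subsp uP w u i.
have aw mu : aa (wpr mu y) by exact: aa_gr.
have gw mu : gs mu (wpr mu y) by split; [apply: aaL; exact: aw | exact: wt_wpr].
have gg mu : gs (- al0 + mu) (ad f0 (wpr mu y)) by apply: (gs_ad charK0 uP sim (tr_f tri0) (gw mu)).
(* a zero Cartan integer is inverted to zero, but then the bracket vanishes too *)
pose D := \sum_(mu <- wts | pair u mu == m0 + j) (ev c0 mu)^-1 *: ad f0 (wpr mu y).
have nD : nn D.
  apply: (subsp_msum _ snn) => mu /eqP e; apply: (subspZ _ snn).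
  have [-> |ne] := eqVneq (ad f0 (wpr mu y)) 0; first exact: (subsp0 snn).
  have pe : pair u (- al0 + mu) = j by rewrite pairD pairN e; lia.
  have d0 : - al0 + mu != 0 by apply: contraTneq j0 => e'; move: pe; rewrite e' pair0 => <-.
  have Pd : Phi (- al0 + mu) by split=> //; exists (ad f0 (wpr mu y)).
  case: (pos_or charK0 uP sim TG hT hg0 Bb TB uQ hQ Pd) => pd.
    exact: (pos_nn charK0 uP sim TG hT hg0 Bb uQ hQ pd (gg mu)).
  by have := u_pos pd; rewrite pairN pe; lia.
have lD : lev j D.
  apply: (subsp_msum _ (sj j)) => mu /eqP e; apply: (subspZ _ (sj j)).
  by apply: (lev_wt uP (gg mu).2); rewrite pairD pairN e; lia.
have aD v : aa v -> aa (ad D v).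
  move=> av; rewrite /D ad_suml; apply: (subsp_msum _ sA) => mu _; rewrite adZl; apply: (subspZ _ sA).
  by rewrite ad_adC //; apply: aa_in.
have aDk v i : aa v -> aa (iter i (ad D) v) by move=> av; elim: i => // i IHi; exact: aD.
pose ww := \sum_(mu <- wts | pair u mu == m0 + j) ((ev c0 mu)^-1 * ev c0 mu) *: wpr mu y.
have De0 : ad D e0 = - ww.
  rewrite /D ad_suml /ww -sumrN; apply: eq_bigr => mu _; rewrite adZl ad_adC //.
  rewrite (tr_h tri0) adC (wt_hh uP c0 (gw mu).2) scalerN scalerA //.
have lww : lev (m0 + j) ww.
  apply: (subsp_msum _ (sj _)) => mu /eqP e; apply: (subspZ _ (sj _)).
  by apply: (lev_wt uP (gw mu).2); rewrite e.
have aww : aa ww by apply: (subsp_msum _ sA) => mu _; apply: (subspZ _ sA).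
have nilD := nn_nilp uQ nD; have BD : B (expm D) by exact: (exp_nn_mem charK0 Bb uQ nD).
have mD a b : mxconj (expm D) (a + b) = mxconj (expm D) a + mxconj (expm D) b.
  by have := mxconj_lin (expm D) 1 a b; rewrite !scale1r.
pose y1 := mxconj (expm D) (e0 + y) - e0.
pose R := (mxconj (expm D) e0 - e0 - ad D e0) + (mxconj (expm D) y - y).
have y1E : y1 = R + (y - ww).
  have zm (a b c d z : 'M[K]_n) : a + b - d = a - d - - c + (b - z) + (z - c).
    by apply/matrixP => i i'; rewrite !mxE; ring.
  by rewrite /y1 /R mD De0; exact: zm.
have ay1 : aa y1.
  rewrite /y1 mD addrAC; apply: (subspD sA).
    by apply: (expm_tail1 charK0 sA nilD) => i; apply: aDk.
  rewrite -[mxconj _ y](subrK y); apply: (subspD sA) => //.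
  by apply: (expm_tail1 charK0 sA nilD) => i; apply: aDk.
have lR : lev (m0 + j + 1) R.
  have sL := sj (m0 + j + 1); apply: (subspD sL).
    apply: (expm_tail2 charK0 sL nilD) => i; rewrite iterSr De0.
    apply: (lev_le (k := m0 + j + j)); first by lia.
    by apply: lev_iter => //; [lia | exact: (subspN (sj _))].
  apply: (expm_tail1 charK0 sL nilD) => i; apply: (lev_le (k := m0 + 1 + j)); first by lia.
  by apply: lev_iter => //; lia.
have ly1 : lev (m0 + 1) y1.
  have sL := sj (m0 + 1); rewrite y1E; apply: (subspD sL).
    by apply: lev_le lR; lia.
  by apply: (subspB sL) => //; apply: lev_le lww; lia.
have ly1f : lev (topl - k%:Z) (ad f0 y1).
  rewrite hj y1E adDr; have sL := sj (j + 1); apply: (subspD sL).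
    apply: (lev_le _ (lev_ad uP lf0 lR)); lia.
  pose s mu : K := if pair u mu == m0 + j then 1 - (ev c0 mu)^-1 * ev c0 mu else 1.
  have -> : y - ww = \sum_(mu <- wts) s mu *: wpr mu y.
    rewrite -{1}(wpr_sum uP w y) /ww [X in _ - X]big_mkcond -sumrB; apply: eq_bigr => mu _.
    by rewrite /s; case: eqP => _; rewrite ?subr0 ?scale1r // scalerBl scale1r.
  rewrite ad_sumr; apply: (subsp_msum _ sL) => mu _; rewrite adZr.
  have [g0|g0] := eqVneq (ad f0 (wpr mu y)) 0; first by rewrite g0 scaler0; exact: (subsp0 sL).
  have jmu : (j <= pair u (- al0 + mu))%R.
    by apply: lf; rewrite (wpr_ad uP _ _ hf0).
  rewrite /s; case: eqP => e.
    have -> : (ev c0 mu)^-1 * ev c0 mu = 1.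
      apply: mulVf; apply/eqP => c00; case/eqP: g0; exact: (f0_kill (gw mu)).
    by rewrite subrr scale0r; exact: (subsp0 sL).
  apply: (subspZ _ sL); apply: (lev_wt uP (gg mu).2); move: jmu e; rewrite pairD pairN; lia.
have Dfix z : ad D z = 0 -> mxconj (expm D) z = z.
  move=> Dz; apply/eqP; rewrite -subr_eq0; apply/eqP.
  have s0 : subsp (fun v : 'M[K]_n => v = 0) by split=> // c a b -> ->; rewrite scaler0 addr0.
  apply: (expm_tail1 charK0 s0 nilD) => i; rewrite iterSr Dz; elim: i => //= i ->; exact: ad0r.
have hE1 ef : ef \in Es -> [/\ mxconj (expm D) ef.1 = ef.1, mxconj (expm D) ef.2 = ef.2 & ad ef.2 y1 = 0].
  move=> /hE [[a1 h1 h2 h3 [al hal]] hy].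
  have fix2 : mxconj (expm D) ef.2 = ef.2.
    apply: Dfix; rewrite adC /D ad_sumr big1 ?oppr0 // => mu _; rewrite adZr (jacobi ef.2 f0).
    by rewrite h2 ad0l add0r -(wpr_ad uP mu y hal) hy wpr0 // ad0r scaler0.
  split=> //.
    apply: Dfix; rewrite /D ad_suml big1 // => mu _.
    by rewrite adZl ad_adC // h1 ad0r scaler0.
  rewrite /y1 adBr h3 subr0 -{1}fix2 -mxconj_ad ?(B_unit Bb) // adDr h3 hy addr0.
  by rewrite /mxconj mulmx0 mul0mx.
have [|b [y' [b1 b2 b3 b4 [b5 b6]]]] := IH y1 _ ay1 ly1 ly1f.
  by move=> ef efE; split; [case: (hE ef efE) | case: (hE1 ef efE)].
exists (b *m expm D), y'; split=> //.
- by case: (B_sub Bb) => _ _ BM _; exact: BM.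
- rewrite mxconjM ?(B_unit Bb) // -b2; congr (mxconj b _); by rewrite /y1 [RHS]addrC subrK.
split=> // ef efE; have [h1 h2] := b6 ef efE; have [h3 _ _] := hE1 ef efE.
by split=> //; rewrite mxconjM ?(B_unit Bb) // h3.
Qed.

End Step.

(** The second vector of [q] kills [y], and the first does so because [aa] is abelian;
    by [so_of_comm] the roots of [y] are strongly orthogonal to [q.1]. *)
Definition split_off (q : 'rV[int]_r * ('M[K]_n * 'M[K]_n)) y :=
  [/\ Phi q.1, aa q.2.1, ad q.2.2 y = 0 & exists c, triple q.1 q.2.1 q.2.2 c].

(** The component [e0] of lowest weight of [y] is completed to a triple, and the rest
    of [y] is made to commute with it by [kill_step].  The rest has higher level and
    only involves roots strongly orthogonal to that of [e0]. *)
Lemma eliminate k (C : seq ('rV[int]_r * ('M[K]_n * 'M[K]_n))) y :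
  (forall q, q \in C -> split_off q y) -> aa y -> lev (topl - k%:Z) y ->
  exists b (S : seq 'rV[int]_r) (v : 'rV[int]_r -> 'M[K]_n),
  [/\ B b, forall q, q \in C -> mxconj b q.2.1 = q.2.1, mxconj b y = \sum_(be <- S) v be, uniq S &
  [/\ forall be, be \in S -> [/\ Phi be, gs be (v be) & v be != 0],
      forall be ga, be \in S -> ga \in S -> be <> ga -> so be ga &
      forall q be, q \in C -> be \in S -> so q.1 be]].
Proof.
elim: k C y => [|k IH] C y hC ay ly.
  exists 1%:M, [::], (fun=> 0); split=> //; first by case: (B_sub Bb).
    by move=> q _; rewrite /mxconj invmx1 mul1mx mulmx1.
  have -> : y = 0 by apply: lev0; rewrite -[topl]subr0.
  rewrite big_nil.
  by rewrite /mxconj mulmx0 mul0mx.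
pose j := topl - k.+1%:Z; have hj : topl - k%:Z = j + 1 by rewrite /j; lia.
case: (pselect (exists mu, wpr mu y != 0 /\ pair u mu = j)) => [[al0 [e0n pj]]|nex]; last first.
  apply: IH => //; rewrite hj => mu mu0; have := ly mu mu0; rewrite -/j.
  have : pair u mu <> j by move=> e; apply: nex; exists mu.
  by lia.
pose e0 := wpr al0 y; have ae0 : aa e0 by exact: aa_gr.
have ge0 : gs al0 e0 by split; [exact: aaL | exact: wt_wpr].
(* a component of weight zero would be a nilpotent element of the Cartan algebra *)
have a0 : al0 != 0.
  apply/eqP => a0; rewrite a0 in ge0; have [b hb] := gs_0hh charK0 uP sim TG hT hg0 ge0.
  case/eqP: e0n; rewrite -/e0 hb; apply: (hh_nilp0 charK0 uP sim TG hT hg0).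
  by rewrite -hb; exact: aa_nil.
have P0 : Phi al0 by split=> //; exists e0.
have [f0 [c0 tri0]] := triple_ex charK0 uP sim TG hT hg0 a0 ge0 e0n.
pose y0 := y - e0.
have ay0 : aa y0 by apply: (subspB sA).
have ly0 : lev (pair u al0 + 1) y0.
  move=> mu; have [-> |ne] := eqVneq mu al0.
    by rewrite /y0 -scaleN1r wprD // wprZ // scaleN1r (wt_wpr uP w al0 y) subrr eqxx.
  have ne' : al0 != mu by rewrite eq_sym.
  rewrite /y0 -scaleN1r wprD // wprZ // (wt_neq uP ge0.2 ne') scaler0 addr0 => mu0.
  have := ly mu mu0; rewrite pj -/j.
  have : pair u mu <> j.
    by move=> e; case/eqP: ne; apply: u_inj; rewrite ?(wpr_wts uP mu0) ?(wpr_wts uP e0n) ?pj.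
  by lia.
have fe q : q \in C -> ad q.2.2 e0 = 0.
  move=> /hC [_ _ hq [c tri]].
  by rewrite -(wpr_ad uP al0 y (tr_f tri).2) hq wpr0.
have soC q : q \in C -> so q.1 al0.
  move=> qC; have [Pq aq hq [c tri]] := hC q qC.
  apply: (so_of_comm charK0 uP sim TG hT hg0 Pq tri P0 ge0 e0n); last exact: fe.
  exact: aa_ab.
have fx q : q \in C -> fixed e0 f0 q.2.
  move=> qC; have [Pq aq hq [c tri]] := hC q qC; have [s1 s2 s3 s4] := soC q qC; split=> //.
  - have g1 : gs (q.1 - al0) (ad q.2.1 f0) by apply: (gs_ad charK0 uP sim (tr_e tri) (tr_f tri0)).
    apply: (gs_nonroot _ s4 g1); apply/eqP => /eqP; rewrite subr_eq0 => /eqP; exact: s1.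
  - have g1 : gs (- q.1 - al0) (ad q.2.2 f0) by apply: (gs_ad charK0 uP sim (tr_f tri) (tr_f tri0)).
    apply: (gs_nonroot _ _ g1).
      by rewrite -opprD oppr_eq0 addr_eq0; apply/eqP.
    by rewrite -opprD => /(PhiN charK0 uP sim TG hT hg0); rewrite opprK.
  - exact: fe.
  - by exists (- q.1); case: (tr_f tri).
pose Es := [seq q.2 | q <- C].
have [||||b1 [y1 [Bb1 e1 ay1 ly1 [fy1 hE1]]]] := @kill_step al0 e0 f0 c0 P0 tri0 ae0 (absz (topl - 1)) Es y0.
- move=> ef /mapP [q qC ->]; split; first exact: fx.
  by have [_ _ hq _] := hC q qC; rewrite /y0 adBr hq fe // subrr.
- exact: ay0.
- exact: ly0.
- have lf0 : lev (- pair u al0) f0 by apply: (lev_wt uP (tr_f tri0).2); rewrite pairN.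
  apply: (lev_le _ (lev_ad uP lf0 ly0)); have : (0 < topl)%R by rewrite /topl.
  lia.
pose C' := (al0, (e0, f0)) :: C.
have [|||b2 [S [v [Bb2 fix2 e2 uS [hS1 hS2 hS3]]]]] := IH C' y1.
- move=> q; rewrite inE => /orP [/eqP ->|qC]; first by split=> //=; exists c0.
  have [Pq aq _ tq] := hC q qC; split=> //; have [|_ -> //] := hE1 q.2; exact: map_f.
- exact: ay1.
- by rewrite hj -pj.
pose v' be := if be == al0 then e0 else v be.
have al0S : al0 \notin S.
  by apply/negP => /(hS3 (al0, (e0, f0)) al0 (mem_head _ _)) [].
exists (b2 *m b1), (al0 :: S), v'; split.
- by case: (B_sub Bb) => _ _ BM _; exact: BM.
- move=> q qC; rewrite mxconjM ?(B_unit Bb) //; have [|-> _] := hE1 q.2; first exact: map_f.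
  by apply: fix2; rewrite inE qC orbT.
- have yE : y = e0 + y0 by rewrite /y0 addrC subrK.
  rewrite mxconjM ?(B_unit Bb) // yE e1 -[e0]scale1r mxconj_lin scale1r e2.
  rewrite (fix2 (al0, (e0, f0)) (mem_head _ _)) big_cons /v' eqxx; congr (_ + _).
  rewrite big_seq [RHS]big_seq; apply: eq_bigr => be bS; case: eqP => // e; by move: al0S; rewrite -e bS.
- by rewrite /= al0S.
split.
- move=> be; rewrite inE /v' => /orP [/eqP ->|bS]; first by rewrite eqxx.
  by case: eqP => e; [move: al0S; rewrite -e bS | exact: hS1].
- move=> be ga; rewrite !inE => /orP [/eqP ->|bS] /orP [/eqP ->|gS] ne //.
  + exact: (hS3 (al0, (e0, f0)) ga (mem_head _ _)).
  + apply: (so_sym charK0 uP sim TG hT hg0).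
    exact: (hS3 (al0, (e0, f0)) be (mem_head _ _)).
  + exact: hS2.
- move=> q be qC; rewrite inE => /orP [/eqP ->|bS]; first exact: soC.
  by apply: hS3 => //; rewrite inE qC orbT.
Qed.

End Elimination.

(** * Rescaling by the torus, and orbits *)

(** The Smith normal form of a matrix with independent rows has no zero row. *)
Lemma mono_surj (K : closedFieldType) (charK0 : [pchar K] =i pred0) (s r : nat) (A : 'M[int]_(s, r)) :
  (forall y : 'rV[int]_s, y *m A = 0 -> y = 0) ->
  forall k : 'I_s -> K, nz k -> exists2 d, nz d & mono A d =1 k.
Proof.
move=> hA k k0; have [L uL [R uR [d _ AE]]] := int_Smith_normal_form A.
have u1 : (1 : 'M[K]_s) \in unitmx by exact: unitmx1.
have [d' d'0 e] : montorus 1 A (dc 1 k).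
  apply/(montorusP 1 (mulVmx uL) (mulmxV uL) (mulmxV uR) AE).
  exists k => //; split=> // i iI.
  have r0 : row i (invmx L) *m A = 0.
    rewrite -row_mul AE !mulmxA mulVmx // mul1mx; apply/rowP => l; rewrite !mxE big1 // => j _.
    rewrite !mxE; case: eqP => [ij|]; rewrite ?mulr0n ?mul0r // mulr1n.
    by move: iI; rewrite inE ij ltn_ord /= => /negPn /eqP ->; rewrite mul0r.
  have := hA _ r0 => /(congr1 (fun B => (B *m L) 0 i)).
  by rewrite /= -row_mul mulVmx // mul0mx !mxE eqxx => /eqP.
by exists d' => // i; apply/esym; move: i; exact: (dc_inj u1 e).
Qed.

Section Orbit.
Variables (K : closedFieldType) (charK0 : [pchar K] =i pred0) (n r : nat).
Variables (P : 'M[K]_n) (uP : P \in unitmx) (w : 'I_n -> 'rV[int]_r) (G T B : set 'M[K]_n).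
Hypotheses (sim : almost_simple G) (TG : T `<=` G)
  (hT : forall A, T A <-> exists2 d, nz d & A = tt P w d)
  (hg0 : forall y, Lie G y -> (forall t, T t -> t * y = y * t) ->
    exists b v, nilp v /\ y = hh P w b + v)
  (Bb : borel_subgroup G B) (TB : T `<=` B).
Implicit Types (x y z v e f : 'M[K]_n) (mu nu al be de : 'rV[int]_r).
Notation wt := (wt P w).
Notation wpr := (wpr P w).
Notation hh := (hh P w).
Notation tt := (tt P w).
Notation gs := (gs P w G).
Notation Phi := (Phi P w G).
Notation wts := (wts w).
Notation so := (so P w G).

(** Strongly orthogonal roots have vanishing Cartan integers, hence are independent. *)
Lemma so_scaling (S : seq 'rV[int]_r) (k : 'rV[int]_r -> K) : uniq S ->
  (forall be, be \in S -> Phi be) ->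
  (forall be ga, be \in S -> ga \in S -> be <> ga -> so be ga) ->
  (forall be, be \in S -> k be != 0) ->
  exists2 d, nz d & forall be, be \in S -> mon be d = k be.
Proof.
move=> uS hP hso hk.
have [a [a2 _ _ aneg [apos _ ac]]] := cartan_integers charK0 uP sim TG hT hg0.
pose A : 'M[int]_(size S, r) := \matrix_(i, l) (S`_i) 0 l.
have iS (i : 'I_(size S)) : S`_i \in S by exact: mem_nth.
have a0 (i j : 'I_(size S)) : i != j -> a S`_i S`_j = 0.
  move=> ij; have ne : S`_i <> S`_j by move/eqP; rewrite nth_uniq // => /eqP /val_inj e; rewrite e eqxx in ij.
  have [h1 h2 h3 h4] := hso _ _ (iS i) (iS j) ne.
  case: (Order.TotalTheory.ltgtP (a S`_i S`_j) 0) => // h.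
    case: (aneg _ _ (hP _ (iS j)) (hP _ (iS i)) h) => // /eqP; rewrite addr_eq0 => /eqP //.
  by case: (apos _ _ (hP _ (iS j)) (hP _ (iS i)) h) => // /eqP; rewrite subr_eq0 => /eqP.
have hA (y : 'rV[int]_(size S)) : y *m A = 0 -> y = 0.
  move=> yA; apply/rowP => j; rewrite [RHS]mxE; have [c _ hc] := ac _ (hP _ (iS j)).
  have : ev c (y *m A) = \sum_i (y 0 i)%:~R * ev c S`_i.
    rewrite /ev; under [RHS]eq_bigr do rewrite mulr_sumr.
    rewrite exchange_big; apply: eq_bigr => l _; rewrite mxE rmorph_sum mulr_suml.
    by apply: eq_bigr => i _; rewrite mxE /= intrM mulrA.
  rewrite yA ev0 (bigD1 j) //= big1 ?addr0 => [|i ij].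
    rewrite (hc _ (hP _ (iS j))) a2; last exact: hP.
    move=> /esym/eqP; rewrite mulf_eq0 => /orP [|/eqP e]; first by rewrite int_eq0 // => /eqP.
    by have /eqP := two_neq0 charK0; rewrite -e.
  by rewrite (hc _ (hP _ (iS i))) a0 // mulr0.
have [|d d0 hd] := mono_surj charK0 hA (k := fun i => k S`_i); first by move=> i; apply: hk.
exists d => // be bS; have ib : (index be S < size S)%N by rewrite index_mem.
have := hd (Ordinal ib); rewrite /= nth_index // => <-.
by congr (mon _ d); apply/rowP => l; rewrite !mxE /= nth_index.
Qed.

(** A first conjugation makes the inner ideal of [x] stable under [ad (hh U)], hence
    graded by the roots; root vectors are then split off. *)
Lemma height2_orbit x : Lie G x -> (forall z, Lie G z -> ad x (ad x (ad x z)) = 0) ->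
  exists b (S : seq 'rV[int]_r) (v : 'rV[int]_r -> 'M[K]_n),
  [/\ B b, mxconj b x = \sum_(be <- S) v be, uniq S,
      forall be, be \in S -> [/\ Phi be, gs be (v be) & v be != 0] &
      forall be ga, be \in S -> ga \in S -> be <> ga -> so be ga].
Proof.
move=> Lx x3; have [Q uQ hQ] := borel_tri Bb.
have [u [u_pos u_inj]] := pos_functional charK0 uP sim TG hT hg0 Bb uQ hQ.
pose hu := hu P w u; pose U (l : 'I_r) : K := (u l)%:~R.
have [z [Lz az nz']] := cartan_lift charK0 uP sim TG hT hg0 Bb TB uQ hQ Lx U.
have l1 : lev P w u (topl w u - (absz (topl w u))%:Z) (z - hh U).
  apply: lev_le (nn_lev charK0 uP sim TG hT hg0 Bb TB u_pos uQ hQ nz'); rewrite /topl; lia.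
have [b1 Bb1 e1] := conj_reg charK0 uP sim TG hT hg0 Bb TB u_pos uQ hQ nz' l1.
have ub1 := B_unit Bb Bb1; have Gb1 := BG Bb Bb1; have sG := sim_sub sim.
have GV : G (invmx b1) by case: sG => _ _ _; apply.
pose x' := mxconj b1 x; have Lx' : Lie G x' by apply: Lie_Ad.
have ctr y : ad x' y = mxconj b1 (ad x (mxconj (invmx b1) y)).
  by rewrite mxconj_ad // mxconjVK.
have x3' y : Lie G y -> ad x' (ad x' (ad x' y)) = 0.
  move=> Ly; rewrite !ctr !mxconjK // x3; first by rewrite /mxconj mulmx0 mul0mx.
  exact: Lie_Ad.
pose aa' := aa (@ad K n) (Lie G : 'M[K]_n -> Prop) x'.
have LhU : Lie G (hh U) by exact: (Lie_hh charK0 uP TG hT).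
have ahx : aa' (ad (hh U) x').
  rewrite adC -scaleN1r; apply: (subspZ _ (aa_subsp _ _)).
  have <- : mxconj b1 z = hh U by rewrite -[RHS]e1; congr (mxconj b1 _); rewrite addrC subrK.
  rewrite /x' -mxconj_ad //; have [y Ly ->] := az; exists (mxconj b1 y); first exact: Lie_Ad.
  by rewrite !ctr !mxconjK.
have gB a b : Lie G a -> Lie G b -> Lie G (ad a b) := Lie_bracket charK0 sG (y := b).
have gD a b : Lie G a -> Lie G b -> Lie G (a + b) := @LieD K n G a b.
have gZ c a : Lie G a -> Lie G (c *: a) := @LieZ K n G c a.
have sA : subsp aa' := aa_subsp G x'.
have aaL v : aa' v -> Lie G v := aa_Lie charK0 sim Lx' (v := v).
have aa_ab y v : aa' y -> aa' v -> ad y v = 0.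
  exact: (aa_abelian charK0 (@adDr K n) (@adZr K n) (@ad0l K n) (@jacobi K n) gB Lx' x3').
have aa_in y v t : aa' y -> aa' v -> Lie G t -> aa' (ad y (ad v t)).
  exact: (aa_inner charK0 (@adDr K n) (@adZr K n) (@ad0l K n) (@jacobi K n) gB Lx' x3').
have aa_st v : aa' v -> aa' (ad (hh U) v).
  exact: (aa_stable charK0 (@adDr K n) (@adZr K n) (@ad0l K n) (@jacobi K n) gD gZ gB Lx' x3' LhU ahx).
have aa_gr mu v : aa' v -> aa' (wpr mu v).
  apply: (hh_graded uP mu sA aa_st) => be ga bw gw _ _; rewrite !ev_u => /(intr_injK charK0).
  exact: u_inj.
have aa_nil v : aa' v -> nilp v := aa_nilp charK0 x3' (v := v).
have ax' : aa' x' := aa_x charK0 uP sim TG hT hg0 Lx' x3'.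
have lx' : lev P w u (topl w u - (absz (topl w u) + absz (topl w u))%N%:Z) x'.
  move=> mu /(wpr_wts uP) ms.
  have : (absz (pair u mu) <= \sum_(mu <- wts) absz (pair u mu))%N by rewrite (big_rem mu ms) /= leq_addr.
  by rewrite /topl; lia.
have [|b2 [S [v [Bb2 _ e2 uS [h1 h2 _]]]]] :=
  eliminate charK0 uP sim TG hT hg0 Bb TB uQ hQ u_pos u_inj sA aaL aa_ab aa_in aa_gr aa_nil (C := [::]) _ ax' lx'.
- by [].
exists (b2 *m b1), S, v; split=> //; first by case: (B_sub Bb) => _ _ BM _; exact: BM.
by rewrite mxconjM ?(B_unit Bb).
Qed.

Lemma gs_prop be x y : Phi be -> gs be x -> gs be y -> x != 0 -> y != 0 ->
  exists2 k, k != 0 & y = k *: x.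
Proof.
move=> [b0 _] gx gy x0 y0.
have [f [c tri]] := triple_ex charK0 uP sim TG hT hg0 b0 gx x0.
have [k yk] := dim1 charK0 uP sim TG hT hg0 b0 tri gy.
by exists k => //; apply: contraNneq y0 => k0; rewrite yk k0 scale0r.
Qed.

(** For [mu = w i - w j] the character is the product of the [i]-th diagonal entry of
    the point by the [j]-th one of its inverse. *)
Lemma weight_char : exists chi : 'rV[int]_r -> (T -> K), forall mu, mu \in wts ->
  regular_function (chi mu) /\
  forall (t : T) d, nz d -> val t = tt d -> chi mu t = mon mu d.
Proof.
have uT (t : T) : val t \in unitmx.
  by apply: (sim_unit sim); apply: TG; exact: (set_mem (valP t)).
have h mu : exists chi : T -> K, mu \in wts ->
    regular_function chi /\ forall (t : T) d, nz d -> val t = tt d -> chi t = mon mu d.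
  case: (boolP (mu \in wts)) => ms; last by exists (fun=> 0).
  move: ms; rewrite mem_undup => /mapP [[i j] _ /= ->].
  pose F A := co P A i i * co P (invmx A) j j; exists (fun t => F (val t)) => _; split.
    have RA := regf_alg K n.
    have RF : regf F.
      apply: (fun_algM RA).
        apply: (entriesM RA); last exact: (entriesC RA).
        by apply: (entriesM RA); [exact: (entriesC RA) | exact: regf_entries].
      apply: (entriesM RA); last exact: (entriesC RA).
      by apply: (entriesM RA); [exact: (entriesC RA) | exact: regf_entries_inv].
    by have [p [k hp]] := RF; exists p, k => t; apply: hp.
  move=> t d d0 e; have -> : F (val t) = F (tt d) by congr F; exact: e.
  rewrite /F /tt dcV //; last by move=> k; apply: mon_neq0.
  by rewrite !co_dc // !dgmE !eqxx !mulr1n monD // monN.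
by have /choice [chi hchi] := h; exists chi.
Qed.

Variable chi : 'rV[int]_r -> (T -> K).
Hypothesis hchi : forall mu, mu \in wts -> regular_function (chi mu) /\
  forall (t : T) d, nz d -> val t = tt d -> chi mu t = mon mu d.

Lemma T_point d : nz d -> exists t : T, val t = tt d.
Proof.
move=> d0; have Td : T (tt d) by apply/hT; exists d.
by exists (SigSub (mem_set Td)).
Qed.

Lemma T_coord (t : T) : exists2 d, nz d & val t = tt d.
Proof. exact: (hT _).1 (set_mem (valP t)). Qed.

Lemma chiE mu t d : mu \in wts -> nz d -> val t = tt d -> chi mu t = mon mu d.
Proof. by move=> /hchi [_ h]; apply: h. Qed.

Lemma chi_inj mu nu : mu \in wts -> nu \in wts -> chi mu = chi nu -> mu = nu.
Proof.
move=> ms ns e; apply: (mon_inj charK0) => d d0; have [t td] := T_point d0.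
by rewrite -(chiE ms d0 td) e (chiE ns d0 td).
Qed.

Lemma chi_root_space mu x : mu \in wts -> (root_space G (chi mu) x <-> gs mu x).
Proof.
move=> ms; split=> [[Lx h]|[Lx hx]]; split=> //.
  by apply: (wt_of_tt charK0 uP) => d d0; have [t td] := T_point d0; rewrite -td h (chiE ms d0 td).
by move=> t; have [d d0 td] := T_coord t; rewrite td (wt_tt uP hx d0) (chiE ms d0 td).
Qed.

Lemma chi_root mu : Phi mu -> is_root G (chi mu).
Proof.
move=> Pm; have ms := Phi_wts uP Pm; have [m0 [x x0 gx]] := Pm; split.
- split; first by case: (hchi ms).
    by move=> t; have [d d0 td] := T_coord t; rewrite (chiE ms d0 td); apply: mon_neq0.
  move=> s t v e; have [d d0 sd] := T_coord s; have [d' d'0 td] := T_coord t.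
  have dd : nz (fun l => d l * d' l) by move=> l; rewrite mulf_neq0.
  rewrite (chiE ms d0 sd) (chiE ms d'0 td) (chiE ms dd (t := v)) ?monMd //.
  rewrite e sd td mulmxE /tt dcM //; apply: eq_dc => i; by rewrite monMd.
- move=> e; case/eqP: m0; apply: (mon_inj charK0) => d d0; have [t td] := T_point d0.
  by rewrite -(chiE ms d0 td) e mon0.
- by exists x => //; apply/chi_root_space.
Qed.

Lemma root_of_chi (alpha : T -> K) mu :
  (forall t d, nz d -> val t = tt d -> alpha t = mon mu d) -> is_root G alpha -> Phi mu.
Proof.
move=> hal [_ a1 [x [Lx hx] x0]]; split.
  apply/eqP => m0; apply: a1; apply/funext => t; have [d d0 td] := T_coord t.
  by rewrite (hal t d d0 td) m0 mon0.
exists x => //; split=> //; apply: (wt_of_tt charK0 uP) => d d0; have [t td] := T_point d0.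
by rewrite -td hx (hal t d d0 td).
Qed.

Lemma chi_so mu nu : Phi mu -> Phi nu -> so mu nu -> strongly_orthogonal_roots G (chi mu) (chi nu).
Proof.
move=> Pm Pn [h1 h2 h3 h4]; have ms := Phi_wts uP Pm; have ns := Phi_wts uP Pn; split.
- by move=> /(chi_inj ms ns).
- move=> e; apply: h2; apply: (mon_inj charK0) => d d0; have [t td] := T_point d0.
  by rewrite -(chiE ms d0 td) e /char_opp (chiE ns d0 td) monN.
- move=> h; apply: h3; apply: root_of_chi h => t d d0 td.
  by rewrite /char_add (chiE ms d0 td) (chiE ns d0 td) monD.
- move=> h; apply: h4; apply: root_of_chi h => t d d0 td.
  by rewrite /char_add /char_opp (chiE ms d0 td) (chiE ns d0 td) monD // monN.
Qed.

Lemma B_orbit_conj b x : B b -> B_orbit B x = B_orbit B (mxconj b x).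
Proof.
move=> Bb'; have ub := B_unit Bb Bb'; have [_ _ BM BV] := B_sub Bb.
apply/seteqP; split=> _ [c Bc <-].
  exists (c *m invmx b); first by apply: BM => //; exact: BV.
  by rewrite mxconjM ?unitmx_inv ?(B_unit Bb Bc) // mxconjK.
by exists (c *m b); [exact: BM | rewrite mxconjM // (B_unit Bb Bc)].
Qed.

(** Root spaces are lines, so the vectors obtained are multiples of the given ones. *)
Lemma orbit_e_sum (e : (T -> K) -> 'M[K]_n)
  (e_root : forall alpha : T -> K, is_root G alpha -> root_space G alpha (e alpha) /\ e alpha != 0) x :
  Lie G x -> (forall z, Lie G z -> ad x (ad x (ad x z)) = 0) ->
  exists S : set (T -> K), strongly_orthogonal G S /\ B_orbit B x = B_orbit B (e_sum e S).
Proof.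
move=> Lx x3; have [b [S [v [Bb' xE uS hS hso]]]] := height2_orbit Lx x3.
have Sw be : be \in S -> be \in wts by move=> /hS [Pb _ _]; exact: (Phi_wts uP Pb).
have ge be : be \in S -> gs be (e (chi be)) /\ e (chi be) != 0.
  move=> bS; have [Pb _ _] := hS be bS; have [h1 h2] := e_root _ (chi_root Pb).
  by split=> //; apply/(chi_root_space _ (Sw be bS)).
have /choice [k hk] : forall be, exists k : K, be \in S -> k != 0 /\ e (chi be) = k *: v be.
  move=> be; case: (boolP (be \in S)) => bS; last by exists 0.
  have [Pb gv v0] := hS be bS; have [g1 e0] := ge be bS.
  by have [k k0 ek] := gs_prop Pb gv g1 v0 e0; exists k.
have [||d d0 hd] := so_scaling (k := k) uS _ hso _.
- by move=> be /hS [].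
- by move=> be /hk [].
exists [set` [seq chi be | be <- S]]; split.
  split; first by move=> al /= /mapP [be bS ->]; apply: chi_root; case: (hS be bS).
  move=> al al' /= /mapP [be bS ->] /mapP [ga gS ->] ne; have [Pb _ _] := hS be bS; have [Pg _ _] := hS ga gS.
  by apply: chi_so => //; apply: hso => // e'; apply: ne; rewrite e'.
have -> : e_sum e [set` [seq chi be | be <- S]] = \sum_(be <- S) e (chi be).
  rewrite /e_sum -fsbig_seq ?big_map // map_inj_in_uniq // => be ga bS gS.
  by apply: chi_inj; apply: Sw.
(* the rescaling is done by a point of [T], which lies in [B] *)
have Bt : B (tt d) by apply: TB; apply/hT; exists d.
have -> : \sum_(be <- S) e (chi be) = mxconj (tt d *m b) x.
  rewrite mxconjM ?(B_unit Bb) // xE /mxconj mulmx_sumr mulmx_suml big_seq [RHS]big_seq.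
  apply: eq_bigr => be bS; have [Pb gv v0] := hS be bS.
  by rewrite -[RHS]/(mxconj (tt d) (v be)) (wt_tt uP gv.2 d0) hd //; case: (hk be bS).
by apply: B_orbit_conj; case: (B_sub Bb) => _ _ BM _; exact: BM.
Qed.

End Orbit.

Unset Implicit Arguments.
Set Strict Implicit.
Set Printing Implicit Defensive.

Theorem corollary3p7 (K : closedFieldType) (charK0 : [pchar K] =i pred0)
    (n : nat) (G B T : set 'M[K]_n)
    (G_almost_simple : almost_simple G)
    (B_borel : borel_subgroup G B)
    (T_maximal : maximal_torus G T)
    (T_sub_B : T `<=` B)
    (e : (T -> K) -> 'M[K]_n)
    (e_root : forall alpha : T -> K, is_root G alpha ->
       root_space G alpha (e alpha) /\ e alpha != 0)
    (x : 'M[K]_n) (x_N2 : nilpotent_height_le2 G x) :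
  exists S : set (T -> K),
    strongly_orthogonal G S /\ B_orbit B x = B_orbit B (e_sum e S).
Proof.
have [r [P [w [uP hT hg0]]]] := torus_coords charK0 G_almost_simple T_maximal.
have TG : T `<=` G by case: T_maximal.
have [chi hchi] := weight_char uP w G_almost_simple TG.
apply: (orbit_e_sum charK0 uP G_almost_simple TG hT hg0 B_borel T_sub_B hchi e_root).
  by case: x_N2 => [[]].
move=> z Lz; case: x_N2 => _ [h [_ hm] h2].
apply/eqP; apply: contraT => ne; have : ad_pow_neq0 G x 3 by exists z.
by move=> /hm; rewrite leqNgt (leq_ltn_trans h2).
Qed.
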